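(* Let $\Omega\subset\mathbb R^n$, $n\in\{2,3\}$, be a bounded convex domain with a Lipschitz continuous boundary and assume that the spaces $V^h=S^1_d(\mathcal T)$ have the optimal approximation property and satisfy the inverse estimates stated in the context. Assume that the discrete problem: find $u_h\in V^h$, $u_h=g_h$ on $\partial\Omega$, with $\langle F_h(u_h),\psi_h\rangle=\int_\Omega f\psi_h\,dx$ for all $\psi_h\in V_0^h$, has a unique strictly convex solution $u_h$. Consider a sequence $(u_k)$ with $u_k\in V^h$, $u_k=g_h$ on $\partial\Omega$, defined by either $$-\nu\int_\Omega(Du_{k+1}-Du_k)\cdot D\psi_h\,dx+\langle F_h'(u_k)(u_{k+1}-u_k),\psi_h\rangle=-\langle F_h(u_k)-f,\psi_h\rangle\quad\forall\psi_h\in V_0^h,$$ or $$-\nu\int_\Omega(u_{k+1}-u_k)\psi_h\,dx+\langle F_h'(u_k)(u_{k+1}-u_k),\psi_h\rangle=-\langle F_h(u_k)-f,\psi_h\rangle\quad\forall\psi_h\in V_0^h.$$ Then, for $h$ sufficiently small and $\nu>0$ sufficiently small (the bound on $\nu$ may depend on $h$), and for a suitable initial guess, i.e. any $u_0\in V^h$ with $u_0=g_h$ on $\partial\Omega$ sufficiently close to $u_h$, the sequence is well defined and converges to the unique strictly convex solution $u_h$. Moreover the convergence rate is linear: there is $\rho\in(0,1)$ such that $\|u_{k+1}-u_h\|_1\le\rho\|u_k-u_h\|_1$ for all $k\ge 0$.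
   Context: $\mathcal T=\mathcal T_h$ is a family of shape-regular, quasi-uniform triangulations of $\Omega$ into simplices with maximal diameter $h$; $S_d^1(\mathcal T)=\{s\in C^1(\Omega): s|_K\in\mathcal P_d\ \forall K\in\mathcal T\}$, with $\mathcal P_d$ the polynomials of degree at most $d$; $V_0^h=V^h\cap H_0^1(\Omega)$. $\|\cdot\|_{k,p}$, $|\cdot|_{k,p}$ are the norm and seminorm of $W^{k,p}(\Omega)$, and $\|\cdot\|_k,|\cdot|_k$ those of $H^k(\Omega)$. Optimal approximation property: there are a linear quasi-interpolation operator $Q_h:L^1(\Omega)\to V^h$ and a constant $C$ independent of $h$ with $\|v-Q_hv\|_{k,p}\le Ch^{l+1-k}|v|_{l+1,p}$ for $v\in W^{l+1,p}(\Omega)$, $1\le p\le\infty$, $0\le k\le l\le d$. Inverse estimates: $\|v\|_{s,p}\le Ch^{l-s+\min(0,n/p-n/q)}\|v\|_{l,q}$ for all $v\in V^h$, $0\le l\le s$, $1\le p,q\le\infty$, norms being understood element by element when necessary. $f\in C(\Omega)$, $f>0$, is such that $\langle f,\psi_h\rangle=\int_\Omega f\psi_h\,dx$ defines an element of the dual $(V_0^h)'$; $g\in C(\partial\Omega)$ and $g_h$ is the interpolant in $V^h$ of a smooth extension of $g$. The map $F_h:V^h\to(V_0^h)'$ is $\langle F_h(v_h),\psi_h\rangle=\int_\Omega(\det D^2v_h)\psi_h\,dx$ (equal to $-\frac1n\int_\Omega(\operatorname{cof}D^2v_h)Dv_h\cdot D\psi_h\,dx$), and its Fréchet derivative is $\langle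 F_h'(v_h)(p),\psi_h\rangle=-\int_\Omega[(\operatorname{cof}D^2v_h)Dp]\cdot D\psi_h\,dx$ for $p,\psi_h\in V_0^h$. Here $\operatorname{cof}A$ is the matrix of cofactors of $A$. *)

(* Defs.v *)
From HB Require Import structures.
From mathcomp Require Import all_boot all_order all_algebra finmap.
From mathcomp Require Import all_classical all_reals all_analysis.

Set Implicit Arguments.
Unset Strict Implicit.
Unset Printing Implicit Defensive.

Import Order.TTheory GRing.Theory Num.Theory.
Import numFieldNormedType.Exports.

Local Open Scope classical_set_scope.
Local Open Scope ring_scope.

(* product sigma-algebra on R^n, generated by the coordinates *)
Section measurable_rV.
Variables (R : realType) (n : nat).

Let coord (i : 'I_n) (x : 'rV[R]_n) : measurableTypeR R := x ord0 i.

Let rV_measurable0 : g_sigma_preimage coord set0.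
Proof. exact: sigma_algebra0. Qed.

Let rV_measurableC A : g_sigma_preimage coord A -> g_sigma_preimage coord (~` A).
Proof. exact: sigma_algebraC. Qed.

Let rV_measurable_bigcup (F : (set 'rV[R]_n)^nat) :
  (forall i, g_sigma_preimage coord (F i)) ->
  g_sigma_preimage coord (\bigcup_i F i).
Proof. exact: sigma_algebra_bigcup. Qed.

HB.instance Definition _ := @isMeasurable.Build default_measure_display
  'rV[R]_n (g_sigma_preimage coord)
  rV_measurable0 rV_measurableC rV_measurable_bigcup.

Lemma measurable_fun_rV d (T : measurableType d) (f : T -> 'rV[R]_n) :
  (forall i, measurable_fun setT (fun t => f t ord0 i : measurableTypeR R)) ->
  measurable_fun setT f.
Proof.
move=> mf _ A mA; rewrite setTI.
pose D : set (set 'rV[R]_n) := [set B | measurable (f @^-1` B)].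
suff : g_sigma_preimage coord `<=` D by apply.
apply: smallest_sub.
  split; rewrite /D /=.
  - by rewrite preimage_set0; exact: measurable0.
  - by move=> B mB; rewrite setTD preimage_setC; exact: measurableC.
  - by move=> F mF; rewrite preimage_bigcup; exact: bigcup_measurable.
apply: subset_trans (_ : [set C | exists i, exists2 B, measurable B & C = coord i @^-1` B] `<=` D).
  move=> C; rewrite -bigcup_seq => -[i _ [B mB <-]].
  by exists i, B => //; rewrite setTI.
by move=> _ [i [B mB ->]]; rewrite /D /= -comp_preimage -[X in measurable X]setTI; exact: mf.
Qed.

Lemma measurable_coord_rV i :
  measurable_fun setT (fun x : 'rV[R]_n => x ord0 i : measurableTypeR R).
Proof.
move=> _ B mB; rewrite setTI; apply: sub_sigma_algebra.
rewrite -bigcup_seq; exists i; first by rewrite /= mem_index_enum.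
by exists B => //; rewrite setTI.
Qed.

End measurable_rV.

(* Lebesgue measure on R^n, as the iterated product measure
   lambda x (lambda x ...) transported to row vectors *)
Section lebesgue_rV.
Variable R : realType.

Definition cons_rV n (p : measurableTypeR R * 'rV[R]_n) : 'rV[R]_n.+1 :=
  \row_i (if unlift ord0 i is Some j then p.2 ord0 j else p.1).

Definition uncons_rV n (x : 'rV[R]_n.+1) : measurableTypeR R * 'rV[R]_n :=
  (x ord0 ord0, \row_j x ord0 (lift ord0 j)).

Lemma uncons_rVK n : cancel (@uncons_rV n) (@cons_rV n).
Proof.
move=> x; apply/rowP => i; rewrite !mxE.
by case: unliftP => [j ->|->]; rewrite ?mxE.
Qed.

Lemma cons_rVK n : cancel (@cons_rV n) (@uncons_rV n).
Proof.
case=> t x; rewrite /uncons_rV mxE unlift_none; congr pair.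
by apply/rowP => j; rewrite !mxE liftK.
Qed.

Lemma measurable_cons_rV n : measurable_fun setT (@cons_rV n).
Proof.
apply: measurable_fun_rV => i.
under eq_fun do rewrite mxE.
case: (unliftP ord0 i) => [j _|_]; last exact: measurable_fst.
exact: measurableT_comp (measurable_coord_rV j) measurable_snd.
Qed.

Lemma measurable_uncons_rV n : measurable_fun setT (@uncons_rV n).
Proof.
apply/measurable_fun_pairP; split; first exact: measurable_coord_rV.
apply: measurable_fun_rV => i.
rewrite [X in measurable_fun _ X](_ : _ = fun x : 'rV[R]_n.+1 => x ord0 (lift ord0 i)).
  exact: measurable_coord_rV.
by apply/funext => x /=; rewrite mxE.
Qed.

Section step.
Variables (n : nat) (mu : {sigma_finite_measure set 'rV[R]_n -> \bar R}).

Definition lebesgue_step : set 'rV[R]_n.+1 -> \bar R :=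
  pushforward (@lebesgue_measure R \x mu)%E (@cons_rV n).

HB.instance Definition _ := Measure.copy lebesgue_step
  (measure_function_pushforward__canonical__measure_function_Measure
    (@lebesgue_measure R \x mu)%E (@measurable_cons_rV n)).

Let lebesgue_step_sigma_finite : sigma_finite setT lebesgue_step.
Proof.
have /sigma_finiteP[F [TF ndF Foo]] := sigma_finiteT (@lebesgue_measure R).
have /sigma_finiteP[G [TG ndG Goo]] := sigma_finiteT mu.
exists (fun k => @uncons_rV n @^-1` (F k `*` G k)).
  rewrite -preimage_bigcup (_ : \bigcup_k _ = setT) ?preimage_setT//.
  rewrite -setXTT TF TG predeqE => -[x y]; split; first by move=> [k _ []/= ? ?]; split; exists k.
  move=> [/= [k _ Fkx] [l _ Gly]]; exists (maxn k l) => //; split.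
    by move: x Fkx; exact/subsetPset/ndF/leq_maxl.
  by move: y Gly; exact/subsetPset/ndG/leq_maxr.
move=> k; have [mF Fk] := Foo k; have [mG Gk] := Goo k; split.
  rewrite -[X in measurable X]setTI; apply: measurable_uncons_rV => //.
  exact: measurableX.
rewrite /lebesgue_step /pushforward -comp_preimage.
rewrite (_ : @uncons_rV n \o @cons_rV n = id) ?preimage_id; last first.
  by apply/funext => x; exact: cons_rVK.
by rewrite product_measure1E// lte_mul_pinfty// ge0_fin_numE.
Qed.

HB.instance Definition _ := @Measure_isSigmaFinite.Build _ _ _ lebesgue_step
  lebesgue_step_sigma_finite.

End step.

Fixpoint lebesgue_rV n : {sigma_finite_measure set 'rV[R]_n -> \bar R} :=
  match n with
  | 0 => \d_(0 : 'rV[R]_0)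
  | n'.+1 => lebesgue_step (lebesgue_rV n')
  end.

Lemma lebesgue_rV_box n (a b : 'rV[R]_n) : (forall i, a ord0 i <= b ord0 i) ->
  lebesgue_rV n [set x : 'rV[R]_n | forall i, a ord0 i <= x ord0 i <= b ord0 i] =
  (\prod_i (b ord0 i - a ord0 i))%:E.
Proof.
elim: n a b => [|n IH] a b ab.
  rewrite big_ord0 /= diracE mem_set//; by case.
rewrite big_ord_recl EFinM.
pose a' : 'rV[R]_n := \row_j a ord0 (lift ord0 j).
pose b' : 'rV[R]_n := \row_j b ord0 (lift ord0 j).
pose B : set 'rV[R]_n := [set x : 'rV[R]_n | forall i, a' ord0 i <= x ord0 i <= b' ord0 i].
have -> : lebesgue_rV n.+1 [set x : 'rV[R]_n.+1 | forall i, a ord0 i <= x ord0 i <= b ord0 i] =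
    (@lebesgue_measure R \x lebesgue_rV n)%E (`[a ord0 ord0, b ord0 ord0]%classic `*` B).
  rewrite /= /lebesgue_step /pushforward; congr (product_measure1 _ _ _).
  apply/seteqP; split => -[t x] /=.
    move=> h; split; first by have := h ord0; rewrite mxE unlift_none in_itv.
    by move=> i; have := h (lift ord0 i); rewrite !mxE liftK.
  rewrite in_itv /= => -[h1 h2] i; rewrite mxE.
  by case: unliftP => [j ->|->//]; have := h2 j; rewrite !mxE.
rewrite product_measure1E//; last first.
  rewrite (_ : B = \bigcap_i ((fun x : 'rV[R]_n => x ord0 i : measurableTypeR R) @^-1` `[a' ord0 i, b' ord0 i])).
    apply: fin_bigcap_measurable => // i _.
    by rewrite -[X in measurable X]setTI; exact: measurable_coord_rV.
  apply/seteqP; split => x /=; first by move=> h i _ /=; rewrite in_itv/=.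
  by move=> h i; have := h i I; rewrite /= in_itv.
rewrite /B IH; last by move=> i; rewrite !mxE.
congr (_ * _)%E; last by congr EFin; apply: eq_bigr => i _; rewrite !mxE.
apply: (etrans (lebesgue_measure_itv `[a ord0 ord0, b ord0 ord0])).
by rewrite /= lte_fin -EFinB; case: ltgtP (ab ord0) => // ->; rewrite subrr.
Qed.
End lebesgue_rV.

Section euclidean.
Variables (R : realType) (n : nat).
Local Notation V := 'rV[R]_n.
Implicit Types (x y : V) (A : set V).

(* the norm `|x| of the library on 'rV[R]_n is the sup norm *)
Definition dotv x y : R := \sum_i x ord0 i * y ord0 i.
Definition enorm x : R := Num.sqrt (dotv x x).
Definition eball x (r : R) : set V := [set y | enorm (y - x) < r].

Definition diam A : R := sup [set enorm (x - y) | x in A & y in A].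

(* diameter of the largest ball contained in A *)
Definition inball_diam A : R :=
  sup [set 2 * r | r in [set r | 0 <= r /\ exists c, eball c r `<=` A]].

Definition frontier A : set V := closure A `\` interior A.

(* near each boundary point, in the orthonormal frame whose last axis is e, A is
   the strict epigraph of a Lipschitz function of the variables orthogonal to e *)
Definition lipschitz_boundary A : Prop :=
  forall x0, frontier A x0 ->
  exists (r L : R) (e : V) (gam : V -> R),
    [/\ 0 < r, enorm e = 1,
        (forall x y, `|gam x - gam y| <= L * enorm (x - y)),
        (forall x t, gam (x + t *: e) = gam x) &
        forall x, eball x0 r x -> (A x <-> gam x < dotv x e)].

Definition strictly_convex A (u : V -> R) : Prop :=
  forall x y (t : R), A x -> A y -> x != y -> 0 < t < 1 ->
    u (t *: x + (1 - t) *: y) < t * u x + (1 - t) * u y.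

End euclidean.

Section calculus.
Variables (R : realType) (n : nat).
Local Notation V := 'rV[R]_n.
Implicit Types (U : set V) (u v w : V -> R).

Definition pderiv (i : 'I_n) u : V -> R := 'D_(delta_mx ord0 i) u.

(* U is meant to be open *)
Fixpoint Ck_on U (k : nat) u : Prop :=
  (forall x, U x -> {for x, continuous u}) /\
  match k with
  | 0 => True
  | k'.+1 => forall i : 'I_n,
      (forall x, U x -> derivable u x (delta_mx ord0 i)) /\
      Ck_on U k' (pderiv i u)
  end.

Definition gdot u v (x : V) : R := \sum_i pderiv i u x * pderiv i v x.

Definition hess u (x : V) : 'M[R]_n := \matrix_(i, j) pderiv i (pderiv j u) x.

Definition cofmx (A : 'M[R]_n) : 'M[R]_n := \matrix_(i, j) cofactor A i j.

Definition msize (a : {ffun 'I_n -> nat}) : nat := (\sum_i a i)%N.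

Definition multis (k : nat) : seq {ffun 'I_n -> nat} :=
  [seq a <- [seq [ffun i : 'I_n => val (b i)] | b : {ffun 'I_n -> 'I_k.+1}]
     | (msize a <= k)%N].

Definition dpart (a : {ffun 'I_n -> nat}) u : V -> R :=
  foldr (fun i w => iter (a i) (pderiv i) w) u (enum 'I_n).

End calculus.

(* As in Gilbarg and Trudinger, the test functions for a weak derivative of
   order k are those of C^k_c(U), and H^1_0(U) is the closure of C^1_c(U) in
   H^1(U); C^oo_c(U) gives the same notions. *)
Section sobolev.
Variables (R : realType) (n : nat).
Local Notation V := 'rV[R]_n.
Local Notation leb := (lebesgue_rV R n).
Implicit Types (U : set V) (u v w : V -> R) (p : \bar R).

Definition test_fun U (k : nat) (phi : V -> R) : Prop :=
  Ck_on setT k phi /\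
  exists K : set V,
    [/\ compact K, K `<=` U & forall x, ~ K x -> phi x = 0].

Definition loc_integrable U u : Prop :=
  measurable_fun U u /\
  forall K : set V, compact K -> K `<=` U -> leb.-integrable K (EFin \o u).

Definition weak_partial U (a : {ffun 'I_n -> nat}) u w : Prop :=
  [/\ loc_integrable U u, loc_integrable U w &
      forall phi, test_fun U (msize a) phi ->
        \int[leb]_(x in U) (u x * dpart a phi x) =
        (-1) ^+ msize a * \int[leb]_(x in U) (w x * phi x)].

Definition Lpnorm U p w : \bar R := 'N[leb]_p[EFin \o (w \_ U)]%E.

(* L^p norm of the weak derivative of index a, +oo when there is none: weak
   derivatives being a.e. unique, the infimum ranges over at most one value *)
Definition dnorm U p (a : {ffun 'I_n -> nat}) u : \bar R :=
  ereal_inf [set Lpnorm U p w | w in weak_partial U a u].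

Definition lp_sum p (s : seq (\bar R)) : \bar R :=
  match p with
  | r%:E => ((\sum_(x <- s) x `^ r) `^ r^-1)%E
  | _ => \big[maxe/0%E]_(x <- s) x
  end.

Definition sobolev_norm U (k : nat) p u : \bar R :=
  lp_sum p [seq dnorm U p a u | a <- multis n k].

Definition sobolev_seminorm U (k : nat) p u : \bar R :=
  lp_sum p [seq dnorm U p a u | a <- multis n k & msize a == k].

Definition in_sobolev U (k : nat) p u : Prop := (sobolev_norm U k p u < +oo)%E.

Definition H1_norm U u : \bar R := sobolev_norm U 1 2%:E u.

Definition H10 U u : Prop :=
  forall e : R, 0 < e ->
  exists2 phi, test_fun U 1 phi & (H1_norm U (u \- phi)%R < e%:E)%E.

End sobolev.

(* A simplex is given by its set of vertices. *)
Section triangulation.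
Variables (R : realType) (n : nat).
Local Notation V := 'rV[R]_n.
Local Notation simplex := {fset V}.
Implicit Types (Omega : set V) (s : simplex) (T : {fset simplex}).
Implicit Types (v : V -> R) (p : \bar R).

Definition hull s : set V :=
  [set x | exists c : V -> R,
    [/\ (forall y, y \in s -> 0 <= c y), \sum_(y <- s) c y = 1 &
        x = \sum_(y <- s) c y *: y]].

Definition affinely_independent s : Prop :=
  forall c : V -> R, \sum_(y <- s) c y = 0 -> \sum_(y <- s) c y *: y = 0 ->
  forall y, y \in s -> c y = 0.

Definition is_simplex s : Prop := #|` s| = n.+1 /\ affinely_independent s.

Definition triangulation Omega T : Prop :=
  [/\ (forall s, s \in T -> is_simplex s),
      (forall s t, s \in T -> t \in T ->
         hull s `&` hull t = hull (s `&` t)%fset) &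
      closure Omega = \bigcup_(s in [set` T]) hull s].

Definition mesh T : R := \big[Num.max/0]_(s <- T) diam (hull s).

(* a family of triangulations indexed by the mesh sizes h in H *)
Definition triangulation_family Omega (H : set R) (T : R -> {fset simplex}) :=
  forall h, H h -> [/\ 0 < h, triangulation Omega (T h) & mesh (T h) = h].

Definition shape_regular (H : set R) (T : R -> {fset simplex}) : Prop :=
  exists sigma : R, forall h s, H h -> s \in T h ->
    diam (hull s) <= sigma * inball_diam (hull s).

Definition quasi_uniform (H : set R) (T : R -> {fset simplex}) : Prop :=
  exists2 tau : R, 0 < tau &
    forall h s, H h -> s \in T h -> tau * h <= diam (hull s).

(* The functions of S_d^1(T) are piecewise polynomial on the closed simplices,
   hence determined on closure Omega; their values elsewhere are irrelevant, and
   they are only compared on closure Omega. *)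
Definition spline Omega T (d : nat) v : Prop :=
  Ck_on Omega 1 v /\
  forall s, s \in T -> exists c : {ffun 'I_n -> nat} -> R,
    forall x, hull s x ->
      v x = \sum_(a <- multis n d) c a * \prod_i x ord0 i ^+ a i.

Definition spline0 Omega T (d : nat) v : Prop := spline Omega T d v /\ H10 Omega v.

(* Sobolev norm taken element by element *)
Definition broken_norm T (k : nat) p v : \bar R :=
  lp_sum p [seq dnorm (interior (hull s)) p a v
             | s <- enum_fset T, a <- multis n k].

Definition L1 Omega v : Prop :=
  (lebesgue_rV R n).-integrable Omega (EFin \o v).

Definition quasi_interpolation Omega T (d : nat) (Q : (V -> R) -> V -> R) : Prop :=
  [/\ (forall v, L1 Omega v -> spline Omega T d (Q v)),
      (forall v w, L1 Omega v -> L1 Omega w ->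
         {ae lebesgue_rV R n, forall x, Omega x -> v x = w x} ->
         forall x, closure Omega x -> Q v x = Q w x) &
      (forall (a : R) v w, L1 Omega v -> L1 Omega w ->
         forall x, closure Omega x ->
           Q (fun y => a * v y + w y) x = a * Q v x + Q w x)].

Definition optimal_approximation Omega (d : nat) (H : set R)
    (T : R -> {fset simplex}) : Prop :=
  exists Q : R -> (V -> R) -> V -> R,
    (forall h, H h -> quasi_interpolation Omega (T h) d (Q h)) /\
    forall p (k l : nat), (1 <= p)%E -> (k <= l <= d)%N ->
    exists C : R, forall h v, H h -> in_sobolev Omega l.+1 p v ->
      (broken_norm (T h) k p (v \- Q h v)%R
       <= (C * h ^+ (l.+1 - k))%:E * sobolev_seminorm Omega l.+1 p v)%E.

Definition inverse_estimates Omega (d : nat) (H : set R)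
    (T : R -> {fset simplex}) : Prop :=
  forall p q (l s : nat), (1 <= p)%E -> (1 <= q)%E -> (l <= s)%N ->
  exists C : R, forall h v, H h -> spline Omega (T h) d v ->
    (broken_norm (T h) s p v
     <= (C * h `^ (l%:R - s%:R
                   + Num.min 0 (n%:R * fine (inve p) - n%:R * fine (inve q))))%:E
        * broken_norm (T h) l q v)%E.

(* Degrees of freedom in the sense of Ciarlet: functionals lam i, linear on the
   space of splines, such that each prescription of their values is met by
   exactly one spline. The interpolant of w is the spline with the values of w. *)
Definition unisolvent Omega T (d N : nat) (lam : 'I_N -> (V -> R) -> R) : Prop :=
  (forall i (a : R) v w, spline Omega T d v -> spline Omega T d w ->
     lam i (fun y => a * v y + w y) = a * lam i v + lam i w) /\
  forall c : 'I_N -> R, exists v,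
    [/\ spline Omega T d v, (forall i, lam i v = c i) &
        forall w, spline Omega T d w -> (forall i, lam i w = c i) ->
          {in closure Omega, w =1 v}].

Definition interpolant Omega T (d N : nat) (lam : 'I_N -> (V -> R) -> R)
    (w v : V -> R) : Prop :=
  spline Omega T d v /\ forall i, lam i v = lam i w.

End triangulation.

Section monge_ampere.
Variables (R : realType) (n : nat).
Local Notation V := 'rV[R]_n.
Local Notation leb := (lebesgue_rV R n).
Variable Omega : set V.
Implicit Types (f u p psi g : V -> R) (T : {fset {fset V}}).

Definition load f psi : R := \int[leb]_(x in Omega) (f x * psi x).

Definition F_form u psi : R := \int[leb]_(x in Omega) (\det (hess u x) * psi x).

Definition dF_form u p psi : R :=
  - \int[leb]_(x in Omega)
      (\sum_i (\sum_j cofmx (hess u x) i j * pderiv j p x) * pderiv i psi x).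

Definition grad_form p psi : R := \int[leb]_(x in Omega) gdot p psi x.

Definition mass_form p psi : R := \int[leb]_(x in Omega) (p x * psi x).

Definition admissible T (d : nat) gh u : Prop :=
  spline Omega T d u /\ {in frontier Omega, u =1 gh}.

Definition discrete_solution T (d : nat) f gh u : Prop :=
  admissible T d gh u /\
  forall psi, spline0 Omega T d psi -> F_form u psi = load f psi.

Definition unique_strictly_convex_solution T (d : nat) f gh u : Prop :=
  [/\ discrete_solution T d f gh u, strictly_convex Omega u &
      forall v, discrete_solution T d f gh v -> strictly_convex Omega v ->
        {in closure Omega, v =1 u}].

Definition pseudo_iteration T (d : nat) f gh (nu : R)
    (B : (V -> R) -> (V -> R) -> R) (u : nat -> V -> R) : Prop :=
  forall k, admissible T d gh (u k) /\
    forall psi, spline0 Omega T d psi ->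
      - nu * B (u k.+1 \- u k) psi + dF_form (u k) (u k.+1 \- u k) psi =
      - (F_form (u k) psi - load f psi).

End monge_ampere.

(* Main.v *)
(* With the mesh fixed, everything takes place in a finite dimensional space, and
   the iteration is a perturbed Newton method: in coordinates w.r.t. a basis of the
   splines of H^1_0, the error is contracted as soon as the derivative of F_h at u_h
   is definite, the remainder is quadratic and nu is small. Three points need work.
   - F_h' really is the derivative of F_h: integrating the cofactor matrix of D^2 u
     by parts, although D^2 u jumps between simplices. The determinant of Lipschitz
     gradients is a null Lagrangian: for difference quotients this is an exact
     discrete Stokes identity, and one passes to the limit.
   - The splines in H^1_0 are exactly those vanishing on the boundary, so that they
     can be used as test functions in the divergence theorem.
   - Coercivity: for a strictly convex spline u_h the Hessian is positive
     semidefinite, and definite on a dense set, hence so is its cofactor matrix; a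
     spline p in H^1_0 whose energy vanishes then has Dp = 0 on a dense set. *)

Require Import Defs.
From mathcomp Require Import all_boot all_order all_algebra finmap.
From mathcomp Require Import all_classical all_reals all_analysis.
From mathcomp Require Import measurable_realfun.
From mathcomp Require Import ring lra.

Set Implicit Arguments.
Unset Strict Implicit.
Unset Printing Implicit Defensive.

Import Order.TTheory GRing.Theory Num.Theory.
Import numFieldNormedType.Exports.

Local Open Scope classical_set_scope.
Local Open Scope ring_scope.

(** * Topology and Borel sets of row vectors *)

(** The contraction is proved for the sup norm of the coordinates and carried to the H^1 norm by
    constants k1, k2 comparing the two norms: a coordinate factor of at most k1 / (2 k2) becomes
    1/2. The derivative of F_h at u_h is negative definite, so the term in -nu B has the favourable
    sign in the coercivity estimate; but it contributes nu B(u_k - u_h, .) to the error equation,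
    which is of first order in the error. This is why the rate is linear and nu has to be small. Two
    definitions shape the analysis. Norms are infima over weak derivatives, so they are bounded
    below by duality, testing against smooth functions. H^1_0 is a closure, so boundary values are
    reached without traces: membership gives integration by parts against every polynomial, and
    polynomial fields concentrating at a point touched by an exterior ball exclude a nonzero
    boundary value. Second derivatives mean nothing on the faces between cells. All integrals are
    therefore taken over the union [inner] of the open cells, whose complement in the closed domain
    is contained in a null set. *)

Section rV_topology.
Variables (R : realType) (n : nat).
Local Notation V := 'rV[R]_n.
Implicit Types (x y : V) (A : set V).

Lemma rV_norm_leP x (e : R) : 0 <= e -> `|x| <= e <-> forall i, `|x ord0 i| <= e.
Proof.
move=> e0; rewrite /Num.norm /= mx_normrE; split=> [/bigmax_leP[_ h] i|h].
  exact: (h (ord0, i)).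
by apply/bigmax_leP; split=> // -[i j] _ /=; rewrite ord1; exact: h.
Qed.

Lemma rV_norm_ltP x (e : R) : 0 < e -> `|x| < e <-> forall i, `|x ord0 i| < e.
Proof.
move=> e0; rewrite /Num.norm /= mx_normrE; split=> [/bigmax_ltP[_ h] i|h].
  exact: (h (ord0, i)).
by apply/bigmax_ltP; split=> // -[i j] _ /=; rewrite ord1; exact: h.
Qed.

Lemma rV_coord_le x i : `|x ord0 i| <= `|x|.
Proof. by have [/(_ (lexx _))] := rV_norm_leP x (normr_ge0 x). Qed.

Lemma rV_openP A : open A <->
  forall x, A x -> exists2 e : R, 0 < e & forall y, `|y - x| < e -> A y.
Proof.
rewrite openE; split=> [oA x /oA|h x /h[e e0 xA]].
  rewrite /interior /= -nbhs_ballE => -[e /= e0 xA]; exists e => // y yx.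
  by apply: xA; rewrite -ball_normE /= distrC.
rewrite /interior /= -nbhs_ballE; exists e => //= y; rewrite -ball_normE /= => yx.
by apply: xA; rewrite distrC.
Qed.

Lemma rV_nbhsP x A : nbhs x A <->
  exists2 e : R, 0 < e & forall y, `|y - x| < e -> A y.
Proof.
rewrite -nbhs_ballE; split=> -[e /= e0 xA]; exists e => //= y.
  by move=> yx; apply: xA; rewrite -ball_normE /= distrC.
by rewrite -ball_normE /= => yx; apply: xA; rewrite distrC.
Qed.

Lemma rV_contP (f : V -> R) x : {for x, continuous f} <->
  forall e : R, 0 < e -> exists2 r : R, 0 < r &
    forall y, `|y - x| < r -> `|f y - f x| < e.
Proof.
split=> [fx e e0|h].
  have /fx/rV_nbhsP[r r0 h] : nbhs (f x) [set t | `|t - f x| < e].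
    by rewrite -nbhs_ballE; exists e => //= t; rewrite -ball_normE /= distrC.
  by exists r.
move=> B; rewrite -nbhs_ballE => -[e /= /h[r r0 {}h] eB].
change (nbhs x (f @^-1` B)); apply/rV_nbhsP; exists r => // y /h fyx.
by apply: eB; rewrite -ball_normE /= distrC.
Qed.

(* The cubes are the rational ones inside A; radius 0 pads the sequence. *)
Lemma open_cube_cover A : open A -> exists (c : nat -> V) (e : nat -> R),
  (forall k, e k <= 0 \/ forall y, `|y - c k| <= e k -> A y) /\
  forall x, A x -> exists k, 0 < e k /\ `|x - c k| < e k.
Proof.
move=> /rV_openP oA.
pose C (q : 'rV[rat]_n) : V := map_mx ratr q.
pose E (m : nat) : R := m.+1%:R^-1.
pose G (p : 'rV[rat]_n * nat) := forall y, `|y - C p.1| <= E p.2 -> A y.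
pose D (k : nat) : option ('rV[rat]_n * nat) := choice.unpickle k.
pose c k := if D k is Some p then C p.1 else 0.
pose e k := if D k is Some p then if `[< G p >] then E p.2 else 0 else 0.
exists c, e; split=> [k|x Ax].
  rewrite /c /e; case: (D k) => [p|]; last by left.
  by case: asboolP => Gp; [right|left].
have [r r0 xA] := oA x Ax.
(* The rational centre will lie within [E m] of x, and 2 [E m] < r keeps the whole cube of radius
   [E m] about it inside A. *)
pose m := Num.truncn (2 / r).
have Em0 : 0 < E m by rewrite invr_gt0.
have Em : E m * 2 < r.
  rewrite /E mulrC ltr_pdivrMr// mulrC -ltr_pdivrMr//.
  exact: truncnS_gt.
have ex i : exists q : rat, x ord0 i - E m < ratr q < x ord0 i + E m.
  have [q] : exists q : rat, ratr q \in `](x ord0 i - E m), (x ord0 i + E m)[.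
    by apply: rat_in_itvoo; rewrite ltrD2l gtrN.
  by rewrite in_itv /= => ?; exists q.
pose q : 'rV[rat]_n := \row_i sval (cid (ex i)).
have qx : `|x - C q| < E m.
  apply/rV_norm_ltP => // i; rewrite !mxE; case: cid => t /= /andP[].
  by rewrite ltr_distl; lra.
have Gq : G (q, m).
  move=> y /= yq; apply: xA.
  rewrite -(subrKA (C q)) (le_lt_trans (ler_normD _ _))//.
  by rewrite (distrC (C q) x); lra.
exists (choice.pickle (q, m)); rewrite /c /e /D choice.pickleK /=.
by case: asboolP.
Qed.

End rV_topology.

Section rV_measure.
Variables (R : realType) (n : nat).
Local Notation V := 'rV[R]_n.
Local Notation leb := (lebesgue_rV R n).
Implicit Types (x y : V) (A U D N : set V).

Lemma measurable_open_cube (c : V) (e : R) : measurable [set y : V | `|y - c| < e].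
Proof.
have [e0|e0] := ltP 0 e; last first.
  rewrite (_ : [set _ | _] = set0)//; apply/seteqP; split=> // y /= h.
  by move: (lt_le_trans h e0); rewrite normr_lt0.
rewrite (_ : [set _ | _] = \bigcap_i
  ((fun x : V => x ord0 i : measurableTypeR R) @^-1` `](c ord0 i - e), (c ord0 i + e)[)).
  apply: fin_bigcap_measurable => // i _.
  by rewrite -[X in measurable X]setTI; exact: measurable_coord_rV.
apply/seteqP; split=> y /=.
  by move/(rV_norm_ltP _ e0) => h i _; rewrite /= in_itv /= -ltr_distl; have := h i; rewrite !mxE.
move=> h; apply/(rV_norm_ltP _ e0) => i; have := h i I.
by rewrite /= in_itv /= -ltr_distl !mxE.
Qed.

(** The sigma-algebra is generated by the coordinates and not by the open sets; the countable cover
    by rational cubes bridges the two. *)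
Lemma rV_open_measurable A : open A -> measurable A.
Proof.
move=> /open_cube_cover[c [e [h1 h2]]].
rewrite (_ : A = \bigcup_k (if 0 < e k then [set y : V | `|y - c k| < e k] else set0)).
  by apply: bigcupT_measurable => k; case: ifP => // _; exact: measurable_open_cube.
apply/seteqP; split=> x.
  by move=> /h2[k [ek xk]]; exists k => //; rewrite ek.
move=> [k _]; case: ifPn => // ek /= xk.
by have [|h] := h1 k; [rewrite leNgt ek|apply: h; exact: ltW].
Qed.

Lemma rV_closed_measurable A : closed A -> measurable A.
Proof. by move/closed_openC/rV_open_measurable/measurableC; rewrite setCK. Qed.

Lemma rV_continuous_measurable U (f : V -> R) : open U ->
  (forall x, U x -> {for x, continuous f}) -> measurable_fun U f.
Proof.
move=> oU cf; apply: (measurability _ (measurable_realfun.RGenOpens.measurableE R)).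
move=> _ [_ [a [b ->] <-]]; apply: rV_open_measurable.
rewrite openE => x [Ux fx]; apply: filterI; first by move: oU; rewrite openE; apply.
apply: (cf x Ux); move: (@interval_open R (BRight a) (BLeft b) isT isT); rewrite openE; exact.
Qed.

Lemma cube_finite (M : R) : (leb [set x : V | (`|x| <= M)%R] < +oo)%E.
Proof.
have [M0|M0] := leP 0 M; last first.
  rewrite (_ : [set _ | _] = set0) ?measure0//; apply/seteqP; split=> // y /= h.
  by have := le_lt_trans h M0; rewrite normr_lt0.
rewrite (_ : [set _ | _] = [set x : V | forall i, (const_mx (- M) : V) ord0 i <= x ord0 i <= (const_mx M : V) ord0 i]).
  rewrite lebesgue_rV_box ?ltry// => i; rewrite !mxE; lra.
apply/seteqP; split=> y /=.
  by move/(rV_norm_leP _ M0) => h i; rewrite !mxE -ler_norml.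
by move=> h; apply/(rV_norm_leP _ M0) => i; have := h i; rewrite !mxE -ler_norml.
Qed.

Lemma open_measure_gt0 A : open A -> A !=set0 -> (0 < leb A)%E.
Proof.
move=> oA [x Ax]; have mA := rV_open_measurable oA.
move/rV_openP : oA => /(_ _ Ax)[e e0 xA].
pose B : set V := [set y : V | forall i, (x - const_mx (e / 2)) ord0 i <= y ord0 i <= (x + const_mx (e / 2)) ord0 i].
have BE : leb B = (\prod_(i < n) e)%:E.
  rewrite /B lebesgue_rV_box; last by move=> i; rewrite !mxE; lra.
  by congr EFin; apply: eq_bigr => i _; rewrite !mxE; lra.
apply: (@lt_le_trans _ _ (leb B)).
  by rewrite BE lte_fin prodr_gt0.
apply: le_measure; rewrite ?inE//.
  rewrite (_ : B = \bigcap_i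
    ((fun x : V => x ord0 i : measurableTypeR R) @^-1` `[(x - const_mx (e / 2)) ord0 i, (x + const_mx (e / 2)) ord0 i])).
    apply: fin_bigcap_measurable => // i _.
    by rewrite -[X in measurable X]setTI; exact: measurable_coord_rV.
  apply/seteqP; split=> y /= h i; first by move=> _; rewrite /= in_itv /=; exact: h.
  by have := h i I; rewrite /= in_itv.
move=> y By; apply: xA; apply/rV_norm_ltP => // i.
by have := By i; rewrite !mxE ltr_distl; lra.
Qed.

End rV_measure.

Section null_sets.
Local Open Scope ereal_scope.
Context d (T : measurableType d) (R : realType).
Variables (mu : {measure set T -> \bar R}) (D N : set T).
Hypotheses (mN : measurable N) (N0 : mu N = 0).
Import HBNNSimple.

(* For a non-measurable integrand, the integral of a nonnegative function is the
   lower integral, and it does not see a measurable null set either. *)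
Lemma integral_setD_null (f : T -> \bar R) :
  \int[mu]_(x in D) f x = \int[mu]_(x in D `\` N) f x.
Proof.
have H : forall g : T -> \bar R, (forall x, 0 <= g x) ->
    \int[mu]_(x in D) g x = \int[mu]_(x in D `\` N) g x.
  move=> {}f f0; rewrite !ge0_integralE//.
  apply/eqP; rewrite eq_le; apply/andP; split.
    apply: ge_ereal_sup => _ [h /= hf <-].
    have mCN := measurableC mN.
    apply: ereal_sup_ubound; exists (proj_nnsfun h mCN); rewrite -?mrestrict.
      move=> x; rewrite -mrestrict /patch; case: ifPn => xN.
        have := hf x; rewrite /patch; case: ifPn => xD; last first.
          move=> hx; rewrite ifF//; apply/negbTE; apply: contra xD.
          by rewrite !inE => -[].
        rewrite ifT// inE; split; first exact: set_mem.
        by move: xN; rewrite inE.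
      by case: ifP => //; rewrite f0.
    transitivity (sintegral mu (h \_ (~` N))).
      by congr sintegral; rewrite (mrestrict h mCN).
    rewrite -integral_nnsfun// -[RHS]integralT_nnsfun.
    rewrite [RHS](@ge0_negligible_integral _ _ _ mu setT N)//=.
    - by rewrite setTD.
    - exact/measurable_EFinP.
    - by move=> x _; rewrite lee_fin.
  apply: ge_ereal_sup => _ [h /= hf <-]; apply: ereal_sup_ubound; exists h => //= x.
  apply: le_trans (hf x) _; rewrite /patch.
  case: ifPn => [|_]; last by case: ifP.
  by rewrite inE => -[Dx _]; rewrite mem_set.
by rewrite integralE [RHS]integralE H// [X in _ - X]H.
Qed.

End null_sets.

(** * Translation invariance of the Lebesgue measure, and null hyperplanes *)

Section shift_invariance.
Variable R : realType.

(** The image measure agrees with the Lebesgue measure on half-open intervals, which determine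
    it. *)
Lemma lebesgue_measure_shift (s : R) (A : set (measurableTypeR R)) : measurable A ->
  lebesgue_measure ((fun t => t + s) @^-1` A) = lebesgue_measure A.
Proof.
move=> mA.
have mphi : measurable_fun setT (fun t : measurableTypeR R => t + s : measurableTypeR R).
  exact: measurable_funD.
pose m : {measure set (measurableTypeR R) -> \bar R} :=
  measure_function_pushforward__canonical__measure_function_Measure
    (@lebesgue_measure R) mphi.
rewrite [RHS](@lebesgue_measure_unique R m)// => X /ocitvP[->|[[a b]/= ab ->]].
  by rewrite !measure0.
rewrite /pushforward.
rewrite (_ : _ @^-1` _ = `](a - s), (b - s)]%classic); last first.
  by apply/seteqP; split=> x /=; rewrite !in_itv /=; lra.
have H c e : (c < e)%R -> lebesgue_measure `]c, e]%classic = (e - c)%:E.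
  by move=> ce; rewrite lebesgue_measure_itv /= lte_fin ce EFinB.
rewrite !H//; last lra.
by congr EFin; lra.
Qed.

(** Induction on the dimension: the tail of v shifts the sections, which the induction hypothesis
    absorbs, and its head shifts the variable of the outer integral. *)
Lemma lebesgue_rV_shift n (v : 'rV[R]_n) (A : set 'rV[R]_n) : measurable A ->
  lebesgue_rV R n ((fun x => x + v) @^-1` A) = lebesgue_rV R n A.
Proof.
elim: n v A => [|n IH] v A mA.
  by congr (lebesgue_rV R 0 _); apply/seteqP; split=> x /=; rewrite (_ : x + v = x)//; apply/rowP; case.
pose C := @cons_rV R n @^-1` A.
have mC : measurable C.
  by rewrite -[X in measurable X]setTI; apply: measurable_cons_rV.
pose v' : 'rV[R]_n := \row_j v ord0 (lift ord0 j).
pose phi t := lebesgue_rV R n (xsection C t).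
have mphi : measurable_fun setT phi by exact: measurable_fun_xsection.
have msh : measurable_fun setT (fun t : measurableTypeR R => t + v ord0 ord0 : measurableTypeR R).
  exact: measurable_funD.
transitivity (\int[@lebesgue_measure R]_t phi (t + v ord0 ord0)%R)%E.
  apply: eq_integral => t _ /=.
  rewrite /phi -(IH v' (xsection C _))//; last exact: measurable_xsection.
  congr (lebesgue_rV R n _); apply/seteqP; split=> x; rewrite /xsection /= !inE /C /=.
    move=> h; rewrite (_ : cons_rV _ = cons_rV (t, x) + v)//.
    by apply/rowP => i; rewrite !mxE; case: unliftP => [j ->|->]; rewrite ?mxE.
  move=> h; rewrite (_ : _ + v = cons_rV (t + v ord0 ord0, x + v'))//.
  by apply/rowP => i; rewrite !mxE; case: unliftP => [j ->|->]; rewrite ?mxE.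
transitivity (\int[pushforward (@lebesgue_measure R) (fun t : measurableTypeR R => (t + v ord0 ord0)%R : measurableTypeR R)]_t phi t)%E.
  by rewrite ge0_integral_pushforward// => y _; exact: measure_ge0.
apply: eq_measure_integral => B mB _.
exact: lebesgue_measure_shift.
Qed.

(** Induction on the dimension. If the tail of d is nonzero, each section is a hyperplane of lower
    dimension; otherwise all sections but the one at [t0] are empty. *)
Lemma hyperplane_null n (c : R) (d : 'rV[R]_n) : d != 0 ->
  measurable [set x : 'rV[R]_n | c + \sum_i d ord0 i * x ord0 i = 0] /\
  lebesgue_rV R n [set x : 'rV[R]_n | c + \sum_i d ord0 i * x ord0 i = 0] = 0%E.
Proof.
have mP m (c' : R) (d' : 'rV[R]_m) :
    measurable [set x : 'rV[R]_m | c' + \sum_i d' ord0 i * x ord0 i = 0].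
  rewrite (_ : [set _ | _] = setT `&` (fun x : 'rV[R]_m => c' + \sum_i d' ord0 i * x ord0 i : measurableTypeR R) @^-1` [set 0]).
    have : measurable_fun setT (fun x : 'rV[R]_m => c' + \sum_i d' ord0 i * x ord0 i : measurableTypeR R).
      apply: measurable_funD => //; apply: measurable_sum => i.
      apply: measurable_funM => //; exact: measurable_coord_rV.
    by apply => //; exact: measurable_set1.
  by rewrite setTI.
move=> dn0; split; first exact: mP.
elim: n c d dn0 => [|n IH] c d dn0; first by rewrite thinmx0 eqxx in dn0.
pose d' : 'rV[R]_n := \row_j d ord0 (lift ord0 j).
pose A := [set x : 'rV[R]_n.+1 | c + \sum_i d ord0 i * x ord0 i = 0].
pose C := @cons_rV R n @^-1` A.
pose phi t := lebesgue_rV R n (xsection C t).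
have E t : xsection C t = [set x | (c + d ord0 ord0 * t) + \sum_i d' ord0 i * x ord0 i = 0].
  have Es (x : 'rV[R]_n) : c + \sum_i d ord0 i * cons_rV (t : measurableTypeR R, x) ord0 i =
      (c + d ord0 ord0 * t) + \sum_i d' ord0 i * x ord0 i.
    rewrite big_ord_recl addrA; congr (_ + _ + _).
      by rewrite mxE unlift_none.
    by apply: eq_bigr => i _; rewrite !mxE liftK.
  by apply/seteqP; split=> x; rewrite /xsection /= inE /C /A /= Es.
transitivity (\int[@lebesgue_measure R]_t phi t)%E => //.
have [d'0|d'0] := eqVneq d' 0; last first.
  by rewrite integral0_eq// => t _; rewrite /phi E IH.
have d00 : d ord0 ord0 != 0.
  apply: contra dn0 => /eqP d00; apply/eqP/rowP => i; rewrite mxE.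
  by case: (unliftP ord0 i) => [j ->|->//]; have /rowP/(_ j) := d'0; rewrite !mxE.
pose t0 : measurableTypeR R := - c / d ord0 ord0.
rewrite (@integral_setD_null _ _ _ _ _ [set t0])//; last exact: lebesgue_measure_set1.
rewrite integral0_eq// => t [_ /= tt0]; rewrite /phi E (_ : [set _ | _] = set0) ?measure0//.
apply/seteqP; split=> // x /=; rewrite d'0 big1 => [|i _]; last by rewrite mxE mul0r.
rewrite addr0 => h; apply: tt0; rewrite /t0.
by rewrite (_ : - c = t * d ord0 ord0) ?mulfK//; lra.
Qed.

End shift_invariance.

(** * Difference quotients and discrete Stokes identities *)

Section zero_integrals.
Variables (R : realType) (n : nat).
Local Notation V := 'rV[R]_n.
Local Notation leb := (lebesgue_rV R n).
Implicit Types (f g h w : V -> R) (x v : V).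

(** Bounded, measurable, of bounded support. A single constant M bounds both the values and the
    radius of the support, which makes the class easy to dominate. *)
Definition bms f := measurable_fun setT f /\
  exists M, forall x, `|f x| <= M /\ (M < `|x| -> f x = 0).

Lemma measurable_cube M : measurable [set x : V | `|x| <= M].
Proof.
rewrite (_ : [set _ | _] = ~` [set x | M < `|x|]); last first.
  by apply/seteqP; split=> x /=; rewrite real_leNgt ?num_real// => /negP.
apply: measurableC; apply: rV_open_measurable; apply/rV_openP => x /= Mx.
exists (`|x| - M) => [|y yx]; first by rewrite subr_gt0.
by have := ler_normB y (y - x); rewrite subKr; lra.
Qed.

Lemma bms_integrable f : bms f -> leb.-integrable setT (EFin \o f).
Proof.
move=> [mf [M fM]]; have mK := measurable_cube M.
rewrite (_ : EFin \o f = (EFin \o f) \_ [set x : V | `|x| <= M]); last first.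
  apply/funext => x; rewrite patchE; case: ifPn => //; rewrite notin_setE /= => /negP.
  by rewrite -ltNge => /(proj2 (fM x)) /= ->.
rewrite -integrable_mkcond//; apply: measurable_bounded_integrable => //.
- exact: cube_finite.
- exact: measurable_funS mf.
- exists M; split; [exact: num_real|move=> t Mt x _ /=].
  by have [fx _] := fM x; rewrite (le_trans fx)// ltW.
Qed.

Lemma bmsB f g : bms f -> bms g -> bms (fun x => f x - g x).
Proof.
move=> [mf [M fM]] [mg [P gP]]; split; first exact: measurable_funB.
exists (`|M| + `|P|) => x; have [f1 f2] := fM x; have [g1 g2] := gP x.
have := ler_norm M; have := ler_norm P; have := normr_ge0 M; have := normr_ge0 P => *.
split; first by have := ler_normB (f x) (g x); lra.
by move=> h; rewrite f2 ?g2 ?subr0//; lra.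
Qed.

Lemma bmsD f g : bms f -> bms g -> bms (fun x => f x + g x).
Proof.
move=> [mf [M fM]] [mg [P gP]]; split; first exact: measurable_funD.
exists (`|M| + `|P|) => x; have [f1 f2] := fM x; have [g1 g2] := gP x.
have := ler_norm M; have := ler_norm P; have := normr_ge0 M; have := normr_ge0 P => *.
split; first by have := ler_normD (f x) (g x); lra.
by move=> h; rewrite f2 ?g2 ?addr0//; lra.
Qed.

Lemma bmsMb f g B : bms f -> measurable_fun setT g -> (forall x, `|g x| <= B) ->
  bms (fun x => f x * g x).
Proof.
move=> [mf [M fM]] mg gB; split; first exact: measurable_funM.
exists (`|M| * `|B| + `|M|) => x; have [f1 f2] := fM x; have gx := gB x.
have MM := ler_norm M; have := ler_norm B => BB.
have ? : 0 <= `|M| * `|B| by rewrite mulr_ge0.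
split.
  rewrite normrM (@le_trans _ _ (`|M| * `|B|)) ?lerDl//.
  by rewrite ler_pM// ; lra.
by move=> h; rewrite f2 ?mul0r//; lra.
Qed.

Lemma measurable_shift (f : V -> R) v : measurable_fun setT f ->
  measurable_fun setT (fun x => f (x + v)).
Proof.
move=> mf; apply: (measurableT_comp mf).
apply: measurable_fun_rV => i.
rewrite [X in measurable_fun _ X](_ : _ = fun t : V => t ord0 i + v ord0 i); last first.
  by apply/funext => t; rewrite mxE.
by apply: measurable_funD => //; exact: measurable_coord_rV.
Qed.

Lemma bms_shift f v : bms f -> bms (fun x => f (x + v)).
Proof.
move=> [mf [M fM]]; split; first exact: measurable_shift.
exists (M + `|v|) => x; have [f1 f2] := fM (x + v); split.
  by have := normr_ge0 v; lra.
move=> h; apply: f2; have := ler_normB (x + v) v; rewrite addrK; lra.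
Qed.

Lemma Rintegral_shift f v : bms f ->
  \int[leb]_x f (x + v) = \int[leb]_x f x.
Proof.
move=> bf; congr fine.
have msh : measurable_fun setT (fun x : V => x + v).
  apply: measurable_fun_rV => i.
  rewrite [X in measurable_fun _ X](_ : _ = fun t : V => t ord0 i + v ord0 i); last first.
    by apply/funext => t; rewrite mxE.
  by apply: measurable_funD => //; exact: measurable_coord_rV.
transitivity (\int[pushforward leb (fun x : V => (x + v)%R)]_x (EFin \o f) x)%E.
  rewrite integral_pushforward//.
    by case: bf => mf _; exact/measurable_EFinP.
  rewrite preimage_setT; exact: (bms_integrable (bms_shift v bf)).
apply: eq_measure_integral => B mB _.
exact: lebesgue_rV_shift.
Qed.

Lemma Rintegral_shiftB f v : bms f -> \int[leb]_x (f (x + v) - f x) = 0.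
Proof.
move=> bf; rewrite RintegralB//.
- by rewrite Rintegral_shift// subrr.
- exact: (bms_integrable (bms_shift v bf)).
- exact: bms_integrable.
Qed.

(** Dominated convergence with M times the indicator of the cube of radius M as majorant. The limit
    is known only off the null set N, hence the domain of the conclusion. *)
Lemma Rintegral_limit_null (F : nat -> V -> R) (W : V -> R) (N : set V) (M : R) :
  (forall k, measurable_fun setT (F k)) ->
  (forall k x, `|F k x| <= M /\ (M < `|x| -> F k x = 0)) ->
  (forall k, \int[leb]_x F k x = 0) ->
  measurable N -> leb N = 0%E ->
  (forall x, ~ N x -> (fun k => F k x) @ \oo --> W x) ->
  \int[leb]_(x in ~` N) W x = 0.
Proof.
move=> mF FM F0 mN N0 FW.
have mCN := measurableC mN.
have mFk k : measurable_fun (~` N) (EFin \o F k).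
  by apply/measurable_EFinP; exact: measurable_funS (mF k).
have cF x : (~` N) x -> (fun k => (EFin \o F k) x) @ \oo --> (EFin \o W) x.
  by move=> Nx; apply: cvg_EFin; [exact: nearW|exact: FW].
have mW : measurable_fun (~` N) (EFin \o W).
  exact: (emeasurable_fun_cvg (fun k => EFin \o F k)).
pose g : V -> \bar R := EFin \o (fun x => M * \1_[set x : V | (`|x| <= M)%R] x).
have M0 : 0 <= M by have [h _] := FM 0%N 0; exact: le_trans h.
have ig : leb.-integrable (~` N) g.
  apply: (@integrableS _ _ _ leb setT) => //.
  apply: bms_integrable; split.
    apply: measurable_funM => //; apply: measurable_indic; exact: measurable_cube.
  exists M => x; rewrite indicE; split.
    by rewrite normrM ger0_norm//; case: (_ \in _); rewrite ?normr1 ?normr0; lra.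
  by move=> h; rewrite memNset ?mulr0//= => xM; move: h; rewrite ltNge xM.
have Fg k x : `|F k x| <= M * \1_[set x : V | (`|x| <= M)%R] x.
  have [h1 h2] := FM k x; rewrite indicE; case: (boolP (_ \in _)) => [|] xM; first by rewrite mulr1.
  by rewrite h2 ?normr0 ?mulr0// ltNge; apply: contra xM => h; rewrite inE.
have [_ _ ] := @dominated_convergence _ _ _ leb (~` N) mCN (fun k => EFin \o F k) (EFin \o W) g mFk mW
  (aeW _ (fun x => cF x)) ig (aeW _ (fun x k _ => Fg k x)).
rewrite (_ : [sequence _]_n = fun=> 0%E).
  move=> h; have h' := cvg_lim (@ereal_hausdorff R) h; rewrite lim_cst// in h'.
  by rewrite /Rintegral -h'.
apply/funext => k /=.
transitivity (\int[leb]_(x in setT) (EFin \o F k) x)%E.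
  by rewrite [RHS](integral_setD_null _ mN N0) setTD.
have := F0 k; rewrite /Rintegral => h; rewrite -[LHS]fineK ?h//.
by apply: integrable_fin_num => //; apply: bms_integrable; split => //; exists M.
Qed.

Definition hstep k : R := k.+1%:R^-1.

Lemma hstep_gt0 k : 0 < hstep k. Proof. by rewrite invr_gt0. Qed.

Lemma hstep_le1 k : hstep k <= 1.
Proof. by rewrite invf_le1// ler1n. Qed.

Lemma hstep_cvg : hstep @ \oo --> (0 : R).
Proof. exact: cvg_harmonic. Qed.

(** Difference quotients of w have integral zero by translation invariance and are bounded by L, so
    the limit has integral zero. Differentiability is asked for almost everywhere only, the
    Lipschitz bound doing the rest. *)
Lemma Rintegral_derivative w W v N L :
  bms w -> (forall x s, 0 < s <= 1 -> `|w (x + s *: v) - w x| <= L * s) ->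
  measurable N -> leb N = 0%E ->
  (forall x, ~ N x -> (fun k => (w (x + hstep k *: v) - w x) / hstep k) @ \oo --> W x) ->
  \int[leb]_(x in ~` N) W x = 0.
Proof.
move=> bw wL mN N0 wW; have [mw [M wM]] := bw.
have h01 k : 0 < hstep k <= 1 by rewrite hstep_gt0 hstep_le1.
pose F k x := (w (x + hstep k *: v) - w x) / hstep k.
(* The quotients are bounded by [|L|]; since the steps are at most 1, their supports exceed that of
   w by at most [|v|]. *)
apply: (@Rintegral_limit_null F W N (`|M| + `|v| + `|L|)) => //.
- move=> k; apply: measurable_funM => //; apply: measurable_funB => //; exact: measurable_shift.
- move=> k x; have := h01 k => /andP[s0 s1].
  have := normr_ge0 M; have := normr_ge0 v; have := normr_ge0 L; have := ler_norm L; have := ler_norm M => *.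
  split.
    rewrite /F normrM normfV (gtr0_norm s0) ler_pdivrMr//.
    apply: le_trans (wL x _ (h01 k)) _; rewrite ler_pM2r//; lra.
  move=> h; rewrite /F.
  have [_ ->] := wM (x + hstep k *: v); last first.
    have := ler_normB (x + hstep k *: v) (hstep k *: v); rewrite addrK normrZ (gtr0_norm s0).
    have : hstep k * `|v| <= `|v| by rewrite ler_piMl.
    lra.
  by have [_ ->] := wM x; rewrite ?subrr ?mul0r//; lra.
- move=> k; rewrite RintegralZr// ?Rintegral_shiftB ?mul0r//.
  by apply: bms_integrable; apply: bmsB => //; exact: bms_shift.
Qed.

(** A quadratic remainder, stronger than differentiability: it controls quotients based at the
    moving points x + s p and not only those based at x. *)
Definition taylor1 (a : V -> R) x (g : V) := exists C r : R, 0 < r /\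
  forall y, `|y| < r -> `|a (x + y) - a x - dotv g y| <= C * `|y| ^+ 2.

Lemma dotvD (g x y : V) : dotv g (x + y) = dotv g x + dotv g y :> R.
Proof. by rewrite -big_split; apply: eq_bigr => i _; rewrite /= mxE mulrDr. Qed.

Lemma dotvZ (g : V) c x : dotv g (c *: x) = c * dotv g x :> R.
Proof. by rewrite mulr_sumr; apply: eq_bigr => i _; rewrite /= mxE; ring. Qed.

Lemma dotv_delta (g : V) i : dotv g (delta_mx ord0 i) = g ord0 i :> R.
Proof.
rewrite /dotv (bigD1 i)//= mxE !eqxx mulr1 big1 ?addr0// => j ji.
by rewrite mxE eqxx (negbTE ji) mulr0.
Qed.

(** The increments s p and s (p + v) are both of order s, so the two Taylor remainders are of order
    s^2 and their difference divided by s tends to 0. *)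
Lemma taylor1_dquot a x (g p v : V) : taylor1 a x g ->
  (fun k => (a (x + hstep k *: p + hstep k *: v) - a (x + hstep k *: p)) / hstep k)
    @ \oo --> dotv g v.
Proof.
move=> [C [r [r0 h]]].
pose K := `|C| * (`|p + v| ^+ 2 + `|p| ^+ 2).
have cK : (fun k => K * hstep k) @ \oo --> (0 : R).
  by rewrite -[X in _ --> X](mulr0 K); apply: cvgMr => //; exact: hstep_cvg.
have cr : \forall k \near \oo, hstep k * (`|p + v| + `|p|) < r.
  have : (fun k => hstep k * (`|p + v| + `|p|)) @ \oo --> (0 : R).
    by rewrite -[X in _ --> X](mul0r (`|p + v| + `|p|)); apply: cvgMl => //; exact: hstep_cvg.
  by move/cvgr_lt; apply.
apply/cvgrPdist_le => e e0.
near=> k.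
have s0 := hstep_gt0 k.
have sr : hstep k * (`|p + v| + `|p|) < r by near: k.
have Ke : K * hstep k <= e.
  by near: k; move/cvgr_le : cK; apply.
set s := hstep k in s0 sr Ke *.
have n1 : `|s *: (p + v)| = s * `|p + v| by rewrite normrZ gtr0_norm.
have n2 : `|s *: p| = s * `|p| by rewrite normrZ gtr0_norm.
have b1 : `|s *: (p + v)| < r by rewrite n1 (le_lt_trans _ sr)// ler_pM2l// lerDl.
have b2 : `|s *: p| < r by rewrite n2 (le_lt_trans _ sr)// ler_pM2l// lerDr.
move: (h _ b1) (h _ b2); rewrite n1 n2 !dotvZ dotvD scalerDr addrA => h1 h2.
apply: le_trans Ke.
set A := a (x + _ + _) in h1 *; set B := a (x + _) in h2 *.
have -> : dotv g v - (A - B) / s =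
    ((B - a x - s * dotv g p) - (A - a x - s * (dotv g p + dotv g v))) / s.
  by field; rewrite gt_eqF.
rewrite normrM normfV (gtr0_norm s0) ler_pdivrMr//.
apply: le_trans (ler_normB _ _) _.
have C1 := ler_norm C.
have : C * (s * `|p + v|) ^+ 2 <= `|C| * (s * `|p + v|) ^+ 2 by rewrite ler_wpM2r// sqr_ge0.
have : C * (s * `|p|) ^+ 2 <= `|C| * (s * `|p|) ^+ 2 by rewrite ler_wpM2r// sqr_ge0.
have -> : K * s * s = `|C| * (s * `|p + v|) ^+ 2 + `|C| * (s * `|p|) ^+ 2.
  by rewrite /K; ring.
lra.
Unshelve. all: by end_near. Qed.

(* Discrete Stokes theorem: with forward differences, d chi /\ d a is exactly the
   coboundary of chi d a, so its integral vanishes by translation invariance. *)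
Lemma Rintegral_det2 (chi a : V -> R) (gchi ga : V -> V) (i j : 'I_n) N L :
  bms chi -> (forall v x s, 0 < s <= 1 -> `|chi (x + s *: v) - chi x| <= L * `|v| * s) ->
  measurable_fun setT a ->
  (forall v x s, 0 < s <= 1 -> `|a (x + s *: v) - a x| <= L * `|v| * s) ->
  measurable N -> leb N = 0%E ->
  (forall x, ~ N x ->
     (taylor1 chi x (gchi x) /\ taylor1 a x (ga x)) \/
     ((\forall y \near x, chi y = 0) /\ gchi x = 0)) ->
  \int[leb]_(x in ~` N) (gchi x ord0 i * ga x ord0 j - gchi x ord0 j * ga x ord0 i) = 0.
Proof.
move=> bchi chiL ma aL mN N0 H.
pose e l : V := delta_mx ord0 l.
(* The terms [hstep k *: 0] put every quotient in the form treated by [taylor1_dquot]. The quotients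
   of a are based at the point already shifted in the other direction, as in a cup product of
   cochains. *)
pose F k x := 
  (chi (x + hstep k *: 0 + hstep k *: e i) - chi (x + hstep k *: 0)) / hstep k *
  ((a (x + hstep k *: e i + hstep k *: e j) - a (x + hstep k *: e i)) / hstep k) -
  (chi (x + hstep k *: 0 + hstep k *: e j) - chi (x + hstep k *: 0)) / hstep k *
  ((a (x + hstep k *: e j + hstep k *: e i) - a (x + hstep k *: e j)) / hstep k).
have h01 k : 0 < hstep k <= 1 by rewrite hstep_gt0 hstep_le1.
have q (f : V -> R) k x p v : (forall v x s, 0 < s <= 1 -> `|f (x + s *: v) - f x| <= L * `|v| * s) ->
    `|(f (x + p + hstep k *: v) - f (x + p)) / hstep k| <= `|L| * `|v|.
  move=> fL; rewrite normrM normfV (gtr0_norm (hstep_gt0 k)) ler_pdivrMr ?hstep_gt0//.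
  apply: le_trans (fL _ _ _ (h01 k)) _.
  by rewrite ler_pM2r ?hstep_gt0// ler_wpM2r// ler_norm.
have [mchi [M chiM]] := bchi.
have nq (f : V -> R) k x p v : 0 <= `|L| * `|v| by rewrite mulr_ge0.
apply: (@Rintegral_limit_null F _ N (`|M| + `|e i| + `|e j| + 2 * (`|L| * `|e i| * (`|L| * `|e j|)))) => //.
- move=> k; rewrite /F; under eq_fun do rewrite scaler0 !addr0.
  apply: measurable_funB; apply: measurable_funM; apply: measurable_funM => //;
    apply: measurable_funB => //; do ?exact: measurable_shift.
  + by under eq_fun do rewrite -addrA; exact: measurable_shift.
  + by under eq_fun do rewrite -addrA; exact: measurable_shift.
- move=> k x; have /andP[s0 s1] := h01 k.
  have := normr_ge0 M; have := normr_ge0 (e i); have := normr_ge0 (e j).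
  have P : 0 <= `|L| * `|e i| * (`|L| * `|e j|) by rewrite !mulr_ge0.
  have := ler_norm M => *; split.
    rewrite /F; apply: le_trans (ler_normB _ _) _; rewrite !normrM.
    apply: (@le_trans _ _ (`|L| * `|e i| * (`|L| * `|e j|) + `|L| * `|e j| * (`|L| * `|e i|))); last first.
      rewrite [X in _ + X <= _]mulrC; lra.
    by rewrite -!normrM lerD// normrM ler_pM//; exact: q.
  move=> h; have c0 v : `|v| <= `|e i| + `|e j| -> chi (x + hstep k *: v) = 0.
    move=> vb; have [_ ->] := chiM (x + hstep k *: v) => //.
    have := ler_normB (x + hstep k *: v) (hstep k *: v); rewrite addrK normrZ (gtr0_norm s0).
    have : hstep k * `|v| <= `|v| by rewrite ler_piMl.
    lra.
  rewrite /F -!addrA -!scalerDr !add0r !c0 ?normr0 ?lerDl ?lerDr ?addr_ge0//.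
  by rewrite subrr !mul0r subrr.
- move=> k; set s := hstep k; have s0 := hstep_gt0 k.
  (* The discrete one-form chi da, divided by s once more; [F k] is its discrete curl, a difference
     of two translation differences. *)
  pose h (m : 'I_n) (x : V) := chi x * ((a (x + s *: e m) - a x) / s ^+ 2).
  have bh m : bms (h m).
    apply: (@bmsMb _ _ (`|L| * `|e m| / s)) => //.
      apply: measurable_funM => //; apply: measurable_funB => //; exact: measurable_shift.
    move=> x; rewrite expr2 invfM mulrA normrM normfV (gtr0_norm s0) ler_pM2r ?invr_gt0//.
    by have := q a k x 0 (e m) aL; rewrite addr0.
  have E x : F k x = (h j (x + s *: e i) - h j x) - (h i (x + s *: e j) - h i x).
    rewrite /F /h -/s scaler0 !addr0 (addrAC x (s *: e j)); field.
    by rewrite gt_eqF.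
  under eq_Rintegral do rewrite E.
  have b l m : bms (fun x => h m (x + s *: e l) - h m x) by apply: bmsB => //; exact: bms_shift.
  rewrite RintegralB//; first by rewrite !Rintegral_shiftB// subrr.
  + exact: bms_integrable.
  + exact: bms_integrable.
- move=> x Nx; have [[tc ta]|[c0 g0]] := H x Nx.
    rewrite -!dotv_delta /F; apply: cvgB; apply: cvgM; exact: taylor1_dquot.
  rewrite g0 !mxE !mul0r subrr.
  have : (fun k => F k x) @ \oo --> (0 : R); last by [].
  have zc v : \forall k \near \oo, chi (x + hstep k *: v) = 0.
    have : (fun k => x + hstep k *: v) @ \oo --> x.
      rewrite -[X in _ --> X]addr0 -(scale0r v); apply: cvgD; first exact: cvg_cst.
      apply: cvgZl; exact: hstep_cvg.
    by move=> /(_ _ c0).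
  apply: cvg_near_cst; near=> k; rewrite /F -!addrA -!scalerDr.
  have -> : chi (x + hstep k *: (0 + e i)) = 0 by near: k; exact: zc.
  have -> : chi (x + hstep k *: (0 + e j)) = 0 by near: k; exact: zc.
  have -> : chi (x + hstep k *: 0) = 0 by near: k; exact: zc.
  by rewrite subrr !mul0r subrr.
Unshelve. all: by end_near. Qed.

(** The same argument one degree higher. On the cubical lattice the antisymmetrized cup product of d
    chi, d a and d b is the coboundary of that of chi, d a and d b, provided each factor is
    evaluated at the point reached after the steps of the factors before it; these are the shifts in
    [T]. Away from the support of chi nothing is asked of the gradients of a and b. *)
Lemma Rintegral_det3 (chi a b : V -> R) (gchi ga gb : V -> V) (i j l : 'I_n) N L :
  bms chi -> (forall v x s, 0 < s <= 1 -> `|chi (x + s *: v) - chi x| <= L * `|v| * s) ->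
  measurable_fun setT a ->
  (forall v x s, 0 < s <= 1 -> `|a (x + s *: v) - a x| <= L * `|v| * s) ->
  measurable_fun setT b ->
  (forall v x s, 0 < s <= 1 -> `|b (x + s *: v) - b x| <= L * `|v| * s) ->
  measurable N -> leb N = 0%E ->
  (forall x, ~ N x ->
     [/\ taylor1 chi x (gchi x), taylor1 a x (ga x) & taylor1 b x (gb x)] \/
     ((\forall y \near x, chi y = 0) /\ gchi x = 0)) ->
  let m p q x := ga x ord0 p * gb x ord0 q - ga x ord0 q * gb x ord0 p in
  \int[leb]_(x in ~` N) (gchi x ord0 i * m j l x + gchi x ord0 j * m l i x +
    gchi x ord0 l * m i j x) = 0.
Proof.
move=> bchi chiL ma aL mb bL mN N0 H m.
pose e t : V := delta_mx ord0 t.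
pose dq (f : V -> R) k x (p v : V) :=
  (f (x + hstep k *: p + hstep k *: v) - f (x + hstep k *: p)) / hstep k.
pose T k (i j l : 'I_n) x := dq chi k x 0 (e i) *
  (dq a k x (e i) (e j) * dq b k x (e i + e j) (e l) -
   dq a k x (e i) (e l) * dq b k x (e i + e l) (e j)).
pose F k x := T k i j l x + T k j l i x + T k l i j x.
have h01 k : 0 < hstep k <= 1 by rewrite hstep_gt0 hstep_le1.
pose E := `|e i| + `|e j| + `|e l|.
have eE t : t \in [:: i; j; l] -> `|e t| <= E.
  rewrite !inE /E; have := normr_ge0 (e i); have := normr_ge0 (e j); have := normr_ge0 (e l).
  by move=> ? ? ? /or3P[] /eqP ->; lra.
have E0 : 0 <= E by rewrite !addr_ge0.
have mdq f k p v : measurable_fun setT f -> measurable_fun setT (fun x => dq f k x p v).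
  move=> mf; apply: measurable_funM => //; apply: measurable_funB => //; last exact: measurable_shift.
  by under eq_fun do rewrite -addrA; exact: measurable_shift.
have q (f : V -> R) k x p v : (forall v x s, 0 < s <= 1 -> `|f (x + s *: v) - f x| <= L * `|v| * s) ->
    `|v| <= E -> `|dq f k x p v| <= `|L| * E.
  move=> fL vE; rewrite normrM normfV (gtr0_norm (hstep_gt0 k)) ler_pdivrMr ?hstep_gt0//.
  apply: le_trans (fL _ _ _ (h01 k)) _.
  rewrite ler_pM2r ?hstep_gt0//; apply: (@le_trans _ _ (`|L| * `|v|)).
    by rewrite ler_wpM2r// ler_norm.
  by rewrite ler_wpM2l.
set K := `|L| * E in q.
have K0 : 0 <= K by rewrite mulr_ge0.
have qab k x p1 p2 p3 p4 t u : t \in [:: i; j; l] -> u \in [:: i; j; l] ->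
    `|dq a k x p1 (e t) * dq b k x p2 (e u) - dq a k x p3 (e u) * dq b k x p4 (e t)| <= 2 * K ^+ 2.
  move=> ti ui; apply: le_trans (ler_normB _ _) _.
  rewrite (normrM (dq a k x p1 (e t))) (normrM (dq a k x p3 (e u))).
  rewrite (_ : 2 * K ^+ 2 = K * K + K * K); last by ring.
  by rewrite lerD// ler_pM//; apply: q => //; exact: eE.
have [mchi [M chiM]] := bchi.
have iI : i \in [:: i; j; l] by rewrite !inE eqxx.
have jI : j \in [:: i; j; l] by rewrite !inE eqxx orbT.
have lI : l \in [:: i; j; l] by rewrite !inE eqxx !orbT.
apply: (@Rintegral_limit_null F _ N (`|M| + E + 3 * (K * (2 * K ^+ 2)))) => //.
- have mT k i' j' l' : measurable_fun setT (T k i' j' l').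
    apply: measurable_funM; first exact: mdq.
    by apply: measurable_funB; apply: measurable_funM; exact: mdq.
  by move=> k; do 2?apply: measurable_funD; exact: mT.
- move=> k x; have /andP[s0 s1] := h01 k.
  have P : 0 <= K * (2 * K ^+ 2) by rewrite !mulr_ge0 ?sqr_ge0.
  have := ler_norm M; have := normr_ge0 M => *; split.
    have TK i' j' l' : i' \in [:: i; j; l] -> j' \in [:: i; j; l] -> l' \in [:: i; j; l] ->
        `|T k i' j' l' x| <= K * (2 * K ^+ 2).
      move=> ? ? ?; rewrite normrM ler_pM//; last exact: qab.
      by apply: q => //; exact: eE.
    have := TK i j l iI jI lI; have := TK j l i jI lI iI; have := TK l i j lI iI jI.
    rewrite /F; have := ler_normD (T k i j l x + T k j l i x) (T k l i j x).
    have := ler_normD (T k i j l x) (T k j l i x); lra.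
  move=> h; have c0 t : t \in [:: i; j; l] -> dq chi k x 0 (e t) = 0.
    move=> tI; have zv v : `|v| <= E -> chi (x + hstep k *: v) = 0.
      move=> vb; have [_ ->] := chiM (x + hstep k *: v) => //.
      have := ler_normB (x + hstep k *: v) (hstep k *: v); rewrite addrK normrZ (gtr0_norm s0).
      have : hstep k * `|v| <= `|v| by rewrite ler_piMl.
      lra.
    by rewrite /dq -!addrA -!scalerDr !add0r !zv ?normr0 ?eE// subrr mul0r.
  by rewrite /F /T !c0// !mul0r !addr0.
- move=> k; set s := hstep k; have s0 := hstep_gt0 k.
  pose h (j l : 'I_n) (x : V) := chi x *
    ((dq a k x 0 (e j) * dq b k x (e j) (e l) - dq a k x 0 (e l) * dq b k x (e l) (e j)) / s).
  have bh t u : t \in [:: i; j; l] -> u \in [:: i; j; l] -> bms (h t u).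
    move=> tI uI; apply: (@bmsMb _ _ (2 * K ^+ 2 / s)) => //.
      apply: measurable_funM => //.
      by apply: measurable_funB; apply: measurable_funM; exact: mdq.
    move=> x; rewrite normrM normfV (gtr0_norm s0) ler_pM2r ?invr_gt0//.
    exact: qab.
  have Eq x : F k x = (h j l (x + s *: e i) - h j l x) + (h l i (x + s *: e j) - h l i x)
      + (h i j (x + s *: e l) - h i j x).
    (* These identities give equal shifts the same form, so that [field] recognizes equal values of
       chi, a and b. *)
    have C1 : e j + e i = e i + e j by rewrite addrC.
    have C2 : e l + e i = e i + e l by rewrite addrC.
    have C3 : e l + e j = e j + e l by rewrite addrC.
    have C4 : e i + e l + e j = e i + e j + e l by rewrite addrAC.
    have C5 : e j + e l + e i = e i + e j + e l by rewrite addrAC C1.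
    have C6 : e i + (e j + e l) = e i + e j + e l by rewrite addrA.
    have C7 : e j + (e i + e l) = e i + e j + e l by rewrite addrA C1.
    have C8 : e l + (e i + e j) = e i + e j + e l by rewrite addrC.
    rewrite /F /T /h /dq /s -!(addrA x) -!scalerDr !add0r !scaler0 !addr0.
    rewrite !(C1, C2, C3, C4, C5, C6, C7, C8).
    by field; rewrite gt_eqF.
  under eq_Rintegral do rewrite Eq.
  have b' (t u w : 'I_n) : t \in [:: i; j; l] -> u \in [:: i; j; l] ->
    bms (fun x => h t u (x + s *: e w) - h t u x).
    by move=> tI uI; apply: bmsB; [apply: bms_shift; exact: bh|exact: bh].
  rewrite RintegralD//; last 2 first.
  + by apply: bms_integrable; apply: bmsD; exact: b'.
  + by apply: bms_integrable; exact: b'.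
  rewrite RintegralD//; try by apply: bms_integrable; exact: b'.
  by rewrite !Rintegral_shiftB ?addr0//; exact: bh.
- move=> x Nx; have [[tc ta tb]|[c0 g0]] := H x Nx.
    rewrite /m -!dotv_delta /F; apply: cvgD; first apply: cvgD;
    by apply: cvgM; [exact: taylor1_dquot|apply: cvgB; apply: cvgM; exact: taylor1_dquot].
  rewrite g0 !mxE !mul0r !addr0.
  have : (fun k => F k x) @ \oo --> (0 : R); last by [].
  have zc v : \forall k \near \oo, chi (x + hstep k *: v) = 0.
    have : (fun k => x + hstep k *: v) @ \oo --> x.
      rewrite -[X in _ --> X]addr0 -(scale0r v); apply: cvgD; first exact: cvg_cst.
      apply: cvgZl; exact: hstep_cvg.
    by move=> /(_ _ c0).
  apply: cvg_near_cst; near=> k; rewrite /F /T /dq -!(addrA x) -!scalerDr.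
  have -> : chi (x + hstep k *: (0 + e i)) = 0 by near: k; exact: zc.
  have -> : chi (x + hstep k *: (0 + e j)) = 0 by near: k; exact: zc.
  have -> : chi (x + hstep k *: (0 + e l)) = 0 by near: k; exact: zc.
  have -> : chi (x + hstep k *: 0) = 0 by near: k; exact: zc.
  by rewrite subrr !mul0r !addr0.
Unshelve. all: by end_near. Qed.

End zero_integrals.

(** * Derivatives and polynomial functions *)

Section directional_derivatives.
Variables (R : realType) (n : nat).
Local Notation V := 'rV[R]_n.
Implicit Types (f g : V -> R) (x v : V).

Lemma is_derive_lineP f x v l : is_derive x v f l <->
  is_derive (0 : R) 1 (fun h => f (h *: v + x)) l.
Proof.
have E : 'D_v f x = 'D_1 (fun h : R => f (h *: v + x)) 0.
  rewrite /derive; set g1 := fun h => h^-1 *: _; set g2 := fun h => h^-1 *: _.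
  suff -> : g1 = g2 by [].
  by rewrite funeqE /g1 /g2 => h /=; rewrite addr0 scale0r add0r [_%:A]mulr1.
split=> -[d dl].
  by apply: DeriveDef; [exact: (proj1 (derivable1P f x v) d)|rewrite -E].
by apply: DeriveDef; [exact: (proj2 (derivable1P f x v) d)|rewrite E].
Qed.

Lemma is_derive_line f x v l (t : R) : is_derive (x + t *: v) v f l ->
  is_derive t 1 (fun h => f (x + h *: v)) l.
Proof.
move=> /is_derive_lineP h.
have -> : (fun h => f (x + h *: v)) = (fun h => f (h *: v + (x + t *: v))) \o (fun h => h - t).
  by apply/funext => s /=; rewrite scalerBl addrACA addNr addr0 addrC.
rewrite -[l]mulr1; apply: is_derive1_comp; first by rewrite subrr.
have := @is_deriveB _ _ _ id (cst t) t 1 1 0 _ _; rewrite subr0; apply.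
Qed.

Lemma is_derive_comp1 f (g : R -> R) x v df dg : is_derive x v f df ->
  is_derive (f x) 1 g dg -> is_derive x v (fun y => g (f y)) (dg * df).
Proof.
move=> /is_derive_lineP hf hg; apply/is_derive_lineP.
apply: (@is_derive1_comp _ g (fun h => f (h *: v + x))) => //.
by rewrite scale0r add0r.
Qed.

Lemma is_derive_dquot f x v l : is_derive x v f l ->
  (fun k => (f (x + hstep R k *: v) - f x) / hstep R k) @ \oo --> l.
Proof.
move=> [df <-].
have -> : (fun k => (f (x + hstep R k *: v) - f x) / hstep R k) =
    (fun h => h^-1 *: ((f \o shift x) (h *: v) - f x)) \o hstep R.
  by apply/funext => k; rewrite /= /shift mulrC (addrC x).
move/cvgr_dnbhsP : df; apply; split; last exact: hstep_cvg.
by move=> k; rewrite gt_eqF// hstep_gt0.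
Qed.

Lemma is_derive_coord i x v : is_derive x v (fun y : V => y ord0 i) (v ord0 i).
Proof.
have c : (fun h : R => h^-1 *: (((fun y : V => y ord0 i) \o shift x) (h *: v) - x ord0 i)) @ 0^'
    --> v ord0 i.
  apply: cvg_near_cst; near=> h.
  rewrite /= !mxE addrK /GRing.scale /= mulrA mulVf ?mul1r//.
  by near: h; exact: nbhs_dnbhs_neq.
by split; [apply/cvg_ex; exists (v ord0 i)|apply/cvg_lim].
Unshelve. all: by end_near. Qed.

Lemma line_mvt f x v (L : R) (s : R) : 0 <= s ->
  (forall t, 0 <= t <= s -> derivable f (x + t *: v) v) ->
  (forall t, 0 <= t <= s -> `|'D_v f (x + t *: v)| <= L) ->
  `|f (x + s *: v) - f x| <= L * s.
Proof.
rewrite le_eqVlt => /predU1P[<- _ _|s0 df bf].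
  by rewrite scale0r addr0 subrr normr0 mulr0.
have D t : 0 <= t <= s -> is_derive t 1 (fun h => f (x + h *: v)) ('D_v f (x + t *: v)).
  by move=> ts; apply: is_derive_line; apply: derivableP; exact: df.
have [||c] := @MVT R (fun h => f (x + h *: v)) (fun t => 'D_v f (x + t *: v)) 0 s s0.
- by move=> t; rewrite in_itv /= => /andP[t1 t2]; apply: D; rewrite !ltW.
- by apply: derivable_within_continuous => t; rewrite in_itv /= => /D[].
rewrite in_itv /= => /andP[c1 c2]; rewrite scale0r addr0 subr0 => ->.
by rewrite normrM (gtr0_norm s0) ler_pM2r// bf// !ltW.
Qed.

End directional_derivatives.

Section polynomial_functions.
Variables (R : realType) (n : nat).
Local Notation V := 'rV[R]_n.
Implicit Types (p q : V -> R) (x v : V).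

(** A predicate on functions rather than a type of polynomials in several variables: continuity,
    Lipschitz bounds, Taylor expansions and restrictions to lines all follow by induction on the
    construction, and partial derivatives stay in the class. *)
Inductive polyf : (V -> R) -> Prop :=
| polyf_cst c : polyf (fun=> c)
| polyf_coord i : polyf (fun x => x ord0 i)
| polyf_add p q : polyf p -> polyf q -> polyf (fun x => p x + q x)
| polyf_mul p q : polyf p -> polyf q -> polyf (fun x => p x * q x).

Lemma polyf_opp p : polyf p -> polyf (fun x => - p x).
Proof.
move=> pp; rewrite (_ : (fun x => - p x) = (fun x => (-1) * p x)).
  by apply: polyf_mul => //; exact: polyf_cst.
by apply/funext => x; rewrite mulN1r.
Qed.

Lemma polyf_sub p q : polyf p -> polyf q -> polyf (fun x => p x - q x).
Proof. by move=> pp pq; apply: polyf_add => //; exact: polyf_opp. Qed.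

Lemma polyf_sum I (r : seq I) (F : I -> V -> R) :
  (forall i, polyf (F i)) -> polyf (fun x => \sum_(i <- r) F i x).
Proof.
move=> h; elim: r => [|i r IH].
  by under eq_fun do rewrite big_nil; exact: polyf_cst.
by under eq_fun do rewrite big_cons; exact: polyf_add.
Qed.

Lemma polyf_prod I (r : seq I) (F : I -> V -> R) :
  (forall i, polyf (F i)) -> polyf (fun x => \prod_(i <- r) F i x).
Proof.
move=> h; elim: r => [|i r IH].
  by under eq_fun do rewrite big_nil; exact: polyf_cst.
by under eq_fun do rewrite big_cons; exact: polyf_mul.
Qed.

Lemma polyf_exp p k : polyf p -> polyf (fun x => p x ^+ k).
Proof.
move=> pp; elim: k => [|k IH]; first by under eq_fun do rewrite expr0; exact: polyf_cst.
by under eq_fun do rewrite exprS; exact: polyf_mul.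
Qed.

Lemma polyf_derivable p x v : polyf p -> derivable p x v.
Proof.
elim=> [c|i|{}p q _ dp _ dq|{}p q _ dp _ dq].
- exact: derivable_cst.
- by case: (is_derive_coord i x v).
- exact: (derivableD dp dq).
- exact: (derivableM dp dq).
Qed.

Lemma polyf_is_derive p x v : polyf p -> is_derive x v p ('D_v p x).
Proof. by move=> pp; apply: derivableP; exact: polyf_derivable. Qed.

Lemma polyf_derive v p : polyf p -> polyf ('D_v p).
Proof.
elim=> [c|i|{}p q pp dp pq dq|{}p q pp dp pq dq].
- rewrite (_ : 'D_v _ = fun=> 0); first exact: polyf_cst.
  by apply/funext => x; exact: derive_cst.
- rewrite (_ : 'D_v _ = fun=> v ord0 i); first exact: polyf_cst.
  by apply/funext => x; case: (is_derive_coord i x v).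
- rewrite (_ : 'D_v _ = fun x => 'D_v p x + 'D_v q x); first exact: polyf_add.
  by apply/funext => x; apply: deriveD; exact: polyf_derivable.
- rewrite (_ : 'D_v _ = fun x => p x * 'D_v q x + q x * 'D_v p x).
    by apply: polyf_add; exact: polyf_mul.
  by apply/funext => x; apply: deriveM; exact: polyf_derivable.
Qed.

Lemma polyf_pderiv i p : polyf p -> polyf (pderiv i p).
Proof. exact: polyf_derive. Qed.

Lemma pderivD i p q : polyf p -> polyf q ->
  pderiv i (fun x => p x + q x) = fun x => pderiv i p x + pderiv i q x.
Proof. by move=> pp pq; apply/funext => x; apply: deriveD; exact: polyf_derivable. Qed.

Lemma pderivM i p q : polyf p -> polyf q ->
  pderiv i (fun x => p x * q x) = fun x => p x * pderiv i q x + q x * pderiv i p x.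
Proof. by move=> pp pq; apply/funext => x; apply: deriveM; exact: polyf_derivable. Qed.

Lemma pderiv_cst i (c : R) : pderiv i (fun _ : V => c) = fun=> 0.
Proof. by apply/funext => x; exact: derive_cst. Qed.

Lemma pderiv_coord i j : pderiv i (fun x : V => x ord0 j) = fun=> (i == j)%:R.
Proof.
apply/funext => x; rewrite /pderiv; have [_ ->] := is_derive_coord j x (delta_mx ord0 i).
by rewrite mxE eqxx eq_sym.
Qed.

Lemma polyf_bounded p M : polyf p -> exists B, forall x, `|x| <= M -> `|p x| <= B.
Proof.
elim=> [c|i|{}p q _ [B hB] _ [C hC]|{}p q _ [B hB] _ [C hC]].
- by exists `|c|.
- by exists M => x; apply: le_trans; exact: rV_coord_le.
- by exists (B + C) => x xM; apply: le_trans (ler_normD _ _) _; rewrite lerD ?hB ?hC.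
- by exists (B * C) => x xM; rewrite normrM ler_pM ?hB ?hC.
Qed.

Lemma polyf_lipschitz p M : polyf p -> exists2 L, 0 <= L &
  forall x y, `|x| <= M -> `|y| <= M -> `|p x - p y| <= L * `|x - y|.
Proof.
elim=> [c|i|{}p q _ [B B0 hB] _ [C C0 hC]|{}p q pp [B B0 hB] pq [C C0 hC]].
- by exists 0 => // x y _ _; rewrite subrr normr0 mul0r.
- exists 1 => // x y _ _; rewrite mul1r; have := rV_coord_le (x - y) i; by rewrite !mxE.
- exists (B + C); rewrite ?addr_ge0// => x y xM yM.
  rewrite opprD addrACA mulrDl; apply: le_trans (ler_normD _ _) _.
  by rewrite lerD ?hB ?hC.
- have [Mp hp] := polyf_bounded M pp; have [Mq hq] := polyf_bounded M pq.
  exists (`|Mp| * C + `|Mq| * B); first by rewrite addr_ge0// mulr_ge0.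
  move=> x y xM yM.
  rewrite (_ : p x * q x - p y * q y = p x * (q x - q y) + q y * (p x - p y)); last by ring.
  apply: le_trans (ler_normD _ _) _; rewrite !normrM mulrDl -!mulrA.
  apply: lerD; apply: ler_pM => //; rewrite ?hB ?hC//.
  + exact: le_trans (hp _ xM) (ler_norm _).
  + exact: le_trans (hq _ yM) (ler_norm _).
Qed.

Lemma polyf_continuous p x : polyf p -> {for x, continuous p}.
Proof.
elim=> [c|i|{}p q _ dp _ dq|{}p q _ dp _ dq].
- exact: (@cst_continuous _ _ c x).
- exact: coord_continuous.
- exact: (continuousD dp dq).
- exact: (continuousM dp dq).
Qed.

Definition grad p x : V := \row_i pderiv i p x.

Lemma polyf_taylor1 p x : polyf p -> taylor1 p x (grad p x).
Proof.
elim=> [c|i|{}p q pp [B [r [r0 hB]]] pq [C [s [s0 hC]]]|{}p q pp [B [r [r0 hB]]] pq [C [s [s0 hC]]]].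
- exists 0, 1; split=> // y _.
  rewrite /= subrr /dotv big1 ?subrr ?normr0 ?mul0r// => j _.
  by rewrite mxE pderiv_cst mul0r.
- exists 0, 1; split=> // y _.
  rewrite /= mul0r /dotv (bigD1 i)//= big1 => [|j ji]; rewrite !mxE pderiv_coord.
    by rewrite eqxx mul1r addr0 (addrAC (x ord0 i)) subrr add0r subrr normr0.
  by rewrite (negbTE ji) mul0r.
- exists (B + C), (Num.min r s); split; first by rewrite lt_min r0.
  move=> y; rewrite lt_min => /andP[yr ys].
  have -> : p (x + y) + q (x + y) - (p x + q x) - dotv (grad (fun x => p x + q x) x) y =
      (p (x + y) - p x - dotv (grad p x) y) + (q (x + y) - q x - dotv (grad q x) y).
    rewrite (_ : grad _ x = grad p x + grad q x).
      by rewrite /dotv; under eq_bigr do rewrite mxE mulrDl; rewrite big_split /=; ring.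
    by apply/rowP => i; rewrite !mxE (pderivD i pp pq).
  by apply: le_trans (ler_normD _ _) _; rewrite mulrDl lerD ?hB ?hC.
- have [Lp Lp0 lp] := polyf_lipschitz (`|x| + 1) pp.
  have [Lq Lq0 lq] := polyf_lipschitz (`|x| + 1) pq.
  (* The remainder of a product is p(x) times that of q, plus q(x) times that of p, plus the product
     of the two increments. Radius at most 1 keeps x + y in the ball where [Lp] and [Lq] are
     valid. *)
  exists (`|p x| * C + `|q x| * B + Lp * Lq), (Num.min 1 (Num.min r s)); split.
    by rewrite !lt_min r0 s0 ltr01.
  move=> y; rewrite !lt_min => /and3P[y1 yr ys].
  have -> : p (x + y) * q (x + y) - p x * q x - dotv (grad (fun x => p x * q x) x) y =
      p x * (q (x + y) - q x - dotv (grad q x) y) + q x * (p (x + y) - p x - dotv (grad p x) y)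
      + (p (x + y) - p x) * (q (x + y) - q x).
    have -> : dotv (grad (fun x => p x * q x) x) y =
        p x * dotv (grad q x) y + q x * dotv (grad p x) y.
      rewrite /dotv !mulr_sumr -big_split /=; apply: eq_bigr => i _.
      by rewrite !mxE (pderivM i pp pq); ring.
    by ring.
  have x1 : `|x| <= `|x| + 1 by rewrite lerDl.
  have xy1 : `|x + y| <= `|x| + 1 by rewrite (le_trans (ler_normD _ _))// lerD2l ltW.
  apply: le_trans (ler_normD _ _) _; rewrite [X in _ <= X]mulrDl; apply: lerD; rewrite ?normrM.
    by apply: le_trans (ler_normD _ _) _; rewrite [X in _ <= X]mulrDl !normrM -!mulrA lerD// ler_wpM2l ?hC ?hB.
  have := lp _ _ xy1 x1; have := lq _ _ xy1 x1; rewrite addrAC subrr add0r => h1 h2.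
  by rewrite expr2 mulrACA ler_pM.
Qed.

Lemma polyf_line p x v : polyf p -> exists P : {poly R}, forall t,
  p (x + t *: v) = P.[t] /\ \sum_i v ord0 i * pderiv i p (x + t *: v) = P^`().[t].
Proof.
elim=> [c|i|{}p q pp [P hP] pq [Q hQ]|{}p q pp [P hP] pq [Q hQ]].
- exists c%:P => t; rewrite hornerC derivC horner0; split=> //.
  by rewrite big1// => i _; rewrite pderiv_cst mulr0.
- exists ((x ord0 i)%:P + v ord0 i *: 'X) => t; rewrite !mxE !hornerE derivD derivC derivZ derivX !hornerE; split.
    by rewrite mulrC.
  rewrite (bigD1 i)//= pderiv_coord eqxx mulr1 big1 ?addr0// => j ji.
  by rewrite pderiv_coord (negbTE ji) mulr0.
- exists (P + Q) => t; have [p1 p2] := hP t; have [q1 q2] := hQ t.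
  rewrite hornerD p1 q1; split=> //.
  rewrite derivD hornerD -p2 -q2 -big_split /=; apply: eq_bigr => i _.
  by rewrite (pderivD i pp pq) mulrDr.
- exists (P * Q) => t; have [p1 p2] := hP t; have [q1 q2] := hQ t.
  rewrite hornerM p1 q1; split=> //.
  rewrite derivM hornerD !hornerM -p2 -q2 -p1 -q1.
  rewrite mulr_suml mulr_sumr -big_split /=; apply: eq_bigr => i _.
  by rewrite (pderivM i pp pq); ring.
Qed.

Lemma poly_ge0_at0 (P : {poly R}) r : 0 < r -> (forall t, 0 < t < r -> 0 <= P.[t]) -> 0 <= P.[0].
Proof.
move=> r0 h; rewrite leNgt; apply/negP => P0.
have := @continuous_horner R P 0; move/cvgrPdist_lt => /(_ (- P.[0])); rewrite oppr_gt0 => /(_ P0).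
move=> /nbhs_ballP[e /= e0 he].
pose t := Num.min (r / 2) (e / 2).
have t0 : 0 < t by rewrite lt_min !divr_gt0.
have tr : t <= r / 2 by rewrite ge_min lexx.
have te : t <= e / 2 by rewrite ge_min lexx orbT.
have := he t; rewrite /ball /= sub0r normrN gtr0_norm// => /(_ _).
have := h t; rewrite t0 /= => /(_ _) Pt.
have {}Pt : 0 <= P.[t] by apply: Pt; lra.
have -> : t < e by lra.
by move=> /(_ isT); rewrite ltr_norml => /andP[]; lra.
Qed.

(** On the line the polynomial is a + b t + S(t) t^2, so its symmetric second difference is t^2
    (S(t) + S(-t)). The sign passes to the limit t = 0, where the second derivative is 2 S(0). *)
Lemma polyf_hess_ge0 p x v r : polyf p -> 0 < r ->
  (forall t, 0 < t < r -> 0 <= p (x + t *: v) + p (x - t *: v) - 2 * p x) ->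
  0 <= \sum_i \sum_j v ord0 i * v ord0 j * pderiv i (pderiv j p) x.
Proof.
move=> pp r0 h.
have [P hP] := polyf_line x v pp.
pose Q j := sval (cid (polyf_line x v (polyf_pderiv j pp))).
have hQ j t : pderiv j p (x + t *: v) = (Q j).[t] /\
    \sum_i v ord0 i * pderiv i (pderiv j p) (x + t *: v) = (Q j)^`().[t].
  by rewrite /Q; case: cid.
(* Equality of values gives equality of polynomials: a nonzero difference cannot have as many roots
   as its size, and here every natural number is a root. *)
have PQ : P^`() = \sum_j v ord0 j *: Q j.
  apply/eqP; rewrite -subr_eq0; apply: contraT => D0.
  pose D := P^`() - \sum_j v ord0 j *: Q j.
  have := @max_poly_roots _ D [seq i%:R | i <- iota 0 (size D)] D0.
  rewrite size_map size_iota ltnn => -> //.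
    apply/allP => _ /mapP[i _ ->]; rewrite /root /D hornerD hornerN horner_sum.
    have [_ <-] := hP i%:R; rewrite subr_eq0; apply/eqP; apply: eq_bigr => j _.
    by rewrite hornerZ; have [<- _] := hQ j i%:R.
  by rewrite map_inj_uniq ?iota_uniq// => i j /eqP; rewrite eqr_nat => /eqP.
have P2 : P^`()^`().[0] = \sum_i \sum_j v ord0 i * v ord0 j * pderiv i (pderiv j p) x.
  rewrite PQ raddf_sum horner_sum exchange_big /=; apply: eq_bigr => j _.
  rewrite derivZ hornerZ; have [_ <-] := hQ j 0; rewrite scale0r addr0 mulr_sumr.
  by apply: eq_bigr => i _; ring.
rewrite -P2.
pose S := drop_poly 2 P.
have PS : P = (P`_0)%:P + P`_1 *: 'X + S * 'X^2.
  by rewrite -[LHS](poly_take_drop 2 P) /take_poly poly_def !big_ord_recr big_ord0 /= add0r expr0 alg_polyC expr1.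
have -> : P^`()^`().[0] = 2 * S.[0].
  by rewrite {1}PS !poly.derivE !hornerE /=; ring.
suff : 0 <= (S + (S \Po (- 'X))).[0] by rewrite hornerD horner_comp hornerN hornerX oppr0; lra.
apply: (@poly_ge0_at0 _ r) => // t tr.
rewrite hornerD horner_comp hornerN hornerX.
have /andP[t0 _] := tr.
have := h t tr; have [-> _] := hP t; rewrite -scaleNr; have [-> _] := hP (- t).
have := hP 0; rewrite scale0r addr0 => -[-> _].
rewrite PS !hornerE /= => hh.
have t2 : 0 < t ^+ 2 by rewrite exprn_gt0.
rewrite -(pmulr_rge0 _ t2); nra.
Qed.

End polynomial_functions.

(** * Quadratic forms, determinants and the Newton step *)

Section quadratic_forms.
Variable R : realType.

Definition qform n (A : 'M[R]_n) (y : 'rV[R]_n) : R :=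
  \sum_i \sum_j A i j * y ord0 i * y ord0 j.

Lemma qformE n (A : 'M[R]_n) y : qform A y = (y *m A *m y^T) ord0 ord0.
Proof.
rewrite mxE /qform exchange_big /=; apply: eq_bigr => j _.
by rewrite !mxE mulr_suml; apply: eq_bigr => i _; rewrite (mulrC (A i j)).
Qed.

Lemma qformT n (A : 'M[R]_n) y : qform A^T y = qform A y.
Proof.
rewrite /qform exchange_big /=; apply: eq_bigr => i _; apply: eq_bigr => j _.
by rewrite mxE mulrAC.
Qed.

Lemma qformD n (A B : 'M[R]_n) y : qform (A + B) y = qform A y + qform B y.
Proof.
rewrite /qform -big_split; apply: eq_bigr => i _; rewrite -big_split.
by apply: eq_bigr => j _; rewrite !mxE !mulrDl.
Qed.

Lemma qformZ n c (A : 'M[R]_n) y : qform (c *: A) y = c * qform A y.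
Proof.
rewrite /qform mulr_sumr; apply: eq_bigr => i _; rewrite mulr_sumr.
by apply: eq_bigr => j _; rewrite !mxE !mulrA.
Qed.

Lemma qform1_gt0 n (y : 'rV[R]_n) : y != 0 -> 0 < qform 1%:M y.
Proof.
move=> y0; have -> : qform 1%:M y = \sum_i y ord0 i ^+ 2.
  apply: eq_bigr => i _; rewrite (bigD1 i)//= !mxE eqxx mul1r big1 ?addr0// => j ji.
  by rewrite mxE eq_sym (negbTE ji) !mul0r.
rewrite lt0r sumr_ge0 ?andbT; last by move=> i _; exact: sqr_ge0.
apply: contra y0 => /eqP/psumr_eq0P h; apply/eqP/rowP => i; rewrite mxE.
by apply/eqP; rewrite -sqrf_eq0; apply/eqP; apply: h => // j _; exact: sqr_ge0.
Qed.

Lemma qform_pos_unit n (A : 'M[R]_n) :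
  (forall y, y != 0 -> 0 < qform A y) -> \det A != 0.
Proof.
move=> h; apply/negP => /det0P[v v0 vA].
by have := h v v0; rewrite qformE vA mul0mx mxE ltxx.
Qed.

(** On the segment from the identity to A the form stays positive definite, so the determinant, a
    polynomial in the parameter, has no root there and keeps the sign it has at the identity. *)
Lemma qform_pos_det_gt0 n (A : 'M[R]_n) :
  (forall y, y != 0 -> 0 < qform A y) -> 0 < \det A.
Proof.
move=> h; rewrite ltNge; apply/negP => A0.
pose Q : {poly R} := \det ('X *: map_mx polyC (A - 1%:M) + map_mx polyC 1%:M).
have QE t : Q.[t] = \det (t *: (A - 1%:M) + 1%:M).
  rewrite -[LHS]/(horner_eval t Q) -det_map_mx; congr (\det _).
  apply/matrixP => i j; rewrite !mxE.
  by rewrite -[LHS]/(('X * (A i j - (i == j)%:R)%:P + ((i == j)%:R)%:P).[t]) !hornerE.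
have [||x] := @poly_ivt R (- Q) 0 1; first exact: ler01.
  rewrite !hornerN !QE scale0r add0r scale1r subrK det1 oppr_ge0 A0.
  by rewrite oppr_le0 ler01.
move=> /andP[x0 x1].
rewrite rootN /root QE; apply/negP; apply: qform_pos_unit => y y0.
have -> : x *: (A - 1%:M) + 1%:M = x *: A + (1 - x) *: 1%:M.
  by rewrite scalerBr scalerBl scale1r -addrA [- _ + _]addrC.
rewrite qformD !qformZ.
have := h y y0; have := qform1_gt0 y0; set a := qform _ _; set b := qform _ _ => a0 b0.
have [->|xn0] := eqVneq x 0; first by rewrite mul0r subr0; lra.
have : 0 < x by rewrite lt0r xn0.
nra.
Qed.

Lemma cofmx_adj n (A : 'M[R]_n) : cofmx A = (\adj A)^T.
Proof. by apply/matrixP => i j; rewrite !mxE. Qed.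

(** With y = z A, the form of the cofactor matrix at y is det A times the form of A at z. *)
Lemma qform_cofmx_gt0 n (A : 'M[R]_n) : (forall y, y != 0 -> 0 < qform A y) ->
  forall y, y != 0 -> 0 < qform (cofmx A) y.
Proof.
move=> h y y0; have d0 := qform_pos_det_gt0 h.
have uA : A \in unitmx by rewrite unitmxE unitfE gt_eqF.
have [z yz] : exists z, y = z *m A by exists (y *m invmx A); rewrite mulmxKV.
have z0 : z != 0 by apply: contra y0 => /eqP z0; rewrite yz z0 mul0mx.
rewrite cofmx_adj qformT qformE {1}yz -(mulmxA z A) mul_mx_adj mul_mx_scalar.
rewrite -scalemxAl mxE mulr_gt0//.
have := h z z0; rewrite -qformT qformE.
by rewrite yz trmx_mul mulmxA.
Qed.

(** Apply the definite case to A + t I for t > 0; the value is a polynomial in t, so its sign passes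
    to t = 0. *)
Lemma qform_cofmx_ge0 n (A : 'M[R]_n) : (forall y, 0 <= qform A y) ->
  forall y, 0 <= qform (cofmx A) y.
Proof.
move=> h y; have [->|y0] := eqVneq y 0.
  by rewrite /qform big1// => i _; rewrite big1// => j _; rewrite !mxE !mulr0.
pose B := map_mx polyC A + 'X%:M.
pose Q : {poly R} := (map_mx polyC y *m \adj B *m (map_mx polyC y)^T) ord0 ord0.
have QE t : Q.[t] = qform (cofmx (A + t%:M)) y.
  rewrite cofmx_adj qformT qformE.
  have -> : A + t%:M = map_mx (horner_eval t) B.
    apply/matrixP => i j; rewrite !mxE.
    by rewrite -[RHS]/(((A i j)%:P + 'X *+ (i == j)).[t]) hornerD hornerMn hornerC hornerX.
  rewrite -map_mx_adj.
  have my : map_mx (horner_eval t) (map_mx polyC y) = y.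
    by apply/matrixP => i j; rewrite !mxE -[LHS]/((y i j)%:P.[t]) hornerC.
  by rewrite -[in RHS]my map_trmx -!map_mxM [in RHS]mxE.
have <- : Q.[0] = qform (cofmx A) y by rewrite QE raddf0 addr0.
apply: (@poly_ge0_at0 R Q 1) => // t /andP[t0 _]; rewrite QE ltW// qform_cofmx_gt0// => z z0.
rewrite qformD -scalemx1 qformZ.
by rewrite ltr_wpDl// mulr_gt0// qform1_gt0.
Qed.

Lemma form_coercive n (q : 'rV[R]_n -> R) : polyf q ->
  (forall t x, q (t *: x) = t ^+ 2 * q x) -> (forall x, x != 0 -> 0 < q x) ->
  exists2 alpha : R, 0 < alpha & forall x, alpha * `|x| ^+ 2 <= q x.
Proof.
move=> pq qZ q0.
pose S := [set x : 'rV[R]_n | `|x| = 1].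
(* The unit sphere is empty only when 0 is the only vector, and then any constant works. *)
have [[x0 Sx0]|S0] := pselect (S !=set0); last first.
  exists 1 => // x; have [->|xn0] := eqVneq x 0.
    by have := qZ 0 0; rewrite scale0r normr0 => ->; rewrite !expr0n !mul0r mulr0.
  case: S0; exists (`|x|^-1 *: x); rewrite /S /= normrZ normfV normr_id mulVf// normr_eq0//.
have cS : closed S.
  rewrite (_ : S = (fun x : 'rV[R]_n => `|x|) @^-1` [set 1])//.
  apply: closed_comp => [x _|]; first exact: norm_continuous.
  exact: (accessible_closed_set1 (hausdorff_accessible (@Rhausdorff R))).
have [||c /set_mem Sc cmin] := @EVT_min_rV R n q S (ex_intro _ x0 Sx0).
  apply: bounded_closed_compact => //; exists 1; split; first exact: num_real.
  by move=> M M1 x; rewrite /S /= => ->; exact: ltW.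
  by move=> x; apply: continuous_subspaceT => y; exact: polyf_continuous.
have qc : 0 < q c by apply: q0; rewrite -normr_gt0 Sc.
exists (q c) => // x; have [->|xn0] := eqVneq x 0.
  by have := qZ 0 0; rewrite scale0r normr0 => ->; rewrite !expr0n !mul0r mulr0.
have x1 : 0 < `|x| by rewrite normr_gt0.
have -> : q x = `|x| ^+ 2 * q (`|x|^-1 *: x).
  by rewrite -qZ scalerA mulfV ?gt_eqF// scale1r.
rewrite mulrC ler_pM2l ?exprn_gt0//; apply: cmin.
by rewrite inE /S /= normrZ normfV normr_id mulVf// gt_eqF.
Qed.

End quadratic_forms.

Section newton.
Variables (R : realType) (m : nat).
Local Notation C := 'rV[R]_m.

Definition linear1 (l : C -> R) := forall k x y, l (k *: x + y) = k * l x + l y.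

Definition bilin (b : C -> C -> R) :=
  (forall y, linear1 (b ^~ y)) /\ (forall x, linear1 (b x)).

Lemma linear1_sum (l : C -> R) : linear1 l -> forall x, l x = \sum_i x ord0 i * l (delta_mx ord0 i).
Proof.
move=> ll x.
have l0 : l 0 = 0.
  by have := ll 1 0 0; rewrite scale1r addr0 mul1r => /eqP; rewrite -subr_eq subrr eq_sym => /eqP.
rewrite {1}(row_sum_delta x); elim/big_rec2 : _ => // i a b _ h.
by rewrite ll h.
Qed.

Lemma linear1B l x y : linear1 l -> l (x - y) = l x - l y.
Proof. by move=> ll; rewrite addrC -scaleN1r ll mulN1r addrC. Qed.

(** A kernel vector of the Gram matrix would make b vanish on the diagonal, so the matrix is
    invertible. *)
Lemma bilin_solve (b : C -> C -> R) (l : C -> R) : bilin b -> linear1 l ->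
  (forall x, x != 0 -> b x x != 0) -> exists x, forall y, b x y = l y.
Proof.
move=> [b1 b2] ll bn0.
pose M := \matrix_(i, j) b (delta_mx ord0 i) (delta_mx ord0 j).
have bM x y : b x y = (x *m M *m y^T) ord0 ord0.
  rewrite (linear1_sum (b2 x)) mxE; apply: eq_bigr => j _.
  rewrite !mxE mulrC; congr (_ * _).
  by rewrite (linear1_sum (b1 _)); apply: eq_bigr => i _; rewrite !mxE.
have uM : M \in unitmx.
  rewrite unitmxE unitfE; apply/negP => /det0P[v v0 vM].
  by have := bn0 v v0; rewrite bM vM mul0mx mxE eqxx.
exists ((\row_j l (delta_mx ord0 j)) *m invmx M) => y.
rewrite bM mulmxKV// mxE (linear1_sum ll); apply: eq_bigr => j _.
by rewrite !mxE mulrC.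
Qed.

(* One step of the iteration in coordinates centered at the solution: a c is the
   derivative at c, r the residual, b the stabilizing form. *)
Lemma newton_contraction (a : C -> C -> C -> R) (b : C -> C -> R) (r : C -> C -> R)
    (K eta alpha rho : R) :
  (forall c, bilin (a c)) -> bilin b -> (forall c, linear1 (r c)) ->
  0 < eta -> 0 < alpha -> 0 < rho ->
  (forall x, alpha * `|x| ^+ 2 <= - a 0 x x) -> (forall x, 0 <= b x x) ->
  (forall c x y, `|c| <= eta -> `|a c x y - a 0 x y| <= K * `|c| * `|x| * `|y|) ->
  (forall c y, `|c| <= eta -> `|r c y - a 0 c y| <= K * `|c| ^+ 2 * `|y|) ->
  (forall x y, `|b x y| <= K * `|x| * `|y|) ->
  exists2 nu0, 0 < nu0 & forall nu, 0 < nu <= nu0 ->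
  exists2 delta, 0 < delta & forall c, `|c| < delta ->
    exists c', [/\ (forall y, - nu * b (c' - c) y + a c (c' - c) y = - r c y),
      (forall c'', (forall y, - nu * b (c'' - c) y + a c (c'' - c) y = - r c y) -> c'' = c') &
      `|c'| <= rho * `|c|].
Proof.
move=> ba bb lr eta0 a0 rho0 coer bpos aK rK bK.
pose K' := `|K| + 1.
have K'0 : 0 < K' by rewrite ltr_wpDl.
have KK' : K <= K' by rewrite (le_trans (ler_norm _))// lerDl.
(* The error equation below has three right-hand terms, due to the change of derivative, to the
   remainder and to nu. Each is made at most alpha rho / 8 times [|c|] [|y|], against a coercivity
   constant of alpha / 2; the sum 3/8 is below 1/2. *)
pose nu0 := alpha * rho / (8 * K').
have nu00 : 0 < nu0 by rewrite divr_gt0 ?mulr_gt0.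
exists nu0 => // nu /andP[nu_gt0 nu_le].
(* In order: the estimates on a and r hold, the derivative at c keeps half of the coercivity, and
   the quadratic terms reach the bound alpha rho / 8. *)
pose delta := Num.min eta (Num.min (alpha / (2 * K')) (alpha * rho / (8 * K'))).
have d0 : 0 < delta by rewrite !lt_min eta0 !divr_gt0 ?mulr_gt0.
exists delta => // c; rewrite !lt_min => /and3P[c1 c2 c3].
have c1' := ltW c1.
pose T x y := a c x y - nu * b x y.
have bT : bilin T.
  split=> [y k x x'|x k y y']; rewrite /T.
    by rewrite (proj1 (ba c)) (proj1 bb); ring.
  by rewrite (proj2 (ba c)) (proj2 bb); ring.
have Tcoer x : alpha / 2 * `|x| ^+ 2 <= - T x x.
  have := coer x; have := bpos x; have := aK c x x c1'; rewrite ler_norml => /andP[_ h1] h2 h3.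
  have : 0 <= nu * b x x by rewrite mulr_ge0// ltW.
  have h4 : K * `|c| * `|x| * `|x| <= alpha / 2 * `|x| ^+ 2.
    rewrite expr2 -mulrA ler_wpM2r ?mulr_ge0//.
    apply: (@le_trans _ _ (K' * `|c|)); first by rewrite ler_wpM2r.
    have -> : alpha / 2 = K' * (alpha / (2 * K')) by field; rewrite gt_eqF.
    by rewrite ler_pM2l// ltW.
  rewrite /T; lra.
have Tinj x : x != 0 -> T x x != 0.
  move=> x0; have := Tcoer x; rewrite -oppr_eq0 => h; rewrite gt_eqF//.
  by apply: lt_le_trans h; rewrite mulr_gt0 ?divr_gt0 ?exprn_gt0 ?normr_gt0.
have lr' : linear1 (fun y => - r c y) by move=> k y z; rewrite lr; ring.
have [x hx] := bilin_solve bT lr' Tinj.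
have Tx y : - nu * b x y + a c x y = T x y by rewrite /T; ring.
exists (c + x); split.
- by move=> y; rewrite addrAC subrr add0r Tx hx.
- move=> c'' hc; have h y : T (c'' - c - x) y = 0.
    by have /= -> := linear1B (c'' - c) x (proj1 bT y); rewrite hx -hc /T; ring.
  have [|/Tinj] := eqVneq (c'' - c - x) 0; last by rewrite h eqxx.
  by rewrite -addrA -opprD => /eqP; rewrite subr_eq0 => /eqP.
(* The equation of the new error c + x: adding T(c, y) to the linear system turns the residual into
   differences that are quadratic in c, except for the term in nu. *)
have E y : T (c + x) y = (a c c y - a 0 c y) - (r c y - a 0 c y) - nu * b c y.
  rewrite -{1}(scale1r c) (proj1 bT) hx /T; ring.
have := Tcoer (c + x); rewrite E.
have := aK c c (c + x) c1'; have := rK c (c + x) c1'; have := bK c (c + x).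
set y := c + x; have y0 := normr_ge0 y; have c0 := normr_ge0 c.
have s1 : K * `|c| * `|c| * `|y| <= K' * `|c| * `|c| * `|y|.
  by rewrite !ler_wpM2r.
have s2 : K * `|c| ^+ 2 * `|y| <= K' * `|c| * `|c| * `|y|.
  by rewrite expr2 !mulrA !ler_wpM2r.
have s3 : K * `|c| * `|y| <= K' * `|c| * `|y| by rewrite !ler_wpM2r.
rewrite !ler_norml => /andP[b1 b2] /andP[r1 r2] /andP[a1 a2].
have n1 : nu * b c y <= nu * (K' * `|c| * `|y|).
  by rewrite ler_wpM2l ?(ltW nu_gt0)// (le_trans b2).
have n2 : nu * (K' * `|c| * `|y|) <= alpha * rho / 8 * (`|c| * `|y|).
  rewrite (_ : nu * _ = nu * K' * (`|c| * `|y|)); last by ring.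
  rewrite ler_wpM2r ?mulr_ge0//.
  apply: (@le_trans _ _ (nu0 * K')); first by rewrite ler_wpM2r// ltW.
  by rewrite le_eqVlt; apply/orP; left; apply/eqP; rewrite /nu0; field; rewrite gt_eqF.
have n3 : K' * `|c| * `|c| * `|y| <= alpha * rho / 8 * (`|c| * `|y|).
  rewrite (_ : K' * `|c| * `|c| * `|y| = K' * `|c| * (`|c| * `|y|)); last by ring.
  rewrite ler_wpM2r ?mulr_ge0//.
  have -> : alpha * rho / 8 = K' * (alpha * rho / (8 * K')) by field; rewrite gt_eqF.
  by rewrite ler_pM2l// ltW.
move=> main.
have fin : alpha / 2 * `|y| ^+ 2 <= 3 * (alpha * rho / 8 * (`|c| * `|y|)) by lra.
have [y00|yn0] := eqVneq `|y| 0; first by rewrite y00 mulr_ge0// ltW.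
have yp : 0 < `|y| by rewrite lt0r yn0.
rewrite -(ler_pM2r yp) -(ler_pM2l a0).
have : 0 <= alpha * (rho * `|c| * `|y|) by rewrite !mulr_ge0// ltW.
move: fin; rewrite expr2; lra.
Qed.

End newton.

Section determinants.
Variable R : realType.

Lemma polyf_det n k (M : 'rV[R]_n -> 'M[R]_k) :
  (forall i j, polyf (fun x => M x i j)) -> polyf (fun x => \det (M x)).
Proof.
move=> pM; rewrite /determinant; apply: polyf_sum => s.
by apply: polyf_mul; [exact: polyf_cst|exact: polyf_prod].
Qed.

Lemma polyf_cofmx n k (M : 'rV[R]_n -> 'M[R]_k) i j :
  (forall i j, polyf (fun x => M x i j)) -> polyf (fun x => cofmx (M x) i j).
Proof.
move=> pM; under eq_fun do rewrite mxE /cofactor.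
apply: polyf_mul; first exact: polyf_cst.
by apply: polyf_det => p q; under eq_fun do rewrite !mxE.
Qed.

(** Cofactors are polynomials in the entries. [mxvec] turns matrices into row vectors, for which
    [polyf_lipschitz] applies on the ball of radius [|M| + 1]; as q <= 1, this ball contains A +
    Q. *)
Lemma cofmx_lipschitz n (M : R) : exists2 C, 0 <= C & forall (A Q : 'M[R]_n) q i j,
  (forall i j, `|A i j| <= M) -> (forall i j, `|Q i j| <= q) -> 0 <= q <= 1 ->
  `|cofmx (A + Q) i j - cofmx A i j| <= C * q.
Proof.
have pvec i j : polyf (fun x : 'rV[R]_(n * n) => vec_mx x i j : R).
  by under eq_fun do rewrite mxE; exact: polyf_coord.
have L i j := polyf_lipschitz (`|M| + 1)
  (@polyf_cofmx (n * n) n vec_mx i j pvec).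
pose l i j := s2val (cid2 (L i j)).
have l0 i j : 0 <= l i j by rewrite /l; case: cid2.
exists (\sum_i \sum_j l i j); first by apply: sumr_ge0 => i _; exact: sumr_ge0.
move=> A Q q i j AM Qq /andP[q0 q1].
have MM := ler_norm M; have M0 := normr_ge0 M.
have v (B : 'M[R]_n) s : 0 <= s -> (forall i j, `|B i j| <= s) -> `|mxvec B| <= s.
  move=> s0 Bs; apply/(rV_norm_leP _ s0) => k.
  by case/mxvec_indexP: k => a b; rewrite mxvecE.
have h : `|cofmx (A + Q) i j - cofmx A i j| <= l i j * q.
  rewrite /l; case: cid2 => C /= C0 /(_ (mxvec (A + Q)) (mxvec A)); rewrite !mxvecK => hC.
  apply: le_trans (hC _ _) _.
  - apply: v => [|a b]; first by lra.
    by rewrite mxE (le_trans (ler_normD _ _))//; have := AM a b; have := Qq a b; lra.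
  - by apply: v => [|a b]; [lra|have := AM a b; lra].
  - by rewrite ler_wpM2l// -linearB /= addrAC subrr add0r; exact: v.
apply: le_trans h _; rewrite ler_wpM2r//.
rewrite (bigD1 i)//= (bigD1 j)//= -addrA lerDl addr_ge0//; first by apply: sumr_ge0.
by apply: sumr_ge0 => p _; exact: sumr_ge0.
Qed.

(* Indexing the entries by nat lets the ordinals produced by [lift] compute. *)
Let ent n (A : 'M[R]_n.+1) (p q : nat) : R := A (inord p) (inord q).

Let entE n (A : 'M[R]_n.+1) i j : A i j = ent A i j.
Proof. by rewrite /ent !inord_val. Qed.

Let fe n (g : 'I_n.+1 -> R) (p : nat) : R := g (inord p).

Let feE n (g : 'I_n.+1 -> R) i : g i = fe g i.
Proof. by rewrite /fe inord_val. Qed.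

Let det2 (A : 'M[R]_2) : \det A = ent A 0 0 * ent A 1 1 - ent A 0 1 * ent A 1 0.
Proof.
rewrite (expand_det_row _ ord0) !big_ord_recl big_ord0 /cofactor !det_mx11 !mxE !entE /= /bump /=.
by ring.
Qed.

Let det3 (A : 'M[R]_3) : \det A =
  ent A 0 0 * (ent A 1 1 * ent A 2 2 - ent A 1 2 * ent A 2 1)
  - ent A 0 1 * (ent A 1 0 * ent A 2 2 - ent A 1 2 * ent A 2 0)
  + ent A 0 2 * (ent A 1 0 * ent A 2 1 - ent A 1 1 * ent A 2 0).
Proof.
rewrite (expand_det_row _ ord0) !big_ord_recl big_ord0 /cofactor !det2 /ent !mxE !entE /= /bump /=.
rewrite !inordK//=.
by ring.
Qed.

Let cof2 (A : 'M[R]_2) i j : cofmx A i j =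
  (-1) ^+ (i + j) * ent A (1 - i) (1 - j).
Proof.
rewrite mxE /cofactor det_mx11 !mxE entE; congr (_ * ent A _ _).
  by case: i => -[|[|[]]].
by case: j => -[|[|[]]].
Qed.

Let cof3 (A : 'M[R]_3) i j : cofmx A i j = (-1) ^+ (i + j) *
  (ent A (bump i 0) (bump j 0) * ent A (bump i 1) (bump j 1) -
   ent A (bump i 0) (bump j 1) * ent A (bump i 1) (bump j 0)).
Proof.
have L (l : 'I_3) p : (p < 2)%N -> lift l (inord p : 'I_2) = inord (bump l p).
  move=> p2; apply/val_inj => /=; rewrite !inordK//.
  by rewrite /bump (leq_ltn_trans (leq_add (leq_b1 _) (leqnn p))).
by rewrite mxE /cofactor det2 /ent !mxE !L.
Qed.

(** The left side is the determinant of A with column j replaced by g. For a Hessian the remaining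
    column k is the gradient of the k-th derivative, so the right side has the form of the
    two-dimensional Stokes identity. *)
Lemma cofmx_col2 (j : 'I_2) : exists (s : R) (p q k : 'I_2), forall A (g : 'I_2 -> R),
  \sum_i cofmx A i j * g i = s * (g p * A q k - g q * A p k).
Proof.
have [j0|j1] := eqVneq j 0.
  exists 1, 0, 1, 1 => A g; rewrite j0 !big_ord_recl big_ord0 !cof2 !(feE g) !entE /= /bump /=; ring.
exists (-1), 0, 1, 0 => A g; have -> : j = 1 by apply/val_inj; case: j j1 => -[|[|[]]].
rewrite !big_ord_recl big_ord0 !cof2 !(feE g) !entE /= /bump /=; ring.
Qed.

(** Expansion along the replaced column j; the two remaining columns k, l of a Hessian are
    gradients, as in the three-dimensional Stokes identity. They are taken in cyclic order, which
    leaves no sign. *)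
Lemma cofmx_col3 (j : 'I_3) : exists (p q r k l : 'I_3), forall A (g : 'I_3 -> R),
  \sum_i cofmx A i j * g i =
    g p * (A q k * A r l - A r k * A q l) + g q * (A r k * A p l - A p k * A r l) +
    g r * (A p k * A q l - A q k * A p l).
Proof.
have o3 : (inord 2 : 'I_3) = 2 :> nat by rewrite inordK.
have o2 : (inord 1 : 'I_3) = 1 :> nat by rewrite inordK.
have o1 : (inord 0 : 'I_3) = 0 :> nat by rewrite inordK.
have [j0|[j1|j2]] : j = inord 0 \/ j = inord 1 \/ j = inord 2.
  case: j => -[|[|[|]]] // h; [left|right; left|right; right]; apply/val_inj => /=; by rewrite inordK.
- exists (inord 0), (inord 1), (inord 2), (inord 1), (inord 2) => A g.
  rewrite j0 !big_ord_recl big_ord0 !cof3 !(feE g) !entE /= /bump /= ?o1 ?o2 ?o3 /=; ring.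
- exists (inord 0), (inord 1), (inord 2), (inord 2), (inord 0) => A g.
  rewrite j1 !big_ord_recl big_ord0 !cof3 !(feE g) !entE /= /bump /= ?o1 ?o2 ?o3 /=; ring.
- exists (inord 0), (inord 1), (inord 2), (inord 0), (inord 1) => A g.
  rewrite j2 !big_ord_recl big_ord0 !cof3 !(feE g) !entE /= /bump /= ?o1 ?o2 ?o3 /=; ring.
Qed.

(** The remainder is det Q when n = 2, a sum of 2 products. When n = 3 it has 18 terms linear in A
    and quadratic in Q, and 6 terms cubic in Q, which q <= 1 bounds by q^2; hence the constants. *)
Lemma det_taylor n (M : R) : n = 2%N \/ n = 3%N ->
  exists2 C, 0 <= C & forall (A Q : 'M[R]_n) q,
  (forall i j, `|A i j| <= M) -> (forall i j, `|Q i j| <= q) -> 0 <= q <= 1 ->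
  `|\det (A + Q) - \det A - \sum_i \sum_j cofmx A i j * Q i j| <= C * q ^+ 2.
Proof.
have M0 := normr_ge0 M; have MM := ler_norm M.
move=> [->|->].
  exists 2 => // A Q q AM Qq /andP[q0 q1].
  have eD p r : ent (A + Q) p r = ent A p r + ent Q p r by rewrite /ent mxE.
  rewrite !det2 !big_ord_recl !big_ord0 !cof2 !entE !eD /= /bump /=.
  have b p r s t : `|ent Q p r * ent Q s t| <= q ^+ 2.
    by rewrite normrM expr2 ler_pM// /ent.
  set X := (X in `|X| <= _).
  have -> : X = ent Q 0 0 * ent Q 1 1 - ent Q 0 1 * ent Q 1 0 by rewrite /X; ring.
  apply: le_trans (ler_normB _ _) _.
  by have := b 0%N 0%N 1%N 1%N; have := b 0%N 1%N 1%N 0%N; lra.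
exists (18 * `|M| + 6) => [|A Q q AM Qq /andP[q0 q1]]; first by rewrite addr_ge0// mulr_ge0.
have eD p r : ent (A + Q) p r = ent A p r + ent Q p r by rewrite /ent mxE.
have o3 : (inord 2 : 'I_3) = 2 :> nat by rewrite inordK.
rewrite !det3 !big_ord_recl !big_ord0 !cof3 !entE !eD /= /bump /=.
have b p r s t : `|ent Q p r * ent Q s t| <= q ^+ 2.
  by rewrite normrM expr2 ler_pM// /ent.
pose m (u v p r s t : nat) := ent A u v * (ent Q p r * ent Q s t).
pose w (u v p r s t : nat) := ent Q u v * (ent Q p r * ent Q s t).
have bm u v p r s t : - (`|M| * q ^+ 2) <= m u v p r s t <= `|M| * q ^+ 2.
  by rewrite -ler_norml normrM ler_pM// /ent (le_trans (AM _ _)).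
have bw u v p r s t : - q ^+ 2 <= w u v p r s t <= q ^+ 2.
  by rewrite -ler_norml normrM -[leRHS]mul1r ler_pM// /ent (le_trans (Qq _ _)).
set X := (X in `|X| <= _).
have -> : X =
  m 0%N 0%N 1%N 1%N 2%N 2%N - m 0%N 0%N 1%N 2%N 2%N 1%N - m 0%N 1%N 1%N 0%N 2%N 2%N + m 0%N 1%N
    1%N 2%N 2%N 0%N + m 0%N 2%N 1%N 0%N 2%N 1%N - m 0%N 2%N 1%N 1%N 2%N 0%N + m 1%N 1%N 0%N 0%N
    2%N 2%N - m 1%N 2%N 0%N 0%N 2%N 1%N - m 1%N 0%N 0%N 1%N 2%N 2%N + m 1%N 2%N 0%N 1%N 2%N 0%N
    + m 1%N 0%N 0%N 2%N 2%N 1%N - m 1%N 1%N 0%N 2%N 2%N 0%N + m 2%N 2%N 0%N 0%N 1%N 1%N - m 2%N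
    1%N 0%N 0%N 1%N 2%N - m 2%N 2%N 0%N 1%N 1%N 0%N + m 2%N 0%N 0%N 1%N 1%N 2%N + m 2%N 1%N 0%N
    2%N 1%N 0%N - m 2%N 0%N 0%N 2%N 1%N 1%N + w 0%N 0%N 1%N 1%N 2%N 2%N - w 0%N 0%N 1%N 2%N 2%N
    1%N - w 0%N 1%N 1%N 0%N 2%N 2%N + w 0%N 1%N 1%N 2%N 2%N 0%N + w 0%N 2%N 1%N 0%N 2%N 1%N - w
    0%N 2%N 1%N 1%N 2%N 0%N.
  by rewrite /X /m /w; ring.
move: m w bm bw => m w bm bw {X}.
have /andP[? ?] := bm 0%N 0%N 1%N 1%N 2%N 2%N.
have /andP[? ?] := bm 0%N 0%N 1%N 2%N 2%N 1%N.
have /andP[? ?] := bm 0%N 1%N 1%N 0%N 2%N 2%N.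
have /andP[? ?] := bm 0%N 1%N 1%N 2%N 2%N 0%N.
have /andP[? ?] := bm 0%N 2%N 1%N 0%N 2%N 1%N.
have /andP[? ?] := bm 0%N 2%N 1%N 1%N 2%N 0%N.
have /andP[? ?] := bm 1%N 1%N 0%N 0%N 2%N 2%N.
have /andP[? ?] := bm 1%N 2%N 0%N 0%N 2%N 1%N.
have /andP[? ?] := bm 1%N 0%N 0%N 1%N 2%N 2%N.
have /andP[? ?] := bm 1%N 2%N 0%N 1%N 2%N 0%N.
have /andP[? ?] := bm 1%N 0%N 0%N 2%N 2%N 1%N.
have /andP[? ?] := bm 1%N 1%N 0%N 2%N 2%N 0%N.
have /andP[? ?] := bm 2%N 2%N 0%N 0%N 1%N 1%N.
have /andP[? ?] := bm 2%N 1%N 0%N 0%N 1%N 2%N.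
have /andP[? ?] := bm 2%N 2%N 0%N 1%N 1%N 0%N.
have /andP[? ?] := bm 2%N 0%N 0%N 1%N 1%N 2%N.
have /andP[? ?] := bm 2%N 1%N 0%N 2%N 1%N 0%N.
have /andP[? ?] := bm 2%N 0%N 0%N 2%N 1%N 1%N.
have /andP[? ?] := bw 0%N 0%N 1%N 1%N 2%N 2%N.
have /andP[? ?] := bw 0%N 0%N 1%N 2%N 2%N 1%N.
have /andP[? ?] := bw 0%N 1%N 1%N 0%N 2%N 2%N.
have /andP[? ?] := bw 0%N 1%N 1%N 2%N 2%N 0%N.
have /andP[? ?] := bw 0%N 2%N 1%N 0%N 2%N 1%N.
have /andP[? ?] := bw 0%N 2%N 1%N 1%N 2%N 0%N.
rewrite ler_norml; apply/andP; split; lra.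
Qed.

End determinants.

(** * Bases of finite dimensional function spaces *)

Section finite_bases.
Variables (R : realType) (T : Type) (D : set T) (S : (T -> R) -> Prop).
Hypothesis S0 : S (fun=> 0).
Hypothesis SZD : forall a f g, S f -> S g -> S (fun x => a * f x + g x).

Definition lincomb m (b : 'I_m -> T -> R) (c : 'rV[R]_m) : T -> R :=
  fun x => \sum_j c ord0 j * b j x.

Lemma lincomb_closed m (b : 'I_m -> T -> R) c : (forall j, S (b j)) -> S (lincomb b c).
Proof.
move=> Sb; rewrite /lincomb; elim: (index_enum _) => [|j s IH].
  by under eq_fun do rewrite big_nil.
by under eq_fun do rewrite big_cons; exact: SZD.
Qed.

Definition independent_on m (b : 'I_m -> T -> R) :=
  forall c, (forall x, D x -> lincomb b c x = 0) -> c = 0.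

(** The [e i] span but may lie outside S, so a basis cannot be extracted from them. An independent
    family in S of maximal size is taken instead; sizes are at most N because more than N coordinate
    vectors are dependent. *)
Lemma exists_basis N (e : 'I_N -> T -> R) :
  (forall f, S f -> exists c, forall x, D x -> f x = lincomb e c x) ->
  exists m (b : 'I_m -> T -> R), [/\ (forall j, S (b j)), independent_on b &
    forall f, S f -> exists c, forall x, D x -> f x = lincomb b c x].
Proof.
move=> span.
pose P m := `[< exists b : 'I_m -> T -> R, (forall j, S (b j)) /\ independent_on b >].
have exP : exists m, P m.
  exists 0%N; apply/asboolP; exists (fun _ _ => 0); split=> // c _.
  by apply/rowP; case.
have leN m : P m -> (m <= N)%N.
  move=> /asboolP[b [Sb ib]]; rewrite leqNgt; apply/negP => Nm.
  pose A := \matrix_(j < m, i < N) (sval (cid (span _ (Sb j)))) ord0 i.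
  have bA j x : D x -> b j x = \sum_i A j i * e i x.
    move=> Dx; rewrite (svalP (cid (span _ (Sb j))) x Dx).
    by apply: eq_bigr => i _; rewrite mxE.
  have : kermx A != 0.
    rewrite kermx_eq0 /row_free neq_ltn (leq_ltn_trans (rank_leq_col A) Nm)//.
  move=> /rowV0Pn[u /sub_kermxP uA u0].
  case/eqP: u0; apply: ib => x Dx; rewrite /lincomb.
  under eq_bigr do rewrite bA// mulr_sumr.
  rewrite exchange_big big1//= => i _.
  under eq_bigr do rewrite mulrA.
  have /rowP/(_ i) := uA; rewrite !mxE => h.
  by rewrite -mulr_suml h mul0r.
have [m /asboolP[b [Sb ib]] mmax] := ex_maxnP exP leN.
exists m, b; split=> // f Sf; apply: contrapT => nf.
pose b' (i : 'I_m.+1) := if unlift ord0 i is Some j then b j else f.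
suff /mmax : P m.+1 by rewrite ltnn.
apply/asboolP; exists b'; split=> [i|c hc].
  by rewrite /b'; case: unliftP.
pose c' : 'rV[R]_m := \row_j c ord0 (lift ord0 j).
have hc' x : D x -> c ord0 ord0 * f x + lincomb b c' x = 0.
  move=> Dx; rewrite -(hc x Dx) /lincomb big_ord_recl /b' unlift_none; congr (_ + _).
  by apply: eq_bigr => j _; rewrite liftK mxE.
have [c0|c0] := eqVneq (c ord0 ord0) 0.
  have c'0 : c' = 0.
    by apply: ib => x Dx; rewrite -(hc' x Dx) c0 mul0r add0r.
  apply/rowP => i; rewrite mxE; case: (unliftP ord0 i) => [j ->|->//].
  by have /rowP/(_ j) := c'0; rewrite !mxE.
case: nf; exists (- (c ord0 ord0)^-1 *: c') => x Dx.
have -> : lincomb b (- (c ord0 ord0)^-1 *: c') x = - (c ord0 ord0)^-1 * lincomb b c' x.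
  by rewrite /lincomb mulr_sumr; apply: eq_bigr => j _; rewrite mxE mulrA.
have /eqP := hc' x Dx; rewrite addr_eq0 => /eqP h.
by rewrite mulNr -mulrN -h mulrA mulVf ?mul1r.
Qed.

End finite_bases.

(** * Simplices *)

Section simplices.
Variables (R : realType) (n : nat).
Local Notation V := 'rV[R]_n.
Implicit Types (s : {fset V}) (x y : V).

Definition affine_fun (c : R) (d : V) x : R := c + \sum_i d ord0 i * x ord0 i.

Lemma polyf_affine c d : polyf (affine_fun c d).
Proof.
apply: polyf_add; first exact: polyf_cst.
by apply: polyf_sum => i; apply: polyf_mul; [exact: polyf_cst|exact: polyf_coord].
Qed.

Lemma affine_fun_conv c d x y (t : R) :
  affine_fun c d (x + t *: (y - x)) = (1 - t) * affine_fun c d x + t * affine_fun c d y.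
Proof.
rewrite /affine_fun !mulrDr !mulr_sumr.
have -> : \sum_i d ord0 i * (x + t *: (y - x)) ord0 i =
    \sum_i (1 - t) * (d ord0 i * x ord0 i) + \sum_i t * (d ord0 i * y ord0 i).
  by rewrite -big_split; apply: eq_bigr => i _; rewrite /= !mxE; ring.
by ring.
Qed.

(** Affine independence says that the square matrix Y with rows (1, vertex) is invertible; the
    columns of its inverse are the coefficients of the barycentric coordinates. The point x0 is the
    barycentre, where all coordinates equal 1 / (n + 1). *)
Lemma barycentric s : is_simplex s -> exists (c : 'I_n.+1 -> R) (d : 'I_n.+1 -> V),
  (forall x, hull s x <-> forall k, 0 <= affine_fun (c k) (d k) x) /\
  exists x0, forall k, 0 < affine_fun (c k) (d k) x0.
Proof.
move=> [ss ai].
pose y (k : 'I_n.+1) : V := nth 0 (enum_fset s) k.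
have us : uniq (enum_fset s) by exact: fset_uniq.
have sumE (W : zmodType) (F : V -> W) : \sum_(z <- s) F z = \sum_k F (y k).
  by rewrite (big_nth 0) big_mkord ss.
have yin k : y k \in s by rewrite /y mem_nth// -[size _]/(#|` s|) ss.
have yidx k : index (y k) (enum_fset s) = k.
  by rewrite index_uniq// -[size _]/(#|` s|) ss.
pose Y : 'M[R]_(n.+1, 1 + n) := \matrix_(k < n.+1) row_mx (const_mx 1 : 'rV[R]_1) (y k).
have rY : row_free Y.
  rewrite -kermx_eq0; apply/negPn/negP => /rowV0Pn[u /sub_kermxP uY u0].
  case/eqP: u0.
  have uE (F : V -> R) k : nth 0 [seq u ord0 j | j <- enum 'I_n.+1] (index (y k) (enum_fset s)) = u ord0 k.
    by rewrite yidx (nth_map ord0) ?size_enum_ord// nth_ord_enum.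
  (* Affine independence is stated for coefficients that are functions of the vertex; the row u is
     read through the index of the vertex. *)
  pose c z := nth 0 [seq u ord0 j | j <- enum 'I_n.+1] (index z (enum_fset s)).
  have h := ai c; apply/rowP => k; rewrite mxE -(uE (fun=> 0)) -/(c _); apply: h => //.
    rewrite sumE; have /rowP/(_ (lshift n 0)) := uY; rewrite !mxE => h0; rewrite -[RHS]h0.
    by apply: eq_bigr => j _; rewrite /c (uE (fun=> 0)) mxE row_mxEl mxE mulr1.
  rewrite sumE; apply/rowP => i; have /rowP/(_ (rshift 1 i)) := uY; rewrite !mxE => h0; rewrite -[RHS]h0.
  by rewrite summxE; apply: eq_bigr => j _; rewrite /c (uE (fun=> 0)) mxE [Y j _]mxE row_mxEr.
have Yu : (Y : 'M[R]_n.+1) \in unitmx.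
  by rewrite -row_free_unit; exact: rY.
pose Z : 'M[R]_(1 + n, n.+1) := invmx (Y : 'M[R]_n.+1).
have YZ : Y *m Z = 1%:M by exact: mulmxV Yu.
have ZY : Z *m Y = 1%:M by exact: mulVmx Yu.
pose c k := Z (lshift n 0) k.
pose d k : V := \row_i Z (rshift 1 i) k.
have lamE x k : affine_fun (c k) (d k) x = (row_mx (const_mx 1 : 'rV[R]_1) x *m Z) ord0 k.
  rewrite /affine_fun mxE big_split_ord /= big_ord1 row_mxEl mxE mul1r; congr (_ + _).
  by apply: eq_bigr => i _; rewrite row_mxEr mxE mulrC.
have comb (u : 'rV[R]_n.+1) : u *m Y = row_mx (const_mx (\sum_k u ord0 k) : 'rV[R]_1) (\sum_k u ord0 k *: y k).
  apply/rowP => j; rewrite mxE [RHS]mxE; case: splitP => i ji.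
    rewrite (_ : j = lshift n i); last exact: val_inj.
    by rewrite mxE; apply: eq_bigr => k _; rewrite [Y k _]mxE row_mxEl mxE mulr1.
  rewrite (_ : j = rshift 1 i); last exact: val_inj.
  by rewrite summxE; apply: eq_bigr => k _; rewrite [Y k _]mxE row_mxEr [RHS]mxE.
have lam_of (u : 'rV[R]_n.+1) x : \sum_k u ord0 k = 1 -> \sum_k u ord0 k *: y k = x ->
    forall k, affine_fun (c k) (d k) x = u ord0 k.
  by move=> u1 ux k; rewrite lamE -u1 -ux -comb -mulmxA YZ mulmx1.
exists c, d; split=> [x|].
  split=> [[g [g0 g1 gx]] k|h].
    rewrite (@lam_of (\row_k g (y k))); first by rewrite mxE g0.
      by rewrite -g1 sumE; apply: eq_bigr => j _; rewrite mxE.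
    by rewrite gx sumE; apply: eq_bigr => j _; rewrite mxE.
  pose u : 'rV[R]_n.+1 := row_mx (const_mx 1 : 'rV[R]_1) x *m Z.
  have uYx : u *m Y = row_mx (const_mx 1 : 'rV[R]_1) x by rewrite -mulmxA ZY mulmx1.
  have [u1 ux] : const_mx (\sum_k u ord0 k) = const_mx 1 :> 'rV[R]_1 /\ \sum_k u ord0 k *: y k = x.
    by move: uYx; rewrite comb => /eq_row_mx.
  pose g z := nth 0 [seq u ord0 j | j <- enum 'I_n.+1] (index z (enum_fset s)).
  have gE k : g (y k) = u ord0 k.
    by rewrite /g yidx (nth_map ord0) ?size_enum_ord// nth_ord_enum.
  exists g; split.
  - move=> z zs; have zi : (index z (enum_fset s) < n.+1)%N.
      by rewrite -ss index_mem.
    have -> : z = y (Ordinal zi) by rewrite /y nth_index.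
    by rewrite gE -lamE.
  - rewrite sumE; under eq_bigr do rewrite gE.
    by have /matrixP/(_ 0 0) := u1; rewrite !mxE.
  - by rewrite sumE -[LHS]ux; apply: eq_bigr => k _; rewrite gE.
pose u : 'rV[R]_n.+1 := const_mx (n.+1%:R^-1).
exists (\sum_k u ord0 k *: y k) => k.
rewrite (@lam_of u)//; first by rewrite mxE invr_gt0.
under eq_bigr do rewrite mxE.
by rewrite sumr_const card_ord -(mulr_natr (n.+1%:R^-1)) mulVf// pnatr_eq0.
Qed.

Lemma common_radius (K : nat) (P : 'I_K -> R -> Prop) :
  (forall k e e', 0 < e' <= e -> P k e -> P k e') ->
  (forall k, exists2 e, 0 < e & P k e) -> exists2 e, 0 < e & forall k, P k e.
Proof.
move=> mP exP; pose e k := s2val (cid2 (exP k)).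
have e0 k : 0 < e k by rewrite /e; case: cid2.
have Pe k : P k (e k) by rewrite /e; case: cid2.
have m0 : 0 < \big[Num.min/1]_k e k by elim/big_ind : _ => // a b a0 b0; rewrite lt_min a0.
exists (\big[Num.min/1]_k e k) => // k; apply: mP (Pe k).
by rewrite m0 bigmin_le_cond.
Qed.

Lemma polyf_gt0_open (K : nat) (q : 'I_K -> V -> R) : (forall k, polyf (q k)) ->
  open [set x | forall k, 0 < q k x].
Proof.
move=> pq; apply/rV_openP => x /= qx.
have [|k|e e0 h] := @common_radius K (fun k e => forall y, `|y - x| < e -> 0 < q k y).
- by move=> k e e' /andP[_ ee'] h y yx; apply: h; exact: lt_le_trans ee'.
- have /rV_contP/(_ _ (qx k))[r r0 h] : {for x, continuous (q k)} by exact: polyf_continuous.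
  by exists r => // y /h; rewrite ltr_norml => /andP[]; lra.
- by exists e => // y yx k; exact: h.
Qed.

Lemma polyf_ge0_closed (K : nat) (q : 'I_K -> V -> R) : (forall k, polyf (q k)) ->
  closed [set x | forall k, 0 <= q k x].
Proof.
move=> pq; rewrite (_ : [set _ | _] = \bigcap_k [set x | 0 <= q k x]); last first.
  by apply/seteqP; split=> x /=; [move=> h k _; exact: h|move=> h k; exact: h].
apply: closed_bigI => k _.
apply: (@closed_comp _ _ (q k) [set t | 0 <= t]) => [x _|]; first exact: polyf_continuous.
exact: closed_ge.
Qed.

Lemma bigsetU_null (I : Type) (r : seq I) (Z : I -> set V) :
  (forall i, measurable (Z i) /\ lebesgue_rV R n (Z i) = 0%E) ->
  measurable (\big[setU/set0]_(k <- r) Z k) /\ lebesgue_rV R n (\big[setU/set0]_(k <- r) Z k) = 0%E.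
Proof.
move=> hZ; elim: r => [|k r [mr r0]]; first by rewrite big_nil measure0.
have [mk k0] := hZ k; rewrite big_cons; split; first exact: measurableU.
exact: null_set_setU.
Qed.

(** [O] is where all barycentric coordinates are positive and [N] is the union of their zero sets,
    which are null. Moving a point of the simplex slightly towards the barycentre makes all
    coordinates positive, hence the density. *)
Lemma simplex_cell s : is_simplex s -> exists (O N : set V),
  [/\ closed (hull s), open O, O `<=` hull s,
      (forall x, hull s x -> forall e, 0 < e -> exists2 y, O y & `|y - x| < e) &
      [/\ measurable N, lebesgue_rV R n N = 0%E & hull s `\` O `<=` N]].
Proof.
move=> /barycentric[c [d [hullE [x0 x0gt]]]].
pose lam k := affine_fun (c k) (d k).
have pl k : polyf (lam k) by exact: polyf_affine.
have hE : hull s = [set x | forall k, 0 <= lam k x].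
  by apply/seteqP; split=> x /hullE.
pose Z k := [set x | lam k x = 0].
have Znull k : measurable (Z k) /\ lebesgue_rV R n (Z k) = 0%E.
  (* A constant coordinate is positive, being positive at x0, so its zero set is empty. *)
  have [d0|d0] := eqVneq (d k) 0; last exact: hyperplane_null.
  have lc x : lam k x = c k.
    by rewrite /lam /affine_fun d0 big1 ?addr0// => i _; rewrite mxE mul0r.
  rewrite (_ : Z k = set0); first by rewrite measure0.
  apply/seteqP; split=> // x; rewrite /Z /= lc => ck0.
  by have := x0gt k; rewrite -/(lam k) lc ck0 ltxx.
exists [set x | forall k, 0 < lam k x], (\big[setU/set0]_k Z k); split.
- by rewrite hE; exact: polyf_ge0_closed.
- exact: polyf_gt0_open.
- by move=> x /= h; apply/hullE => k; exact: (ltW (h k)).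
- move=> x /hullE hx e e0.
  pose t := Num.min 1 (e / (2 * (`|x0 - x| + 1))).
  have D0 : 0 < `|x0 - x| + 1 by rewrite ltr_wpDl.
  have t0 : 0 < t by rewrite lt_min ltr01 divr_gt0// mulr_gt0.
  have t1 : t <= 1 by rewrite ge_min lexx.
  exists (x + t *: (x0 - x)) => [k|].
    rewrite /lam affine_fun_conv; apply: ltr_wpDl; last by rewrite mulr_gt0// x0gt.
    by apply: mulr_ge0; [rewrite subr_ge0|exact: hx].
  rewrite addrAC subrr add0r normrZ (gtr0_norm t0).
  have : t * (`|x0 - x| + 1) <= e / 2.
    rewrite -ler_pdivlMr// -mulrA -invfM ge_min; apply/orP; right; exact: lexx.
  have := normr_ge0 (x0 - x); lra.
split.
- by have [] := bigsetU_null (index_enum _) Znull.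
- by have [] := bigsetU_null (index_enum _) Znull.
- move=> x [/hullE hx Ox]; rewrite -bigcup_seq /=; apply: contrapT => h.
  apply: Ox => k; rewrite lt0r hx andbT; apply/eqP => k0; apply: h.
  by exists k => //=; rewrite mem_index_enum.
Qed.

End simplices.

(** * Lipschitz functions *)

Section lipschitz_covers.
Variable R : realType.

Lemma closed_itv_ends (F : set R) c d : closed F -> c < d ->
  (forall t, c < t < d -> F t) -> F c /\ F d.
Proof.
move=> cF cd h; split; apply: contrapT => nF.
  have : nbhs c (~` F) by apply: open_nbhs_nbhs; split => //; exact: closed_openC.
  rewrite -nbhs_ballE => -[e /= e0 he].
  pose t := c + Num.min (e / 2) ((d - c) / 2).
  have t1 : 0 < Num.min (e / 2) ((d - c) / 2) by rewrite lt_min !divr_gt0// subr_gt0.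
  have t2 : Num.min (e / 2) ((d - c) / 2) <= e / 2 by rewrite ge_min lexx.
  have t3 : Num.min (e / 2) ((d - c) / 2) <= (d - c) / 2 by rewrite ge_min lexx orbT.
  apply: (he t); last by apply: h; rewrite /t; apply/andP; split; lra.
  by rewrite -ball_normE /= /t opprD addNKr normrN gtr0_norm//; lra.
have : nbhs d (~` F) by apply: open_nbhs_nbhs; split => //; exact: closed_openC.
rewrite -nbhs_ballE => -[e /= e0 he].
pose t := d - Num.min (e / 2) ((d - c) / 2).
have t1 : 0 < Num.min (e / 2) ((d - c) / 2) by rewrite lt_min !divr_gt0// subr_gt0.
have t2 : Num.min (e / 2) ((d - c) / 2) <= e / 2 by rewrite ge_min lexx.
have t3 : Num.min (e / 2) ((d - c) / 2) <= (d - c) / 2 by rewrite ge_min lexx orbT.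
apply: (he t); last by apply: h; rewrite /t; apply/andP; split; lra.
by rewrite -ball_normE /= /t opprB addrCA subrr addr0 gtr0_norm//; lra.
Qed.

(* Induction on the cover: the first closed set is removed after cutting the
   interval at its smallest and largest points. *)
Lemma lipschitz_cover_itv (E : seq (set R)) (g : R -> R) (L : R) : 0 <= L ->
  (forall A, A \in E -> closed A) ->
  forall a b, a <= b -> (forall t, a <= t <= b -> exists2 A, A \in E & A t) ->
  (forall A s t, A \in E -> a <= s <= b -> a <= t <= b -> A s -> A t ->
     `|g s - g t| <= L * `|s - t|) ->
  `|g b - g a| <= L * (b - a).
Proof.
move=> L0; elim: E => [|A E IH] cE a b ab cov lip.
  by have [|A] := cov a; [rewrite lexx|rewrite in_nil].
have cE' B : B \in E -> closed B by move=> BE; apply: cE; rewrite inE BE orbT.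
have lip' B s t : B \in E -> a <= s <= b -> a <= t <= b -> B s -> B t ->
    `|g s - g t| <= L * `|s - t|.
  by move=> BE; apply: lip; rewrite inE BE orbT.
have cA : closed A by apply: cE; rewrite inE eqxx.
(* An interval whose interior misses A is covered by the other sets, the end points being recovered
   from their closedness. *)
have IH' c d : a <= c -> c <= d -> d <= b -> (forall t, c < t < d -> ~ A t) ->
    `|g d - g c| <= L * (d - c).
  move=> ac; rewrite le_eqVlt => /predU1P[<- _ _|cd db nA].
    by rewrite !subrr normr0 mulr0.
  pose F := \bigcup_(B in [set` E]) B.
  have Fin t : c < t < d -> F t.
    move=> tcd; have [|B] := cov t; first by move: tcd => /andP[? ?]; apply/andP; split; lra.
    rewrite inE => /predU1P[->|BE Bt]; first by move=> /nA; case.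
    by exists B.
  have clF : closed F by apply: closed_bigcup => [|B /= BE]; [exact: finite_seq|exact: cE'].
  have [Fc Fd] := closed_itv_ends clF cd Fin.
  apply: IH => [//||t /andP[ct td]|B s t BE sc tc Bs Bt].
  - exact: ltW.
  - have [B /= BE Bt] : F t.
      have [<-//|ct'] := eqVneq c t; have [->//|td'] := eqVneq t d.
      by apply: Fin; rewrite !lt_neqAle ct' ct td' td.
    by exists B.
  - move: sc tc => /andP[? ?] /andP[? ?]; apply: (lip' B) => //; apply/andP; split; lra.
have [[z [/= zab Az]]|nA] := pselect ([set` `[a, b]] `&` A !=set0); last first.
  apply: IH' => // t /andP[at_ tb] At; apply: nA; exists t; split=> //=.
  by rewrite in_itv /= !ltW.
pose K := [set` `[a, b]] `&` A.
have K0 : K !=set0 by exists z.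
have cK : compact K by apply: compact_closedI => //; exact: segment_compact.
have cid_ : {within K, continuous (id : R -> R)} by apply: continuous_subspaceT => x; exact: cvg_id.
have [M /set_mem[Mab AM] Mmax] := compact_EVT_max K0 cK cid_.
have [m /set_mem[mab Am] mmin] := compact_EVT_min K0 cK cid_.
move: Mab mab; rewrite /= !in_itv /= => /andP[aM Mb] /andP[am mb].
have mM : m <= M by apply: mmin; rewrite inE; split => //=; rewrite in_itv /= aM.
have h1 : `|g m - g a| <= L * (m - a).
  apply: IH' => // t /andP[at_ tm] At.
  have : m <= t by apply: mmin; rewrite inE; split => //=; rewrite in_itv /=; apply/andP; split; lra.
  lra.
have h2 : `|g b - g M| <= L * (b - M).
  apply: IH' => // t /andP[Mt tb] At.
  have : t <= M by apply: Mmax; rewrite inE; split => //=; rewrite in_itv /=; apply/andP; split; lra.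
  lra.
have h3 : `|g M - g m| <= L * `|M - m|.
  by apply: (lip A); rewrite ?inE ?eqxx// ?aM ?Mb ?am ?mb.
rewrite (@ger0_norm _ (M - m)) ?subr_ge0// in h3.
have := ler_normD (g b - g M + (g M - g m)) (g m - g a).
have := ler_normD (g b - g M) (g M - g m).
rewrite (_ : g b - g M + (g M - g m) + (g m - g a) = g b - g a); last by ring.
lra.
Qed.

Variable n : nat.
Local Notation V := 'rV[R]_n.

(** The cover and f are pulled back to [0, 1]. Only the segment has to be covered, which suits
    functions controlled inside a convex domain; the constant does not grow with the number of
    pieces. *)
Lemma lipschitz_cover_segment (K : nat) (E : 'I_K -> set V) (f : V -> R) (L : R) (x y : V) :
  0 <= L -> (forall i, closed (E i)) ->
  (forall t, 0 <= t <= 1 -> exists i, E i (x + t *: (y - x))) ->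
  (forall i s t, 0 <= s <= 1 -> 0 <= t <= 1 -> E i (x + s *: (y - x)) -> E i (x + t *: (y - x)) ->
    `|f (x + s *: (y - x)) - f (x + t *: (y - x))| <= L * `|s - t| * `|y - x|) ->
  `|f y - f x| <= L * `|y - x|.
Proof.
move=> L0 cE cov lip.
pose l t := x + t *: (y - x).
have lc : continuous l.
  move=> t; apply: cvgD; first exact: cvg_cst.
  by apply: cvgZl; exact: cvg_id.
have := @lipschitz_cover_itv [seq l @^-1` (E i) | i <- enum 'I_K] (f \o l) (L * `|y - x|).
rewrite mulr_ge0// => /(_ isT _ 0 1 ler01) h.
have e : x + (y - x) = y by rewrite addrC subrK.
have := h _ _ _; rewrite /= /l scale0r addr0 scale1r e subr0 mulr1; apply.
- move=> A /mapP[i _ ->]; apply: closed_comp => // t _; exact: lc.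
- move=> t t01; have [i Ei] := cov t t01; exists (l @^-1` E i) => //.
  by apply: map_f; rewrite mem_enum.
- move=> A s t /mapP[i _ ->] s01 t01 Es Et.
  by rewrite mulrAC; exact: (lip i).
Qed.

Lemma lipschitz_cover (K : nat) (E : 'I_K -> set V) (f : V -> R) (L : R) :
  0 <= L -> (forall i, closed (E i)) -> (forall x, exists i, E i x) ->
  (forall i x y, E i x -> E i y -> `|f x - f y| <= L * `|x - y|) ->
  forall x y, `|f x - f y| <= L * `|x - y|.
Proof.
move=> L0 cE cov lip x y; rewrite (distrC (f x)) (distrC x).
apply: (@lipschitz_cover_segment K E) => // i s t _ _ Es Et.
apply: le_trans (lip i _ _ Es Et) _.
by rewrite opprD addrACA subrr add0r -scalerBl normrZ mulrA.
Qed.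

Lemma lipschitz_continuous (f : V -> R) (L : R) :
  (forall x y, `|f x - f y| <= L * `|x - y|) -> continuous f.
Proof.
move=> lip x; apply/rV_contP => e e0; exists (e / (`|L| + 1)).
  by rewrite divr_gt0// ltr_wpDl.
move=> y; rewrite ltr_pdivlMr ?ltr_wpDl// => h.
have := lip y x; have := ler_norm L; have := normr_ge0 (y - x); nra.
Qed.

(* McShane's formula *)
Lemma lipschitz_extension (A : set V) (f : V -> R) (L : R) : A !=set0 -> 0 <= L ->
  (forall x y, A x -> A y -> `|f x - f y| <= L * `|x - y|) ->
  exists g : V -> R, (forall x, A x -> g x = f x) /\
    forall x y, `|g x - g y| <= L * `|x - y|.
Proof.
move=> [x0 Ax0] L0 lip.
pose S x := [set f y + L * `|x - y| | y in A].
have S0 x : S x !=set0 by exists (f x0 + L * `|x - x0|), x0.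
have lbS x : has_lbound (S x).
  exists (f x0 - L * `|x - x0|) => _ [y Ay <-].
  have := lip x0 y Ax0 Ay; rewrite ler_norml => /andP[_ h].
  have : `|x0 - y| <= `|x - x0| + `|x - y|.
    have -> : x0 - y = (x - y) - (x - x0) by rewrite opprB [RHS]addrC subrKA.
    by rewrite (le_trans (ler_normB _ _))// addrC.
  by move=> /(ler_wpM2l L0); lra.
have iS x : has_inf (S x) by split; [exact: S0|exact: lbS].
have gle x y : inf (S x) <= inf (S y) + L * `|x - y|.
  rewrite -lerBlDr; apply: lb_le_inf => // _ [z Az <-].
  rewrite lerBlDr; apply: le_trans (_ : f z + L * `|x - z| <= _).
    by apply: ge_inf => //; exists z.
  have : `|x - z| <= `|y - z| + `|x - y|.
    have -> : x - z = (y - z) + (x - y) by rewrite [RHS]addrC subrKA.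
    exact: ler_normD.
  by move=> /(ler_wpM2l L0); lra.
exists (fun x => inf (S x)); split=> [x Ax|x y].
  apply/eqP; rewrite eq_le; apply/andP; split.
    by apply: ge_inf => //; exists x => //; rewrite subrr normr0 mulr0 addr0.
  apply: lb_le_inf => // _ [y Ay <-].
  by have := lip x y Ax Ay; rewrite ler_norml => /andP[_]; lra.
rewrite ler_norml; apply/andP; split.
  by have := gle y x; rewrite (distrC y); lra.
by have := gle x y; lra.
Qed.

End lipschitz_covers.

(** * Integrals over meshes *)

(** What the analysis retains of a triangulation of a bounded convex domain: closed cells [C i],
    open subsets [O i] dense in them and contained in Omega, and a null set [N] that contains what
    is left. Vertices and faces are forgotten. *)
Record cells (R : realType) (n K : nat) (Omega : set 'rV[R]_n) (C O : 'I_K -> set 'rV[R]_n)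
    (N : set 'rV[R]_n) : Prop := Cells {
  cells_domain : open Omega;
  cells_neq0 : Omega !=set0;
  cells_bounded : exists2 M : R, 0 <= M & forall x, closure Omega x -> `|x| <= M;
  cells_convex : forall x y t, Omega x -> Omega y -> 0 <= t <= 1 -> Omega (x + t *: (y - x));
  cells_closed : forall i, closed (C i);
  cells_open : forall i, open (O i);
  cells_sub : forall i x, O i x -> C i x /\ Omega x;
  cells_dense : forall i x, C i x -> forall e, 0 < e -> exists2 y, O i y & `|y - x| < e;
  cells_mnull : measurable N;
  cells_null0 : lebesgue_rV R n N = 0%E;
  cells_null : forall i x, C i x -> ~ O i x -> N x;
  cells_cover : forall x, closure Omega x <-> exists i, C i x }.

Section meshes.
Variables (R : realType) (n K : nat).
Local Notation V := 'rV[R]_n.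
Local Notation leb := (lebesgue_rV R n).
Variables (Omega : set V) (C O : 'I_K -> set V) (N : set V).
Hypothesis hc : cells Omega C O N.
Implicit Types (f g : V -> R) (x y : V).

Let oO : forall i, open (O i). Proof. exact (cells_open hc). Qed.

Lemma pderiv_congr (A : set V) i f g x : open A -> (forall y, A y -> f y = g y) -> A x ->
  pderiv i f x = pderiv i g x.
Proof.
move=> oA fg Ax; apply: near_eq_derive.
by apply: filterS fg _; move: oA; rewrite openE; apply.
Qed.

Lemma continuous_congr (A : set V) f g x : open A -> (forall y, A y -> f y = g y) -> A x ->
  {for x, continuous f} -> {for x, continuous g}.
Proof.
move=> /rV_openP oA fg Ax /rV_contP cf; apply/rV_contP => e /cf[r r0 h].
have [s s0 hs] := oA x Ax; exists (Num.min r s); first by rewrite lt_min r0.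
by move=> y; rewrite lt_min => /andP[yr ys]; rewrite -!fg//; [exact: h|exact: hs].
Qed.

Definition inner : set V := [set x | exists i, O i x].

Lemma inner_open : open inner.
Proof.
rewrite (_ : inner = \bigcup_i O i); last first.
  by apply/seteqP; split=> x [i]; [exists i|move=> _; exists i].
by apply: bigcup_open => i _; exact: (@oO i).
Qed.

Lemma inner_sub x : inner x -> Omega x.
Proof. by move=> [i /(cells_sub hc)[]]. Qed.

Lemma closure_sub x : Omega x -> closure Omega x.
Proof. exact: subset_closure. Qed.

Lemma inner_compl_null x : closure Omega x -> ~ inner x -> N x.
Proof.
move=> /(cells_cover hc)[i Ci] nI; apply: (cells_null hc Ci) => Oi; apply: nI.
by exists i.
Qed.

Lemma inner_dense x e : Omega x -> 0 < e -> exists2 y, inner y & `|y - x| < e.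
Proof.
move=> /closure_sub/(cells_cover hc)[i Ci] e0.
by have [y Oy yx] := cells_dense hc Ci e0; exists y => //; exists i.
Qed.

Lemma inner_measurable : measurable inner.
Proof. exact: rV_open_measurable inner_open. Qed.

Lemma domain_bounded : exists2 M : R, 0 <= M & forall x, Omega x -> `|x| <= M.
Proof. by have [M M0 hM] := cells_bounded hc; exists M => // x /closure_sub/hM. Qed.

Lemma domain_measurable : measurable Omega.
Proof. exact: rV_open_measurable (cells_domain hc). Qed.

Lemma domain_finite : (leb Omega < +oo)%E.
Proof.
have [M M0 hM] := domain_bounded; apply: le_lt_trans (cube_finite n M).
by apply: le_measure; rewrite ?inE//; [exact: domain_measurable|exact: measurable_cube].
Qed.

Lemma inner_finite : (leb inner < +oo)%E.
Proof.
apply: le_lt_trans domain_finite.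
apply: le_measure; rewrite ?inE; [exact: inner_measurable|exact: domain_measurable|exact: inner_sub].
Qed.

(** Continuous and bounded on the union of the open cells: an algebra of integrable functions that
    contains splines and their derivatives of all orders, whatever their values on the faces. *)
Definition ucb f := (forall x, inner x -> {for x, continuous f}) /\
  exists B, forall x, inner x -> `|f x| <= B.

Lemma ucb_cst c : ucb (fun=> c).
Proof. by split=> [x _|]; [exact: cst_continuous|exists `|c|]. Qed.

Lemma ucbD f g : ucb f -> ucb g -> ucb (fun x => f x + g x).
Proof.
move=> [cf [B fB]] [cg [D gD]]; split=> [x Ux|].
  by apply: continuousD; [exact: cf|exact: cg].
by exists (B + D) => x Ux; rewrite (le_trans (ler_normD _ _))// lerD ?fB ?gD.
Qed.

Lemma ucbM f g : ucb f -> ucb g -> ucb (fun x => f x * g x).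
Proof.
move=> [cf [B fB]] [cg [D gD]]; split=> [x Ux|].
  by apply: continuousM; [exact: cf|exact: cg].
by exists (B * D) => x Ux; rewrite normrM ler_pM ?fB ?gD.
Qed.

Lemma ucbZ c f : ucb f -> ucb (fun x => c * f x).
Proof. by apply: ucbM; exact: ucb_cst. Qed.

Lemma ucbN f : ucb f -> ucb (fun x => - f x).
Proof. by move=> uf; under eq_fun do rewrite -mulN1r; exact: ucbZ. Qed.

Lemma ucbB f g : ucb f -> ucb g -> ucb (fun x => f x - g x).
Proof. by move=> uf ug; apply: ucbD => //; exact: ucbN. Qed.

Lemma ucb_sum I (r : seq I) (F : I -> V -> R) : (forall i, ucb (F i)) ->
  ucb (fun x => \sum_(i <- r) F i x).
Proof.
move=> uF; elim: r => [|i r IH].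
  by under eq_fun do rewrite big_nil; exact: ucb_cst.
by under eq_fun do rewrite big_cons; exact: ucbD.
Qed.

Definition itg f := \int[leb]_(x in inner) f x.

Lemma ucb_integrable f : ucb f -> leb.-integrable inner (EFin \o f).
Proof.
move=> [cf [B fB]]; apply: measurable_bounded_integrable.
- exact: inner_measurable.
- exact: inner_finite.
- by apply: rV_continuous_measurable; [exact: inner_open|exact: cf].
- exists B; split; [exact: num_real|move=> t Bt x Ux /=].
  by rewrite (le_trans (fB x Ux))// ltW.
Qed.

Lemma itgD f g : ucb f -> ucb g -> itg (fun x => f x + g x) = itg f + itg g.
Proof.
by move=> uf ug; apply: RintegralD; [exact: inner_measurable|exact: ucb_integrable|exact: ucb_integrable].
Qed.

Lemma itgZ c f : ucb f -> itg (fun x => c * f x) = c * itg f.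
Proof. by move=> uf; apply: RintegralZl; [exact: inner_measurable|exact: ucb_integrable]. Qed.

Lemma itgN f : ucb f -> itg (fun x => - f x) = - itg f.
Proof.
by move=> uf; rewrite -mulN1r -itgZ//; congr itg; apply/funext => x; rewrite mulN1r.
Qed.

Lemma itgB f g : ucb f -> ucb g -> itg (fun x => f x - g x) = itg f - itg g.
Proof. by move=> uf ug; rewrite itgD ?itgN//; exact: ucbN. Qed.

Lemma itg0 : itg (fun=> 0) = 0.
Proof.
have h := itgZ 0 (ucb_cst 0); rewrite [RHS]mul0r in h.
by rewrite -[RHS]h; congr itg; apply/funext => x; rewrite mul0r.
Qed.

Lemma itg_sum I (r : seq I) (F : I -> V -> R) : (forall i, ucb (F i)) ->
  itg (fun x => \sum_(i <- r) F i x) = \sum_(i <- r) itg (F i).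
Proof.
move=> uF; elim: r => [|i r IH].
  by under eq_fun do rewrite big_nil; rewrite itg0 big_nil.
by under eq_fun do rewrite big_cons; rewrite itgD ?IH ?big_cons//; exact: ucb_sum.
Qed.

Lemma eq_itg f g : (forall x, inner x -> f x = g x) -> itg f = itg g.
Proof. by move=> fg; apply: eq_Rintegral => x; rewrite inE; exact: fg. Qed.

Lemma itg_le f g : ucb f -> ucb g -> (forall x, inner x -> f x <= g x) -> itg f <= itg g.
Proof.
by move=> uf ug; apply: le_Rintegral; [exact: inner_measurable|exact: ucb_integrable|exact: ucb_integrable].
Qed.

Lemma itg_ge0 f : (forall x, inner x -> 0 <= f x) -> 0 <= itg f.
Proof. exact: Rintegral_ge0. Qed.

Definition vol : R := fine (leb inner).

Lemma vol_ge0 : 0 <= vol. Proof. exact: fine_ge0. Qed.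

Lemma itg_cst c : itg (fun=> c) = c * vol.
Proof. by apply: Rintegral_cst; exact: inner_measurable. Qed.

Lemma itg_norm_le f B : ucb f -> (forall x, inner x -> `|f x| <= B) -> `|itg f| <= B * vol.
Proof.
move=> uf fB; rewrite ler_norml; apply/andP; split.
  rewrite -mulNr -itg_cst; apply: itg_le => // [|x /fB]; first exact: ucb_cst.
  by rewrite ler_norml => /andP[].
rewrite -itg_cst; apply: itg_le => // [|x /fB]; first exact: ucb_cst.
by rewrite ler_norml => /andP[].
Qed.

(** If f x > 0, then f exceeds f x / 2 on a neighbourhood of x, which has positive measure. *)
Lemma itg_eq0 f : ucb f -> (forall x, inner x -> 0 <= f x) -> itg f = 0 ->
  forall x, inner x -> f x = 0.
Proof.
move=> uf f0 If x Ux; apply/eqP; rewrite eq_le f0// andbT leNgt; apply/negP => fx.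
have fx2 : 0 < f x / 2 by rewrite divr_gt0.
have [r r0 hr] := proj1 (rV_contP _ _) (proj1 uf x Ux) _ fx2.
pose W := inner `&` [set y | `|y - x| < r].
have oW : open W.
  apply: openI; first exact: inner_open.
  apply/rV_openP => y /= yx; exists (r - `|y - x|); first by rewrite subr_gt0.
  move=> z zy; have := ler_normD (z - y) (y - x); rewrite subrKA; lra.
have mW := rV_open_measurable oW.
have Wx : W !=set0 by exists x; split=> //=; rewrite subrr normr0.
have /(_ oW Wx) W0 := @open_measure_gt0 R n W.
have WU : W `<=` inner by move=> y [].
have Wfin : leb W \is a fin_num.
  rewrite ge0_fin_numE//; apply: le_lt_trans inner_finite.
  by apply: le_measure; rewrite ?inE//; exact: inner_measurable.
have le1 : ((f x / 2)%:E * leb W <= \int[leb]_(y in inner) (f y)%:E)%E.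
  rewrite -integral_cst//; apply: (@le_trans _ _ (\int[leb]_(y in W) (f y)%:E)%E).
    apply: ge0_le_integral => //.
    - by move=> y _; rewrite lee_fin ltW.
    - apply/measurable_EFinP; apply: rV_continuous_measurable => // y Wy; apply: (proj1 uf); exact: WU.
    - by move=> y [_ /= /hr]; rewrite lee_fin ltr_norml => /andP[]; lra.
  apply: ge0_subset_integral => //; first exact: inner_measurable.
    apply/measurable_EFinP; apply: rV_continuous_measurable; first exact: inner_open.
    exact: (proj1 uf).
have Ifin : (\int[leb]_(y in inner) (f y)%:E)%E \is a fin_num.
  by apply: integrable_fin_num; [exact: inner_measurable|exact: ucb_integrable].
move: le1; rewrite -[(\int[leb]_(y in inner) _)%E]fineK// -/(Rintegral _ _ _) -/(itg f) If.
by rewrite leNgt mule_gt0// lte_fin.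
Qed.

(** Here f is arbitrary, possibly non-measurable on the faces, so the null set is removed by
    [integral_setD_null]. *)
Lemma itg_domain f : \int[leb]_(x in Omega) f x = itg f.
Proof.
rewrite /itg /Rintegral (integral_setD_null _ (cells_mnull hc) (cells_null0 hc)).
rewrite [in RHS](integral_setD_null _ (cells_mnull hc) (cells_null0 hc)).
congr (fine (integral _ _ _)); apply/seteqP; split=> x [Ux Nx]; split=> //.
  by apply: contrapT => nU; apply: Nx; apply: inner_compl_null => //; exact: closure_sub.
exact: inner_sub.
Qed.

(** No matching between cells is asked for, so that the class is stable under differentiation and
    contains the Hessian entries, determinant and cofactors of a spline. *)
Definition pw f := forall i, exists2 q, polyf q & forall x, O i x -> f x = q x.

Lemma polyf_pw q : polyf q -> pw q.
Proof. by move=> pq i; exists q. Qed.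

Lemma pw_cst c : pw (fun=> c). Proof. by apply: polyf_pw; exact: polyf_cst. Qed.

Lemma pwD f g : pw f -> pw g -> pw (fun x => f x + g x).
Proof.
move=> pf pg i; have [p pp fp] := pf i; have [q pq gq] := pg i.
by exists (fun x => p x + q x); [exact: polyf_add|move=> x Ox; rewrite fp ?gq].
Qed.

Lemma pwM f g : pw f -> pw g -> pw (fun x => f x * g x).
Proof.
move=> pf pg i; have [p pp fp] := pf i; have [q pq gq] := pg i.
by exists (fun x => p x * q x); [exact: polyf_mul|move=> x Ox; rewrite fp ?gq].
Qed.

Lemma pw_sum I (r : seq I) (F : I -> V -> R) : (forall i, pw (F i)) ->
  pw (fun x => \sum_(i <- r) F i x).
Proof.
move=> pF; elim: r => [|i r IH].
  by under eq_fun do rewrite big_nil; exact: pw_cst.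
by under eq_fun do rewrite big_cons; exact: pwD.
Qed.

Lemma pw_pderiv j f : pw f -> pw (pderiv j f).
Proof.
move=> pf i; have [p pp fp] := pf i; exists (pderiv j p); first exact: polyf_pderiv.
by move=> x; apply: pderiv_congr => //; exact: (@oO i).
Qed.

Lemma pw_det k (M : V -> 'M[R]_k) : (forall a b, pw (fun x => M x a b)) -> pw (fun x => \det (M x)).
Proof.
move=> pM i; pose q a b := s2val (cid2 (pM a b i)).
have pq a b : polyf (q a b) by rewrite /q; case: cid2.
have Mq a b x : O i x -> M x a b = q a b x by rewrite /q; case: cid2 => p /= _; apply.
exists (fun x => \det (\matrix_(a, b) q a b x)).
  by apply: polyf_det => a b; under eq_fun do rewrite mxE.
by move=> x Ox; congr (\det _); apply/matrixP => a b; rewrite mxE Mq.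
Qed.

Lemma pw_cofmx k (M : V -> 'M[R]_k) a b : (forall a b, pw (fun x => M x a b)) ->
  pw (fun x => cofmx (M x) a b).
Proof.
move=> pM; under eq_fun do rewrite mxE /cofactor.
apply: pwM; first exact: pw_cst.
by apply: pw_det => c d; under eq_fun do rewrite !mxE; exact: pM.
Qed.

Lemma pw_hess f a b : pw f -> pw (fun x => hess f x a b).
Proof. by move=> pf; under eq_fun do rewrite mxE; do 2 apply: pw_pderiv. Qed.

Lemma pw_local f x : pw f -> inner x -> exists2 q, polyf q & \forall y \near x, f y = q y.
Proof.
move=> pf [i Ox]; have [q pq fq] := pf i; exists q => //.
by apply: filterS fq _; have := @oO i; rewrite openE; apply.
Qed.

Lemma pw_ucb f : pw f -> ucb f.
Proof.
move=> pf; split=> [x [i Ox]|].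
  have [q pq fq] := pf i; apply: (@continuous_congr (O i) q) => //.
  - by move=> y /fq.
  - exact: polyf_continuous.
have [M M0 hM] := domain_bounded.
have B i : exists B, forall x, O i x -> `|f x| <= B.
  have [q pq fq] := pf i; have [B hB] := polyf_bounded M pq.
  by exists B => x Ox; rewrite fq// hB// hM//; have [] := cells_sub hc Ox.
exists (\sum_i `|sval (cid (B i))|) => x [i Ox].
rewrite (bigD1 i)//= ler_wpDr ?sumr_ge0//.
by apply: le_trans (ler_norm _); case: cid => D /= hD; exact: hD.
Qed.

Lemma pw_derivable f x v : pw f -> inner x -> derivable f x v.
Proof.
move=> pf /(pw_local pf)[q pq fq].
apply: (@near_eq_derivable _ _ _ q f x v); last exact: polyf_derivable.
by apply: filterS fq => y.
Qed.

Lemma pw_pderivD f g i x : pw f -> pw g -> inner x ->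
  pderiv i (fun y => f y + g y) x = pderiv i f x + pderiv i g x.
Proof. by move=> pf pg Ux; apply: deriveD; exact: pw_derivable. Qed.

Lemma pw_pderivM f g i x : pw f -> pw g -> inner x ->
  pderiv i (fun y => f y * g y) x = f x * pderiv i g x + g x * pderiv i f x.
Proof. by move=> pf pg Ux; apply: deriveM; exact: pw_derivable. Qed.

Lemma pw_taylor1 f x : pw f -> inner x -> taylor1 f x (grad f x).
Proof.
move=> pf /(pw_local pf)[q pq fq].
have -> : grad f x = grad q x.
  by apply/rowP => i; rewrite !mxE; apply: near_eq_derive.
have [B [r [r0 h]]] := polyf_taylor1 x pq.
have /rV_nbhsP[s s0 hs] := fq.
exists B, (Num.min r s); split; first by rewrite lt_min r0.
move=> y; rewrite lt_min => /andP[yr ys].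
have -> : f x = q x by apply: hs; rewrite subrr normr0.
by rewrite hs ?h// addrAC subrr add0r.
Qed.

End meshes.

(** * Divergence structure of the determinant *)

Lemma cofmx_col_cases (R : realType) n (n23 : n = 2%N \/ n = 3%N) (j : 'I_n) :
  (exists (s : R) (p q k : 'I_n), forall (A : 'M[R]_n) (g : 'I_n -> R),
    \sum_i cofmx A i j * g i = s * (g p * A q k - g q * A p k)) \/
  (exists (p q r k l : 'I_n), forall (A : 'M[R]_n) (g : 'I_n -> R),
    \sum_i cofmx A i j * g i =
    g p * (A q k * A r l - A r k * A q l) + g q * (A r k * A p l - A p k * A r l) +
    g r * (A p k * A q l - A q k * A p l)).
Proof.
case: n23 j => -> j; [left; exact: cofmx_col2|right; exact: cofmx_col3].
Qed.

Lemma gradE (R : realType) n (f : 'rV[R]_n -> R) x i : grad f x ord0 i = pderiv i f x.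
Proof. by rewrite mxE. Qed.

Lemma hessE (R : realType) n (f : 'rV[R]_n -> R) x i j :
  hess f x i j = pderiv i (pderiv j f) x.
Proof. by rewrite mxE. Qed.

Section splines.
Variables (R : realType) (n K : nat).
Local Notation V := 'rV[R]_n.
Local Notation leb := (lebesgue_rV R n).
Variables (Omega : set V) (C O : 'I_K -> set V) (N : set V).
Hypothesis hc : cells Omega C O N.
Local Notation inner := (inner O).
Local Notation itg := (itg O).
Local Notation pw := (pw O).
Implicit Types (f g p u : V -> R) (x y : V).

Let dOmega : open Omega. Proof. exact (cells_domain hc). Qed.
Let oO : forall i, open (O i). Proof. exact (cells_open hc). Qed.

Lemma patch_in f x : Omega x -> (f \_ Omega) x = f x.
Proof. by move=> Ox; rewrite patchE mem_set. Qed.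

Lemma patch_out f x : ~ Omega x -> (f \_ Omega) x = 0.
Proof. by move=> Ox; rewrite patchE memNset. Qed.

Lemma itg_patch f : \int[leb]_(x in ~` N) (f \_ inner) x = itg f.
Proof.
rewrite -Rintegral_mkcondr setIC -setDE /itg /Rintegral.
by rewrite [in RHS](integral_setD_null _ (cells_mnull hc) (cells_null0 hc)).
Qed.

Lemma outer_open x : ~ N x -> ~ inner x -> exists2 r : R, 0 < r & forall y, `|y - x| < r -> ~ Omega y.
Proof.
move=> Nx Ix.
have cx : ~ closure Omega x by move=> clx; apply: Nx; exact: (inner_compl_null hc).
have : open (~` closure Omega) by apply: closed_openC; exact: closed_closure.
move=> /rV_openP/(_ x cx)[r r0 h]; exists r => // y /h ny Oy; apply: ny.
exact: subset_closure.
Qed.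

(** The divergence theorem for functions vanishing off Omega. A point outside [N] and outside the
    open cells is exterior to Omega, where the difference quotients of w are eventually zero; so W
    extended by zero is the derivative off [N]. *)
Lemma itg_derive0 (w W : V -> R) (v : V) (L B : R) :
  (forall x, ~ Omega x -> w x = 0) -> measurable_fun setT w -> (forall x, `|w x| <= B) ->
  (forall x s, 0 < s <= 1 -> `|w (x + s *: v) - w x| <= L * s) ->
  (forall x, inner x -> is_derive x v w (W x)) -> itg W = 0.
Proof.
move=> w0 mw wB wL wW; rewrite -itg_patch.
have [M M0 hM] := domain_bounded hc.
have bw : bms w.
  split=> //; exists (`|M| + `|B|) => x; split.
    by have := wB x; have := ler_norm B; have := normr_ge0 M; lra.
  move=> h; apply: w0 => /hM; have := ler_norm M; have := normr_ge0 B; lra.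
apply: (@Rintegral_derivative R n w (W \_ inner) v N L) => //.
- exact: cells_mnull hc.
- exact: cells_null0 hc.
move=> x Nx; have [Ix|Ix] := pselect (inner x).
  by rewrite patchE mem_set//; apply: is_derive_dquot; exact: wW.
rewrite patchE memNset//.
have [r r0 h] := outer_open Nx Ix.
have hw y : `|y - x| < r -> w y = 0 by move=> /h; exact: w0.
have cr : \forall k \near \oo, hstep R k * `|v| < r.
  have : (fun k => hstep R k * `|v|) @ \oo --> (0 : R).
    by rewrite -[X in _ --> X](mul0r `|v|); apply: cvgMl => //; exact: hstep_cvg.
  by move/cvgr_lt; apply.
apply: cvg_near_cst; near=> k.
rewrite !hw ?subrr ?mul0r ?normr0//.
rewrite addrAC subrr add0r normrZ gtr0_norm ?hstep_gt0//.
by near: k.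
Unshelve. all: by end_near. Qed.

Lemma lipschitz_measurable f L : (forall x y, `|f x - f y| <= L * `|x - y|) ->
  measurable_fun setT f.
Proof.
move=> fL; apply: rV_continuous_measurable; first exact: openT.
by move=> x _; exact: (lipschitz_continuous fL).
Qed.

Lemma lipschitz_dir f L : (forall x y, `|f x - f y| <= L * `|x - y|) ->
  forall v x s, 0 < s <= 1 -> `|f (x + s *: v) - f x| <= L * `|v| * s.
Proof.
move=> fL v x s /andP[s0 _]; apply: le_trans (fL _ _) _.
by rewrite addrAC subrr add0r normrZ gtr0_norm// mulrA mulrAC.
Qed.

Lemma lipschitz_bounded f L : (forall x y, `|f x - f y| <= L * `|x - y|) ->
  (forall x, ~ Omega x -> f x = 0) -> exists B, forall x, `|f x| <= B.
Proof.
move=> fL f0; have [M M0 hM] := domain_bounded hc.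
exists (`|f 0| + `|L| * M) => x.
have LM : 0 <= `|L| * M by rewrite mulr_ge0.
have [Ox|Ox] := pselect (Omega x); last by rewrite f0// normr0 addr_ge0.
have := fL x 0; rewrite subr0 => h1.
have := ler_normD (f x - f 0) (f 0); rewrite subrK.
have : L * `|x| <= `|L| * M.
  by apply: le_trans (_ : `|L| * `|x| <= _); [rewrite ler_wpM2r// ler_norm|rewrite ler_wpM2l// hM].
lra.
Qed.

Lemma lipschitz_bms f L : (forall x y, `|f x - f y| <= L * `|x - y|) ->
  (forall x, ~ Omega x -> f x = 0) -> bms f.
Proof.
move=> fL f0; split; first exact: lipschitz_measurable fL.
have [M M0 hM] := domain_bounded hc; have [B hB] := lipschitz_bounded fL f0.
have B0 : 0 <= B by apply: le_trans (hB 0).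
exists (M + B) => x; split; first by have := hB x; lra.
by move=> h; apply: f0 => /hM; lra.
Qed.

Lemma itg_det2 (chi a : V -> R) (gchi ga : V -> V) (i j : 'I_n) (L : R) :
  (forall x, ~ Omega x -> chi x = 0) ->
  (forall x y, `|chi x - chi y| <= L * `|x - y|) ->
  (forall x y, `|a x - a y| <= L * `|x - y|) ->
  (forall x, inner x -> taylor1 chi x (gchi x)) -> (forall x, inner x -> taylor1 a x (ga x)) ->
  itg (fun x => gchi x ord0 i * ga x ord0 j - gchi x ord0 j * ga x ord0 i) = 0.
Proof.
move=> chi0 chiL aL tchi ta; rewrite -itg_patch.
pose gchi' x := if x \in inner then gchi x else 0.
rewrite -[RHS](@Rintegral_det2 R n chi a gchi' ga i j N L (lipschitz_bms chiL chi0)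
  (lipschitz_dir chiL) (lipschitz_measurable aL) (lipschitz_dir aL)
  (cells_mnull hc) (cells_null0 hc)).
  apply: eq_Rintegral => x _; rewrite patchE /gchi'; case: ifP => // _.
  by rewrite !mxE !mul0r subrr.
move=> x Nx; rewrite /gchi'; have [Ix|Ix] := pselect (inner x).
  by left; rewrite mem_set//; split; [exact: tchi|exact: ta].
right; rewrite memNset//; split=> //.
have [r r0 h] := outer_open Nx Ix.
by apply/rV_nbhsP; exists r => // y /h; exact: chi0.
Qed.

Lemma itg_det3 (chi a b : V -> R) (gchi ga gb : V -> V) (i j l : 'I_n) (L : R) :
  (forall x, ~ Omega x -> chi x = 0) ->
  (forall x y, `|chi x - chi y| <= L * `|x - y|) ->
  (forall x y, `|a x - a y| <= L * `|x - y|) ->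
  (forall x y, `|b x - b y| <= L * `|x - y|) ->
  (forall x, inner x -> taylor1 chi x (gchi x)) -> (forall x, inner x -> taylor1 a x (ga x)) ->
  (forall x, inner x -> taylor1 b x (gb x)) ->
  let m (s t : 'I_n) x := ga x ord0 s * gb x ord0 t - ga x ord0 t * gb x ord0 s in
  itg (fun x => gchi x ord0 i * m j l x + gchi x ord0 j * m l i x + gchi x ord0 l * m i j x) = 0.
Proof.
move=> chi0 chiL aL bL tchi ta tb m; rewrite -itg_patch.
pose gchi' x := if x \in inner then gchi x else 0.
rewrite -[RHS](@Rintegral_det3 R n chi a b gchi' ga gb i j l N L (lipschitz_bms chiL chi0)
  (lipschitz_dir chiL) (lipschitz_measurable aL) (lipschitz_dir aL)
  (lipschitz_measurable bL) (lipschitz_dir bL) (cells_mnull hc) (cells_null0 hc)).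
  apply: eq_Rintegral => x _; rewrite patchE /gchi'; case: ifP => // _.
  by rewrite !mxE !mul0r !addr0.
move=> x Nx; rewrite /gchi'; have [Ix|Ix] := pselect (inner x).
  by left; rewrite mem_set//; split; [exact: tchi|exact: ta|exact: tb].
right; rewrite memNset//; split=> //.
have [r r0 h] := outer_open Nx Ix.
by apply/rV_nbhsP; exists r => // y /h; exact: chi0.
Qed.

(** [chi] and [a] are globally Lipschitz, as the finite differences require, while the derivatives
    are those of the functions [G] and [A] that they extend. *)
Lemma itg_pderiv_det2 (chi a G A : V -> R) (i j : 'I_n) (L : R) :
  (forall x, ~ Omega x -> chi x = 0) ->
  (forall x y, `|chi x - chi y| <= L * `|x - y|) ->
  (forall x y, `|a x - a y| <= L * `|x - y|) ->
  (forall x, inner x -> taylor1 chi x (grad G x)) ->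
  (forall x, inner x -> taylor1 a x (grad A x)) ->
  itg (fun x => pderiv i G x * pderiv j A x - pderiv j G x * pderiv i A x) = 0.
Proof.
move=> chi0 chiL aL tchi ta.
rewrite -(itg_det2 i j chi0 chiL aL tchi ta); apply: eq_itg => x _.
by rewrite (gradE G x i) (gradE A x j) (gradE G x j) (gradE A x i).
Qed.

Lemma itg_pderiv_det3 (chi a b G A B : V -> R) (i j l : 'I_n) (L : R) :
  (forall x, ~ Omega x -> chi x = 0) ->
  (forall x y, `|chi x - chi y| <= L * `|x - y|) ->
  (forall x y, `|a x - a y| <= L * `|x - y|) ->
  (forall x y, `|b x - b y| <= L * `|x - y|) ->
  (forall x, inner x -> taylor1 chi x (grad G x)) ->
  (forall x, inner x -> taylor1 a x (grad A x)) ->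
  (forall x, inner x -> taylor1 b x (grad B x)) ->
  itg (fun x =>
    pderiv i G x * (pderiv j A x * pderiv l B x - pderiv l A x * pderiv j B x) +
    pderiv j G x * (pderiv l A x * pderiv i B x - pderiv i A x * pderiv l B x) +
    pderiv l G x * (pderiv i A x * pderiv j B x - pderiv j A x * pderiv i B x)) = 0.
Proof.
move=> chi0 chiL aL bL tchi ta tb.
rewrite -(itg_det3 i j l chi0 chiL aL bL tchi ta tb); apply: eq_itg => x _.
rewrite (gradE G x i) (gradE A x j) (gradE G x j) (gradE A x i) (gradE G x l) (gradE A x l).
by rewrite (gradE B x i) (gradE B x j) (gradE B x l).
Qed.

Definition spl f := Ck_on Omega 1 f /\
  forall i, exists2 q, polyf q & forall x, C i x -> f x = q x.

Definition vanishing f := forall x, closure Omega x -> ~ Omega x -> f x = 0.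

Lemma spl_pw f : spl f -> pw f.
Proof.
move=> [_ sf] i; have [q pq fq] := sf i; exists q => // x Ox; apply: fq.
by have [] := cells_sub hc Ox.
Qed.

Lemma C1_pderiv_continuous f i x : Ck_on Omega 1 f -> Omega x -> {for x, continuous (pderiv i f)}.
Proof. by move=> [_ /(_ i)[_ [cf _]]]; exact: cf. Qed.

Lemma eq_on_cell f g i x : {for x, continuous f} -> {for x, continuous g} ->
  (forall y, O i y -> f y = g y) -> C i x -> f x = g x.
Proof.
move=> cf cg fg Cx; apply/eqP; rewrite -subr_eq0; apply: contraT => d0.
have d1 : 0 < `|f x - g x| / 2 by rewrite divr_gt0// normr_gt0.
have [r r0 hr] := proj1 (rV_contP _ _) cf _ d1.
have [s s0 hs] := proj1 (rV_contP _ _) cg _ d1.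
have [|y Oy] := cells_dense hc Cx (_ : 0 < Num.min r s); first by rewrite lt_min r0.
rewrite lt_min => /andP[/hr h1 /hs h2].
have := ler_normD (f x - f y) (g y - g x); rewrite -(fg y Oy) subrKA.
by rewrite (distrC (f x) (f y)); rewrite -(fg y Oy) in h2; lra.
Qed.

(** Both sides are continuous at x and agree on the dense open part of the cell, so the equality
    also holds on the faces inside Omega. *)
Lemma spl_pderiv_cell f q i j x : spl f -> polyf q -> (forall y, C i y -> f y = q y) ->
  C i x -> Omega x -> pderiv j f x = pderiv j q x.
Proof.
move=> sf pq fq Cx Ox; apply: (@eq_on_cell _ _ i) => //.
- by apply: C1_pderiv_continuous => //; case: sf.
- by apply: polyf_continuous; exact: polyf_pderiv.
- move=> y Oy; apply: (@pderiv_congr _ _ (O i)) => //.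
  by move=> z Oz; apply: fq; have [] := cells_sub hc Oz.
Qed.

Lemma cell_bounded : exists2 M : R, 0 <= M & forall i x, C i x -> `|x| <= M.
Proof.
have [M M0 hM] := cells_bounded hc; exists M => // i x Cx; apply: hM.
by apply/(cells_cover hc); exists i.
Qed.

(** The cells and the complement of Omega form a finite closed cover of the space, on each member of
    which the extension by zero is Lipschitz: on a cell it equals h, since h vanishes at the
    boundary points of the cell. *)
Lemma zero_lipschitz g :
  (forall i, exists (h : V -> R) (L : R), [/\ 0 <= L,
     (forall x y, C i x -> C i y -> `|h x - h y| <= L * `|x - y|),
     (forall x, C i x -> Omega x -> g x = h x) & (forall x, C i x -> ~ Omega x -> h x = 0)]) ->
  exists2 L, 0 <= L & forall x y, `|(g \_ Omega) x - (g \_ Omega) y| <= L * `|x - y|.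
Proof.
move=> H; pose L i := sval (cid (svalP (cid (H i)))).
have HL i : exists h : V -> R, [/\ 0 <= L i,
     (forall x y, C i x -> C i y -> `|h x - h y| <= L i * `|x - y|),
     (forall x, C i x -> Omega x -> g x = h x) & (forall x, C i x -> ~ Omega x -> h x = 0)].
  by exists (sval (cid (H i))); exact: svalP (cid (svalP (cid (H i)))).
have L0 i : 0 <= L i by have [h []] := HL i.
exists (\sum_i L i); first exact: sumr_ge0.
have cC : forall i, closed (C i) by exact (cells_closed hc).
pose E (i : 'I_K.+1) := if unlift ord0 i is Some j then C j else ~` Omega.
apply: (@lipschitz_cover R n K.+1 E); first exact: sumr_ge0.
- move=> i; rewrite /E; case: unlift => [j|]; first exact: cC.
  exact: open_closedC.
- move=> x; have [Ox|Ox] := pselect (Omega x); last by exists ord0; rewrite /E unlift_none.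
  have /(cells_cover hc)[i Ci] := subset_closure Ox.
  by exists (lift ord0 i); rewrite /E liftK.
- move=> i x y; rewrite /E; case: unlift => [j Cx Cy|nx ny]; last first.
    by rewrite !patch_out// subrr normr0 mulr_ge0// sumr_ge0.
  have [h [_ hL gh h0]] := HL j.
  have E' z : C j z -> (g \_ Omega) z = h z.
    move=> Cz; have [Oz|Oz] := pselect (Omega z); first by rewrite patch_in// gh.
    by rewrite patch_out// h0.
  rewrite !E'//; apply: le_trans (hL _ _ Cx Cy) _; rewrite ler_wpM2r//.
  by rewrite (bigD1 j)//= lerDl sumr_ge0.
Qed.

Lemma zero_lipschitz_polyf g : (forall i, exists h : V -> R, [/\ polyf h,
     (forall x, C i x -> Omega x -> g x = h x) & (forall x, C i x -> ~ Omega x -> h x = 0)]) ->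
  exists2 L, 0 <= L & forall x y, `|(g \_ Omega) x - (g \_ Omega) y| <= L * `|x - y|.
Proof.
move=> H; apply: zero_lipschitz => i; have [h [ph gh h0]] := H i.
have [M M0 hM] := cell_bounded.
have [L L0 hL] := polyf_lipschitz M ph.
by exists h, L; split=> // x y Cx Cy; apply: hL; apply: hM; eassumption.
Qed.

(** First derivatives of a C^1 spline are Lipschitz on each cell inside Omega; convexity keeps the
    segment between two points of Omega in Omega, where the cells cover it. *)
Lemma spl_pderiv_lipschitz f k : spl f -> exists2 L, 0 <= L &
  forall x y, Omega x -> Omega y -> `|pderiv k f x - pderiv k f y| <= L * `|x - y|.
Proof.
move=> sf; have [M M0 hM] := cell_bounded.
have H i : exists L, 0 <= L /\ forall x y, C i x -> C i y -> Omega x -> Omega y ->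
    `|pderiv k f x - pderiv k f y| <= L * `|x - y|.
  have [q pq fq] := proj2 sf i.
  have [L L0 hL] := polyf_lipschitz M (polyf_pderiv k pq).
  exists L; split=> // x y Cx Cy Ox Oy.
  by rewrite !(spl_pderiv_cell k sf pq fq)//; apply: hL; exact: (hM i).
pose L i := sval (cid (H i)).
have [L0 hL] : (forall i, 0 <= L i) /\ forall i x y, C i x -> C i y -> Omega x -> Omega y ->
    `|pderiv k f x - pderiv k f y| <= L i * `|x - y|.
  by split=> i; have [] := svalP (cid (H i)).
exists (\sum_i L i); first exact: sumr_ge0.
move=> x y Ox Oy; rewrite distrC (distrC x).
have cC : forall i, closed (C i) by exact (cells_closed hc).
have seg t : 0 <= t <= 1 -> Omega (x + t *: (y - x)) by exact: (cells_convex hc).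
apply: (@lipschitz_cover_segment R n K C) => //; first exact: sumr_ge0.
- by move=> t /seg/(@subset_closure _ Omega)/(cells_cover hc).
- move=> i s t /seg Os /seg Ot Cs Ct; apply: le_trans (hL i _ _ Cs Ct Os Ot) _.
  rewrite opprD addrACA subrr add0r -scalerBl normrZ mulrA ler_wpM2r// ler_wpM2r//.
  by rewrite (bigD1 i)//= lerDl sumr_ge0.
Qed.

(** Finite differences step out of Omega, and these derivatives need not vanish on the boundary, so
    an extension by zero would not be Lipschitz. *)
Lemma spl_pderiv_extension f k : spl f -> exists (a : V -> R) (L : R), [/\ 0 <= L,
  (forall x, Omega x -> a x = pderiv k f x) & forall x y, `|a x - a y| <= L * `|x - y|].
Proof.
move=> sf; have [L L0 hL] := spl_pderiv_lipschitz k sf.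
have [a [aE aL]] := @lipschitz_extension R n Omega (pderiv k f) L (cells_neq0 hc) L0 hL.
by exists a, L.
Qed.

Lemma pderiv_mul_lipschitz p psi j : spl p -> spl psi -> vanishing psi ->
  exists2 L, 0 <= L & forall x y,
    `|((fun x => pderiv j p x * psi x) \_ Omega) x - ((fun x => pderiv j p x * psi x) \_ Omega) y|
    <= L * `|x - y|.
Proof.
move=> sp spsi psi0; apply: zero_lipschitz_polyf => i.
have [q pq pE] := proj2 sp i; have [r pr psiE] := proj2 spsi i.
exists (fun x => pderiv j q x * r x); split.
- by apply: polyf_mul => //; exact: polyf_pderiv.
- by move=> x Cx Ox; rewrite psiE// (spl_pderiv_cell j sp pq pE).
- move=> x Cx Ox; rewrite -psiE// psi0 ?mulr0//.
  by apply/(cells_cover hc); exists i.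
Qed.

Lemma taylor1_congr f g x v : (\forall y \near x, f y = g y) -> taylor1 f x v -> taylor1 g x v.
Proof.
move=> /rV_nbhsP[s s0 hs] [B [r [r0 h]]].
exists B, (Num.min r s); split; first by rewrite lt_min r0.
move=> y; rewrite lt_min => /andP[yr ys].
by rewrite -!hs ?subrr ?normr0 ?h// addrAC subrr add0r.
Qed.

Lemma near_inner f g x : inner x -> (forall y, Omega y -> f y = g y) -> \forall y \near x, f y = g y.
Proof.
move=> Ix fg; have Ox := inner_sub hc Ix.
by apply: filterS fg _; move: dOmega; rewrite openE; apply.
Qed.

(* Columns of the cofactor matrix of the Hessian are divergence free, in spite of
   the jumps of the second derivatives between cells. *)
Lemma itg_cofmx_div (n23 : n = 2%N \/ n = 3%N) u p psi j :
  spl u -> spl p -> spl psi -> vanishing psi ->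
  itg (fun x => \sum_i cofmx (hess u x) i j *
    pderiv i (fun y => pderiv j p y * psi y) x) = 0.
Proof.
move=> su sp spsi psi0.
have [L1 L10 hchi] := pderiv_mul_lipschitz j sp spsi psi0.
set g := (fun x => pderiv j p x * psi x) in hchi *.
have pg : pw g by apply: pwM; [apply: (pw_pderiv hc)|]; exact: spl_pw.
have tchi x : inner x -> taylor1 (g \_ Omega) x (grad g x).
  move=> Ix; apply: taylor1_congr (pw_taylor1 hc pg Ix).
  by apply: near_inner => // y Oy; rewrite patch_in.
have ta a k x : (forall x, Omega x -> a x = pderiv k u x) -> inner x ->
    taylor1 a x (grad (pderiv k u) x).
  move=> aE Ix; apply: taylor1_congr (pw_taylor1 hc (pw_pderiv hc k (spl_pw su)) Ix).
  by apply: near_inner => // y Oy; rewrite aE.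
have [[s [p' [q [k E]]]]|[p' [q [r [k [l E]]]]]] := cofmx_col_cases R n23 j.
  have [a [L [L0 aE aL]]] := spl_pderiv_extension k su.
  rewrite (@eq_itg _ _ _ O _ (fun x => s * (pderiv p' g x * pderiv q (pderiv k u) x -
      pderiv q g x * pderiv p' (pderiv k u) x))); last first.
    by move=> x Ix; rewrite E !hessE.
  rewrite (itgZ hc); last first.
    apply: (pw_ucb hc).
    under eq_fun do rewrite -mulN1r.
    have pk : pw (pderiv k u) by apply: (pw_pderiv hc); exact: spl_pw.
    have pgr f i : pw f -> pw (pderiv i f) by exact: (pw_pderiv hc).
    apply: pwD; first exact: (pwM (pgr _ _ pg) (pgr _ _ pk)).
    exact: (pwM (pw_cst _ _) (pwM (pgr _ _ pg) (pgr _ _ pk))).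
  rewrite (@itg_pderiv_det2 (g \_ Omega) a g (pderiv k u) p' q (L1 + L)) ?mulr0//.
  - by move=> x Ox; rewrite patch_out.
  - by move=> x y; apply: le_trans (hchi x y) _; rewrite ler_wpM2r// lerDl.
  - by move=> x y; apply: le_trans (aL x y) _; rewrite ler_wpM2r// lerDr.
  - by move=> x; exact: ta.
have [a [L [L0 aE aL]]] := spl_pderiv_extension k su.
have [b [L' [L'0 bE bL]]] := spl_pderiv_extension l su.
rewrite -[RHS](@itg_pderiv_det3 (g \_ Omega) a b g (pderiv k u) (pderiv l u) p' q r (L1 + L + L')).
- by apply: eq_itg => x Ix; rewrite E !hessE.
- by move=> x Ox; rewrite patch_out.
- by move=> x y; apply: le_trans (hchi x y) _; rewrite ler_wpM2r// -addrA lerDl addr_ge0.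
- by move=> x y; apply: le_trans (aL x y) _; rewrite ler_wpM2r// addrAC lerDr addr_ge0.
- by move=> x y; apply: le_trans (bL x y) _; rewrite ler_wpM2r// lerDr addr_ge0.
- exact: tchi.
- by move=> x; exact: ta.
- by move=> x; exact: ta.
Qed.

(** By the product rule, moving everything to one side leaves the sum over j of column j of the
    cofactor matrix paired with the gradient of (D_j p) psi, whose integral vanishes. This
    identifies the pointwise derivative of the determinant with [dF_form]. *)
Lemma itg_cof_parts (n23 : n = 2%N \/ n = 3%N) u p psi :
  spl u -> spl p -> spl psi -> vanishing psi ->
  itg (fun x => (\sum_i \sum_j cofmx (hess u x) i j * hess p x i j) * psi x) =
  - itg (fun x => \sum_i (\sum_j cofmx (hess u x) i j * pderiv j p x) * pderiv i psi x).
Proof.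
move=> su sp spsi psi0; apply/eqP; rewrite -addr_eq0; apply/eqP.
have [pu pp ppsi] := And3 (spl_pw su) (spl_pw sp) (spl_pw spsi).
have pc i j : pw (fun x => cofmx (hess u x) i j) by apply: pw_cofmx => a b; exact: (pw_hess hc).
rewrite -(itgD hc); last 2 first.
- apply: (pw_ucb hc); apply: pwM => //; apply: pw_sum => i; apply: pw_sum => j.
  by apply: pwM => //; exact: (pw_hess hc).
- apply: (pw_ucb hc); apply: pw_sum => i; apply: pwM; last exact: (pw_pderiv hc).
  by apply: pw_sum => j; apply: pwM => //; exact: (pw_pderiv hc).
rewrite (@eq_itg _ _ _ O _ (fun x => \sum_j \sum_i cofmx (hess u x) i j *
    pderiv i (fun y => pderiv j p y * psi y) x)).
  rewrite (itg_sum hc).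
    by rewrite big1// => j _; exact: itg_cofmx_div.
  move=> j; apply: (pw_ucb hc); apply: pw_sum => i; apply: pwM => //; apply: (pw_pderiv hc).
  by apply: pwM => //; exact: (pw_pderiv hc).
move=> x Ix; rewrite [RHS]exchange_big /= mulr_suml -big_split /=; apply: eq_bigr => i _.
rewrite !mulr_suml -big_split /=; apply: eq_bigr => j _.
rewrite (pw_pderivM hc i (pw_pderiv hc j pp) ppsi Ix) hessE.
by ring.
Qed.

End splines.

(** * Sobolev norms *)

Section C1_functions.
Variables (R : realType) (n : nat).
Local Notation V := 'rV[R]_n.
Implicit Types (f g : V -> R) (A : set V) (x : V).

Lemma C1_intro A f (df : 'I_n -> V -> R) : open A ->
  (forall x, A x -> {for x, continuous f}) ->
  (forall i x, A x -> is_derive x (delta_mx ord0 i) f (df i x)) ->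
  (forall i x, A x -> {for x, continuous (df i)}) ->
  Ck_on A 1 f /\ forall i x, A x -> pderiv i f x = df i x.
Proof.
move=> oA cf fd cd.
have E i x : A x -> pderiv i f x = df i x by move=> Ax; have [_] := fd i x Ax.
split=> //; split=> // i; split=> [x Ax|]; first by have [] := fd i x Ax.
split=> // x Ax; apply: (@continuous_congr _ _ A (df i)) => //; last exact: cd.
by move=> y Ay; rewrite E.
Qed.

Lemma C1_der A f i x : Ck_on A 1 f -> A x -> is_derive x (delta_mx ord0 i) f (pderiv i f x).
Proof. by move=> [_ /(_ i)[df _]] Ax; apply: derivableP; exact: df. Qed.

Lemma C1_cont A f x : Ck_on A 1 f -> A x -> {for x, continuous f}.
Proof. by move=> [cf _]; exact: cf. Qed.

Lemma C1_cst A c : open A -> Ck_on A 1 (fun=> c) /\ forall i x, A x -> pderiv i (fun=> c : R) x = 0.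
Proof.
move=> oA; apply: (@C1_intro A (fun=> c) (fun _ _ => 0)) => // *;
  [exact: cst_continuous|exact: cst_continuous].
Qed.

Lemma C1_D A f g : open A -> Ck_on A 1 f -> Ck_on A 1 g ->
  Ck_on A 1 (fun x => f x + g x) /\
  forall i x, A x -> pderiv i (fun x => f x + g x) x = pderiv i f x + pderiv i g x.
Proof.
move=> oA Cf Cg.
apply: (@C1_intro A _ (fun i x => pderiv i f x + pderiv i g x)) => // [x Ax|i x Ax|i x Ax].
- by apply: continuousD; [exact: C1_cont Cf Ax|exact: C1_cont Cg Ax].
- by apply: is_deriveD; [exact: C1_der Cf Ax|exact: C1_der Cg Ax].
- by apply: continuousD; [exact: C1_pderiv_continuous Cf Ax|exact: C1_pderiv_continuous Cg Ax].
Qed.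

Lemma C1_M A f g : open A -> Ck_on A 1 f -> Ck_on A 1 g ->
  Ck_on A 1 (fun x => f x * g x) /\
  forall i x, A x -> pderiv i (fun x => f x * g x) x = f x * pderiv i g x + g x * pderiv i f x.
Proof.
move=> oA Cf Cg.
apply: (@C1_intro A _ (fun i x => f x * pderiv i g x + g x * pderiv i f x)) => // [x Ax|i x Ax|i x Ax].
- by apply: continuousM; [exact: C1_cont Cf Ax|exact: C1_cont Cg Ax].
- by apply: is_deriveM; [exact: C1_der Cf Ax|exact: C1_der Cg Ax].
- have h1 := continuousM (C1_cont Cf Ax) (C1_pderiv_continuous (i := i) Cg Ax).
  have h2 := continuousM (C1_cont Cg Ax) (C1_pderiv_continuous (i := i) Cf Ax).
  exact: (continuousD h1 h2).
Qed.

Lemma C1_comp A f (h dh : R -> R) : open A -> Ck_on A 1 f ->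
  (forall x, A x -> is_derive (f x) 1 h (dh (f x))) -> (forall x, A x -> {for f x, continuous dh}) ->
  Ck_on A 1 (fun x => h (f x)) /\
  forall i x, A x -> pderiv i (fun x => h (f x)) x = dh (f x) * pderiv i f x.
Proof.
move=> oA Cf hd cd.
apply: (@C1_intro A _ (fun i x => dh (f x) * pderiv i f x)) => // [x Ax|i x Ax|i x Ax].
- apply: (@continuous_comp _ _ _ f h); first exact: C1_cont Cf Ax.
  by have [d _] := hd x Ax; apply: differentiable_continuous; apply/derivable1_diffP.
- by apply: is_derive_comp1; [exact: C1_der Cf Ax|exact: hd].
- apply: continuousM; last exact: C1_pderiv_continuous Cf Ax.
  by apply: (@continuous_comp _ _ _ f dh); [exact: C1_cont Cf Ax|exact: cd].
Qed.

Lemma C1_polyf A f : open A -> polyf f -> Ck_on A 1 f.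
Proof.
move=> oA pf; apply: (proj1 (@C1_intro A f (fun i => pderiv i f) oA _ _ _)).
- by move=> x _; exact: polyf_continuous.
- by move=> i x _; exact: polyf_is_derive.
- by move=> i x _; apply: polyf_continuous; exact: polyf_pderiv.
Qed.

Lemma C1_sub A B f : (forall x, A x -> B x) -> Ck_on B 1 f -> Ck_on A 1 f.
Proof.
move=> AB [cf df]; split=> [x /AB|i]; first exact: cf.
have [d1 [d2 _]] := df i; split=> [x /AB|]; first exact: d1.
by split=> // x /AB; exact: d2.
Qed.

Lemma C1_congr A f g : open A -> (forall x, A x -> f x = g x) -> Ck_on A 1 f -> Ck_on A 1 g.
Proof.
move=> oA fg Cf; apply: (proj1 (@C1_intro A g (fun i => pderiv i f) oA _ _ _)).
- by move=> x Ax; apply: (continuous_congr oA fg Ax); exact: C1_cont Cf Ax.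
- move=> i x Ax; apply: (@near_eq_is_derive _ _ _ f); last exact: C1_der Cf Ax.
  by apply: filterS fg _; move: oA; rewrite openE; apply.
- by move=> i x Ax; exact: C1_pderiv_continuous Cf Ax.
Qed.

Lemma is_derive_quad (f : R -> R) (t l c : R) :
  (forall h, `|f (t + h) - f t - l * h| <= c * h ^+ 2) -> is_derive t (1 : R) f l.
Proof.
move=> H.
have c' : (fun h : R => h^-1 *: ((f \o shift t) (h *: (1 : R)) - f t)) @ 0^' --> l.
  apply/cvgrPdist_le => e e0; near=> h.
  have h0 : h != 0 by near: h; exact: nbhs_dnbhs_neq.
  have he : `|h| <= e / (`|c| + 1).
    near: h; apply: dnbhs0_le; rewrite divr_gt0// ltr_wpDl//.
  rewrite /= /GRing.scale /= mulr1 [h + t]addrC.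
  have -> : l - h^-1 * (f (t + h) - f t) = - h^-1 * (f (t + h) - f t - l * h).
    by field.
  rewrite normrM normrN normfV.
  apply: le_trans (_ : `|h|^-1 * (c * h ^+ 2) <= _); first by rewrite ler_wpM2l// invr_ge0.
  rewrite -(real_normK (num_real h)) expr2.
  have n0 : `|h| != 0 by rewrite normr_eq0.
  have simp (a b : R) : a != 0 -> a^-1 * (b * (a * a)) = b * a by move=> a0; field.
  rewrite simp//.
  move: he; rewrite ler_pdivlMr ?ltr_wpDl// => he.
  have := ler_norm c; have := normr_ge0 h; nra.
by split; [apply/cvg_ex; exists l|apply/cvg_lim].
Unshelve. all: by end_near. Qed.

(** A C^1 function vanishing on a half-line. First-order test functions are only C^1, so the bumps
    and truncations below are built from it. *)
Definition sqp (t : R) := Num.max t 0 ^+ 2.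

Lemma is_derive_sqp (t : R) : is_derive t (1 : R) sqp (2 * Num.max t 0).
Proof.
apply: (@is_derive_quad _ _ _ 1) => h; rewrite /sqp mul1r ler_norml.
have := sqr_ge0 h; have := sqr_ge0 t; have := sqr_ge0 (t + h).
by rewrite !maxEle; case: ifPn; case: ifPn; rewrite -?ltNge => *; apply/andP; split; nra.
Qed.

Lemma continuous_pos : continuous (fun t : R => Num.max t 0).
Proof. by move=> t; apply: continuous_max; [exact: cvg_id|exact: cst_continuous]. Qed.

Lemma sqp_ge0 (t : R) : 0 <= sqp t. Proof. exact: sqr_ge0. Qed.

Lemma sqp_eq0 (t : R) : t <= 0 -> sqp t = 0.
Proof. by move=> t0; rewrite /sqp max_r// expr0n. Qed.

Lemma sqp_gt0 (t : R) : 0 < t -> 0 < sqp t.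
Proof. by move=> t0; rewrite /sqp max_l ?exprn_gt0// ltW. Qed.

End C1_functions.

(** * Test functions *)

Section test_functions.
Variables (R : realType) (n : nat).
Local Notation V := 'rV[R]_n.
Variables (Omega : set V).
Hypothesis oO : open Omega.
Implicit Types (f g phi : V -> R) (x : V).

Lemma rV_compact_closed (A : set V) : compact A -> closed A.
Proof. by apply: compact_closed; exact: norm_hausdorff. Qed.

(** Omega and the complement of A are open and cover the space; the extension is f on the first and
    0 on the second. *)
Lemma test_fun_patch f (A : set V) : Ck_on Omega 1 f -> compact A -> A `<=` Omega ->
  (forall x, Omega x -> ~ A x -> f x = 0) -> test_fun Omega 1 (f \_ Omega).
Proof.
move=> Cf cA AO f0.
have oA : open (~` A) by apply: closed_openC; exact: rV_compact_closed.
have E1 x : Omega x -> (f \_ Omega) x = f x by exact: patch_in.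
have E0 x : (~` A) x -> (f \_ Omega) x = 0.
  move=> Ax; have [Ox|Ox] := pselect (Omega x); last by rewrite patch_out.
  by rewrite E1// f0.
split; last by exists A; split=> // x; exact: E0.
have C1 := C1_congr oO (fun x Ox => esym (E1 x Ox)) Cf.
have C2 := C1_congr oA (fun x Ax => esym (E0 x Ax)) (proj1 (C1_cst 0 oA)).
have cov x : Omega x \/ (~` A) x.
  by have [Ax|Ax] := pselect (A x); [left; exact: AO|right].
split=> [x _|i]; first by have [Ox|Ax] := cov x; [exact: C1_cont C1 Ox|exact: C1_cont C2 Ax].
split=> [x _|]; first by have [Ox|Ax] := cov x; [case: (C1_der i C1 Ox)|case: (C1_der i C2 Ax)].
by split=> // x _; have [Ox|Ax] := cov x; [exact: C1_pderiv_continuous C1 Ox|exact: C1_pderiv_continuous C2 Ax].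
Qed.

Lemma compact_bound (A : set V) (f : V -> R) : compact A -> (forall x, {for x, continuous f}) ->
  exists2 B, 0 <= B & forall x, A x -> `|f x| <= B.
Proof.
move=> cA cf; have [[x0 Ax0]|nA] := pselect (A !=set0); last first.
  by exists 0 => // x Ax; exfalso; apply: nA; exists x.
have ch : {within A, continuous (fun x => `|f x|)}.
  by apply: continuous_subspaceT => x; apply: continuous_comp; [exact: cf|exact: norm_continuous].
have [c _ hc] := @compact_EVT_max _ R (fun x => `|f x|) A (ex_intro _ x0 Ax0) cA ch.
by exists `|f c| => // x Ax; apply: hc; rewrite inE.
Qed.

Lemma test_fun_bounded phi : test_fun Omega 1 phi -> exists2 B, 0 <= B &
  forall x, `|phi x| <= B /\ forall i, `|pderiv i phi x| <= B.
Proof.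
move=> [Cp [A [cA AO p0]]].
have oA : open (~` A) by apply: closed_openC; exact: rV_compact_closed.
have d0 i x : ~ A x -> pderiv i phi x = 0.
  move=> Ax; rewrite (@pderiv_congr _ _ (~` A) i phi (fun=> 0) x)//.
  by rewrite pderiv_cst.
have [B B0 hB] := compact_bound cA (fun x => @C1_cont _ _ setT phi x Cp I).
have D i : exists2 B, 0 <= B & forall x, A x -> `|pderiv i phi x| <= B.
  by apply: compact_bound => // x; exact: (@C1_pderiv_continuous _ _ setT phi i x Cp I).
pose b i := s2val (cid2 (D i)).
have [b0 hb] : (forall i, 0 <= b i) /\ forall i x, A x -> `|pderiv i phi x| <= b i.
  by split=> i; rewrite /b; case: cid2.
have bs0 : 0 <= \sum_i b i by exact: sumr_ge0.
exists (B + \sum_i b i) => [|x]; first exact: addr_ge0.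
have [Ax|Ax] := pselect (A x); last first.
  rewrite p0// normr0; split=> [|i]; first exact: addr_ge0.
  by rewrite d0// normr0 addr_ge0.
split=> [|i]; first by rewrite (le_trans (hB x Ax))// lerDl.
rewrite (le_trans (hb i x Ax))// ler_wpDl// (bigD1 i)//= lerDl.
exact: sumr_ge0.
Qed.

Lemma test_fun1_0 phi : test_fun Omega 1 phi -> test_fun Omega 0 phi.
Proof. by move=> [[cp _] hA]; split. Qed.

End test_functions.

Section sobolev_norms.
Variables (R : realType) (n K : nat).
Local Notation V := 'rV[R]_n.
Local Notation leb := (lebesgue_rV R n).
Variables (Omega : set V) (C O : 'I_K -> set V) (N : set V).
Hypothesis hc : cells Omega C O N.
Implicit Types (f g w phi : V -> R) (x y : V) (a : {ffun 'I_n -> nat}).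

Let oD : open Omega. Proof. exact (cells_domain hc). Qed.

Definition bC1 f := Ck_on Omega 1 f /\
  exists B, forall x, Omega x -> `|f x| <= B /\ forall i, `|pderiv i f x| <= B.

Lemma bC1_ucb f : bC1 f -> ucb O f.
Proof.
move=> [Cf [B fB]]; split=> [x /(inner_sub hc) Ox|]; first exact: C1_cont Cf Ox.
by exists B => x /(inner_sub hc) /fB[].
Qed.

Lemma bC1_pucb f i : bC1 f -> ucb O (pderiv i f).
Proof.
move=> [Cf [B fB]]; split=> [x /(inner_sub hc) Ox|]; first exact: C1_pderiv_continuous Cf Ox.
by exists B => x /(inner_sub hc) /fB[_].
Qed.

Lemma bC1D f g : bC1 f -> bC1 g -> bC1 (fun x => f x + g x).
Proof.
move=> [Cf [B fB]] [Cg [B' gB]]; have [Cs ds] := C1_D oD Cf Cg; split=> //.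
exists (B + B') => x Ox; have [? fi] := fB x Ox; have [? gi] := gB x Ox; split=> [|i].
  by rewrite (le_trans (ler_normD _ _))// lerD.
by rewrite ds// (le_trans (ler_normD _ _))// lerD.
Qed.

Lemma bC1M f g : bC1 f -> bC1 g -> bC1 (fun x => f x * g x).
Proof.
move=> [Cf [B fB]] [Cg [B' gB]]; have [Cs ds] := C1_M oD Cf Cg; split=> //.
have M (a b c d : R) : `|a| <= c -> `|b| <= d -> `|a * b| <= c * d.
  by move=> ac bd; rewrite normrM ler_pM.
exists (B * B' + B' * B) => x Ox; have [fb fi] := fB x Ox; have [gb gi] := gB x Ox; split=> [|i].
  rewrite ler_wpDr ?M//; exact: mulr_ge0 (le_trans (normr_ge0 _) gb) (le_trans (normr_ge0 _) fb).
by rewrite ds// (le_trans (ler_normD _ _))// lerD// M.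
Qed.

Lemma bC1_cst c : bC1 (fun=> c).
Proof.
have [Cc dc] := C1_cst c oD; split=> //; exists `|c| => x Ox; split=> // i.
by rewrite dc// normr0.
Qed.

Lemma bC1Z c f : bC1 f -> bC1 (fun x => c * f x).
Proof. by move=> bf; apply: bC1M => //; exact: bC1_cst. Qed.

Lemma bC1B f g : bC1 f -> bC1 g -> bC1 (fun x => f x - g x).
Proof.
move=> bf bg; have := bC1D bf (bC1Z (-1) bg).
by under eq_fun do rewrite mulN1r.
Qed.

Lemma bC1_pderivB f g i x : bC1 f -> bC1 g -> Omega x ->
  pderiv i (fun x => f x - g x) x = pderiv i f x - pderiv i g x.
Proof.
move=> [Cf _] [Cg _] Ox.
have -> : (fun x => f x - g x) = (fun x => f x + (-1) * g x).
  by apply/funext => y; rewrite mulN1r.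
have [C1 d1] := C1_cst (-1 : R) oD; have [C2 d2] := C1_M oD C1 Cg.
have [_ ->//] := C1_D oD Cf C2.
by rewrite d2// d1// mulr0 addr0 mulN1r.
Qed.

Lemma polyf_bC1 f : polyf f -> bC1 f.
Proof.
move=> pf; split; first exact: C1_polyf.
have [M M0 OM] := domain_bounded hc.
have [B fB] := polyf_bounded M pf.
pose b i := sval (cid (polyf_bounded M (polyf_pderiv i pf))).
have hb i x : `|x| <= M -> `|pderiv i f x| <= b i by rewrite /b; case: cid => ? h /h.
have bs0 (P : pred 'I_n) : 0 <= \sum_(i | P i) `|b i| by apply: sumr_ge0.
exists (`|B| + \sum_i `|b i|) => x Ox; split=> [|i].
  by rewrite (le_trans (fB x (OM x Ox)))// (le_trans (ler_norm _))// lerDl.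
rewrite (le_trans (hb i x (OM x Ox)))// ler_wpDl// (bigD1 i)//=.
by rewrite (le_trans (ler_norm _))// lerDl.
Qed.

Lemma bC1_test phi : test_fun Omega 1 phi -> bC1 phi.
Proof.
move=> tp; have [B B0 pB] := test_fun_bounded tp; split; last by exists B => x _; exact: pB.
by case: tp => Cp _; apply: C1_sub Cp.
Qed.

Lemma bC1_congr f g : (forall x, Omega x -> f x = g x) -> bC1 f -> bC1 g.
Proof.
move=> fg [Cf [B fB]]; split; first exact: C1_congr fg Cf.
exists B => x Ox; have [? fi] := fB x Ox; split=> [|i]; first by rewrite -fg.
by rewrite -(pderiv_congr i oD fg Ox).
Qed.

Lemma bC1_comp f (h dh : R -> R) b : bC1 f ->
  (forall x, Omega x -> is_derive (f x) (1 : R) h (dh (f x))) ->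
  (forall x, Omega x -> {for f x, continuous dh}) ->
  (forall x, Omega x -> `|h (f x)| <= b /\ `|dh (f x)| <= b) ->
  bC1 (fun x => h (f x)) /\
  forall i x, Omega x -> pderiv i (fun x => h (f x)) x = dh (f x) * pderiv i f x.
Proof.
move=> [Cf [B fB]] hd cd hb; have [Ch dE] := C1_comp oD Cf hd cd; split=> //; split=> //.
exists (b + b * B) => x Ox; have [hx dx] := hb x Ox; have [fx fi] := fB x Ox.
have b0 : 0 <= b := le_trans (normr_ge0 _) hx.
have B0 : 0 <= B := le_trans (normr_ge0 _) fx.
split=> [|i]; first by rewrite ler_wpDr// mulr_ge0.
by rewrite dE// normrM ler_wpDl// ler_pM.
Qed.

(** The product f phi, extended by zero, is C^1 on the whole space with bounded derivatives, hence
    Lipschitz along the axis, and [itg_derive0] applies. *)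
Lemma bC1_ibp f phi i : bC1 f -> test_fun Omega 1 phi ->
  itg O (fun x => f x * pderiv i phi x) = - itg O (fun x => pderiv i f x * phi x).
Proof.
move=> bf tp; have bp := bC1_test tp.
have [Cfp dfp] := C1_M oD bf.1 bp.1.
have [_ [A [cA AO p0]]] := tp.
have tw : test_fun Omega 1 ((fun x => f x * phi x) \_ Omega).
  by apply: test_fun_patch cA AO _ => // x _ /p0 ->; rewrite mulr0.
set w := _ \_ _ in tw; have [B B0 wB] := test_fun_bounded tw.
have [Cw _] := tw.
have : itg O (fun x => f x * pderiv i phi x + pderiv i f x * phi x) = 0.
  apply: (@itg_derive0 _ _ _ _ _ _ _ hc w _ (delta_mx ord0 i) B B).
  - by move=> x Ox; exact: patch_out.
  - apply: rV_continuous_measurable; first exact: openT.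
    by move=> x _; exact: (C1_cont Cw).
  - by move=> x; have [] := wB x.
  - move=> x s /andP[s0 _]; apply: line_mvt; first exact: ltW.
      by move=> t _; have [] := C1_der i Cw (I : setT (x + t *: delta_mx ord0 i)).
    by move=> t _; have [_] := wB (x + t *: delta_mx ord0 i); apply.
  - move=> x Ux; have Ox := inner_sub hc Ux.
    rewrite [pderiv i f x * _]mulrC -dfp//.
    apply: (@near_eq_is_derive _ _ _ (fun x => f x * phi x)); last exact: C1_der Cfp Ox.
    apply: (near_inner hc Ux) => y Oy; by rewrite /w patch_in.
rewrite (itgD hc); last 2 first.
- by apply: ucbM; [exact: bC1_ucb|exact: bC1_pucb].
- by apply: ucbM; [exact: bC1_pucb|exact: bC1_ucb].
by move/eqP; rewrite addr_eq0 => /eqP.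
Qed.

Lemma dpart_msize0 a : msize a = 0%N -> forall phi, dpart a phi = phi.
Proof.
move=> a0 phi; have ai i : a i = 0%N.
  by move/eqP: a0; rewrite /msize sum_nat_eq0 => /forallP/(_ i)/implyP/(_ isT)/eqP.
by rewrite /dpart; elim: (enum 'I_n) => //= j s ->; rewrite ai.
Qed.

Lemma dpart_msize1 a : msize a = 1%N -> exists i, forall phi, dpart a phi = pderiv i phi.
Proof.
move=> a1.
have [i ai] : exists i, a i != 0%N.
  apply/existsP; apply: contraPT a1; rewrite negb_exists => /forallP a0.
  by rewrite /msize big1// => i _; apply/eqP; have := a0 i; rewrite negbK.
move: a1; rewrite /msize (bigD1 i)//= => a1.
have ai1 : a i = 1%N by case: (a i) ai a1 => // -[|k]//; rewrite !addSn.
move/eqP: a1; rewrite ai1 add1n eqSS sum_nat_eq0 => /forallP a0.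
exists i => phi; rewrite /dpart.
have H s : uniq s -> foldr (fun i w => iter (a i) (pderiv i) w) phi s =
    if i \in s then pderiv i phi else phi.
  elim: s => //= j s IH /andP[js us]; rewrite inE IH//.
  move: js; case: (eqVneq i j) => [<-|ij] js; first by rewrite ai1 /= (negbTE js).
  have := a0 j; rewrite eq_sym ij /= => /eqP ->/=; by [].
by rewrite H ?enum_uniq// mem_enum.
Qed.

Lemma multis_mem a k : (msize a <= k)%N -> a \in multis n k.
Proof.
move=> ak; rewrite mem_filter ak /=.
have ai i : (a i < k.+1)%N.
  by rewrite ltnS (leq_trans _ ak)// /msize (bigD1 i)//= leq_addr.
apply/mapP; exists [ffun i => Ordinal (ai i)]; first by rewrite mem_enum.
by apply/ffunP => i; rewrite !ffunE.
Qed.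

Lemma multis0 : exists2 a, a \in multis n 1 & msize a = 0%N.
Proof.
have a0 : msize [ffun _ : 'I_n => 0%N] = 0%N by rewrite /msize big1// => i _; rewrite ffunE.
by exists [ffun _ => 0%N] => //; apply: multis_mem; rewrite a0.
Qed.

Lemma multis1 i : exists a, [/\ a \in multis n 1, msize a = 1%N &
  forall phi, dpart a phi = pderiv i phi].
Proof.
pose a : {ffun 'I_n -> nat} := [ffun j => (j == i) : nat].
have a1 : msize a = 1%N.
  rewrite /msize (bigD1 i)//= ffunE eqxx big1 ?addn0// => j /negbTE ji.
  by rewrite ffunE ji.
exists a; split=> //; first by apply: multis_mem; rewrite a1.
move=> phi; rewrite /dpart.
have H s : uniq s -> foldr (fun i w => iter (a i) (pderiv i) w) phi s =
    if i \in s then pderiv i phi else phi.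
  elim: s => //= j s IH /andP[js us]; rewrite inE IH// /a ffunE.
  by move: js; case: (eqVneq i j) => [<-|ij] js; rewrite ?eqxx /= ?(negbTE js)// eq_sym (negbTE ij).

by rewrite H ?enum_uniq// mem_enum.
Qed.

Lemma ucb_loc_integrable f : (forall x, Omega x -> {for x, continuous f}) ->
  (exists B, forall x, Omega x -> `|f x| <= B) -> loc_integrable Omega f.
Proof.
move=> cf [B fB]; split; first exact: rV_continuous_measurable.
move=> A cA AO; have mA : measurable A by apply: rV_closed_measurable; exact: rV_compact_closed.
have mO := domain_measurable hc.
apply: measurable_bounded_integrable => //.
- by apply: le_lt_trans (domain_finite hc); apply: le_measure; rewrite ?inE.
- by apply: measurable_funS AO _ => //; exact: rV_continuous_measurable.
- exists B; split; [exact: num_real|move=> t Bt x /AO Ox /=].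
  by rewrite (le_trans (fB x Ox))// ltW.
Qed.

Lemma bC1_loc_integrable f : bC1 f -> loc_integrable Omega f.
Proof.
move=> [Cf [B fB]]; apply: ucb_loc_integrable => [x|]; first exact: C1_cont.
by exists B => x /fB[].
Qed.

Lemma bC1_pderiv_loc_integrable f i : bC1 f -> loc_integrable Omega (pderiv i f).
Proof.
move=> [Cf [B fB]]; apply: ucb_loc_integrable => [x|]; first exact: C1_pderiv_continuous.
by exists B => x /fB[_].
Qed.

Lemma bC1_weak0 f a : bC1 f -> msize a = 0%N -> weak_partial Omega a f f.
Proof.
move=> bf a0; split; [exact: bC1_loc_integrable|exact: bC1_loc_integrable|].
by move=> phi _; rewrite dpart_msize0// a0 expr0 mul1r.
Qed.

Lemma bC1_weak1 f a i : bC1 f -> msize a = 1%N -> (forall phi, dpart a phi = pderiv i phi) ->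
  weak_partial Omega a f (pderiv i f).
Proof.
move=> bf a1 ai; split; [exact: bC1_loc_integrable|exact: bC1_pderiv_loc_integrable|].
by move=> phi; rewrite a1 expr1 mulN1r ai => tp; rewrite !(itg_domain hc) bC1_ibp.
Qed.

Lemma Lpnorm_itg f : ucb O f -> (forall x, Omega x -> {for x, continuous f}) ->
  (exists B, forall x, Omega x -> `|f x| <= B) ->
  Lpnorm Omega 2%:E f = (Num.sqrt (itg O (fun x => f x ^+ 2)))%:E.
Proof.
move=> uf cf [B fB].
have uf2 : ucb O (fun x => f x ^+ 2) by under eq_fun do rewrite expr2; exact: ucbM.
have I0 : 0 <= itg O (fun x => f x ^+ 2) by apply: itg_ge0 => x _; exact: sqr_ge0.
rewrite /Lpnorm unlock.
have -> : (\int[leb]_x (`|(EFin \o f \_ Omega) x| `^ 2) =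
          \int[leb]_(x in Omega) (f x ^+ 2)%:E)%E.
  rewrite [RHS]integral_mkcond; apply: eq_integral => x _ /=.
  rewrite powR_mulrn// real_normK ?num_real// !patchE.
  by case: ifPn => // _; rewrite expr0n.
have fi : (\int[leb]_(x in Omega) (f x ^+ 2)%:E)%E \is a fin_num.
  apply: integrable_fin_num; first exact: domain_measurable hc.
  apply: measurable_bounded_integrable.
  - exact: domain_measurable hc.
  - exact: domain_finite hc.
  - rewrite (_ : (fun x => _) = (fun x => f x * f x)); last by apply/funext => x; rewrite expr2.
    by apply: rV_continuous_measurable => // x Ox; exact: (continuousM (cf x Ox) (cf x Ox)).
  - exists (B ^+ 2); split; [exact: num_real|move=> t Bt x Ox /=].
    rewrite (le_trans _ (ltW Bt))// normrX; apply: lerXn2r; rewrite ?nnegrE//.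
      exact: le_trans (normr_ge0 _) (fB x Ox).
    exact: fB.
rewrite -[X in (X `^ _)%E]fineK// poweR_EFin; congr EFin.
by rewrite -(powR12_sqrt I0) -(itg_domain hc).
Qed.

(** Meant for a weak derivative w, of which only measurability and a bound on the norm are known;
    the bound also yields the integrability of w g. *)
Lemma cauchy_schwarz_Omega w g (e : R) : measurable_fun Omega w ->
  (Lpnorm Omega 2%:E w <= e%:E)%E ->
  (forall x, Omega x -> {for x, continuous g}) ->
  (exists B, forall x, Omega x -> `|g x| <= B) ->
  `|\int[leb]_(x in Omega) (w x * g x)| <= e * Num.sqrt (itg O (fun x => g x ^+ 2)).
Proof.
move=> mw we cg gB; have mO := domain_measurable hc.
have ug : ucb O g.
  split=> [x /(inner_sub hc)|]; first exact: cg.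
  by have [B gb] := gB; exists B => x /(inner_sub hc); exact: gb.
have mg : measurable_fun Omega g by exact: rV_continuous_measurable.
have half : ((2 : R)^-1 + 2^-1 = 1)%R by rewrite -[in RHS](mulVf (x := (2 : R)))// mulr2n; ring.
have := hoelder leb ((measurable_restrictT w mO).1 mw) ((measurable_restrictT g mO).1 mg)
  (ltr0n R 2) (ltr0n R 2) half.
rewrite Lnorm1 => H.
have {}H : (\int[leb]_(x in Omega) `|(w x * g x)%:E| <=
    (e * Num.sqrt (itg O (fun x => g x ^+ 2)))%:E)%E.
  rewrite EFinM -(Lpnorm_itg ug cg gB); apply: (@le_trans _ _ _ _ _ (_ : (_ <= Lpnorm Omega 2%:E w * _)%E)).
    apply: le_trans H; rewrite le_eqVlt; apply/orP; left; apply/eqP.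
    rewrite [LHS]integral_mkcond; apply: eq_integral => x _ /=.
    by rewrite !patchE; case: ifPn => // _; rewrite mulr0 normr0.
  by apply: lee_wpmul2r => //; exact: Lnorm_ge0.
have iw : leb.-integrable Omega (EFin \o (fun x => w x * g x)).
  apply/integrableP; split; first by apply/measurable_EFinP; exact: measurable_funM.
  by apply: le_lt_trans H _; exact: ltry.
apply: le_trans (le_normr_Rintegral mO iw) _.
have fi : (\int[leb]_(x in Omega) `|(w x * g x)%:E|)%E \is a fin_num.
  rewrite ge0_fin_numE; last exact: integral_ge0.
  by apply: le_lt_trans H _; exact: ltry.
by rewrite /Rintegral -lee_fin fineK.
Qed.

End sobolev_norms.

Section sequence_norm.
Variable R : realType.
Implicit Types (s : seq (\bar R)) (x : \bar R).
Local Open Scope ereal_scope.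

Lemma lp_sum2_le s (b : R) : (0 <= b)%R -> (forall x, x \in s -> 0 <= x <= b%:E) ->
  lp_sum 2%:E s <= (Num.sqrt (size s)%:R * b)%:E.
Proof.
move=> b0 sb.
have H : 0 <= \sum_(x <- s) x `^ 2 <= ((size s)%:R * b ^+ 2)%:E.
  elim: s sb => [|x s IH] sb; first by rewrite big_nil /= mul0r lexx.
  rewrite big_cons /=; have /andP[x0 xb] := sb x (mem_head x s).
  have /andP[s0 sl] := IH (fun y ys => sb y (mem_behead (s := x :: s) ys)).
  apply/andP; split; first by rewrite adde_ge0// poweR_ge0.
  rewrite (_ : (size s).+1%:R * b ^+ 2 = b ^+ 2 + (size s)%:R * b ^+ 2)%R; last by rewrite -natr1; ring.
  rewrite EFinD leeD//.
  case: x x0 xb {sb} => [x| |]//; rewrite !lee_fin => x0 xb.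
  by rewrite /= powR_mulrn// lerXn2r// nnegrE.
have /andP[H0 H1] := H.
rewrite /lp_sum.
apply: (@le_trans _ _ (((size s)%:R * b ^+ 2)%:E `^ 2^-1)).
  by apply: gt0_ler_poweR; rewrite ?invr_ge0// in_itv/= ?H0 ?leey// (le_trans H0 H1).
rewrite poweR_EFin powR12_sqrt ?mulr_ge0 ?sqr_ge0//.
by rewrite sqrtrM// sqrtr_sqr ger0_norm.
Qed.

Lemma lp_sum2_ge s x : x \in s -> (forall y, y \in s -> 0 <= y) -> x <= lp_sum 2%:E s.
Proof.
move=> xs s0; have x0 := s0 x xs.
have H : x `^ 2 <= \sum_(y <- s) y `^ 2.
  rewrite (big_rem x)//= leeDl// big_seq; apply: sume_ge0 => y _; exact: poweR_ge0.
rewrite /lp_sum.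
have -> : x = (x `^ 2) `^ 2^-1 by rewrite -poweRrM mulfV// poweRe1.
by apply: gt0_ler_poweR; rewrite ?invr_ge0// in_itv/= ?poweR_ge0 ?leey// (le_trans (poweR_ge0 _ _) H).
Qed.

Lemma lp_sum2_ge0 s : 0 <= lp_sum 2%:E s.
Proof. exact: poweR_ge0. Qed.

End sequence_norm.

(** * Cutoff functions *)

Section cutoffs.
Variables (R : realType) (n : nat).
Local Notation V := 'rV[R]_n.
Implicit Types (f g : V -> R) (x y c : V).

Lemma C1_bigsum (A : set V) I (r : seq I) (F : I -> V -> R) : open A ->
  (forall i, Ck_on A 1 (F i)) -> Ck_on A 1 (fun x => \sum_(i <- r) F i x).
Proof.
move=> oA CF; elim: r => [|i r IH].
  by under eq_fun do rewrite big_nil; have [] := C1_cst (0 : R) oA.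
by under eq_fun do rewrite big_cons; have [] := C1_D oA (CF i) IH.
Qed.

Lemma C1_bigprod (A : set V) I (r : seq I) (F : I -> V -> R) : open A ->
  (forall i, Ck_on A 1 (F i)) -> Ck_on A 1 (fun x => \prod_(i <- r) F i x).
Proof.
move=> oA CF; elim: r => [|i r IH].
  by under eq_fun do rewrite big_nil; have [] := C1_cst (1 : R) oA.
by under eq_fun do rewrite big_cons; have [] := C1_M oA (CF i) IH.
Qed.

Lemma C1_sqp (A : set V) f : open A -> Ck_on A 1 f -> Ck_on A 1 (fun x => sqp (f x)).
Proof.
move=> oA Cf.
have [] // := @C1_comp _ _ A f (@sqp R) (fun t => 2 * Num.max t 0) oA Cf.
  by move=> x _; exact: is_derive_sqp.
move=> x _; apply: continuousM; [exact: cst_continuous|exact: continuous_pos].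
Qed.

(** A product over the coordinates, because the balls of the sup norm are cubes. *)
Definition bump c (e : R) x := \prod_i sqp (e ^+ 2 - (x ord0 i - c ord0 i) ^+ 2).

Lemma bump_C1 c e : Ck_on setT 1 (bump c e).
Proof.
have oT : open [set: V] by exact: openT.
apply: C1_bigprod => // i; apply: C1_sqp => //; apply: C1_polyf => //.
apply: polyf_sub; first exact: polyf_cst.
by apply: polyf_exp; apply: polyf_sub; [exact: polyf_coord|exact: polyf_cst].
Qed.

Lemma bump_ge0 c e x : 0 <= bump c e x.
Proof. by apply: prodr_ge0 => i _; exact: sqp_ge0. Qed.

Lemma bump_gt0 c e x : `|x - c| < e -> 0 < bump c e x.
Proof.
move=> xc; have e0 : 0 < e := le_lt_trans (normr_ge0 _) xc.
apply: prodr_gt0 => i _; apply: sqp_gt0.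
have h : `|x ord0 i - c ord0 i| < e.
  by apply: le_lt_trans xc; have := rV_coord_le (x - c) i; rewrite !mxE.
move: h; rewrite ltr_norml => /andP[h1 h2]; nra.
Qed.

Lemma bump_eq0 c e x : 0 < e -> e < `|x - c| -> bump c e x = 0.
Proof.
move=> e0 xc; have [i hi] : exists i, e < `|(x - c) ord0 i|.
  apply: contrapT => H; move: xc; apply/negP; rewrite -leNgt; apply/rV_norm_leP => [|i].
    exact: ltW.
  by rewrite leNgt; apply/negP => h; apply: H; exists i.
rewrite /bump (bigD1 i)//= sqp_eq0 ?mul0r//.
move: hi; rewrite !mxE -(@real_normK _ (x ord0 i - _)) ?num_real// => hi.
have := normr_ge0 (x ord0 i - c ord0 i); nra.
Qed.

(** [M m] is the sum of the bumps of the first m cubes of a cover of Omega, so it vanishes off a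
    compact subset of Omega. The truncation [1 - sqp (1 - m%:R * M m x)] is 0 where [M m] is and 1
    where m [M m] >= 1, which at a given point of Omega holds for all large m. *)
Lemma cutoff_sequence (Omega : set V) : open Omega -> exists zeta : nat -> V -> R,
  [/\ forall m, test_fun Omega 1 (zeta m), forall m x, 0 <= zeta m x <= 1 &
      forall x, Omega x -> exists M, forall m, (M <= m)%N -> zeta m x = 1].
Proof.
move=> oO; have oT : open [set: V] by exact: openT.
have [c [e [ce cov]]] := open_cube_cover oO.
pose b k : V -> R := if 0 < e k then bump (c k) (e k) else fun=> 0.
have b0 k x : 0 <= b k x by rewrite /b; case: ifP => // _; exact: bump_ge0.
have bC k : Ck_on setT 1 (b k).
  rewrite /b; case: ifP => _; first exact: bump_C1.
  by have [] := C1_cst (0 : R) oT.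
have bK m : exists A : set V, [/\ compact A, A `<=` Omega &
    forall x k, ~ A x -> (k < m)%N -> b k x = 0].
  elim: m => [|m [A [cA AO A0]]]; first by exists set0; split=> //; exact: compact0.
  have [em|em] := ltP 0 (e m); last first.
    exists A; split=> // x k Ax; rewrite ltnS leq_eqVlt => /predU1P[->|]; last exact: A0.
    by rewrite /b ltNge em.
  exists (A `|` [set x | `|x - c m| <= e m]); split.
  - apply: compactU => //; apply: bounded_closed_compact.
      exists (`|c m| + e m); split; first exact: num_real.
      move=> t ht x /= xe; have := ler_normD (x - c m) (c m); rewrite subrK; lra.
    rewrite (_ : [set x | _] = (fun x : V => `|x - c m|) @^-1` [set t | t <= e m])//.
    have lc : continuous (fun x : V => `|x - c m|).
      apply: (@lipschitz_continuous _ _ _ 1) => x y.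
      by rewrite mul1r (le_trans (ler_dist_dist _ _))// opprB addrA subrK.
    by apply: (preimage_closed _ (@closed_le _ _)) => x _; exact: lc.
  - by move=> x [/AO//|xe]; have [h|] := ce m; [rewrite leNgt em in h|apply].
  - move=> x k /not_orP[Ax xe]; rewrite ltnS leq_eqVlt => /predU1P[->|]; last exact: A0.
    by rewrite /b em bump_eq0// ltNge; apply/negP.
pose M m x := \sum_(k < m) b k x.
have M0 m x : 0 <= M m x by exact: sumr_ge0.
have s1 (t : R) : t <= 1 -> 0 <= sqp t <= 1.
  by move=> t1; rewrite sqp_ge0 exprn_ile1 ?le_max ?lexx ?orbT// ge_max t1 ler01.
exists (fun m x => 1 - sqp (1 - m%:R * M m x)); split.
- move=> m; split.
    have C1 : Ck_on setT 1 (fun x => 1 + (- m%:R) * M m x).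
      have [C1 _] := C1_cst (1 : R) oT; have [C2 _] := C1_cst (- m%:R : R) oT.
      have C3 : Ck_on setT 1 (M m) by apply: C1_bigsum => // i; exact: bC.
      by have [C4 _] := C1_M oT C2 C3; have [] := C1_D oT C1 C4.
    have C2 := C1_sqp oT C1; have [C3 _] := C1_cst (1 : R) oT; have [C4 _] := C1_cst (- 1 : R) oT.
    have [C5 _] := C1_M oT C4 C2; have [C6 _] := C1_D oT C3 C5.
    by apply: C1_congr C6 => // x _; rewrite mulN1r mulNr.
  have [A [cA AO A0]] := bK m; exists A; split=> // x Ax.
  rewrite /M big1 => [|i _]; last by rewrite (A0 x i Ax).
  by rewrite mulr0 subr0 /sqp max_l// expr1n subrr.
- move=> m x; have /s1/andP[] : 1 - m%:R * M m x <= 1 by rewrite gerBl mulr_ge0.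
  lra.
- move=> x /cov[k [ek xk]].
  have bk : 0 < b k x by rewrite /b ek bump_gt0.
  pose m0 := Num.bound (b k x)^-1.
  exists (maxn k.+1 m0) => m; rewrite geq_max => /andP[km m0m].
  rewrite sqp_eq0 ?subr0// subr_le0.
  have Mk : b k x <= M m x by rewrite /M (bigD1 (Ordinal km))//= lerDl; exact: sumr_ge0.
  apply: le_trans (_ : m%:R * b k x <= _); last by rewrite ler_wpM2l.
  rewrite -ler_pdivrMr// mul1r; apply: le_trans (_ : m0%:R <= _); last by rewrite ler_nat.
  by apply/ltW/archi_boundP; rewrite invr_ge0.
Qed.

End cutoffs.

Section sobolev_bounds.
Variables (R : realType) (n K : nat).
Local Notation V := 'rV[R]_n.
Local Notation leb := (lebesgue_rV R n).
Variables (Omega : set V) (C O : 'I_K -> set V) (N : set V).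
Hypothesis hc : cells Omega C O N.
Implicit Types (f g v w G phi : V -> R) (x y : V) (a : {ffun 'I_n -> nat}).

Let oD : open Omega. Proof. exact (cells_domain hc). Qed.

Lemma itg_cvg (F : nat -> V -> R) W (B : R) : (forall k, ucb O (F k)) -> ucb O W ->
  (forall k x, inner O x -> `|F k x| <= B) ->
  (forall x, inner O x -> (fun k => F k x) @ \oo --> W x) ->
  (fun k => itg O (F k)) @ \oo --> itg O W.
Proof.
move=> uF uW FB FW; have mI := inner_measurable hc.
have iB : leb.-integrable (inner O) (EFin \o (fun=> B)).
  by apply: (ucb_integrable hc); exact: ucb_cst.
have mF k : measurable_fun (inner O) (EFin \o F k) by case/integrableP: (ucb_integrable hc (uF k)).
have mW : measurable_fun (inner O) (EFin \o W) by case/integrableP: (ucb_integrable hc uW).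
have cF x : inner O x -> (fun k => (EFin \o F k) x) @ \oo --> (EFin \o W) x.
  by move=> Ux; apply: cvg_EFin; [exact: nearW|exact: FW].
have bF x k : inner O x -> (`|(EFin \o F k) x| <= (EFin \o (fun=> B)) x)%E.
  by move=> Ux; rewrite lee_fin FB.
have [_ _ H] := @dominated_convergence _ _ _ leb _ mI (fun k => EFin \o F k) (EFin \o W) _ mF mW
  (aeW _ (fun x => cF x)) iB (aeW _ (fun x k => bF x k)).
apply: fine_cvg; apply: cvg_trans H _.
rewrite fineK; last exact: (integrable_fin_num mI (ucb_integrable hc uW)).
exact: cvg_refl.
Qed.

(* The weak derivative w is only tested against compactly supported functions;
   cutoffs extend the bound to all G. *)
Lemma weak_dual_bound w v G (e : R) : loc_integrable Omega w ->
  (forall x, Omega x -> {for x, continuous v}) -> (exists B, forall x, Omega x -> `|v x| <= B) ->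
  (forall phi, test_fun Omega 1 phi ->
     \int[leb]_(x in Omega) (w x * phi x) = itg O (fun x => v x * phi x)) ->
  (Lpnorm Omega 2%:E w <= e%:E)%E -> bC1 Omega G ->
  `|itg O (fun x => v x * G x)| <= e * Num.sqrt (itg O (fun x => G x ^+ 2)).
Proof.
move=> [mw _] cv [B vB] wv we bG.
have e0 : 0 <= e by rewrite -lee_fin; apply: le_trans we; exact: Lnorm_ge0.
have uv : ucb O v.
  split=> [x /(inner_sub hc)|]; first exact: cv.
  by exists B => x /(inner_sub hc); exact: vB.
have uG := bC1_ucb hc bG; have [B' GB] := uG.2.
have [zeta [tz z01 z1]] := cutoff_sequence oD.
have bzG m : bC1 Omega (fun x => zeta m x * G x) by apply: (bC1M hc) => //; exact: (bC1_test (tz m)).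
have tG m : test_fun Omega 1 ((fun x => zeta m x * G x) \_ Omega).
  have [_ [A [cA AO A0]]] := tz m; apply: (test_fun_patch oD _ cA AO); first by have [] := bzG m.
  by move=> x _ /A0 ->; rewrite mul0r.
have sq f : (fun x => f x ^+ 2) = (fun x => f x * f x) by apply/funext => x; rewrite expr2.
have bound m : `|itg O (fun x => v x * (zeta m x * G x))| <= e * Num.sqrt (itg O (fun x => G x ^+ 2)).
  have -> : itg O (fun x => v x * (zeta m x * G x)) = \int[leb]_(x in Omega) (w x * (zeta m x * G x)).
    transitivity (itg O (fun x => v x * ((fun x => zeta m x * G x) \_ Omega) x)).
      by apply: eq_itg => x /(inner_sub hc) Ox; rewrite patch_in.
    by rewrite -wv//; apply: eq_Rintegral => x /set_mem Ox; rewrite patch_in.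
  have [Czg [Bz zB]] := bzG m.
  apply: le_trans (cauchy_schwarz_Omega hc mw we _ _) _.
  - by move=> x Ox; exact: C1_cont Czg Ox.
  - by exists Bz => x /zB[].
  rewrite ler_wpM2l// ler_sqrt; last by apply: itg_ge0 => x _; exact: sqr_ge0.
  apply: (itg_le hc).
  - by rewrite sq; apply: ucbM; exact: (bC1_ucb hc).
  - by rewrite sq; apply: ucbM.
  - move=> x _; rewrite exprMn ler_piMl ?sqr_ge0//.
    by have /andP[] := z01 m x; exact: exprn_ile1.
have lim : (fun m => itg O (fun x => v x * (zeta m x * G x))) @ \oo --> itg O (fun x => v x * G x).
  apply: (@itg_cvg _ _ (B * B')).
  - by move=> m; apply: ucbM => //; exact: (bC1_ucb hc).
  - exact: ucbM.
  - move=> m x Ux; rewrite !normrM ler_pM ?mulr_ge0//; first by apply: vB; exact: (inner_sub hc).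
    apply: le_trans (GB x Ux); rewrite ler_piMl//.
    by have /andP[z0 ?] := z01 m x; rewrite ger0_norm.
  - move=> x Ux; have [M zM] := z1 x (inner_sub hc Ux).
    apply: cvg_near_cst; exists M => // m /= Mm.
    by rewrite zM// mul1r.
have lim' : (fun m => `|itg O (fun x => v x * (zeta m x * G x))|) @ \oo -->
    `|itg O (fun x => v x * G x)| by exact: cvg_norm.
rewrite -(cvg_lim _ lim')//; apply: limr_le; first by apply/cvg_ex; eexists; exact: lim'.
by apply: nearW => m; exact: bound.
Qed.

Lemma dnorm_ge0 p a f : (0 <= dnorm Omega p a f)%E.
Proof. by apply: le_ereal_inf_tmp => _ [w _ <-]; exact: Lnorm_ge0. Qed.

Lemma H1_dnorm_le a f : a \in multis n 1 -> (dnorm Omega 2%:E a f <= H1_norm Omega f)%E.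
Proof.
move=> am; apply: lp_sum2_ge; first by apply/mapP; exists a.
by move=> y /mapP[b _ ->]; exact: dnorm_ge0.
Qed.

Lemma H1_norm_ge0 f : (0 <= H1_norm Omega f)%E.
Proof. exact: lp_sum2_ge0. Qed.

(** The norm is built from infima, so the strict bound provides some weak derivative w with norm at
    most e. The definition of w pairs it with test functions as the classical derivative, and
    [weak_dual_bound] applies; uniqueness of weak derivatives is bypassed. *)
Lemma H1_dual0 f G (e : R) : bC1 Omega f -> bC1 Omega G -> (H1_norm Omega f < e%:E)%E ->
  `|itg O (fun x => f x * G x)| <= e * Num.sqrt (itg O (fun x => G x ^+ 2)).
Proof.
move=> bf bG fe; have [a am a0] := multis0 n.
have /ereal_inf_lt[_ [w [_ lw ww] <-] /ltW we] := le_lt_trans (H1_dnorm_le f am) fe.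
have [Cf [B fB]] := bf.
apply: (weak_dual_bound lw _ _ _ we bG) => [x|//|phi tp]; first exact: C1_cont.
  by exists B => x /fB[].
have := ww phi; rewrite a0 expr0 mul1r dpart_msize0// => <-; last exact: test_fun1_0.
by rewrite (itg_domain hc).
Qed.

Lemma H1_dual1 f G i (e : R) : bC1 Omega f -> bC1 Omega G -> (H1_norm Omega f < e%:E)%E ->
  `|itg O (fun x => pderiv i f x * G x)| <= e * Num.sqrt (itg O (fun x => G x ^+ 2)).
Proof.
move=> bf bG fe; have [a [am a1 ai]] := multis1 R i.
have /ereal_inf_lt[_ [w [_ lw ww] <-] /ltW we] := le_lt_trans (H1_dnorm_le f am) fe.
have [Cf [B fB]] := bf.
apply: (weak_dual_bound lw _ _ _ we bG) => [x|//|phi tp]; first exact: C1_pderiv_continuous.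
  by exists B => x /fB[_].
have := ww phi; rewrite a1 expr1 mulN1r ai => /(_ tp); rewrite (itg_domain hc) (bC1_ibp hc)//.
by move/oppr_inj => <-.
Qed.

(** Testing f against itself gives I <= e sqrt I for every e above the norm. Were the norm below
    sqrt I, the midpoint of the two would be such an e, with e < sqrt I. *)
Lemma H1_norm_lower f : bC1 Omega f ->
  ((Num.sqrt (itg O (fun x => f x ^+ 2)))%:E <= H1_norm Omega f)%E.
Proof.
move=> bf; rewrite leNgt; apply/negP => lt1.
set I := itg O _ in lt1 *.
have I0 : 0 <= I by apply: itg_ge0 => x _; exact: sqr_ge0.
have Hfin : H1_norm Omega f \is a fin_num.
  by rewrite ge0_fin_numE ?H1_norm_ge0//; apply: lt_trans lt1 _; exact: ltry.
move: lt1; rewrite -(fineK Hfin) lte_fin => lt1.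
pose e := (fine (H1_norm Omega f) + Num.sqrt I) / 2.
have fe : (H1_norm Omega f < e%:E)%E by rewrite -(fineK Hfin) lte_fin /e; lra.
have := H1_dual0 bf bf fe.
have -> : itg O (fun x => f x * f x) = I by apply: eq_itg => x _; rewrite expr2.
rewrite -/I ger0_norm// -{1}(sqr_sqrtr I0) expr2 => h.
have s0 : 0 <= Num.sqrt I := sqrtr_ge0 _.
have f0 : 0 <= fine (H1_norm Omega f) by apply: fine_ge0; exact: H1_norm_ge0.
have es : e < Num.sqrt I by rewrite /e; lra.
nra.
Qed.

(** Each infimum is bounded by the norm of the classical derivative; the constant is the square root
    of the number of multi-indices of size at most 1. *)
Lemma H1_norm_le f (b : R) : bC1 Omega f -> 0 <= b ->
  itg O (fun x => f x ^+ 2) <= b ^+ 2 ->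
  (forall i, itg O (fun x => pderiv i f x ^+ 2) <= b ^+ 2) ->
  (H1_norm Omega f <= (Num.sqrt (size (multis n 1))%:R * b)%:E)%E.
Proof.
move=> bf b0 fb db; have [Cf [B fB]] := bf.
have key g : ucb O g -> (forall x, Omega x -> {for x, continuous g}) ->
    (exists B, forall x, Omega x -> `|g x| <= B) ->
    itg O (fun x => g x ^+ 2) <= b ^+ 2 -> (Lpnorm Omega 2%:E g <= b%:E)%E.
  move=> ug cg gB gb; rewrite (Lpnorm_itg hc)// lee_fin -(ger0_norm b0) -sqrtr_sqr.
  by rewrite ler_sqrt// sqr_ge0.
rewrite /H1_norm /sobolev_norm; set s := map _ _.
have -> : size (multis n 1) = size s by rewrite size_map.
apply: lp_sum2_le => //.
move=> y /mapP[a]; rewrite mem_filter => /andP[a1 _] ->; rewrite dnorm_ge0 /=.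
move: a1; rewrite leq_eqVlt ltnS leqn0 => /orP[/eqP a1|/eqP a0]; last first.
  apply: le_trans (ereal_inf_lbound _) (key f _ _ _ fb).
  - by exists f => //; exact: (bC1_weak0 hc).
  - exact: (bC1_ucb hc).
  - by move=> x; exact: C1_cont.
  - by exists B => x /fB[].
have [i ai] := dpart_msize1 R a1.
apply: le_trans (ereal_inf_lbound _) (key (pderiv i f) _ _ _ (db i)).
- by exists (pderiv i f) => //; exact: (bC1_weak1 hc).
- exact: (bC1_pucb hc).
- by move=> x; exact: C1_pderiv_continuous.
- by exists B => x /fB[_].
Qed.

Lemma eq_weak_partial a f g w : (forall x, Omega x -> f x = g x) ->
  weak_partial Omega a f w -> weak_partial Omega a g w.
Proof.
move=> fg [[mf lf] lw fw]; split=> //.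
  split; first by apply: eq_measurable_fun mf => x /set_mem; exact: fg.
  move=> A cA AO; apply: eq_integrable (lf A cA AO); first last.
  - by move=> x /set_mem /AO Ox /=; rewrite fg.
  - by apply: rV_closed_measurable; exact: rV_compact_closed.
move=> phi /fw <-; apply: eq_Rintegral => x /set_mem Ox; by rewrite fg.
Qed.

Lemma eq_H1_norm f g : (forall x, Omega x -> f x = g x) -> H1_norm Omega f = H1_norm Omega g.
Proof.
move=> fg; rewrite /H1_norm /sobolev_norm; congr lp_sum; apply: eq_map => a.
congr ereal_inf; apply/seteqP; split=> _ [w ww <-]; exists w => //.
  exact: eq_weak_partial fg ww.
by apply: eq_weak_partial ww => x Ox; rewrite fg.
Qed.

End sobolev_bounds.

(** * Splines vanishing on the boundary *)

Section shrinking.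
Variables (R : realType) (e : R).
Hypothesis e0 : 0 < e.

(* The C^1 functions shrink and clip = id - shrink: shrink vanishes on [-e, e], clip
   is small, and its derivative dclip takes its values in [0, 1]. *)
Definition shrink (t : R) :=
  (sqp (t - e) - sqp (t - 2 * e) - sqp (- t - e) + sqp (- t - 2 * e)) / (2 * e).

(** Equal to 1 on [-e, e] and to 0 outside [-2e, 2e], affine in between. *)
Definition dclip (t : R) :=
  1 - (Num.max (t - e) 0 - Num.max (t - 2 * e) 0 + Num.max (- t - e) 0 - Num.max (- t - 2 * e) 0) / e.

Definition clip (t : R) := t - shrink t.

Lemma sqp_taylor (t h : R) : `|sqp (t + h) - sqp t - 2 * Num.max t 0 * h| <= h ^+ 2.
Proof.
rewrite /sqp ler_norml.
have := sqr_ge0 h; have := sqr_ge0 t; have := sqr_ge0 (t + h).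
by rewrite !maxEle; case: ifPn; case: ifPn; rewrite -?ltNge => *; apply/andP; split; nra.
Qed.

Lemma is_derive_clip (t : R) : is_derive t (1 : R) clip (dclip t).
Proof.
apply: (@is_derive_quad _ _ _ _ (2 / e)) => h; rewrite /clip /shrink /dclip.
have := sqp_taylor (t - e) h; have := sqp_taylor (t - 2 * e) h.
have := sqp_taylor (- t - e) (- h); have := sqp_taylor (- t - 2 * e) (- h).
rewrite sqrrN.
have -> : - t - 2 * e - h = - (t + h) - 2 * e by ring.
have -> : - t - e - h = - (t + h) - e by ring.
have -> : t - 2 * e + h = t + h - 2 * e by ring.
have -> : t - e + h = t + h - e by ring.
move: (sqp (t + h - e)) (sqp (t + h - 2 * e)) (sqp (- (t + h) - e)) (sqp (- (t + h) - 2 * e)) => a1 a2 a3 a4.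
move: (sqp (t - e)) (sqp (t - 2 * e)) (sqp (- t - e)) (sqp (- t - 2 * e)) => b1 b2 b3 b4.
move: (Num.max (t - e) 0) (Num.max (t - 2 * e) 0) (Num.max (- t - e) 0) (Num.max (- t - 2 * e) 0) => m1 m2 m3 m4.
have en : e != 0 by rewrite gt_eqF.
rewrite !ler_norml => /andP[k1 k1'] /andP[k2 k2'] /andP[k3 k3'] /andP[k4 k4'].
have -> : t + h - (a1 - a2 - a3 + a4) / (2 * e) - (t - (b1 - b2 - b3 + b4) / (2 * e)) -
    (1 - (m1 - m2 + m3 - m4) / e) * h =
    - ((a1 - b1 - 2 * m1 * h) - (a2 - b2 - 2 * m2 * h) - (a3 - b3 - 2 * m3 * - h) +
       (a4 - b4 - 2 * m4 * - h)) / (2 * e) by field.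
have -> : 2 / e * h ^+ 2 = 4 * h ^+ 2 / (2 * e) by field.
rewrite -mulNr ler_pM2r ?invr_gt0 ?mulr_gt0// ler_pM2r ?invr_gt0 ?mulr_gt0//.
by apply/andP; split; lra.
Qed.

Lemma dclip_itv t : 0 <= dclip t <= 1.
Proof.
rewrite /dclip.
have -> : 1 - (Num.max (t - e) 0 - Num.max (t - 2 * e) 0 + Num.max (- t - e) 0 -
    Num.max (- t - 2 * e) 0) / e = (e - (Num.max (t - e) 0 - Num.max (t - 2 * e) 0 +
    Num.max (- t - e) 0 - Num.max (- t - 2 * e) 0)) / e.
  by rewrite [RHS]mulrBl divff ?gt_eqF.
rewrite ler_pdivlMr// ler_pdivrMr// mul0r mul1r.
rewrite !maxEle; do 4 (case: ifPn; rewrite -?ltNge => ?); apply/andP; split; move: e0 => e0'; lra.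
Qed.

Lemma dclip_continuous : continuous dclip.
Proof.
have cm (f : R -> R) : continuous f -> continuous (fun t => Num.max (f t) 0).
  by move=> cf t; apply: continuous_max; [exact: cf|exact: cst_continuous].
have ca (a : R) : continuous (fun t : R => t - a).
  by move=> t; apply: continuousB; [exact: cvg_id|exact: cst_continuous].
have cb (a : R) : continuous (fun t : R => - t - a).
  by move=> t; apply: continuousB; [apply: continuousN; exact: cvg_id|exact: cst_continuous].
have cs := fun t => continuousD (continuousB (cm _ (ca e) t) (cm _ (ca (2 * e)) t)) (cm _ (cb e) t).
move=> t; have c1 := continuousB (cs t) (cm _ (cb (2 * e)) t).
have c2 := continuousM c1 (@cst_continuous R R (e^-1) t).
exact: (continuousB (@cst_continuous R R (1 : R) t) c2).
Qed.

(** [clip] is constant beyond 2e, with value the integral of [dclip] over [0, 2e], that is e + e /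
    2. *)
Lemma clip_le t : `|clip t| <= 3 / 2 * e.
Proof.
have -> : clip t = (t * (2 * e) - (sqp (t - e) - sqp (t - 2 * e) - sqp (- t - e) + sqp (- t - 2 * e))) / (2 * e).
  by rewrite /clip /shrink [RHS]mulrBl mulfK// mulf_neq0 ?gt_eqF.
rewrite normrM normfV (gtr0_norm (_ : 0 < 2 * e)) ?mulr_gt0// ler_pdivrMr ?mulr_gt0//.
rewrite ler_norml /sqp !maxEle.
by do 4 (case: ifPn; rewrite -?ltNge => ?); apply/andP; split; nra.
Qed.

Lemma clip0 : clip 0 = 0.
Proof. by rewrite /clip /shrink !sqp_eq0 ?subr0 ?addr0 ?mul0r ?subr0//; move: e0 => e0'; lra. Qed.

Lemma shrink_eq0 t : `|t| <= e -> shrink t = 0.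
Proof.
rewrite ler_norml => /andP[h1 h2].
by rewrite /shrink !sqp_eq0 ?subrr ?addr0 ?mul0r//; lra.
Qed.

Lemma clip_lipschitz s t : `|clip s - clip t| <= `|s - t|.
Proof.
wlog st : s t / t <= s => [H|].
  by have [/H//|/ltW/H] := leP t s; rewrite distrC (distrC t).
have [||c _ ->] := @MVT_segment R clip dclip t s st.
- by move=> x _; exact: is_derive_clip.
- apply: continuous_subspaceT => x; have [d _] := is_derive_clip x.
  by apply: differentiable_continuous; apply/derivable1_diffP.
have /andP[d0 d1] := dclip_itv c.
by rewrite normrM ger0_norm// ler_piMl.
Qed.

End shrinking.

Section spline_zero.
Variables (R : realType) (n K : nat).
Local Notation V := 'rV[R]_n.
Local Notation leb := (lebesgue_rV R n).
Variables (Omega : set V) (C O : 'I_K -> set V) (N : set V).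
Hypothesis hc : cells Omega C O N.
Implicit Types (f g p q : V -> R) (x y : V).

Let oD : open Omega. Proof. exact (cells_domain hc). Qed.
Let cC : forall i, closed (C i). Proof. exact (cells_closed hc). Qed.

Lemma domain_cell x : Omega x -> exists i, C i x.
Proof. by move=> /(@subset_closure _ Omega)/(cells_cover hc). Qed.

Lemma cell_bound (F : 'I_K -> V -> R) : (forall i, polyf (F i)) ->
  exists2 B, 0 <= B & forall i x, C i x -> `|F i x| <= B.
Proof.
move=> pF; have [M M0 hM] := cell_bounded hc.
pose b i := sval (cid (polyf_bounded M (pF i))).
have hb i x : C i x -> `|F i x| <= b i by rewrite /b; case: cid => /= B h /(hM i) /h.
exists (\sum_i `|b i|) => [|i x Cx]; first exact: sumr_ge0.
rewrite (le_trans (hb i x Cx))// (bigD1 i)//= (le_trans (ler_norm _))// lerDl.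
exact: sumr_ge0.
Qed.

Lemma spl_poly f : spl Omega C f -> exists q : 'I_K -> V -> R,
  (forall i, polyf (q i)) /\ forall i x, C i x -> f x = q i x.
Proof.
move=> [_ H]; pose q i := s2val (cid2 (H i)).
by exists q; split=> i; rewrite /q; case: cid2.
Qed.

Lemma spl_bC1 f : spl Omega C f -> bC1 Omega f.
Proof.
move=> sf; have [q [pq fq]] := spl_poly sf; split; first by case: sf.
have [B B0 qB] := cell_bound pq.
pose b j := s2val (cid2 (cell_bound (fun i => polyf_pderiv j (pq i)))).
have b0 j : 0 <= b j by rewrite /b; case: cid2.
have hb j i x : C i x -> `|pderiv j (q i) x| <= b j by rewrite /b; case: cid2 => /= ? _; apply.
exists (B + \sum_j b j) => x Ox; have [i Cx] := domain_cell Ox; split=> [|j].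
  by rewrite (fq i)// (le_trans (qB i x Cx))// lerDl sumr_ge0.
rewrite (spl_pderiv_cell hc j sf (pq i) (fq i))// (le_trans (hb j i x Cx))//.
by rewrite ler_wpDl// (bigD1 j)//= lerDl sumr_ge0.
Qed.

Lemma spl_pderiv_bound f : spl Omega C f ->
  exists2 B, 0 <= B & forall i x, inner O x -> `|pderiv i (pderiv i f) x| <= B.
Proof.
move=> sf; have pf := spl_pw hc sf.
have H i : exists B, forall x, inner O x -> `|pderiv i (pderiv i f) x| <= B.
  by have [_] := pw_ucb hc (pw_pderiv hc i (pw_pderiv hc i pf)).
pose b i := sval (cid (H i)).
have hb i x : inner O x -> `|pderiv i (pderiv i f) x| <= b i by rewrite /b; case: cid => /= ? h /h.
exists (\sum_i `|b i|) => [|i x Ix]; first exact: sumr_ge0.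
rewrite (le_trans (hb i x Ix))// (bigD1 i)//= (le_trans (ler_norm _))// lerDl.
exact: sumr_ge0.
Qed.

Section clipping.
Variable e : R.
Hypothesis e0 : 0 < e.

Lemma clip_bC1 f : bC1 Omega f -> bC1 Omega (fun x => clip e (f x)) /\
  forall i x, Omega x -> pderiv i (fun x => clip e (f x)) x = dclip e (f x) * pderiv i f x.
Proof.
move=> bf; apply: (@bC1_comp _ _ _ _ _ _ _ hc f (clip e) (dclip e) (3 / 2 * e + 1) bf).
- by move=> x _; exact: is_derive_clip.
- by move=> x _; exact: dclip_continuous.
- move=> x _; have h := clip_le e0 (f x); have /andP[d0 d1] := dclip_itv e0 (f x).
  by rewrite (ger0_norm d0); split; move: e0 => e0'; lra.
Qed.

(** The function clip(p) D_i p vanishes on the boundary together with p, so its extension by zero is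
    Lipschitz and its derivative has integral zero. *)
Lemma clip_parts p i : spl Omega C p -> vanishing Omega p ->
  itg O (fun x => dclip e (p x) * pderiv i p x ^+ 2) =
  - itg O (fun x => clip e (p x) * pderiv i (pderiv i p) x).
Proof.
move=> sp p0; have [q [pq fq]] := spl_poly sp; have [M M0 hM] := cell_bounded hc.
have pp := spl_pw hc sp; have bp := spl_bC1 sp.
have [[Cc [Bc cB]] dc] := clip_bC1 bp.
have ppd := pw_pderiv hc i pp.
have [B B0 qB] := cell_bound (fun j => polyf_pderiv i (pq j)).
pose w := (fun x => clip e (p x) * pderiv i p x) \_ Omega.
have [L L0 wL] : exists2 L, 0 <= L & forall x y, `|w x - w y| <= L * `|x - y|.
  apply: (zero_lipschitz hc) => j.
  have [L1 L10 hL1] := polyf_lipschitz M (pq j).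
  have [L2 L20 hL2] := polyf_lipschitz M (polyf_pderiv i (pq j)).
  exists (fun x => clip e (q j x) * pderiv i (q j) x), (L1 * B + 3 / 2 * e * L2); split.
  - by rewrite addr_ge0// !mulr_ge0// ltW.
  - move=> x y Cx Cy.
    have -> : clip e (q j x) * pderiv i (q j) x - clip e (q j y) * pderiv i (q j) y =
      (clip e (q j x) - clip e (q j y)) * pderiv i (q j) x +
      clip e (q j y) * (pderiv i (q j) x - pderiv i (q j) y) by ring.
    rewrite (le_trans (ler_normD _ _))// !normrM mulrDl lerD//.
      rewrite mulrAC; apply: ler_pM => //; last exact: qB.
      by rewrite (le_trans (clip_lipschitz e0 _ _))// hL1// (hM j).
    by rewrite -[leRHS]mulrA; apply: ler_pM => //; [exact: clip_le|apply: hL2; exact: (hM j)].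
  - by move=> x Cx Ox; rewrite (spl_pderiv_cell hc i sp (pq j) (fq j))// (fq j).
  - move=> x Cx Ox; rewrite -fq// p0 ?clip0 ?mul0r//.
    by apply/(cells_cover hc); exists j.
have w0 x : ~ Omega x -> w x = 0 by exact: patch_out.
have [Bw wB] := lipschitz_bounded hc wL w0.
have : itg O (fun x => clip e (p x) * pderiv i (pderiv i p) x +
                       pderiv i p x * (dclip e (p x) * pderiv i p x)) = 0.
  apply: (@itg_derive0 _ _ _ _ _ _ _ hc w _ (delta_mx ord0 i) (L * `|delta_mx ord0 i : V|) Bw) => //.
  - exact: lipschitz_measurable wL.
  - move=> x s /andP[s0 _]; apply: le_trans (wL _ _) _.
    by rewrite addrAC subrr add0r normrZ (gtr0_norm s0) mulrA mulrAC.
  - move=> x Ix; have Ox := inner_sub hc Ix.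
    apply: (@near_eq_is_derive _ _ _ (fun x => clip e (p x) * pderiv i p x)).
      by apply: (near_inner hc Ix) => y Oy; rewrite /w patch_in.
    have d1 : is_derive x (delta_mx ord0 i) (fun x => clip e (p x)) (dclip e (p x) * pderiv i p x).
      by rewrite -dc//; exact: C1_der Cc Ox.
    have d2 : is_derive x (delta_mx ord0 i) (pderiv i p) (pderiv i (pderiv i p) x).
      by apply: derivableP; exact: (pw_derivable hc).
    exact: (is_deriveM d1 d2).
have uc : ucb O (fun x => clip e (p x)) by apply: (bC1_ucb hc); split=> //; exists Bc.
have ud : ucb O (fun x => dclip e (p x)).
  split=> [x Ix|].
    apply: (@continuous_comp _ _ _ p (dclip e)); last exact: dclip_continuous.
    by exact: C1_cont bp.1 (inner_sub hc Ix).
  by exists 1 => x _; have /andP[d0 d1] := dclip_itv e0 (p x); rewrite ger0_norm.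
have up := bC1_pucb hc i bp.
have upp := pw_ucb hc (pw_pderiv hc i ppd).
rewrite (itgD hc); last 2 first.
- exact: ucbM.
- by apply: ucbM => //; exact: ucbM.
move/eqP; rewrite addrC addr_eq0 => /eqP <-.
by apply: eq_itg => x _; rewrite expr2; ring.
Qed.

End clipping.

(* p is approximated by shrink d p; integrating by parts, the energy of the error
   clip d p is bounded by the integral of |clip d p| |D^2 p|, which is O(d). *)
Lemma vanishing_H10 p : spl Omega C p -> vanishing Omega p -> H10 Omega p.
Proof.
move=> sp p0 e e0; have [q [pq fq]] := spl_poly sp; have bp := spl_bC1 sp.
have [B B0 pB] := spl_pderiv_bound sp.
pose S : R := Num.sqrt (size (multis n 1))%:R.
have S0 : 0 <= S by exact: sqrtr_ge0.
pose b := e / (S + 1) / 2.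
have b0 : 0 < b by rewrite !divr_gt0// ltr_wpDl.
pose v := vol O; have v0 : 0 <= v by exact: vol_ge0.
(* With d <= 1, the L^2 part of the error is at most 9/4 d v and its energy at most 3/2 d B v; the
   denominator exceeds the sum of both coefficients of d, and b is chosen so that S b < e. *)
pose d := Num.min 1 (b ^+ 2 / ((3 / 2 + B) * 3 / 2 * v + 1)).
have k0 : 0 < (3 / 2 + B) * 3 / 2 * v + 1 by rewrite ltr_wpDl// !mulr_ge0// addr_ge0.
have d0 : 0 < d by rewrite /d lt_min ltr01 divr_gt0// exprn_gt0.
have d1 : d <= 1 by rewrite /d ge_min lexx.
have db : d * ((3 / 2 + B) * 3 / 2 * v + 1) <= b ^+ 2.
  by rewrite -ler_pdivlMr// /d ge_min lexx orbT.
have [bc dc] := clip_bC1 d0 bp.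
have bs : bC1 Omega (fun x => shrink d (p x)).
  apply: (bC1_congr hc) (bC1B hc bp bc) => x Ox; rewrite /clip; ring.
exists ((fun x => shrink d (p x)) \_ Omega).
  (* The set where [|p|] >= d, written with the cell polynomials so that it is visibly closed. It
     avoids the boundary because p vanishes there and d > 0. *)
  apply: (@test_fun_patch _ _ _ oD _ [set x | exists i, C i x /\ d <= `|q i x|]) => //.
  - by case: bs.
  - rewrite (_ : [set x | _] = \bigcup_(i in [set: 'I_K]) [set x | C i x /\ d <= `|q i x|]).
      apply: bounded_closed_compact.
        have [M M0 hM] := cell_bounded hc; exists M; split; first exact: num_real.
        by move=> t Mt x [i _ [Cx _]] /=; rewrite (le_trans (hM i x Cx))// ltW.
      apply: closed_bigcup; first exact: finite_finset.
      move=> i _; apply: closedI => //.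
      apply: (preimage_closed _ (@closed_ge _ d)) => x _.
      by apply: continuous_comp; [exact: polyf_continuous|exact: norm_continuous].
    by apply/seteqP; split=> x [i]; [exists i|move=> _; exists i].
  - move=> x [i [Cx dq]]; apply: contrapT => Ox; move: dq.
    rewrite -fq// p0 ?normr0 ?leNgt ?d0//.
    by apply/(cells_cover hc); exists i.
  - move=> x Ox nK; have [i Cx] := domain_cell Ox.
    apply: shrink_eq0 => //; rewrite leNgt; apply/negP => h; apply: nK.
    by exists i; split=> //; rewrite -fq// ltW.
rewrite (@eq_H1_norm _ _ _ _ (fun x => clip d (p x))); last first.
  by move=> x Ox /=; rewrite patch_in.
apply: le_lt_trans (_ : (S * b)%:E < e%:E)%E.
  have uc := bC1_ucb hc bc.
  have sq f : (fun x => f x ^+ 2) = (fun x => f x * f x) by apply/funext => x; rewrite expr2.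
  apply: (H1_norm_le hc) => //; first exact: ltW.
    apply: le_trans (_ : (3 / 2 * d) ^+ 2 * v <= _).
      rewrite -(itg_cst hc); apply: (itg_le hc); [by rewrite sq; exact: ucbM|exact: ucb_cst|].
      move=> x _; rewrite -(real_normK (num_real (clip _ _))) lerXn2r ?nnegrE ?mulr_ge0 ?(ltW d0)//.
      exact: clip_le.
    apply: le_trans db; rewrite exprMn.
    have : d ^+ 2 * v <= d * v by rewrite ler_wpM2r// expr2 ler_piMl// ltW.
    have : 0 <= B * (d * v) by rewrite !mulr_ge0// ltW.
    nra.
  move=> i; have up := bC1_pucb hc i bp; have ucp := bC1_pucb hc i bc.
  have ud : ucb O (fun x => dclip d (p x)).
    split=> [x Ix|].
      apply: (@continuous_comp _ _ _ p (dclip d)); last exact: dclip_continuous.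
      by exact: C1_cont bp.1 (inner_sub hc Ix).
    by exists 1 => x _; have /andP[? ?] := dclip_itv d0 (p x); rewrite ger0_norm.
  apply: le_trans (_ : itg O (fun x => dclip d (p x) * pderiv i p x ^+ 2) <= _).
    apply: (itg_le hc).
    - by rewrite sq; exact: ucbM.
    - by apply: ucbM => //; rewrite sq; exact: ucbM.
    - move=> x Ix; rewrite dc; last exact: (inner_sub hc).
      rewrite exprMn ler_wpM2r ?sqr_ge0// expr2.
      by have /andP[? ?] := dclip_itv d0 (p x); rewrite ler_piMr.
  rewrite clip_parts//.
  have uPP : ucb O (fun x => clip d (p x) * pderiv i (pderiv i p) x).
    apply: ucbM => //; apply: (pw_ucb hc).
    by apply: (pw_pderiv hc); apply: (pw_pderiv hc); exact: (spl_pw hc).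
  have := @itg_norm_le _ _ _ _ _ _ _ hc _ (3 / 2 * d * B) uPP _.
  rewrite -/v => /(_ _)/wrap[].
    move=> x Ix; rewrite normrM ler_pM ?clip_le//; exact: pB.
  rewrite ler_norml => /andP[h _].
  have : 0 <= d * v by rewrite mulr_ge0// ltW.
  have : 0 <= B * (d * v) by rewrite !mulr_ge0// ltW.
  nra.
rewrite lte_fin /b -mulrA mulrCA mulrA -[ltRHS]mulr1 -mulrA ltr_pM2l//.
have : S / (S + 1) < 1 by rewrite ltr_pdivrMr ?mul1r ?ltrDl// ltr_wpDl.
have : 0 <= S / (S + 1) by rewrite divr_ge0// addr_ge0.
nra.
Qed.

End spline_zero.

(** * Exterior balls of convex domains *)

Section convex_domains.
Variables (R : realType) (n : nat).
Local Notation V := 'rV[R]_n.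
Implicit Types (x y z c : V) (Omega : set V).

Lemma closure_near Omega x e : closure Omega x -> 0 < e -> exists2 y, Omega y & `|y - x| < e.
Proof.
move=> cx e0; have [|y [Oy ye]] := cx [set y | `|y - x| < e]; last by exists y.
by apply/rV_nbhsP; exists e.
Qed.

(** Replacing y by a nearby point y' of Omega is compensated by moving x to x' = x + t / (1 - t) (y
    - y'), which stays in Omega since Omega is open and t < 1. *)
Lemma convex_closure_segment Omega x y t : open Omega ->
  (forall a b s, Omega a -> Omega b -> 0 <= s <= 1 -> Omega (a + s *: (b - a))) ->
  Omega x -> closure Omega y -> 0 <= t < 1 -> Omega (x + t *: (y - x)).
Proof.
move=> oO cO Ox cy /andP[t0 t1]; have s0 : 0 < 1 - t by rewrite subr_gt0.
move: oO; rewrite openE => /(_ x Ox) /rV_nbhsP[r r0 hr].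
have [|y' Oy' yy'] := closure_near cy (_ : 0 < r * (1 - t)); first exact: mulr_gt0.
pose x' := x + (t / (1 - t)) *: (y - y').
have Ox' : Omega x'.
  apply: hr; rewrite /x' addrAC subrr add0r normrZ ger0_norm ?divr_ge0 ?(ltW s0)//.
  rewrite distrC mulrAC ltr_pdivrMr//; apply: le_lt_trans yy'.
  by rewrite ler_piMl// ltW.
have -> : x + t *: (y - x) = x' + t *: (y' - x').
  apply/rowP => i; rewrite !mxE; field; exact: lt0r_neq0.
by apply: cO => //; rewrite t0 ltW.
Qed.

(** The squared Euclidean distance, a polynomial in x, whereas the norm of [x - c] is the sup
    norm. *)
Definition d2 c x : R := \sum_i (x ord0 i - c ord0 i) ^+ 2.

Lemma polyf_d2 c : polyf (d2 c).
Proof.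
apply: polyf_sum => i; apply: polyf_exp; apply: polyf_sub; [exact: polyf_coord|exact: polyf_cst].
Qed.

Lemma pderiv_exp i p k x : polyf p ->
  pderiv i (fun y => p y ^+ k.+1) x = k.+1%:R * p x ^+ k * pderiv i p x :> R.
Proof.
move=> pp; elim: k => [|k IH]; first by rewrite expr0 !mul1r; congr (pderiv i _ x); apply/funext.
have -> : (fun y => p y ^+ k.+2) = (fun y => p y * p y ^+ k.+1) by apply/funext => y; rewrite exprS.
rewrite (pderivM i pp (polyf_exp k.+1 pp)) IH -[in RHS]natr1 !exprS; ring.
Qed.

Lemma pderiv_sum i I (r : seq I) (F : I -> V -> R) x : (forall k, polyf (F k)) ->
  pderiv i (fun x => \sum_(k <- r) F k x) x = \sum_(k <- r) pderiv i (F k) x.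
Proof.
move=> pF; elim: r => [|k r IH].
  by under eq_fun do rewrite big_nil; rewrite pderiv_cst big_nil.
rewrite big_cons -IH -[RHS]/((fun y => pderiv i (F k) y + pderiv i (fun x => \sum_(k <- r) F k x) y) x).
rewrite -(pderivD i (pF k) (polyf_sum r pF)); congr (pderiv i _ x).
by apply/funext => y; rewrite big_cons.
Qed.

Lemma pderiv_d2 c i x : pderiv i (d2 c) x = 2 * (x ord0 i - c ord0 i).
Proof.
have pc k : polyf (fun x : V => x ord0 k - c ord0 k).
  by apply: polyf_sub; [exact: polyf_coord|exact: polyf_cst].
have dc k : pderiv i (fun x => x ord0 k - c ord0 k) x = (i == k)%:R :> R.
  by rewrite (pderivD i (polyf_coord R k) (polyf_cst n (- c ord0 k))) pderiv_coord pderiv_cst addr0.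
rewrite pderiv_sum => [|k]; last exact: polyf_exp.
rewrite (bigD1 i)//= big1 ?addr0 => [|k /negbTE ki].
  by rewrite (pderiv_exp i 1 x (pc i)) dc eqxx mulr1 expr1.
by rewrite (pderiv_exp i 1 x (pc k)) dc eq_sym ki mulr0.
Qed.

Lemma d2_ge0 c x : 0 <= d2 c x.
Proof. by apply: sumr_ge0 => i _; exact: sqr_ge0. Qed.

Lemma d2_norm c x : `|x - c| ^+ 2 <= d2 c x.
Proof.
rewrite leNgt; apply/negP => h.
have x0 : 0 < `|x - c|.
  rewrite lt_neqAle normr_ge0 andbT; apply: contraPneq h => <-.
  by rewrite expr0n /= ltNge d2_ge0.
have : `|x - c| < `|x - c|; last by rewrite ltxx.
apply/rV_norm_ltP => // i; rewrite ltNge; apply/negP => hi.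
have : `|x - c| ^+ 2 <= d2 c x; last by rewrite leNgt h.
rewrite /d2 (bigD1 i)//=; apply: ler_wpDr; first by apply: sumr_ge0 => k _; exact: sqr_ge0.
rewrite -(real_normK (num_real (x ord0 i - _))) lerXn2r ?nnegrE//.
by move: hi; rewrite !mxE.
Qed.

Lemma d2_le c x : d2 c x <= n%:R * `|x - c| ^+ 2.
Proof.
apply: le_trans (_ : \sum_(i < n) `|x - c| ^+ 2 <= _); last first.
  by rewrite sumr_const card_ord mulr_natl.
apply: ler_sum => i _; rewrite -(real_normK (num_real (x ord0 i - _))) lerXn2r ?nnegrE//.
by have := rV_coord_le (x - c) i; rewrite !mxE.
Qed.

Lemma d2_gt0 c x : x != c -> 0 < d2 c x.
Proof.
by move=> xc; apply: lt_le_trans (d2_norm c x); rewrite exprn_gt0// normr_gt0 subr_eq0.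
Qed.

(* For z the point of a set closest to y, the ball around the midpoint of y and z
   touches the set only at z, and quadratically so. *)
Lemma midpoint_ball y z x : d2 y z <= d2 y x ->
  d2 z x / 2 <= d2 (2^-1 *: (y + z)) x - d2 (2^-1 *: (y + z)) z.
Proof.
move=> h.
have -> : d2 (2^-1 *: (y + z)) x - d2 (2^-1 *: (y + z)) z = (d2 y x - d2 y z) / 2 + d2 z x / 2.
  rewrite /d2 -!sumrB !mulr_suml -big_split/=; apply: eq_bigr => i _; rewrite !mxE.
  by field.
by rewrite lerDr divr_ge0// subr_ge0.
Qed.

Lemma midpoint_gt0 y z : z != y -> 0 < d2 (2^-1 *: (y + z)) z.
Proof.
move=> zy; apply: d2_gt0; apply: contra zy => /eqP E; apply/eqP.
have E' : z = y + z - z by rewrite {1}E; apply/rowP => i; move/rowP: E => /(_ i); rewrite !mxE; lra.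
by rewrite E' addrK.
Qed.

(** The boundary point x0 is pushed away from an interior point w to y, which by convexity is
    outside the closure; z is a point of the closure closest to y and c the midpoint of y and z. The
    touching point is z, close to x0 but possibly different from it. *)
Lemma exterior_ball Omega x0 e : open Omega -> bounded_set Omega -> Omega !=set0 ->
  (forall a b s, Omega a -> Omega b -> 0 <= s <= 1 -> Omega (a + s *: (b - a))) ->
  closure Omega x0 -> ~ Omega x0 -> 0 < e -> exists z c,
  [/\ closure Omega z, `|z - x0| < e, 0 < d2 c z &
      forall x, Omega x -> d2 z x / 2 <= d2 c x - d2 c z].
Proof.
move=> oO bO [w Ow] cO cx0 nx0 e0.
pose D := `|x0 - w|; pose k : R := n.+1%:R.
have D0 : 0 <= D by exact: normr_ge0.
(* Minimality is Euclidean, so the sup norm of z - y is only bounded by n times that of x0 - y; with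
   the distance from y to x0 this makes the factor k = n + 1. *)
pose t := e / 2 / (k * (D + 1)).
have k0 : 0 < k by rewrite ltr0n.
have t0 : 0 < t by rewrite !divr_gt0// mulr_gt0// ltr_wpDl.
pose y := x0 + t *: (x0 - w).
have yx : `|x0 - y| = t * D.
  by rewrite /y opprD addrA subrr add0r normrN normrZ gtr0_norm.
have nclos : ~ closure Omega y.
  move=> cy; apply: nx0.
  have -> : x0 = w + (1 + t)^-1 *: (y - w).
    by apply/rowP => i; rewrite !mxE; field; rewrite gt_eqF// addr_gt0.
  apply: convex_closure_segment => //; rewrite invr_ge0 addr_ge0 ?(ltW t0)//=.
  by rewrite invf_lt1 ?addr_gt0// ltrDl.
have cpt : compact (closure Omega).
  apply: bounded_closed_compact; last exact: closed_closure.
  have [M [Mr hM]] := bO; exists M; split=> // u Mu.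
  move=> x cx; rewrite /= leNgt; apply/negP => ux.
  have [|x' Ox' xx'] := closure_near cx (_ : 0 < `|x| - u); first by rewrite subr_gt0.
  have h1 : `|x'| <= u := hM u Mu x' Ox'.
  have := ler_normD (x - x') x'; rewrite subrK (distrC x); lra.
have [|z /set_mem cz zmin] := @EVT_min_rV R n (d2 y) _ (ex_intro _ x0 cx0) cpt.
  by apply: continuous_subspaceT => x; apply: polyf_continuous; exact: polyf_d2.
exists z, (2^-1 *: (y + z)); split=> //.
- have zy : `|z - y| <= n%:R * `|x0 - y|.
    have h1 : `|z - y| ^+ 2 <= n%:R * `|x0 - y| ^+ 2.
      apply: le_trans (d2_norm _ _) _; apply: le_trans (d2_le _ _).
      by apply: zmin; rewrite inE.
    have h2 : (n%:R : R) <= n%:R ^+ 2 by rewrite -natrX ler_nat; case: (n) => // q; rewrite leq_pmulr.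
    rewrite -(@ler_pXn2r _ 2)// ?nnegrE ?mulr_ge0//.
    by apply: le_trans h1 _; rewrite exprMn ler_wpM2r// sqr_ge0.
  apply: (@le_lt_trans _ _ (k * (t * D))).
    rewrite -yx /k -natr1 mulrDl mul1r.
    have := ler_normD (z - y) (y - x0); rewrite subrKA (distrC y); lra.
  have -> : k * (t * D) = e / 2 * (D / (D + 1)).
    by rewrite /t; field; rewrite !gt_eqF// ltr_wpDl.
  have : D / (D + 1) <= 1 by rewrite ler_pdivrMr ?mul1r ?lerDl// ltr_wpDl.
  have : 0 <= D / (D + 1) by rewrite divr_ge0// addr_ge0.
  nra.
- by apply: midpoint_gt0; apply: contraPneq cz => ->.
- move=> x Ox; apply: midpoint_ball; apply: zmin; rewrite inE; exact: subset_closure.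
Qed.

End convex_domains.

(** * Boundary values of functions in H^1_0 *)

Section boundary_values.
Variables (R : realType) (n K : nat).
Local Notation V := 'rV[R]_n.
Variables (Omega : set V) (C O : 'I_K -> set V) (N : set V).
Hypothesis hc : cells Omega C O N.
Implicit Types (u G : V -> R) (x z c : V).

Let oD : open Omega. Proof. exact (cells_domain hc). Qed.

(** A weak form of a zero boundary value: G need not vanish on the boundary, yet there is no
    boundary term. *)
Definition parts_formula u := forall i G, polyf G ->
  itg O (fun x => pderiv i u x * G x) = - itg O (fun x => u x * pderiv i G x).

(** The formula holds for the test functions approximating u; by duality the defect for u is at most
    e times a constant depending on G only, for every e > 0. *)
Lemma H10_parts u : bC1 Omega u -> H10 Omega u -> parts_formula u.
Proof.
move=> bu hu i G pG; have bG := polyf_bC1 hc pG; have bdG := polyf_bC1 hc (polyf_pderiv i pG).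
pose k1 := Num.sqrt (itg O (fun x => G x ^+ 2)).
pose k2 := Num.sqrt (itg O (fun x => pderiv i G x ^+ 2)).
have k10 : 0 <= k1 := sqrtr_ge0 _; have k20 : 0 <= k2 := sqrtr_ge0 _.
have key e : 0 < e -> `|itg O (fun x => pderiv i u x * G x) + itg O (fun x => u x * pderiv i G x)| <=
    e * (k1 + k2).
  move=> e0; have [phi tp hp] := hu e e0; have bp := bC1_test tp.
  have bd : bC1 Omega (u \- phi) := bC1B hc bu bp.
  have d0 := H1_dual0 hc bd bdG hp; have d1 := H1_dual1 hc i bd bG hp.
  have := bC1_ibp hc i bG tp.
  have -> : itg O (fun x => G x * pderiv i phi x) = itg O (fun x => pderiv i phi x * G x).
    by apply: eq_itg => x _; rewrite mulrC.
  have -> : itg O (fun x => pderiv i G x * phi x) = itg O (fun x => phi x * pderiv i G x).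
    by apply: eq_itg => x _; rewrite mulrC.
  move: d0 d1; rewrite -/k1 -/k2.
  have uG := bC1_ucb hc bG; have udG := bC1_ucb hc bdG.
  have -> : itg O (fun x => (u \- phi) x * pderiv i G x) =
      itg O (fun x => u x * pderiv i G x) - itg O (fun x => phi x * pderiv i G x).
    rewrite -(itgB hc); [|by apply: ucbM => //; exact: (bC1_ucb hc)|by apply: ucbM => //; exact: (bC1_ucb hc)].
    by apply: eq_itg => x _; rewrite mulrBl.
  have -> : itg O (fun x => pderiv i (u \- phi) x * G x) =
      itg O (fun x => pderiv i u x * G x) - itg O (fun x => pderiv i phi x * G x).
    rewrite -(itgB hc); [|by apply: ucbM => //; exact: (bC1_pucb hc)|by apply: ucbM => //; exact: (bC1_pucb hc)].
    by apply: eq_itg => x /(inner_sub hc) Ox; rewrite -mulrBl (bC1_pderivB hc).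
  rewrite !ler_norml; move: (itg _ _) (itg _ _) (itg _ _) (itg _ _) => a b c d.
  by move=> /andP[h1 h2] /andP[h3 h4] h5; apply/andP; split; lra.
move: key; set X := itg _ _; set Y := itg _ _ => key.
apply/eqP; rewrite -addr_eq0 -normr_eq0 eq_le normr_ge0 andbT leNgt; apply/negP => XY.
have k0 : 0 < k1 + k2 + 1 by rewrite ltr_wpDl// addr_ge0.
have := key (`|X + Y| / 2 / (k1 + k2 + 1)).
rewrite !divr_gt0// => /(_ isT); apply/negP; rewrite -ltNge.
rewrite mulrAC ltr_pdivrMr//.
have : 0 <= `|X + Y| * (k1 + k2) by rewrite mulr_ge0 ?addr_ge0.
nra.
Qed.



(** Bernoulli's inequality for t / theta, weakened by theta <= 1: above theta the powers of t
    outgrow those of theta by a factor linear in j. *)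
Lemma bernoulli_excess (theta t : R) j : 0 < theta <= 1 -> 0 <= t ->
  theta ^+ j * (j%:R * Num.max (t - theta) 0) <= t ^+ j.
Proof.
move=> /andP[th0 th1] t0; have [h|h] := leP (t - theta) 0.
  by rewrite !mulr0 exprn_ge0.
suff : theta ^+ j * (1 + j%:R * (t - theta)) <= t ^+ j.
  by have : 0 < theta ^+ j by [rewrite exprn_gt0]; nra.
elim: j => [|j IH]; first by rewrite !expr0 mul0r addr0 mulr1.
rewrite !exprS -natr1.
have tj : 0 < theta ^+ j by rewrite exprn_gt0.
have : t * (theta ^+ j * (1 + j%:R * (t - theta))) <= t * t ^+ j by rewrite ler_wpM2l.
have : 0 <= j%:R * (t - theta) by rewrite mulr_ge0// ltW.
have : 0 <= (1 - theta) * (theta ^+ j * (t - theta)) by rewrite !mulr_ge0 ?(ltW tj) ?(ltW h)// subr_ge0.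
have : 0 <= theta ^+ j * (j%:R * (t - theta)) * (t - theta).
  by rewrite !mulr_ge0 ?(ltW tj) ?(ltW h).
move: (theta ^+ j) tj (t ^+ j) => a a0 b; nra.
Qed.

(* The fields tau^k (x - c), with tau = 1 - (|x - c|^2 - |z - c|^2) / S peaking at z,
   concentrate at z as k grows, which is incompatible with the divergence theorem
   without boundary term if u is positive near z. *)
Lemma boundary_not_positive u z c (m delta : R) : bC1 Omega u -> parts_formula u ->
  closure Omega z -> 0 < d2 c z -> (forall x, Omega x -> d2 z x / 2 <= d2 c x - d2 c z) ->
  0 < m -> 0 < delta -> (forall x, Omega x -> `|x - z| < delta -> m <= u x) -> False.
Proof.
have aux (a b : R) : 2 * (a - b) <= a -> a <= 2 * b by lra.
have sw4 (a b d e : R) : a * (b * d * e) = b * (a * e) * d by ring.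
move=> bu hu cz cz0 hz m0 de0 hm.
have uu := bC1_ucb hc bu.
have [Mo Mo0 hMo] := domain_bounded hc.
have [S0 hS0] := polyf_bounded Mo (polyf_d2 c).
(* S exceeds the values of [d2 c] on Omega, which places [tau] in [0, 1]; S >= delta^2 places
   [theta] below in [1/2, 1). *)
pose S := `|S0| + 1 + delta ^+ 2.
have de2 : 0 < delta ^+ 2 by rewrite exprn_gt0.
have S1 : S0 < S by have := ler_norm S0; rewrite /S; lra.
have Sde : delta ^+ 2 <= S by have := normr_ge0 S0; rewrite /S; lra.
have Sp : 0 < S by exact: lt_le_trans Sde.
pose s x := d2 c x - d2 c z.
have ps : polyf s by apply: polyf_sub; [exact: polyf_d2|exact: polyf_cst].
have s0 x : Omega x -> 0 <= s x by move=> /hz; apply: le_trans; rewrite divr_ge0// d2_ge0.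
have sS x : Omega x -> s x <= S.
  move=> Ox; have := hS0 x (hMo x Ox); have := ler_norm (d2 c x); rewrite /s; lra.
pose tau x := 1 - s x * S^-1.
have pt : polyf tau.
  by apply: polyf_sub; [exact: polyf_cst|apply: polyf_mul => //; exact: polyf_cst].
have t01 x : Omega x -> 0 <= tau x <= 1.
  move=> Ox; rewrite /tau subr_ge0 ler_pdivrMr// mul1r sS//= gerBl divr_ge0 ?s0//.
  exact: ltW.
have dcoord i k x : pderiv i (fun x => x ord0 k - c ord0 k) x = (i == k)%:R :> R.
  by rewrite (pderivD i (polyf_coord R k) (polyf_cst n (- c ord0 k))) pderiv_coord pderiv_cst addr0.
have pc i : polyf (fun x => x ord0 i - c ord0 i) by apply: polyf_sub; [exact: polyf_coord|exact: polyf_cst].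
have dt i x : pderiv i tau x = - (2 / S) * (x ord0 i - c ord0 i).
  have -> : tau = fun x => (1 + d2 c z / S) + (- S^-1) * d2 c x.
    by apply/funext => y; rewrite /tau /s; ring.
  rewrite (pderivD i (polyf_cst n _) (polyf_mul (polyf_cst n _) (polyf_d2 c))).
  by rewrite (pderivM i (polyf_cst n _) (polyf_d2 c)) !pderiv_cst pderiv_d2; ring.
(* The divergence of u (x - c). *)
pose D x := \sum_i pderiv i u x * (x ord0 i - c ord0 i) + n%:R * u x.
have up i := bC1_pucb hc i bu.
have upol p : polyf p -> ucb O p by move=> pp; exact: (bC1_ucb hc (polyf_bC1 hc pp)).
have uD : ucb O D.
  apply: ucbD; last exact: ucbZ.
  by apply: ucb_sum => i; apply: ucbM => //; exact: upol.
have [_ [A hA]] := uD.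
have utk k : ucb O (fun x => tau x ^+ k) by apply: upol; exact: polyf_exp.
have ur2 : ucb O (fun x => u x * d2 c x) by apply: ucbM => //; apply: upol; exact: polyf_d2.
have [_ [M hM]] := ur2.
(* Integration by parts against each component of the field [tau x ^+ j.+1] (x - c), summed over i;
   the gradient of [tau] is -(2 / S) (x - c). The factor j + 1 on the right is what makes large j
   contradictory. *)
have ident j : itg O (fun x => tau x ^+ j.+1 * D x) =
    j.+1%:R * (2 / S) * itg O (fun x => u x * d2 c x * tau x ^+ j).
  pose G i x := tau x ^+ j.+1 * (x ord0 i - c ord0 i).
  have pG i : polyf (G i) by apply: polyf_mul => //; exact: polyf_exp.
  have dG i x : pderiv i (G i) x = tau x ^+ j.+1 +
      (x ord0 i - c ord0 i) * (j.+1%:R * tau x ^+ j * (- (2 / S) * (x ord0 i - c ord0 i))).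
    by rewrite (pderivM i (polyf_exp j.+1 pt) (pc i)) dcoord eqxx mulr1 pderiv_exp// dt.
  have u1 i : ucb O (fun x => pderiv i u x * G i x) by apply: ucbM => //; exact: upol.
  have u2 i : ucb O (fun x => u x * pderiv i (G i) x).
    by apply: ucbM => //; apply: upol; exact: polyf_pderiv.
  have u3 : ucb O (fun x => u x * d2 c x * tau x ^+ j) by exact: ucbM.
  have : itg O (fun x => \sum_i (pderiv i u x * G i x + u x * pderiv i (G i) x)) = 0.
    rewrite (itg_sum hc) => [|i]; last exact: ucbD.
    by apply: big1 => i _; rewrite (itgD hc)// hu// addNr.
  rewrite -(itgZ hc)// => H; apply/eqP; rewrite -subr_eq0 -H -(itgB hc); first last.
  - exact: ucbZ.
  - exact: ucbM.
  apply/eqP/eq_itg => x _.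
  have -> : tau x ^+ j.+1 * D x = \sum_i (tau x ^+ j.+1 * (pderiv i u x * (x ord0 i - c ord0 i)) +
      tau x ^+ j.+1 * u x).
    by rewrite big_split/= -mulr_sumr sumr_const card_ord /D mulrDr -mulr_natl; congr (_ + _); ring.
  have -> : j.+1%:R * (2 / S) * (u x * d2 c x * tau x ^+ j) =
      \sum_i (j.+1%:R * (2 / S) * (u x * (x ord0 i - c ord0 i) ^+ 2 * tau x ^+ j)).
    by rewrite -!(mulr_sumr, mulr_suml) .
  rewrite -sumrB; apply: eq_bigr => i _; rewrite dG /G.
  move: (tau x ^+ j.+1) (tau x ^+ j) (x ord0 i - c ord0 i) (pderiv i u x) (u x) (2 / S) (j.+1%:R : R) => *.
  ring.
pose theta := 1 - delta ^+ 2 / 2 / S.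
have th : 1 / 2 <= theta < 1.
  rewrite /theta; have : delta ^+ 2 / 2 / S <= 1 / 2.
    by rewrite ler_pdivrMr//; lra.
  have : 0 < delta ^+ 2 / 2 / S by rewrite !divr_gt0.
  by move=> h1 h2; apply/andP; split; lra.
have [th0 th1] : 0 < theta /\ theta <= 1 by move: th => /andP[]; lra.
have far x : Omega x -> delta <= `|x - z| -> tau x <= theta.
  move=> Ox xz; rewrite /tau /theta lerD2l lerN2 ler_pM2r ?invr_gt0//.
  apply: le_trans (hz x Ox); rewrite ler_pM2r//; apply: le_trans (d2_norm _ _).
  by rewrite lerXn2r ?nnegrE// ltW.
pose c1 := m * d2 c z; have c10 : 0 < c1 by rewrite mulr_gt0.
have [x1 Ix1 x1z] : exists2 x, inner O x & theta < tau x.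
  have tz : tau z = 1 by rewrite /tau /s subrr mul0r subr0.
  have /rV_contP ct := polyf_continuous (x := z) pt.
  have [|r r0 hr] := ct (1 - theta); first by rewrite subr_gt0; case/andP: th.
  have [|x Ox xz] := closure_near cz (_ : 0 < r / 2); first exact: divr_gt0.
  have [|y Iy yx] := inner_dense hc Ox (_ : 0 < r / 2); first exact: divr_gt0.
  exists y => //; have : `|y - z| < r by have := ler_normD (y - x) (x - z); rewrite subrKA; lra.
  move/hr; rewrite tz ltr_norml => /andP[]; lra.
have M0 : 0 <= M by apply: le_trans (normr_ge0 _) (hM x1 Ix1).
have A0 : 0 <= A by apply: le_trans (normr_ge0 _) (hA x1 Ix1).
pose chi x := Num.max (tau x - theta) 0.
have uchi : ucb O chi.
  split=> [x Ix|].
    apply: (@continuous_comp _ _ _ (fun x => tau x - theta) (fun t => Num.max t 0)).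
      by apply: polyf_continuous; apply: polyf_sub => //; exact: polyf_cst.
    exact: continuous_pos.
  exists 1 => x /(inner_sub hc)/t01/andP[t0 t1]; rewrite ger0_norm ?le_max ?lexx ?orbT//.
  by rewrite /chi ge_max ler01 andbT; lra.
have chi0 x : 0 <= chi x by rewrite le_max lexx orbT.
have I0 : 0 < itg O chi.
  rewrite lt_neqAle itg_ge0// andbT; apply/eqP => /esym I0.
  have := itg_eq0 hc uchi (fun x _ => chi0 x) I0 Ix1.
  by rewrite /chi max_l; lra.
have J1 j : j%:R * theta ^+ j * itg O chi <= itg O (fun x => tau x ^+ j).
  rewrite -(itgZ hc)//; apply: (itg_le hc) => //; first exact: ucbZ.
  move=> x /(inner_sub hc)/t01/andP[t0 _]; rewrite -mulrA mulrCA.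
  by apply: bernoulli_excess; rewrite ?th0.
pose v := vol O; have v0 : 0 <= v := vol_ge0 O.
(* Near z the integrand is at least [c1] times the power of [tau]; away from z, where [tau] <=
   [theta], the deficit is at most (M + c1) theta^j. *)
have low j : c1 * itg O (fun x => tau x ^+ j) - (M + c1) * theta ^+ j * v <=
    itg O (fun x => u x * d2 c x * tau x ^+ j).
  rewrite -(itgZ hc)// -(itg_cst hc) -(itgB hc); [|exact: ucbZ|exact: ucb_cst].
  apply: (itg_le hc); [by apply: ucbB; [exact: ucbZ|exact: ucb_cst]|exact: ucbM|].
  move=> x Ix; have Ox := inner_sub hc Ix; have /andP[t0 t1] := t01 x Ox.
  have tj : 0 <= tau x ^+ j by exact: exprn_ge0.
  have thj : 0 <= theta ^+ j by apply: exprn_ge0; exact: ltW.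
  have [xz|xz] := ltP `|x - z| delta.
    have h1 := hm x Ox xz; have h2 : d2 c z <= d2 c x by rewrite -subr_ge0; exact: s0.
    have h3 : c1 <= u x * d2 c x by apply: ler_pM => //; exact: ltW.
    have h4 : c1 * tau x ^+ j <= u x * d2 c x * tau x ^+ j by rewrite ler_wpM2r.
    have h5 : 0 <= (M + c1) * theta ^+ j by rewrite mulr_ge0// addr_ge0// ltW.
    lra.
  have h1 : tau x ^+ j <= theta ^+ j by rewrite lerXn2r ?nnegrE ?(ltW th0)//; exact: far.
  have h2 : (M + c1) * tau x ^+ j <= (M + c1) * theta ^+ j by rewrite ler_wpM2l// addr_ge0// ltW.
  have := hM x Ix; rewrite ler_norml => /andP[h3 _].
  have h4 : - M * tau x ^+ j <= u x * d2 c x * tau x ^+ j by rewrite ler_wpM2r.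
  lra.
have up2 j : itg O (fun x => tau x ^+ j.+1 * D x) <= A * itg O (fun x => tau x ^+ j).
  rewrite -(itgZ hc)//; apply: (itg_le hc); [exact: ucbM|exact: ucbZ|].
  move=> x Ix; have /andP[t0 t1] := t01 x (inner_sub hc Ix).
  have tj : 0 <= tau x ^+ j by exact: exprn_ge0.
  have := hA x Ix; rewrite ler_norml => /andP[_ h1]; rewrite exprS.
  have h2 : tau x * tau x ^+ j <= tau x ^+ j by rewrite ler_piMl.
  have h3 : 0 <= tau x * tau x ^+ j by rewrite mulr_ge0.
  have : tau x * tau x ^+ j * D x <= tau x * tau x ^+ j * A by rewrite ler_wpM2l.
  nra.
pose I := itg O chi.
(* The first summand lets half of the lower bound absorb the upper bound A J, leaving c1 J <= 2 (M +
   c1) v theta^j; the second makes this contradict J >= j theta^j I. *)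
pose j := (Num.bound (A * S / c1) + Num.bound (2 * (M + c1) * v / (c1 * I)))%N.
have jA : A * S <= j.+1%:R * c1.
  rewrite -ler_pdivrMr//; apply: ltW; apply: lt_le_trans (archi_boundP _) _.
    by rewrite divr_ge0 ?mulr_ge0// ltW.
  by rewrite ler_nat /j -addnS leq_addr.
have jB : 2 * (M + c1) * v < j%:R * (c1 * I).
  rewrite -ltr_pdivrMr ?mulr_gt0//; apply: lt_le_trans (archi_boundP _) _.
    by rewrite divr_ge0 ?mulr_ge0 ?addr_ge0 ?(ltW c10) ?(ltW I0)// ltW// mulr_gt0.
  by rewrite ler_nat /j leq_addl.
pose J := itg O (fun x => tau x ^+ j).
have thj : 0 < theta ^+ j by exact: exprn_gt0.
have J0 : 0 <= J by apply: itg_ge0 => x /(inner_sub hc)/t01/andP[t0 _]; exact: exprn_ge0.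
have e1 : j.+1%:R * (2 / S) * (c1 * J - (M + c1) * theta ^+ j * v) <= A * J.
  apply: le_trans (up2 j); rewrite ident ler_wpM2l//; last exact: low.
  by rewrite mulr_ge0// divr_ge0// ltW.
have e2 : c1 * J <= 2 * (M + c1) * v * theta ^+ j.
  have e3 : A * J <= j.+1%:R * (c1 / S) * J.
    by rewrite ler_wpM2r// mulrA ler_pdivlMr.
  have e4 : j.+1%:R * (2 / S) * (c1 * J - (M + c1) * theta ^+ j * v) <= j.+1%:R * (c1 / S) * J.
    exact: le_trans e1 e3.
  have k0 : 0 < j.+1%:R / S :> R by rewrite divr_gt0.
  have : j.+1%:R / S * (2 * (c1 * J - (M + c1) * theta ^+ j * v)) <= j.+1%:R / S * (c1 * J).
    have sw (a b x y : R) : a / b * (x * y) = a * (x / b) * y by ring.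
    by rewrite !sw.
  rewrite ler_pM2l// => /aux; by rewrite [2 * _ * v * _]mulrAC -!mulrA.
have e5 := J1 j; rewrite -/J -/I in e5.
have : c1 * (j%:R * theta ^+ j * I) <= 2 * (M + c1) * v * theta ^+ j.
  by apply: le_trans e2; rewrite ler_pM2l.
by rewrite sw4 ler_pM2r// leNgt jB.
Qed.

End boundary_values.

(** * Strict convexity and coercivity *)

Section strict_convexity.
Variables (R : realType) (n : nat).
Local Notation V := 'rV[R]_n.
Implicit Types (q : V -> R) (x y v : V).

(** Compare convexity at y + t v with the Taylor expansion, whose remainder is of order t^2: were
    the slope larger than the increment by D > 0, then a t small with respect to D would give a
    contradiction. *)
Lemma convex_tangent q y v : polyf q ->
  (forall t, 0 < t < 1 -> q (y + t *: v) <= (1 - t) * q y + t * q (y + v)) ->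
  dotv (grad q y) v <= q (y + v) - q y.
Proof.
move=> pq hq; have [B [r [r0 hB]]] := polyf_taylor1 y pq.
rewrite leNgt; apply/negP; rewrite -subr_gt0; set D := _ - _ => D0.
pose w := `|v| + 1; have w0 : 0 < w by rewrite ltr_wpDl.
pose b := `|B| * w ^+ 2 + 1; have b0 : 0 < b by rewrite ltr_wpDl// mulr_ge0// exprn_ge0// ltW.
pose t := Num.min (1 / 2) (Num.min (r / w) (D / b)).
have t0 : 0 < t by rewrite !lt_min !divr_gt0.
have t1 : t <= 1 / 2 by rewrite /t ge_min lexx.
have tw : t * w <= r by rewrite -ler_pdivlMr// /t !ge_min lexx !orbT.
have tb : t * b <= D by rewrite -ler_pdivlMr// /t !ge_min lexx !orbT.
have tv : `|t *: v| < r.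
  by apply: lt_le_trans tw; rewrite normrZ gtr0_norm// ltr_pM2l// ltrDl.
have := hB _ tv; rewrite dotvZ normrZ gtr0_norm// ler_norml => /andP[h1 _].
have h2 : q (y + t *: v) <= (1 - t) * q y + t * q (y + v) by apply: hq; rewrite t0; lra.
have h3 : B * (t * `|v|) ^+ 2 <= t * (t * (b - 1)).
  have -> : t * (t * (b - 1)) = `|B| * (t * w) ^+ 2 by rewrite /b; ring.
  apply: le_trans (_ : `|B| * (t * `|v|) ^+ 2 <= _); first by rewrite ler_wpM2r ?sqr_ge0 ?ler_norm.
  by rewrite ler_wpM2l// lerXn2r ?nnegrE ?mulr_ge0 ?(ltW t0) ?(ltW w0)// ler_wpM2l ?(ltW t0)// lerDl.
have h4 : t * (t * b) <= t * D by rewrite ler_pM2l.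
have h5 : 0 < t * t by exact: mulr_gt0.
move: h1 h2 h3 h4 h5; rewrite /D; move: (q (y + t *: v)) (q (y + v)) (q y) (dotv _ v) => a1 a2 a3 a4.
nra.
Qed.

(* The Hessian is at least 2 eps at a minimum of q minus its tangent at y minus
   eps |x - y|^2, and for small eps this minimum is not on the boundary of the ball. *)
Lemma positive_hessian_point q y rho : polyf q -> 0 < rho ->
  (forall v, v != 0 -> `|v| <= rho -> dotv (grad q y) v < q (y + v) - q y) ->
  exists2 x, `|x - y| < rho &
    forall v, v != 0 -> 0 < \sum_i \sum_j v ord0 i * v ord0 j * pderiv i (pderiv j q) x.
Proof.
move=> pq rho0 hq; pose g := grad q y.
pose A x := - q y + \sum_i (- g ord0 i) * (x ord0 i - y ord0 i).
have pA : polyf A.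
  apply: polyf_add; first exact: polyf_cst.
  apply: polyf_sum => i; apply: polyf_mul; first exact: polyf_cst.
  by apply: polyf_sub; [exact: polyf_coord|exact: polyf_cst].
have AE v : A (y + v) = - q y - dotv g v.
  rewrite /A /dotv -sumrN; congr (_ + _); apply: eq_bigr => i _.
  by rewrite !mxE [y ord0 i + _]addrC addrK mulNr.
pose Q x := q x + A x.
have pQ : polyf Q by exact: polyf_add.
have Qpos v : v != 0 -> `|v| <= rho -> 0 < Q (y + v).
  by move=> v0 vr; rewrite /Q AE; have := hq v v0 vr; rewrite -/g; lra.
have Q0 : Q y = 0 by rewrite /Q -{2}(addr0 y) AE -(scale0r 0) dotvZ mul0r subr0 subrr.
pose S := [set x : V | `|x - y| = rho]; pose Bl := [set x : V | `|x - y| <= rho].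
have nc : continuous (fun x : V => `|x - y|).
  apply: (@lipschitz_continuous _ _ _ 1) => x z.
  by rewrite mul1r (le_trans (ler_dist_dist _ _))// opprB addrA subrK.
have bBl : bounded_set Bl.
  exists (`|y| + rho); split; first exact: num_real.
  move=> t ht x /= xe; have := ler_normD (x - y) y; rewrite subrK; move: xe; rewrite /Bl /=; lra.
have cBl : compact Bl.
  apply: bounded_closed_compact => //.
  by apply: (preimage_closed _ (@closed_le _ rho)) => x _; exact: nc.
have cS : compact S.
  apply: bounded_closed_compact; first last.
    rewrite (_ : S = (fun x : V => `|x - y|) @^-1` [set rho])//.
    apply: closed_comp => [x _|]; first exact: nc.
    exact: (accessible_closed_set1 (hausdorff_accessible (@Rhausdorff R))).
  have [M [Mr hM]] := bBl; exists M; split=> // t Mt x Sx; apply: hM => //.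
  by rewrite /Bl /=; move: Sx; rewrite /S /= => ->.
have [m m0 hm] : exists2 m, 0 < m & forall x, S x -> m <= Q x.
  have [[x0 Sx0]|S0] := pselect (S !=set0); last by exists 1 => // x Sx; case: S0; exists x.
  have [|c /set_mem Sc cmin] := @EVT_min_rV R n Q S (ex_intro _ x0 Sx0) cS.
    by apply: continuous_subspaceT => x; exact: polyf_continuous.
  exists (Q c) => [|x Sx]; last by apply: cmin; rewrite inE.
  have := Qpos (c - y); rewrite [y + _]addrC subrK; apply; last by move: Sc; rewrite /S/= => ->.
  by rewrite -normr_gt0; move: Sc; rewrite /S /= => ->.
pose k := n%:R * rho ^+ 2; have k0 : 0 <= k by rewrite mulr_ge0// sqr_ge0.
(* k bounds [d2 y] on the sphere, so eps k < m and [w] is positive there, while w y = 0: the minimum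
   is interior. *)
pose eps := m / (k + 1); have eps0 : 0 < eps by rewrite divr_gt0// ltr_wpDl.
pose w x := Q x + (- eps) * d2 y x.
have pw : polyf w.
  by apply: polyf_add => //; apply: polyf_mul; [exact: polyf_cst|exact: polyf_d2].
have d2y : d2 y y = 0 by rewrite /d2 big1// => i _; rewrite subrr expr0n.
have wy : w y = 0 by rewrite /w Q0 d2y mulr0 addr0.
have By : Bl y by rewrite /Bl /= subrr normr0 ltW.
have [|x /set_mem Bx xmin] := @EVT_min_rV R n w Bl (ex_intro _ y By) cBl.
  by apply: continuous_subspaceT => x; exact: polyf_continuous.
have xr : `|x - y| < rho.
  rewrite lt_neqAle [X in _ && X]Bx andbT; apply/eqP => xS.
  have : w x <= w y by apply: xmin; rewrite inE /Bl /= subrr normr0 ltW.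
  have h1 : m <= Q x by exact: hm.
  have h2 : d2 y x <= k by rewrite (le_trans (d2_le _ _))// xS.
  have h3 : eps * d2 y x <= eps * k by rewrite ler_pM2l.
  have h4 : eps * (k + 1) = m by rewrite /eps divfK// gt_eqF// ltr_wpDl.
  rewrite wy /w; lra.
exists x => // v v0.
have vp : 0 < `|v| by rewrite normr_gt0.
have r0 : 0 < (rho - `|x - y|) / `|v| by rewrite divr_gt0// subr_gt0.
have := @polyf_hess_ge0 _ _ w x v _ pw r0.
move=> /(_ _)/wrap[t /andP[t0 tr]|hw].
  have tv : t * `|v| < rho - `|x - y| by rewrite -ltr_pdivlMr.
  have b1 : w x <= w (x + t *: v).
    apply: xmin; rewrite inE /Bl /=; have := ler_normD (x - y) (t *: v).
    by rewrite normrZ gtr0_norm// addrAC; lra.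
  have b2 : w x <= w (x - t *: v).
    apply: xmin; rewrite inE /Bl /=; have := ler_normB (x - y) (t *: v).
    by rewrite normrZ gtr0_norm// addrAC; lra.
  lra.
have dw i j : pderiv i (pderiv j w) x = pderiv i (pderiv j q) x - 2 * eps * (i == j)%:R.
  have dA : pderiv j A = fun=> - g ord0 j.
    apply/funext => z; rewrite /A (pderivD j (polyf_cst n _)); last first.
      apply: polyf_sum => i'; apply: polyf_mul; first exact: polyf_cst.
      by apply: polyf_sub; [exact: polyf_coord|exact: polyf_cst].
    rewrite pderiv_cst add0r pderiv_sum => [|l]; last first.
      apply: polyf_mul; first exact: polyf_cst.
      by apply: polyf_sub; [exact: polyf_coord|exact: polyf_cst].
    have dl l : pderiv j (fun z => - g ord0 l * (z ord0 l - y ord0 l)) z = - g ord0 l * (j == l)%:R.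
      rewrite (pderivM j (polyf_cst n _) (polyf_add (polyf_coord R l) (polyf_cst n (- y ord0 l)))).
      rewrite (pderivD j (polyf_coord R l) (polyf_cst n (- y ord0 l))) !pderiv_cst pderiv_coord.
      by rewrite mulr0 !addr0.
    rewrite (eq_bigr _ (fun l _ => dl l)) (bigD1 j)//= eqxx mulr1 big1 ?addr0// => l lj.
    by rewrite eq_sym (negbTE lj) mulr0.
  have dW : pderiv j w = fun z => (pderiv j q z + (- g ord0 j)) + (- (2 * eps)) * (z ord0 j - y ord0 j).
    apply/funext => z; rewrite /w (pderivD j pQ (polyf_mul (polyf_cst n _) (polyf_d2 y))).
    rewrite (pderivM j (polyf_cst n _) (polyf_d2 y)) pderiv_cst pderiv_d2 mulr0 addr0.
    by rewrite /Q (pderivD j pq pA) dA; ring.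
  have pl := polyf_add (polyf_coord R j) (polyf_cst n (- y ord0 j)).
  rewrite dW (pderivD i (polyf_add (polyf_pderiv j pq) (polyf_cst n _)) (polyf_mul (polyf_cst n _) pl)).
  rewrite (pderivD i (polyf_pderiv j pq) (polyf_cst n _)) (pderivM i (polyf_cst n _) pl).
  rewrite (pderivD i (polyf_coord R j) (polyf_cst n (- y ord0 j))) !pderiv_cst pderiv_coord.
  ring.
have E : \sum_i \sum_j v ord0 i * v ord0 j * pderiv i (pderiv j w) x =
    \sum_i \sum_j v ord0 i * v ord0 j * pderiv i (pderiv j q) x - 2 * eps * d2 0 v.
  have -> : d2 0 v = \sum_i v ord0 i ^+ 2 by apply: eq_bigr => i _; rewrite mxE subr0.
  rewrite mulr_sumr -sumrB; apply: eq_bigr => i _.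
  rewrite -[X in _ = _ - X](_ : \sum_j v ord0 i * v ord0 j * (2 * eps * (i == j)%:R) = _).
    by rewrite -sumrB; apply: eq_bigr => j _; rewrite dw mulrBr.
  rewrite (bigD1 i)//= eqxx mulr1 big1 ?addr0 => [|j ji]; first by ring.
  by rewrite eq_sym (negbTE ji) !mulr0.
have dv : 0 < d2 0 v by exact: d2_gt0.
rewrite E subr_ge0 in hw; apply: lt_le_trans hw.
by apply: mulr_gt0 => //; exact: mulr_gt0.
Qed.

End strict_convexity.

Section splines.
Variables (R : realType) (n K : nat).
Local Notation V := 'rV[R]_n.
Variables (Omega : set V) (C O : 'I_K -> set V) (N : set V).
Hypothesis hc : cells Omega C O N.
Implicit Types (f g p u v w : V -> R) (x y z : V).

Let oD : open Omega. Proof. exact (cells_domain hc). Qed.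
Let cC : forall i, closed (C i). Proof. exact (cells_closed hc). Qed.
Let oO : forall i, open (O i). Proof. exact (cells_open hc). Qed.

Lemma spl_lin a v w : spl Omega C v -> spl Omega C w -> spl Omega C (fun y => a * v y + w y).
Proof.
move=> [Cv pv] [Cw pw]; split.
  by have [Ca _] := C1_cst a oD; have [Cav _] := C1_M oD Ca Cv; have [] := C1_D oD Cav Cw.
move=> i; have [q pq vq] := pv i; have [r pr wr] := pw i.
exists (fun x => a * q x + r x); last by move=> x Cx; rewrite vq// wr.
by apply: polyf_add => //; apply: polyf_mul => //; exact: polyf_cst.
Qed.

Lemma vanishing_lin a v w : vanishing Omega v -> vanishing Omega w ->
  vanishing Omega (fun y => a * v y + w y).
Proof. by move=> v0 w0 x cx Ox; rewrite v0// w0// mulr0 addr0. Qed.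

Lemma spl0 : spl Omega C (fun=> 0).
Proof.
by split=> [|i]; [have [] := C1_cst (0 : R) oD|exists (fun=> 0) => //; exact: polyf_cst].
Qed.

(** Differentiability is only known inside Omega; continuity up to the boundary comes from the
    polynomials on the closed cells, those not containing x0 being at a positive distance from
    it. *)
Lemma spl_near u x0 e : spl Omega C u -> closure Omega x0 -> 0 < e ->
  exists2 r, 0 < r & forall x, closure Omega x -> `|x - x0| < r -> `|u x - u x0| < e.
Proof.
move=> su cx0 e0; have [q [pq uq]] := spl_poly su.
have [|i|r r0 hr] := @common_radius R K
    (fun i r => forall x, C i x -> `|x - x0| < r -> `|u x - u x0| < e).
- by move=> i r r' /andP[_ rr'] h x Cx xr; apply: h => //; exact: lt_le_trans rr'.
- have [Cx0|nCx0] := pselect (C i x0).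
    have /rV_contP/(_ _ e0)[r r0 hr] := polyf_continuous (x := x0) (pq i).
    by exists r => // x Cx xr; rewrite !(uq i)//; exact: hr.
  have : open (~` C i) by apply: closed_openC; exact: cC.
  rewrite openE => /(_ x0 nCx0)/rV_nbhsP[r r0 hr]; exists r => // x Cx xr.
  by exfalso; apply: (hr x xr).
- exists r => // x /(cells_cover hc)[i Cx]; exact: (hr i).
Qed.

(** A positive value at a boundary point x0 persists near a point z touched by an exterior ball and
    close to x0, which [boundary_not_positive] excludes. For a negative value the argument applies
    to -u. *)
Lemma H10_vanishing u : spl Omega C u -> H10 Omega u -> vanishing Omega u.
Proof.
move=> su hu.
have bO : bounded_set Omega.
  have [M M0 hM] := domain_bounded hc; exists M; split; first exact: num_real.
  by move=> t Mt x /hM h; exact: le_trans h (ltW Mt).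
have main w : spl Omega C w -> parts_formula O w ->
    forall x0, closure Omega x0 -> ~ Omega x0 -> ~ 0 < w x0.
  move=> sw hw x0 cx0 nx0 w0.
  have [|r r0 hr] := spl_near sw cx0 (_ : 0 < w x0 / 2); first exact: divr_gt0.
  have [|z [c [cz zx0 dz hz]]] := @exterior_ball _ _ Omega x0 (r / 2) oD bO (cells_neq0 hc)
    (cells_convex hc) cx0 nx0; first exact: divr_gt0.
  apply: (@boundary_not_positive _ _ _ _ _ _ _ hc w z c (w x0 / 2) (r / 2)) => //.
  - exact: (spl_bC1 hc).
  - exact: divr_gt0.
  - exact: divr_gt0.
  - move=> x Ox xz.
    have := hr x (subset_closure Ox); have := ler_normD (x - z) (z - x0); rewrite subrKA => h1 h2.
    have := h2 _; rewrite ltr_norml => /(_ _)/wrap[|/andP[]]; lra.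
have pu := H10_parts hc (spl_bC1 hc su) hu.
(* -u is taken in the form [-1 * u y + 0], that of [spl_lin]; its integration by parts formula
   follows from that of u by linearity. *)
have sN := spl_lin (-1) su spl0.
have pN : parts_formula O (fun y => -1 * u y + 0).
  move=> i G pG; have bu := spl_bC1 hc su.
  have uu := ucbM (bC1_ucb hc bu) (bC1_ucb hc (polyf_bC1 hc (polyf_pderiv i pG))).
  have du := ucbM (bC1_pucb hc i bu) (bC1_ucb hc (polyf_bC1 hc pG)).
  transitivity (itg O (fun x => -1 * (pderiv i u x * G x))).
    apply: eq_itg => x /(inner_sub hc) Ox.
    have [C1 d1] := C1_cst (-1 : R) oD; have [C2 d2] := C1_M oD C1 bu.1.
    have [C3 d3] := C1_cst (0 : R) oD; have [_ ->//] := C1_D oD C2 C3.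
    by rewrite d2// d1// d3// mulr0 !addr0 mulrA.
  rewrite (itgZ hc)// pu// mulN1r opprK -(itgN hc); last first.
    exact: ucbM (bC1_ucb hc (spl_bC1 hc sN)) (bC1_ucb hc (polyf_bC1 hc (polyf_pderiv i pG))).
  by apply: eq_itg => x _; ring.
move=> x0 cx0 nx0; apply/eqP; rewrite eq_le !leNgt; apply/andP; split; apply/negP => h.
  exact: main h.
by apply: (main _ sN pN x0) => //; rewrite addr0 mulN1r oppr_gt0.
Qed.

Lemma hess_cell u q k x i j : O k x -> (forall y, O k y -> u y = q y) ->
  hess u x i j = pderiv i (pderiv j q) x.
Proof.
move=> Ox uq; rewrite mxE; have ok := @oO k.
by apply: (pderiv_congr _ ok) => // y Oy; exact: (pderiv_congr _ ok).
Qed.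

Lemma cell_poly u k : spl Omega C u -> exists2 q, polyf q & forall x, O k x -> u x = q x.
Proof. by move=> su; exact: (spl_pw hc su k). Qed.

Lemma cell_ball k x : O k x -> exists2 r, 0 < r & forall y, `|y - x| < r -> O k y.
Proof. by move=> Ox; have := @oO k; rewrite openE => /(_ x Ox)/rV_nbhsP. Qed.

Lemma hess_psd u x (v : V) : spl Omega C u -> strictly_convex Omega u -> inner O x ->
  0 <= qform (hess u x) v.
Proof.
move=> su cu [k Ox]; have [q pq uq] := cell_poly k su; have [r r0 hr] := cell_ball Ox.
have -> : qform (hess u x) v = \sum_i \sum_j v ord0 i * v ord0 j * pderiv i (pderiv j q) x.
  apply: eq_bigr => i _; apply: eq_bigr => j _; rewrite (hess_cell _ _ Ox uq); ring.
have [->|v0] := eqVneq v 0.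
  by apply: sumr_ge0 => i _; apply: sumr_ge0 => j _; rewrite mxE !mul0r.
have vp : 0 < `|v| by rewrite normr_gt0.
apply: (@polyf_hess_ge0 _ _ q x v (r / `|v|)) => //; first exact: divr_gt0.
move=> t /andP[t0]; rewrite ltr_pdivlMr// => tr.
have b1 : O k (x + t *: v) by apply: hr; rewrite addrAC subrr add0r normrZ gtr0_norm.
have b2 : O k (x - t *: v) by apply: hr; rewrite addrAC subrr add0r normrN normrZ gtr0_norm.
rewrite -!uq//.
have := cu (x + t *: v) (x - t *: v) (1 / 2) (inner_sub hc (ex_intro _ k b1))
  (inner_sub hc (ex_intro _ k b2)).
have -> : (1 / 2) *: (x + t *: v) + (1 - 1 / 2) *: (x - t *: v) = x.
  by apply/rowP => i; rewrite !mxE; field.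
move=> /(_ _)/wrap[|h].
  rewrite -subr_eq0 opprD opprK addrACA subrr add0r -scalerDl scaler_eq0 negb_or v0 andbT.
  by rewrite gt_eqF// addr_gt0.
by have := h _; lra.
Qed.

(** Strict convexity allows the Hessian to degenerate at points, as for a fourth power;
    [positive_hessian_point] finds a point of definiteness in every small ball inside a cell. *)
Lemma hess_pd_dense u x e : spl Omega C u -> strictly_convex Omega u -> Omega x -> 0 < e ->
  exists y, [/\ inner O y, `|y - x| < e & forall v : V, v != 0 -> 0 < qform (hess u y) v].
Proof.
move=> su cu Ox e0; have [|y [k Oy] yx] := inner_dense hc Ox (_ : 0 < e / 2); first exact: divr_gt0.
have [q pq uq] := cell_poly k su; have [r r0 hr] := cell_ball Oy.
pose rho := Num.min (r / 2) (e / 2).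
have rho0 : 0 < rho by rewrite lt_min !divr_gt0.
have rr : rho < r by rewrite gt_min; apply/orP; left; lra.
have re : rho <= e / 2 by rewrite ge_min lexx orbT.
have ball (v : V) t : `|v| <= rho -> 0 <= t <= 1 -> O k (y + t *: v).
  move=> vr /andP[t0 t1]; apply: hr; rewrite addrAC subrr add0r normrZ ger0_norm//.
  by apply: le_lt_trans rr; apply: le_trans vr; rewrite ler_piMl.
have strict (v : V) t : v != 0 -> `|v| <= rho -> 0 < t < 1 ->
    q (y + t *: v) < (1 - t) * q y + t * q (y + v).
  move=> v0 vr t01; have /andP[t0 t1] := t01.
  have B0 := ball v 0 vr; have B1 := ball v 1 vr; have Bt := ball v t vr.
  rewrite scale0r addr0 in B0; rewrite scale1r in B1.
  rewrite -!uq; [|by apply: B1; lra|by apply: B0; lra|by apply: Bt; lra].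
  have := cu (y + v) y t _ _ _ t01.
  rewrite (_ : t *: (y + v) + (1 - t) *: y = y + t *: v); last first.
    by apply/rowP => i; rewrite !mxE; ring.
  move=> H; rewrite [ltRHS]addrC; apply: H.
  - by apply: (inner_sub hc); exists k; apply: B1; lra.
  - by apply: (inner_sub hc); exists k; apply: B0; lra.
  - by rewrite -subr_eq0 addrAC subrr add0r.
have [|x' x'y hx'] := @positive_hessian_point _ _ q y rho pq rho0.
  move=> v v0 vr.
  (* The tangent inequality is strict at v because it holds weakly at v / 2 and the midpoint
     inequality between y and y + v is strict. *)
  have h2 : 2^-1 *: v != 0 by rewrite scaler_eq0 negb_or v0 invr_eq0 pnatr_eq0.
  have vr2 : `|2^-1 *: v| <= rho.
    by apply: le_trans vr; rewrite normrZ ger0_norm ?invr_ge0// ler_piMl// invf_le1// ler1n.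
  have := @convex_tangent _ _ q y (2^-1 *: v) pq (fun t ht => ltW (strict _ t h2 vr2 ht)).
  rewrite dotvZ => h.
  have := strict v 2^-1 v0 vr; rewrite invr_gt0 ltr0n invf_lt1 ?ltr1n//= => /(_ isT).
  lra.
exists x'; have Ox' : O k x' by apply: hr; exact: lt_trans rr.
split; first by exists k.
  by have := ler_normD (x' - y) (y - x); rewrite subrKA; lra.
move=> v v0; have -> : qform (hess u x') v =
    \sum_i \sum_j v ord0 i * v ord0 j * pderiv i (pderiv j q) x'.
  apply: eq_bigr => i _; apply: eq_bigr => j _; rewrite (hess_cell _ _ Ox' uq); ring.
exact: hx'.
Qed.

Lemma spl_dense_eq0 p : spl Omega C p -> (forall x, inner O x -> p x = 0) ->
  forall x, closure Omega x -> p x = 0.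
Proof.
move=> sp p0 x cx; apply/eqP; rewrite -normr_eq0; apply: contraT => px.
have p1 : 0 < `|p x| by rewrite lt0r px normr_ge0.
have [r r0 hr] := spl_near sp cx p1.
have [|y Oy yx] := closure_near cx (_ : 0 < r / 2); first exact: divr_gt0.
have [|z Iz zy] := inner_dense hc Oy (_ : 0 < r / 2); first exact: divr_gt0.
have := hr z (subset_closure (inner_sub hc Iz)).
have := ler_normD (z - y) (y - x); rewrite subrKA => h1 h2.
by have := h2 _; rewrite p0// sub0r normrN => /(_ _)/wrap[|]; lra.
Qed.

Lemma spl_itg_sqr_eq0 p : spl Omega C p -> itg O (fun x => p x ^+ 2) = 0 ->
  forall x, closure Omega x -> p x = 0.
Proof.
move=> sp I0; apply: spl_dense_eq0 => // x Ix; apply/eqP; rewrite -sqrf_eq0; apply/eqP.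
have up := bC1_ucb hc (spl_bC1 hc sp).
apply: (itg_eq0 hc _ _ I0 Ix) => [|y _]; last exact: sqr_ge0.
by rewrite (_ : (fun x => _) = (fun x => p x * p x)); [exact: ucbM|apply/funext => y; rewrite expr2].
Qed.

(** The function p^2 x_i vanishes on the boundary and, as D_i p = 0, its i-th derivative is p^2; so
    p^2 has integral zero. A single direction is enough. *)
Lemma spl_pderiv_eq0 p i : spl Omega C p -> vanishing Omega p ->
  (forall x, inner O x -> pderiv i p x = 0) -> forall x, closure Omega x -> p x = 0.
Proof.
move=> sp p0 dp; have [q [pq uq]] := spl_poly sp; have pp := spl_pw hc sp.
apply: spl_itg_sqr_eq0 => //.
pose F x := p x * (p x * x ord0 i).
pose w := F \_ Omega.
have [L L0 wL] : exists2 L, 0 <= L & forall x y, `|w x - w y| <= L * `|x - y|.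
  apply: (zero_lipschitz_polyf hc) => j; exists (fun x => q j x * (q j x * x ord0 i)); split.
  - by apply: polyf_mul => //; apply: polyf_mul => //; exact: polyf_coord.
  - by move=> x Cx _; rewrite /F (uq j).
  - move=> x Cx Ox; rewrite -uq// p0 ?mul0r//.
    by apply/(cells_cover hc); exists j.
have w0 x : ~ Omega x -> w x = 0 by exact: patch_out.
have [B wB] := lipschitz_bounded hc wL w0.
apply: (@itg_derive0 _ _ _ _ _ _ _ hc w _ (delta_mx ord0 i) (L * `|delta_mx ord0 i : V|) B) => //.
- exact: lipschitz_measurable wL.
- move=> x s /andP[s0 _]; apply: le_trans (wL _ _) _.
  by rewrite addrAC subrr add0r normrZ (gtr0_norm s0) mulrA mulrAC.
- move=> x Ix; apply: (@near_eq_is_derive _ _ _ F).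
    by apply: (near_inner hc Ix) => y Oy; rewrite /w patch_in.
  have d1 : is_derive x (delta_mx ord0 i) p 0.
    by rewrite -(dp x Ix); apply: derivableP; exact: (pw_derivable hc).
  have d2 := is_derive_coord i x (delta_mx ord0 i).
  rewrite mxE !eqxx in d2.
  have d3 := is_deriveM d1 (is_deriveM d1 d2).
  apply: is_derive_eq d3 _; rewrite /GRing.scale /= !mulr0 !addr0 mulr1.
  by rewrite expr2.
Qed.

Lemma cof_form_ge0 u p x : spl Omega C u -> strictly_convex Omega u -> inner O x ->
  0 <= qform (cofmx (hess u x)) (grad p x).
Proof. by move=> su cu Ix; apply: qform_cofmx_ge0 => y; exact: hess_psd. Qed.

Lemma cof_form_pw u p i j : spl Omega C u -> spl Omega C p -> pw O (fun x => cofmx (hess u x) i j * pderiv i p x * pderiv j p x).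
Proof.
move=> su sp; apply: (pwM); last by apply: (pw_pderiv hc); exact: (spl_pw hc).
apply: pwM; last by apply: (pw_pderiv hc); exact: (spl_pw hc).
by apply: pw_cofmx => a b; apply: (pw_hess hc); exact: (spl_pw hc).
Qed.

Lemma cof_form_definite u p (i0 : 'I_n) : spl Omega C u -> strictly_convex Omega u ->
  spl Omega C p -> vanishing Omega p ->
  itg O (fun x => qform (cofmx (hess u x)) (grad p x)) = 0 ->
  forall x, closure Omega x -> p x = 0.
Proof.
move=> su cu sp p0 I0.
have uF : ucb O (fun x => qform (cofmx (hess u x)) (grad p x)).
  rewrite (_ : (fun x => _) = fun x => \sum_i \sum_j cofmx (hess u x) i j * pderiv i p x * pderiv j p x).
    by apply: ucb_sum => i; apply: ucb_sum => j; apply: (pw_ucb hc); exact: cof_form_pw.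
  by apply/funext => x; apply: eq_bigr => i _; apply: eq_bigr => j _; rewrite (gradE p x i) (gradE p x j).
have z := itg_eq0 hc uF (fun x Ix => cof_form_ge0 p su cu Ix) I0.
have [Cp _] := sp.
apply: (spl_pderiv_eq0 (i := i0)) => // x Ix; have Ox := inner_sub hc Ix.
apply/eqP; rewrite -normr_eq0; apply: contraT => px.
have p1 : 0 < `|pderiv i0 p x| by rewrite lt0r px normr_ge0.
have /rV_contP/(_ _ p1)[r r0 hr] := C1_pderiv_continuous (i := i0) Cp Ox.
have [y [Iy yx hy]] := hess_pd_dense su cu Ox r0.
have gy : grad p y = 0.
  apply/eqP; apply: contraT => g0.
  by have := qform_cofmx_gt0 hy g0; rewrite z// ltxx.
have := hr y yx; rewrite -(gradE p y i0) gy mxE sub0r normrN ltxx; by [].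
Qed.

End splines.

(** * From triangulations to cells, and the finite dimension of the spline space *)

Section from_triangulation.
Variables (R : realType) (n : nat).
Local Notation V := 'rV[R]_n.
Variables (Omega : set V) (T : {fset {fset V}}).
Implicit Types (v w : V -> R).

Lemma convex_set_segment : convex_set Omega ->
  forall x y (t : R), Omega x -> Omega y -> 0 <= t <= 1 -> Omega (x + t *: (y - x)).
Proof.
move=> cO x y t Ox Oy /andP[t0 t1].
have := cO y x (Itv01 t0 t1); rewrite !inE => /(_ Oy Ox).
by rewrite /conv /= /GRing.scale /=; congr (Omega _); apply/rowP => i; rewrite !mxE /= /unstable.onem; ring.
Qed.

Lemma triangulation_cells : open Omega -> Omega !=set0 -> bounded_set Omega -> convex_set Omega ->
  triangulation Omega T -> exists (K : nat) (C O : 'I_K -> set V) (N : set V),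
    cells Omega C O N /\ forall i, exists2 s, s \in T & C i = hull s.
Proof.
move=> oO nO bO cO [sT _ cov]; have [w Ow] := nO.
have seg := convex_set_segment cO.
pose s (i : 'I_#|` T|) := nth fset0 T i.
have sin i : s i \in T by rewrite /s mem_nth.
have ex i : exists ON : set V * set V,
    [/\ closed (hull (s i)), open ON.1, ON.1 `<=` hull (s i),
      (forall x, hull (s i) x -> forall e, 0 < e -> exists2 y, ON.1 y & `|y - x| < e) &
      [/\ measurable ON.2, lebesgue_rV R n ON.2 = 0%E & hull (s i) `\` ON.1 `<=` ON.2]].
  by case: (simplex_cell (sT _ (sin i))) => O1 [N1 h]; exists (O1, N1).
pose O i := (sval (cid (ex i))).1; pose N i := (sval (cid (ex i))).2.
have h i : [/\ closed (hull (s i)), open (O i), O i `<=` hull (s i),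
      (forall x, hull (s i) x -> forall e, 0 < e -> exists2 y, O i y & `|y - x| < e) &
      [/\ measurable (N i), lebesgue_rV R n (N i) = 0%E & hull (s i) `\` O i `<=` N i]].
  by rewrite /O /N; case: cid.
have hcov x : closure Omega x <-> exists i, hull (s i) x.
  rewrite cov; split=> [[t /= tT hx]|[i hx]]; last by exists (s i) => //=; exact: sin.
  have it : (index t T < #|` T|)%N by rewrite index_mem.
  by exists (Ordinal it); rewrite /s /= nth_index.
exists #|` T|, (fun i => hull (s i)), O, (\big[setU/set0]_i N i); split; last by move=> i; exists (s i).
have nN i : measurable (N i) /\ lebesgue_rV R n (N i) = 0%E by have [_ _ _ _ []] := h i.
split=> //.
- have [M [Mr hM]] := bO; exists (`|M| + 1) => [|x cx]; first by rewrite addr_ge0.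
  rewrite leNgt; apply/negP => ux.
  have [|x' Ox' xx'] := closure_near cx (_ : 0 < `|x| - (`|M| + 1)); first by rewrite subr_gt0.
  have h1 : `|x'| <= `|M| + 1 by apply: hM => //; have := ler_norm M; lra.
  have := ler_normD (x - x') x'; rewrite subrK (distrC x); lra.
- by move=> i; have [] := h i.
- by move=> i; have [] := h i.
- move=> i x Oix; have [_ oi sub _ _] := h i; split; first exact: sub.
  move: oi; rewrite openE => /(_ x Oix)/rV_nbhsP[r r0 hr].
  (* The open cells must lie in Omega and not only in its closure: x is pushed slightly away from an
     interior point w while staying in the cell, which puts x strictly inside a segment from w to a
     point of the closure. *)
  pose D := `|x - w| + 1; have D0 : 0 < D by rewrite ltr_wpDl.
  pose t := r / 2 / D; have t0 : 0 < t by rewrite !divr_gt0.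
  have cy : closure Omega (x + t *: (x - w)).
    apply/hcov; exists i; apply: sub; apply: hr.
    rewrite addrAC subrr add0r normrZ gtr0_norm// /t -mulrA.
    have : D^-1 * `|x - w| <= 1 by rewrite mulrC ler_pdivrMr// mul1r lerDl.
    have : 0 <= D^-1 * `|x - w| by rewrite mulr_ge0// invr_ge0 ltW.
    nra.
  have -> : x = w + (1 + t)^-1 *: (x + t *: (x - w) - w).
    by apply/rowP => j; rewrite !mxE; field; rewrite gt_eqF// addr_gt0.
  apply: convex_closure_segment => //; rewrite invr_ge0 addr_ge0 ?(ltW t0)//=.
  by rewrite invf_lt1 ?addr_gt0// ltrDl.
- by move=> i; have [] := h i.
- by have [] := bigsetU_null (index_enum _) nN.
- by have [] := bigsetU_null (index_enum _) nN.
- move=> i x Cx nOx; rewrite -bigcup_seq; exists i; first by rewrite /= mem_index_enum.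
  by have [_ _ _ _ [_ _]] := h i; apply.
Qed.

Lemma spline_lin d a v w : open Omega -> spline Omega T d v -> spline Omega T d w ->
  spline Omega T d (fun y => a * v y + w y).
Proof.
move=> oO [Cv pv] [Cw pw]; split.
  by have [Ca _] := C1_cst a oO; have [Cav _] := C1_M oO Ca Cv; have [] := C1_D oO Cav Cw.
move=> s sT; have [c hc] := pv s sT; have [e he] := pw s sT.
exists (fun k => a * c k + e k) => x hx; rewrite hc// he// mulr_sumr -big_split/=.
by apply: eq_bigr => k _; rewrite mulrDl mulrA.
Qed.

Lemma spline0_fun d : open Omega -> spline Omega T d (fun=> 0).
Proof.
move=> oO; split; first by have [] := C1_cst (0 : R) oO.
by move=> s _; exists (fun=> 0) => x _; rewrite big1// => k _; rewrite mul0r.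
Qed.

Lemma spline_spl K (C : 'I_K -> set V) d v : (forall i, exists2 s, s \in T & C i = hull s) ->
  spline Omega T d v -> spl Omega C v.
Proof.
move=> hC [Cv pv]; split=> // i; have [s sT ->] := hC i; have [c hc] := pv s sT.
exists (fun x => \sum_(a <- multis n d) c a * \prod_i x ord0 i ^+ a i) => //.
apply: polyf_sum => a; apply: polyf_mul; first exact: polyf_cst.
by apply: polyf_prod => j; apply: polyf_exp; exact: polyf_coord.
Qed.

(** The [e j] are dual to the degrees of freedom; a spline f and the combination of the [e j] with
    coefficients [lam j f] have the same degrees of freedom, hence agree on the closure. *)
Lemma unisolvent_span d N (lam : 'I_N -> (V -> R) -> R) : open Omega -> unisolvent Omega T d lam ->
  exists e : 'I_N -> V -> R, forall f, spline Omega T d f ->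
    exists c, forall x, closure Omega x -> f x = lincomb e c x.
Proof.
move=> oO [lin un].
pose e j := sval (cid (un (fun i => (i == j)%:R))).
have he j : [/\ spline Omega T d (e j), (forall i, lam i (e j) = (i == j)%:R) &
    forall w, spline Omega T d w -> (forall i, lam i w = (i == j)%:R) -> {in closure Omega, w =1 e j}].
  by rewrite /e; case: cid.
have Se j : spline Omega T d (e j) by have [] := he j.
have s0 := spline0_fun d oO.
have l0 i : lam i (fun=> 0) = 0.
  have := lin i (-1) _ _ s0 s0; rewrite (_ : (fun y => _) = fun=> 0); last first.
    by apply/funext => y; rewrite mulr0 addr0.
  by rewrite mulN1r addNr.
have Sl c : spline Omega T d (lincomb e c).
  by apply: (@lincomb_closed _ _ (spline Omega T d)) => // a f g; exact: spline_lin.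
have lamc i c : lam i (lincomb e c) = c ord0 i.
  have H (r : seq 'I_N) : spline Omega T d (fun x => \sum_(j <- r) c ord0 j * e j x) /\
      lam i (fun x => \sum_(j <- r) c ord0 j * e j x) = \sum_(j <- r) c ord0 j * (i == j)%:R.
    elim: r => [|j r [Sr Lr]].
      rewrite big_nil (_ : (fun x => _) = fun=> 0)//.
      by apply/funext => x; rewrite big_nil.
    rewrite (_ : (fun x => _) = fun x => c ord0 j * e j x + \sum_(j <- r) c ord0 j * e j x); last first.
      by apply/funext => x; rewrite big_cons.
    by split; [exact: spline_lin|rewrite lin// Lr big_cons; have [_ -> _] := he j].
  have [_ ->] := H (index_enum _).
  by rewrite (bigD1 i)//= eqxx mulr1 big1 ?addr0// => j ji; rewrite eq_sym (negbTE ji) mulr0.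
exists e => f sf; exists (\row_j lam j f) => x cx.
have [v [sv lv uv]] := un (fun i => lam i f).
rewrite (uv f sf) ?inE// (uv (lincomb e _)) ?inE// => i.
by rewrite lamc mxE.
Qed.

End from_triangulation.

(** * The iteration in coordinates *)

Section linear_coordinates.
Variables (R : realType) (n m : nat).
Local Notation V := 'rV[R]_n.
Implicit Types (x y c : 'rV[R]_m) (b : 'I_m -> V -> R).

Lemma lincomb_lin b k x y : lincomb b (k *: x + y) = fun z => k * lincomb b x z + lincomb b y z.
Proof.
apply/funext => z; rewrite /lincomb mulr_sumr -big_split/=.
by apply: eq_bigr => j _; rewrite !mxE mulrDl mulrA.
Qed.

Lemma lincomb_delta b k : lincomb b (delta_mx ord0 k) = b k.
Proof.
apply/funext => z; rewrite /lincomb (bigD1 k)//= mxE !eqxx mul1r big1 ?addr0// => j jk.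
by rewrite mxE (negbTE jk) andbF mul0r.
Qed.

Lemma lincomb0 b : lincomb b 0 = fun=> 0.
Proof. by apply/funext => z; rewrite /lincomb big1// => j _; rewrite mxE mul0r. Qed.

Lemma linear1_bound (l : 'rV[R]_m -> R) (B : 'I_m -> R) : linear1 l ->
  (forall k, `|l (delta_mx ord0 k)| <= B k) -> forall x, `|l x| <= (\sum_k B k) * `|x|.
Proof.
move=> ll hB x; rewrite (linear1_sum ll) (le_trans (ler_norm_sum _ _ _))// mulr_suml.
by apply: ler_sum => k _; rewrite normrM mulrC ler_pM// rV_coord_le.
Qed.

Lemma bilin_polyf (a : 'rV[R]_m -> 'rV[R]_m -> R) : bilin a -> polyf (fun x => a x x).
Proof.
move=> [a1 a2].
rewrite (_ : (fun x => _) = fun x => \sum_i x ord0 i * \sum_j x ord0 j *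
    a (delta_mx ord0 j) (delta_mx ord0 i)).
  apply: polyf_sum => i; apply: polyf_mul; first exact: polyf_coord.
  by apply: polyf_sum => j; apply: polyf_mul; [exact: polyf_coord|exact: polyf_cst].
apply/funext => x; rewrite (linear1_sum (a2 x)); apply: eq_bigr => i _; congr (_ * _).
exact: (linear1_sum (a1 (delta_mx ord0 i))).
Qed.

Lemma linear1_Z (l : 'rV[R]_m -> R) t x : linear1 l -> l (t *: x) = t * l x.
Proof.
move=> ll; have l0 : l 0 = 0 by have := linear1B 0 0 ll; rewrite !subrr.
by have := ll t x 0; rewrite !addr0 l0 addr0.
Qed.

Lemma linear1_sub (f g : 'rV[R]_m -> R) : linear1 f -> linear1 g -> linear1 (fun x => f x - g x).
Proof. by move=> lf lg k x y; rewrite lf lg mulrBr opprD addrACA. Qed.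

Lemma bilin_opp (a : 'rV[R]_m -> 'rV[R]_m -> R) : bilin a -> bilin (fun x y => - a x y).
Proof.
by move=> [h1 h2]; split=> [y k x x'|x k y y'] /=; rewrite ?(h1 y k) ?(h2 x k) opprD mulrN.
Qed.

Lemma bilin_coercive (a : 'rV[R]_m -> 'rV[R]_m -> R) : bilin a -> (forall x, x != 0 -> 0 < a x x) ->
  exists2 alpha, 0 < alpha & forall x, alpha * `|x| ^+ 2 <= a x x.
Proof.
move=> ba a0; apply: (@form_coercive _ _ (fun x => a x x) (bilin_polyf ba)) => // t x.
by rewrite (linear1_Z t x (ba.1 _)) (linear1_Z t x (ba.2 _)) expr2 mulrA.
Qed.

End linear_coordinates.

Section spline_coordinates.
Variables (R : realType) (n K m : nat).
Local Notation V := 'rV[R]_n.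
Local Notation Cm := 'rV[R]_m.
Variables (Omega : set V) (C O : 'I_K -> set V) (N : set V).
Hypothesis hc : cells Omega C O N.
Variable b : 'I_m -> V -> R.
Hypothesis sb : forall k, spl Omega C (b k).
Hypothesis vb : forall k, vanishing Omega (b k).
Hypothesis ib : independent_on (closure Omega) b.
Implicit Types (u v w p : V -> R) (x y c : Cm) (z : V).

Let oD : open Omega. Proof. exact (cells_domain hc). Qed.
Local Notation X := (lincomb b).

Lemma spl_pderiv_lin a v w j z : spl Omega C v -> spl Omega C w -> Omega z ->
  pderiv j (fun z => a * v z + w z) z = a * pderiv j v z + pderiv j w z.
Proof.
move=> [Cv _] [Cw _] Oz; have [C1 d1] := C1_cst a oD; have [C2 d2] := C1_M oD C1 Cv.
have [_ ->//] := C1_D oD C2 Cw; by rewrite d2// d1// mulr0 addr0.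
Qed.

Lemma spl_hess_lin a v w z : spl Omega C v -> spl Omega C w -> inner O z ->
  hess (fun z => a * v z + w z) z = a *: hess v z + hess w z.
Proof.
move=> sv sw Iz; have Oz := inner_sub hc Iz; apply/matrixP => i j.
have mE (P Q : 'M[R]_n) : (a *: P + Q) i j = a * P i j + Q i j by rewrite !mxE.
suff H : pderiv i (pderiv j (fun z => a * v z + w z)) z =
    a * pderiv i (pderiv j v) z + pderiv i (pderiv j w) z.
  apply: etrans (hessE _ z i j) (etrans H _).
  by rewrite -(hessE v z i j) -(hessE w z i j); exact/esym/mE.
rewrite (@pderiv_congr _ _ Omega i _ (fun z => a * pderiv j v z + pderiv j w z) z oD)//; last first.
  by move=> y Oy; exact: spl_pderiv_lin.
have pv := pw_pderiv hc j (spl_pw hc sv); have pw := pw_pderiv hc j (spl_pw hc sw).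
have pc := pw_cst O a.
rewrite (pw_pderivD hc i (pwM pc pv) pw Iz) (pw_pderivM hc i pc pv Iz).
by rewrite pderiv_cst mulr0 addr0.
Qed.

Lemma spl_comb c : spl Omega C (X c).
Proof. by apply: lincomb_closed => //; [exact: (spl0 hc)|move=> a f g; exact: (spl_lin hc)]. Qed.

Lemma vanishing_comb c : vanishing Omega (X c).
Proof. by move=> x cx Ox; rewrite /lincomb big1// => k _; rewrite vb// mulr0. Qed.

Lemma comb_pderiv_linear j z : Omega z -> linear1 (fun x => pderiv j (X x) z).
Proof. by move=> Oz k x y; rewrite lincomb_lin spl_pderiv_lin//; exact: spl_comb. Qed.

Lemma comb_hess_linear z i j : inner O z -> linear1 (fun x => hess (X x) z i j).
Proof.
move=> Iz k x y; rewrite lincomb_lin (spl_hess_lin _ (spl_comb x) (spl_comb y) Iz).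
have mE (P Q : 'M[R]_n) : (k *: P + Q) i j = k * P i j + Q i j by rewrite !mxE.
exact: mE.
Qed.

Lemma comb_linear z : linear1 (fun x => X x z).
Proof. by move=> k x y; rewrite lincomb_lin. Qed.

Lemma spl_ucb v : spl Omega C v -> ucb O v.
Proof. by move=> sv; exact: (bC1_ucb hc (spl_bC1 hc sv)). Qed.

Lemma spl_pucb v i : spl Omega C v -> ucb O (pderiv i v).
Proof. by move=> sv; exact: (bC1_pucb hc i (spl_bC1 hc sv)). Qed.

Lemma spl_hucb v i j : spl Omega C v -> ucb O (fun z => hess v z i j).
Proof. by move=> sv; apply: (pw_ucb hc); apply: (pw_hess hc); exact: (spl_pw hc). Qed.

Lemma spl_cucb v i j : spl Omega C v -> ucb O (fun z => cofmx (hess v z) i j).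
Proof.
move=> sv; apply: (pw_ucb hc); apply: pw_cofmx => a e; apply: (pw_hess hc); exact: (spl_pw hc).
Qed.

Lemma spl_ducb v : spl Omega C v -> ucb O (fun z => \det (hess v z)).
Proof.
move=> sv; apply: (pw_ucb hc); apply: pw_det => a e; apply: (pw_hess hc); exact: (spl_pw hc).
Qed.

Lemma ucb_bound (I : finType) (F : I -> V -> R) : (forall i, ucb O (F i)) ->
  exists2 B, 0 <= B & forall i z, inner O z -> `|F i z| <= B.
Proof.
move=> uF; have H i : exists B, forall z, inner O z -> `|F i z| <= B by have [_] := uF i.
pose B i := sval (cid (H i)).
have hB i z : inner O z -> `|F i z| <= B i by rewrite /B; case: cid => /= ? h /h.
exists (\sum_i `|B i|) => [|i z Iz]; first exact: sumr_ge0.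
by rewrite (le_trans (hB i z Iz))// (bigD1 i)//= (le_trans (ler_norm _))// lerDl sumr_ge0.
Qed.

Lemma comb_bounds : exists2 M, 0 <= M & forall x z, inner O z ->
  [/\ `|X x z| <= M * `|x|, forall j, `|pderiv j (X x) z| <= M * `|x| &
      forall i j, `|hess (X x) z i j| <= M * `|x|].
Proof.
have [B1 B10 h1] := ucb_bound (fun k => spl_ucb (sb k)).
have [B2 B20 h2] := ucb_bound (fun k : 'I_m * 'I_n => spl_pucb k.2 (sb k.1)).
have [B3 B30 h3] := ucb_bound (fun k : 'I_m * ('I_n * 'I_n) => spl_hucb k.2.1 k.2.2 (sb k.1)).
pose B := B1 + B2 + B3; have B0 : 0 <= B by rewrite !addr_ge0.
have M0 : 0 <= \sum_(k < m) B by exact: sumr_ge0.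
have [l1 [l2 l3]] : B1 <= B /\ B2 <= B /\ B3 <= B by rewrite /B; lra.
exists (\sum_(k < m) B) => // x z Iz; have Oz := inner_sub hc Iz; split=> [|j|i j].
- apply: (linear1_bound (comb_linear z)) => k; rewrite lincomb_delta.
  exact: le_trans (h1 k z Iz) l1.
- apply: (linear1_bound (comb_pderiv_linear j Oz)) => k; rewrite lincomb_delta.
  exact: le_trans (h2 (k, j) z Iz) l2.
- apply: (linear1_bound (comb_hess_linear i j Iz)) => k; rewrite lincomb_delta.
  exact: le_trans (h3 (k, (i, j)) z Iz) l3.
Qed.

Lemma itg_linear (F : Cm -> V -> R) : (forall x, ucb O (F x)) ->
  (forall z, inner O z -> linear1 (F ^~ z)) -> linear1 (fun x => itg O (F x)).
Proof.
move=> uF lF k x y /=; rewrite -(itgZ hc)// -(itgD hc)//; last exact: ucbZ.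
by apply: eq_itg => z /lF ->.
Qed.

Definition mass_density x y z := X x z * X y z.
Definition grad_density x y z := \sum_i pderiv i (X x) z * pderiv i (X y) z.
Definition cof_density u x y z :=
  \sum_i (\sum_j cofmx (hess u z) i j * pderiv j (X x) z) * pderiv i (X y) z.

Lemma mass_density_ucb x y : ucb O (mass_density x y).
Proof. by apply: ucbM; apply: spl_ucb; exact: spl_comb. Qed.

Lemma grad_density_ucb x y : ucb O (grad_density x y).
Proof. by apply: ucb_sum => i; apply: ucbM; apply: spl_pucb; exact: spl_comb. Qed.

Lemma cof_density_ucb u x y : spl Omega C u -> ucb O (cof_density u x y).
Proof.
move=> su; apply: ucb_sum => i; apply: ucbM; last by apply: spl_pucb; exact: spl_comb.
apply: ucb_sum => j; apply: ucbM; first exact: spl_cucb.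
by apply: spl_pucb; exact: spl_comb.
Qed.

Lemma mass_bilin : bilin (fun x y => itg O (mass_density x y)).
Proof.
split=> [y|x].
  apply: (itg_linear (F := fun x => mass_density x y)) => [x|z Iz k x x']; first exact: mass_density_ucb.
  by rewrite /mass_density (comb_linear z) mulrDl mulrA.
apply: (itg_linear (F := fun y => mass_density x y)) => [y|z Iz k y y']; first exact: mass_density_ucb.
by rewrite /mass_density (comb_linear z) mulrDr mulrCA.
Qed.

Lemma grad_bilin : bilin (fun x y => itg O (grad_density x y)).
Proof.
split=> [y|x].
  apply: (itg_linear (F := fun x => grad_density x y)) => [x|z Iz k x x']; first exact: grad_density_ucb.
  have Oz := inner_sub hc Iz.
  rewrite /grad_density mulr_sumr -big_split; apply: eq_bigr => i _.
  by rewrite (comb_pderiv_linear i Oz) mulrDl mulrA.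
apply: (itg_linear (F := fun y => grad_density x y)) => [y|z Iz k y y']; first exact: grad_density_ucb.
have Oz := inner_sub hc Iz.
rewrite /grad_density mulr_sumr -big_split; apply: eq_bigr => i _.
by rewrite (comb_pderiv_linear i Oz) mulrDr mulrCA.
Qed.

Lemma cof_bilin u : spl Omega C u -> bilin (fun x y => itg O (cof_density u x y)).
Proof.
move=> su; split=> [y|x].
  apply: (itg_linear (F := fun x => cof_density u x y)) => [x|z Iz k x x']; first exact: cof_density_ucb.
  have Oz := inner_sub hc Iz.
  rewrite /cof_density mulr_sumr -big_split; apply: eq_bigr => i _.
  rewrite /= mulrA -mulrDl mulr_sumr -big_split; congr (_ * _); apply: eq_bigr => j _.
  by rewrite /= (comb_pderiv_linear j Oz) mulrDr mulrCA.
apply: (itg_linear (F := fun y => cof_density u x y)) => [y|z Iz k y y']; first exact: cof_density_ucb.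
have Oz := inner_sub hc Iz.
rewrite /cof_density mulr_sumr -big_split; apply: eq_bigr => i _.
by rewrite (comb_pderiv_linear i Oz) mulrDr mulrCA.
Qed.

Lemma mass_coercive : exists2 alpha, 0 < alpha &
  forall x, alpha * `|x| ^+ 2 <= itg O (mass_density x x).
Proof.
apply: (bilin_coercive mass_bilin) => x x0; rewrite lt_neqAle eq_sym; apply/andP; split; last first.
  by apply: itg_ge0 => z _; rewrite /mass_density -expr2 sqr_ge0.
apply: contra x0 => /eqP I0; apply/eqP; apply: ib.
apply: (spl_itg_sqr_eq0 hc) (spl_comb x) _.
by rewrite -[RHS]I0; apply: eq_itg => z _; rewrite expr2.
Qed.

Lemma cof_coercive u (i0 : 'I_n) : spl Omega C u -> strictly_convex Omega u ->
  exists2 alpha, 0 < alpha & forall x, alpha * `|x| ^+ 2 <= itg O (cof_density u x x).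
Proof.
move=> su cu.
have E x : itg O (cof_density u x x) = itg O (fun z => qform (cofmx (hess u z)) (grad (X x) z)).
  apply: eq_itg => z _; apply: eq_bigr => i _; rewrite mulr_suml; apply: eq_bigr => j _.
  by rewrite -(gradE (X x) z i) -(gradE (X x) z j) mulrAC.
apply: (bilin_coercive (cof_bilin su)) => x x0; rewrite lt_neqAle eq_sym; apply/andP; split; last first.
  by rewrite E; apply: itg_ge0 => z Iz; exact: (cof_form_ge0 hc _ su cu Iz).
apply: contra x0; rewrite E => /eqP I0; apply/eqP; apply: ib.
exact: (cof_form_definite hc i0 su cu (spl_comb x) (@vanishing_comb x) I0).
Qed.

Lemma density_bounds : exists2 k, 0 <= k & forall x y,
  `|itg O (mass_density x y)| <= k * `|x| * `|y| /\ `|itg O (grad_density x y)| <= k * `|x| * `|y|.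
Proof.
have [M M0 hM] := comb_bounds; have v0 := vol_ge0 O.
exists ((1 + n%:R) * M ^+ 2 * vol O) => [|x y]; first by rewrite !mulr_ge0 ?sqr_ge0// addr_ge0.
have W : M * `|x| * (M * `|y|) <= (1 + n%:R) * M ^+ 2 * `|x| * `|y|.
  rewrite (_ : (1 + n%:R) * _ * _ * _ = (1 + n%:R) * (M * `|x| * (M * `|y|))); last by ring.
  by rewrite ler_peMl ?mulr_ge0// lerDl.
split.
  apply: le_trans (@itg_norm_le _ _ _ _ _ _ _ hc _ (M * `|x| * (M * `|y|)) (mass_density_ucb x y) _) _.
    by move=> z Iz; have [h1 _ _] := hM x z Iz; have [h2 _ _] := hM y z Iz; rewrite normrM ler_pM.
  by rewrite (_ : _ * vol O * _ * _ = (1 + n%:R) * M ^+ 2 * `|x| * `|y| * vol O) ?ler_wpM2r//; ring.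
apply: le_trans (@itg_norm_le _ _ _ _ _ _ _ hc _ (n%:R * (M * `|x| * (M * `|y|))) (grad_density_ucb x y) _) _.
  move=> z Iz; have [_ h1 _] := hM x z Iz; have [_ h2 _] := hM y z Iz.
  apply: le_trans (ler_norm_sum _ _ _) _.
  apply: le_trans (_ : \sum_(i < n) M * `|x| * (M * `|y|) <= _).
    by apply: ler_sum => i _; rewrite normrM ler_pM.
  by rewrite sumr_const card_ord mulr_natl.
rewrite (_ : (1 + n%:R) * M ^+ 2 * vol O * _ * _ = (1 + n%:R) * (M * `|x| * (M * `|y|)) * vol O); last by ring.
by rewrite ler_wpM2r// ler_wpM2r ?mulr_ge0// lerDr.
Qed.

(** The lower bound comes from the L^2 part alone, through the coercivity of the mass form, and the
    upper bound from uniform bounds on the basis functions and their derivatives. The extended real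
    norm is thus replaced by a norm on coordinates. *)
Lemma H1_norm_coord : exists k1 k2, [/\ 0 < k1, 0 < k2 &
  forall x, ((k1 * `|x|)%:E <= H1_norm Omega (X x) <= (k2 * `|x|)%:E)%E].
Proof.
have [al al0 hal] := mass_coercive; have [M M0 hM] := comb_bounds.
pose S : R := Num.sqrt (size (multis n 1))%:R; have S0 : 0 <= S by exact: sqrtr_ge0.
pose v := vol O; have v0 : 0 <= v := vol_ge0 O.
exists (Num.sqrt al), (S * (M * (v + 1)) + 1); split.
- by rewrite sqrtr_gt0.
- by rewrite ltr_wpDl// !mulr_ge0// addr_ge0.
move=> x; have bX := spl_bC1 hc (spl_comb x); apply/andP; split.
  apply: le_trans (H1_norm_lower hc bX); rewrite lee_fin.
  rewrite -{1}(ger0_norm (normr_ge0 x)) -sqrtr_sqr -sqrtrM ?(ltW al0)// ler_sqrt.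
    apply: le_trans (hal x) _; rewrite le_eqVlt; apply/orP; left; apply/eqP.
    by apply: eq_itg => z _; rewrite expr2.
  by apply: itg_ge0 => z _; exact: sqr_ge0.
apply: (@le_trans _ _ (S * (M * (v + 1) * `|x|))%:E); last first.
  by rewrite lee_fin [leRHS]mulrDl mul1r -(mulrA S) lerDl.
have b0 : 0 <= M * (v + 1) * `|x| by rewrite !mulr_ge0// addr_ge0.
have sq f : (fun z : V => f z ^+ 2 : R) = (fun z => f z * f z) by apply/funext => z; rewrite expr2.
have key g : ucb O g -> (forall z, inner O z -> `|g z| <= M * `|x|) ->
    itg O (fun z => g z ^+ 2) <= (M * (v + 1) * `|x|) ^+ 2.
  move=> ug gb; apply: (@le_trans _ _ ((M * `|x|) ^+ 2 * v)).
    rewrite -(itg_cst hc); apply: (itg_le hc); [by rewrite sq; exact: ucbM|exact: ucb_cst|].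
    by move=> z Iz; rewrite -(real_normK (num_real (g z))) lerXn2r ?nnegrE ?gb// mulr_ge0.
  rewrite (_ : (M * (v + 1) * `|x|) ^+ 2 = (M * `|x|) ^+ 2 * (v + 1) ^+ 2); last by ring.
  by rewrite ler_wpM2l ?sqr_ge0//; move: v0; nra.
apply: (H1_norm_le hc) => //.
  by apply: key => [|z Iz]; [exact: (spl_ucb (spl_comb x))|have [] := hM x z Iz].
by move=> i; apply: key => [|z Iz]; [exact: (spl_pucb i (spl_comb x))|have [_ ->] := hM x z Iz].
Qed.

Section newton_coordinates.
Hypothesis n23 : n = 2%N \/ n = 3%N.
Variable u : V -> R.
Hypothesis su : spl Omega C u.
Hypothesis cu : strictly_convex Omega u.

Definition shifted c z := u z + X c z.

Lemma shiftedE c : shifted c = fun z => 1 * u z + X c z.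
Proof. by apply/funext => z; rewrite mul1r. Qed.

Lemma shifted0 : shifted 0 = u.
Proof. by apply/funext => z; rewrite /shifted lincomb0 addr0. Qed.

Lemma spl_shifted c : spl Omega C (shifted c).
Proof. by rewrite shiftedE; apply: (spl_lin hc) => //; exact: spl_comb. Qed.

Lemma hess_shifted c z : inner O z -> hess (shifted c) z = hess u z + hess (X c) z.
Proof. by move=> Iz; rewrite shiftedE spl_hess_lin// ?scale1r//; exact: spl_comb. Qed.

(** As u will be the discrete solution, its determinant term stands for the load, and f disappears
    from the coordinates. *)
Definition residual c y :=
  itg O (fun z => \det (hess (shifted c) z) * X y z) - itg O (fun z => \det (hess u z) * X y z).

Lemma residual_linear c : linear1 (residual c).
Proof.
have H v : spl Omega C v -> linear1 (fun y => itg O (fun z => \det (hess v z) * X y z)).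
  move=> sv; apply: (itg_linear (F := fun y z => \det (hess v z) * X y z)) => [y|z Iz k y y'].
    by apply: ucbM; [exact: spl_ducb|apply: spl_ucb; exact: spl_comb].
  by rewrite (comb_linear z) mulrDr mulrCA.
exact: linear1_sub (H _ (spl_shifted c)) (H _ su).
Qed.

Lemma hess_bound : exists2 M, 0 <= M & forall i j z, inner O z -> `|hess u z i j| <= M.
Proof.
have [B B0 hB] := ucb_bound (fun k : 'I_n * 'I_n => spl_hucb k.1 k.2 su).
by exists B => // i j z; exact: (hB (i, j)).
Qed.

Lemma cof_density_lipschitz : exists k eta, 0 < eta /\ forall c x y, `|c| <= eta ->
  `|- itg O (cof_density (shifted c) x y) - - itg O (cof_density (shifted 0) x y)| <=
  k * `|c| * `|x| * `|y|.
Proof.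
have [M M0 hM] := comb_bounds; have [H H0 hH] := hess_bound.
have [k k0 hk] := cofmx_lipschitz n H.
have v0 := vol_ge0 O.
(* This radius ensures M [|c|] <= 1, the range of perturbations in which [cofmx_lipschitz] holds. *)
exists (n%:R * (n%:R * (k * M * M * M)) * vol O), (M + 1)^-1.
split; first by rewrite invr_gt0 ltr_wpDl.
move=> c x y ce; rewrite shifted0.
have Mc : 0 <= M * `|c| <= 1.
  rewrite mulr_ge0//=; apply: le_trans (_ : (M + 1) * `|c| <= _); first by rewrite ler_wpM2r// lerDl.
  by rewrite mulrC -ler_pdivlMr ?mul1r// ltr_wpDl.
rewrite opprK addrC -(itgB hc); [|exact: cof_density_ucb|by apply: cof_density_ucb; exact: spl_shifted].
apply: le_trans (@itg_norm_le _ _ _ _ _ _ _ hc _ (n%:R * (n%:R * (k * (M * `|c|) * (M * `|x|) * (M * `|y|)))) _ _) _.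
- by apply: ucbB; apply: cof_density_ucb => //; exact: spl_shifted.
- move=> z Iz; have [_ hx _] := hM x z Iz; have [_ hy _] := hM y z Iz; have [_ _ hhc] := hM c z Iz.
  rewrite distrC /cof_density -sumrB (hess_shifted c Iz).
  have sumle (F : 'I_n -> R) B : (forall i, `|F i| <= B) -> `|\sum_i F i| <= n%:R * B.
    move=> FB; apply: le_trans (ler_norm_sum _ _ _) _.
    by apply: le_trans (ler_sum _ (fun i _ => FB i)) _; rewrite sumr_const card_ord mulr_natl.
  apply: (sumle) => i; rewrite -mulrBl -sumrB normrM
    [leRHS](_ : _ = n%:R * (k * (M * `|c|) * (M * `|x|)) * (M * `|y|)); last by ring.
  apply: ler_pM => //; apply: (sumle) => j; rewrite -mulrBl normrM; apply: ler_pM => //.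
  exact (hk _ _ _ i j (fun i' j' => hH i' j' z Iz) hhc Mc).
- rewrite le_eqVlt; apply/orP; left; apply/eqP.
  by move: (vol O) (`|c|) (`|x|) (`|y|) => *; ring.
Qed.

(** [itg_cof_parts] rewrites the gradient form as the integral of the cofactor matrix against the
    Hessian of the increment, after which [det_taylor] applies at each point of the cells. *)
Lemma residual_taylor : exists k eta, 0 < eta /\ forall c y, `|c| <= eta ->
  `|residual c y - - itg O (cof_density (shifted 0) c y)| <= k * `|c| ^+ 2 * `|y|.
Proof.
have [M M0 hM] := comb_bounds; have [H H0 hH] := hess_bound.
have [k k0 hk] := det_taylor H n23.
exists (k * M ^+ 3 * vol O), (M + 1)^-1; split; first by rewrite invr_gt0 ltr_wpDl.
move=> c y ce; rewrite shifted0.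
have Mc : 0 <= M * `|c| <= 1.
  rewrite mulr_ge0//=; apply: le_trans (_ : (M + 1) * `|c| <= _); first by rewrite ler_wpM2r// lerDl.
  by rewrite mulrC -ler_pdivlMr ?mul1r// ltr_wpDl.
have := itg_cof_parts hc n23 su (spl_comb c) (spl_comb y) (@vanishing_comb y).
rewrite -[X in _ = - X]/(itg O (cof_density u c y)) => <-.
have uy := spl_ucb (spl_comb y).
have u1 := ucbM (spl_ducb (spl_shifted c)) uy; have u2 := ucbM (spl_ducb su) uy.
have u3 : ucb O (fun z => (\sum_i \sum_j cofmx (hess u z) i j * hess (X c) z i j) * X y z).
  apply: ucbM => //; apply: ucb_sum => i; apply: ucb_sum => j; apply: ucbM; first exact: spl_cucb.
  by apply: spl_hucb; exact: spl_comb.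
pose F1 z := \det (hess (shifted c) z) * X y z; pose F2 z := \det (hess u z) * X y z.
pose F3 z := (\sum_i \sum_j cofmx (hess u z) i j * hess (X c) z i j) * X y z.
have e1 : itg O (fun z => F1 z - F2 z) = itg O F1 - itg O F2 := itgB hc u1 u2.
have e2 : itg O (fun z => F1 z - F2 z - F3 z) = itg O (fun z => F1 z - F2 z) - itg O F3 :=
  itgB hc (ucbB u1 u2) u3.
rewrite -/(itg O F3) /residual -/(itg O F1) -/(itg O F2) -e1 -e2.
apply: le_trans (@itg_norm_le _ _ _ _ _ _ _ hc _ (k * (M * `|c|) ^+ 2 * (M * `|y|)) _ _) _.
- exact: (ucbB (ucbB u1 u2) u3).
- move=> z Iz; have [hy _ _] := hM y z Iz; have [_ _ hhc] := hM c z Iz.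
  rewrite /F1 /F2 /F3 (hess_shifted c Iz) -!mulrBl normrM; apply: ler_pM => //.
  exact (hk _ _ _ (fun i j => hH i j z Iz) hhc Mc).
- by rewrite le_eqVlt; apply/orP; left; apply/eqP; ring.
Qed.

Lemma newton_coordinates (bf : Cm -> Cm -> R) (kb rho : R) : bilin bf -> (forall x, 0 <= bf x x) ->
  (forall x y, `|bf x y| <= kb * `|x| * `|y|) -> 0 < rho ->
  exists2 nu0, 0 < nu0 & forall nu, 0 < nu <= nu0 ->
  exists2 delta, 0 < delta & forall c, `|c| < delta ->
    exists c', [/\ (forall y, - nu * bf (c' - c) y + - itg O (cof_density (shifted c) (c' - c) y) =
                              - residual c y),
      (forall c'', (forall y, - nu * bf (c'' - c) y + - itg O (cof_density (shifted c) (c'' - c) y) =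
                              - residual c y) -> c'' = c') &
      `|c'| <= rho * `|c|].
Proof.
move=> bb b0 bk rho0.
have [k1 [e1 [e10 h1]]] := cof_density_lipschitz; have [k2 [e2 [e20 h2]]] := residual_taylor.
have [i0 _] : exists i : 'I_n, true by case: n23 => ->; exists ord0.
have [al al0 hal] := cof_coercive i0 su cu.
pose k := `|k1| + `|k2| + `|kb|; pose eta := Num.min e1 e2.
have [q1 [q2 q3]] : k1 <= k /\ k2 <= k /\ kb <= k.
  have := ler_norm k1; have := ler_norm k2; have := ler_norm kb.
  have := normr_ge0 k1; have := normr_ge0 k2; have := normr_ge0 kb; rewrite /k; lra.
apply: (@newton_contraction R m (fun c x y => - itg O (cof_density (shifted c) x y)) bf residual
  k eta al rho) => //.
- by move=> c; apply: bilin_opp; apply: cof_bilin; exact: spl_shifted.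
- exact: residual_linear.
- by rewrite lt_min e10.
- by move=> x; rewrite opprK shifted0.
- move=> c x y; rewrite le_min => /andP[c1 _]; apply: le_trans (h1 c x y c1) _.
  by rewrite !ler_wpM2r.
- move=> c y; rewrite le_min => /andP[_ c2]; apply: le_trans (h2 c y c2) _.
  by rewrite !ler_wpM2r// sqr_ge0.
- by move=> x y; apply: le_trans (bk x y) _; rewrite !ler_wpM2r.
Qed.

End newton_coordinates.

End spline_coordinates.

(** * The forms depend only on values in the open domain *)

Section form_congruence.
Variables (R : realType) (n : nat).
Local Notation V := 'rV[R]_n.
Variable Omega : set V.
Hypothesis oO : open Omega.
Implicit Types (u v p q psi phi : V -> R) (x : V).

Lemma eq_hess u v x : (forall y, Omega y -> u y = v y) -> Omega x -> hess u x = hess v x.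
Proof.
move=> uv Ox; apply/matrixP => i j; apply: etrans (hessE u x i j) (etrans _ (esym (hessE v x i j))).
by apply: (pderiv_congr _ oO) => // y Oy; exact: (pderiv_congr _ oO).
Qed.

Lemma eq_F_form u v psi phi : (forall y, Omega y -> u y = v y) ->
  (forall y, Omega y -> psi y = phi y) -> F_form Omega u psi = F_form Omega v phi.
Proof.
move=> uv pp; have E x : Omega x -> \det (hess u x) * psi x = \det (hess v x) * phi x.
  by move=> Ox; rewrite (eq_hess uv Ox) (pp x Ox).
by apply: eq_Rintegral => x /set_mem; exact: E.
Qed.

Lemma eq_dF_form u v p q psi phi : (forall y, Omega y -> u y = v y) ->
  (forall y, Omega y -> p y = q y) -> (forall y, Omega y -> psi y = phi y) ->
  dF_form Omega u p psi = dF_form Omega v q phi.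
Proof.
move=> uv pq pp; refine (f_equal -%R _); apply: eq_Rintegral => x /set_mem Ox.
apply: eq_bigr => i _; refine (f_equal2 *%R _ (pderiv_congr i oO pp Ox)).
apply: eq_bigr => j _.
exact (f_equal2 (fun (A : 'M[R]_n) t => cofmx A i j * t) (eq_hess uv Ox) (pderiv_congr j oO pq Ox)).
Qed.

Lemma eq_grad_form p q psi phi : (forall y, Omega y -> p y = q y) ->
  (forall y, Omega y -> psi y = phi y) -> grad_form Omega p psi = grad_form Omega q phi.
Proof.
move=> pq pp; apply: eq_Rintegral => x /set_mem Ox; apply: eq_bigr => i _.
exact (f_equal2 *%R (pderiv_congr i oO pq Ox) (pderiv_congr i oO pp Ox)).
Qed.

Lemma eq_mass_form p q psi phi : (forall y, Omega y -> p y = q y) ->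
  (forall y, Omega y -> psi y = phi y) -> mass_form Omega p psi = mass_form Omega q phi.
Proof. by move=> pq pp; apply: eq_Rintegral => x /set_mem Ox; exact (f_equal2 *%R (pq x Ox) (pp x Ox)). Qed.

Lemma eq_load f psi phi : (forall y, Omega y -> psi y = phi y) -> load Omega f psi = load Omega f phi.
Proof. by move=> pp; apply: eq_Rintegral => x /set_mem Ox; exact (f_equal _ (pp x Ox)). Qed.

Lemma frontierE x : frontier Omega x <-> closure Omega x /\ ~ Omega x.
Proof.
split=> [[cx ix]|[cx ix]]; split=> // Ox; apply: ix; last exact: interior_subset.
by move: oO; rewrite openE; apply.
Qed.

End form_congruence.

Theorem theorem3p1 (R : realType) (n : nat) (n23 : n = 2%N \/ n = 3%N)
    (Omega : set 'rV[R]_n)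
    (Omega_open : open Omega) (Omega_neq0 : Omega !=set0)
    (Omega_bounded : bounded_set Omega) (Omega_convex : convex_set Omega)
    (Omega_lipschitz : lipschitz_boundary Omega)
    (d : nat) (H : set R) (T : R -> {fset {fset 'rV[R]_n}})
    (T_family : triangulation_family Omega H T)
    (T_shape : shape_regular H T) (T_quasi : quasi_uniform H T)
    (approx : optimal_approximation Omega d H T)
    (inverse : inverse_estimates Omega d H T)
    (f : 'rV[R]_n -> R)
    (f_cont : forall x, Omega x -> {for x, continuous f})
    (f_gt0 : forall x, Omega x -> 0 < f x)
    (f_dual : forall h psi, H h -> spline0 Omega (T h) d psi ->
       L1 Omega (fun x => f x * psi x))
    (g : 'rV[R]_n -> R) (g_cont : {within frontier Omega, continuous g})
    (G : 'rV[R]_n -> R) (G_smooth : forall k, Ck_on Omega k G)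
    (G_cont : {within closure Omega, continuous G})
    (G_ext : {in frontier Omega, G =1 g})
    (N : R -> nat) (lam : forall h, 'I_(N h) -> ('rV[R]_n -> R) -> R)
    (lam_unisolvent : forall h, H h -> unisolvent Omega (T h) d (lam h))
    (gh : R -> 'rV[R]_n -> R)
    (gh_interp : forall h, H h -> interpolant Omega (T h) d (lam h) G (gh h))
    (uh : R -> 'rV[R]_n -> R)
    (uh_sol : forall h, H h ->
       unique_strictly_convex_solution Omega (T h) d f (gh h) (uh h))
    (B : ('rV[R]_n -> R) -> ('rV[R]_n -> R) -> R)
    (B_def : B = grad_form Omega \/ B = mass_form Omega) :
  exists2 h0 : R, 0 < h0 & forall h, H h -> h <= h0 ->
  exists2 nu0 : R, 0 < nu0 & forall nu, 0 < nu <= nu0 ->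
  exists2 delta : R, 0 < delta &
  forall u0, admissible Omega (T h) d (gh h) u0 ->
    (H1_norm Omega (u0 \- uh h)%R < delta%:E)%E ->
  exists u : nat -> 'rV[R]_n -> R,
    [/\ u 0%N = u0,
        pseudo_iteration Omega (T h) d f (gh h) nu B u,
        (forall v, v 0%N = u0 ->
           pseudo_iteration Omega (T h) d f (gh h) nu B v ->
           forall k, {in closure Omega, v k =1 u k}),
        (fun k => H1_norm Omega (u k \- uh h)) @ \oo --> 0%E &
        exists2 rho : R, 0 < rho < 1 &
          forall k, (H1_norm Omega (u k.+1 \- uh h)%R
                     <= rho%:E * H1_norm Omega (u k \- uh h)%R)%E].
Proof.
exists 1 => // h Hh _; have [h0 tri _] := T_family h Hh.
have [K [C [D [N0 [hc hC]]]]] := triangulation_cells Omega_open Omega_neq0 Omega_bounded Omega_convex tri.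
have [[[sU bU] solU] cU _] := uh_sol h Hh.
pose S v := spline Omega (T h) d v /\ vanishing Omega v.
have S0 : S (fun=> 0) by split; first exact: spline0_fun.
have SZD a v w : S v -> S w -> S (fun x => a * v x + w x).
  by move=> [sv vv] [sw vw]; split; [exact: spline_lin|exact: vanishing_lin].
have [e he] := unisolvent_span Omega_open (lam_unisolvent h Hh).
have span v : S v -> exists c, forall x, closure Omega x -> v x = lincomb e c x by case=> /he.
have [m [b [Sb ib spanb]]] := exists_basis S0 span.
have SX c : S (lincomb b c) by exact: lincomb_closed.
have sb k : spl Omega C (b k) := spline_spl hC (Sb k).1.
have vb k : vanishing Omega (b k) := (Sb k).2.
have su : spl Omega C (uh h) := spline_spl hC sU.
have spline0P psi : spline0 Omega (T h) d psi <-> S psi.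
  split=> -[sp hp]; split=> //.
    exact: (H10_vanishing hc (spline_spl hC sp)).
  exact: (vanishing_H10 hc (spline_spl hC sp)).
have OC x : Omega x -> closure Omega x by exact: subset_closure.
pose bf x y := B (lincomb b x) (lincomb b y).
have [kb0 kb00 kbP] := density_bounds hc sb.
have [bB [b0 bK]] : bilin bf /\ (forall x, 0 <= bf x x) /\
    forall x y, `|bf x y| <= kb0 * `|x| * `|y|.
  case: B_def => BE.
    have E : bf = fun x y => itg D (grad_density b x y).
      by apply/funext => x; apply/funext => y; rewrite /bf BE /grad_form (itg_domain hc).
    rewrite E; split; first exact: (grad_bilin hc sb).
    split=> [x|x y]; last by have [] := kbP x y.
    by apply: itg_ge0 => z _; apply: sumr_ge0 => i _; rewrite -expr2 sqr_ge0.
  have E : bf = fun x y => itg D (mass_density b x y).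
    by apply/funext => x; apply/funext => y; rewrite /bf BE /mass_form (itg_domain hc).
  rewrite E; split; first exact: (mass_bilin hc sb).
  split=> [x|x y]; last by have [] := kbP x y.
  by apply: itg_ge0 => z _; rewrite /mass_density -expr2 sqr_ge0.
have eqB p q psi phi : (forall y, Omega y -> p y = q y) -> (forall y, Omega y -> psi y = phi y) ->
    B p psi = B q phi.
  by move=> pq pp; case: B_def => ->; [exact: eq_grad_form|exact: eq_mass_form].
have [k1 [k2 [k10 k20 H1]]] := H1_norm_coord hc sb ib.
(* The second bound turns the coordinate factor into 1/2 in the H^1 norm after the two norm
   comparisons; the first keeps the coordinates in the ball of radius delta and makes them tend to
   zero. *)
pose rho := Num.min (1 / 2) (k1 / (2 * k2)).
have rho0 : 0 < rho by rewrite lt_min !divr_gt0// mulr_gt0.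
have rho1 : rho <= 1 / 2 by rewrite ge_min lexx.
have rhok : k2 * rho <= 1 / 2 * k1.
  have : rho <= k1 / (2 * k2) by rewrite ge_min lexx orbT.
  by rewrite ler_pdivlMr ?mulr_gt0//; lra.
have [nu0 nu00 newton] := newton_coordinates hc sb vb ib n23 su cU bB b0 bK rho0.
exists nu0 => // nu /newton[delta d0 step].
(* An H^1 distance below k1 delta forces coordinates of norm below delta. *)
exists (k1 * delta) => [|u0 adm0 u0small]; first exact: mulr_gt0.
pose U := shifted b (uh h).
have coord v : admissible Omega (T h) d (gh h) v ->
    exists c, forall x, closure Omega x -> v x = U c x.
  move=> [sv bv]; have [|c cE] := spanb (fun x => -1 * uh h x + v x).
    split; first exact: spline_lin.
    move=> x cx Ox; have fx : x \in frontier Omega by rewrite inE; apply/frontierE.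
    by rewrite bU// bv// mulN1r addNr.
  by exists c => x cx; rewrite /U /shifted -cE// mulN1r addrA subrr add0r.
have admU c : admissible Omega (T h) d (gh h) (U c).
  split; first by rewrite /U shiftedE; apply: spline_lin => //; have [] := SX c.
  move=> x fx; have /set_mem/(frontierE Omega_open)[cx Ox] := fx.
  by rewrite /U /shifted bU// (SX c).2// addr0.
have XB c c' x : lincomb b (c' - c) x = U c' x - U c x.
  rewrite /U /shifted opprD addrACA subrr add0r.
  exact: (linear1B c' c (comb_linear b x)).
have H1E v c : (forall x, closure Omega x -> v x = U c x) ->
    H1_norm Omega (v \- uh h) = H1_norm Omega (lincomb b c).
  move=> vc; apply: eq_H1_norm => x /OC cx /=.
  by rewrite vc// /U /shifted addrAC subrr add0r.
pose eqn c c' := forall y, - nu * bf (c' - c) y + - itg D (cof_density b (U c) (c' - c) y) =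
  - residual D b (uh h) c y.
(* The equation for functions and the one for coordinates are equivalent: one direction gives
   existence of the iterates, the other their uniqueness. The load is eliminated by the equation of
   u_h. *)
have eqnP v v' c c' : (forall x, closure Omega x -> v x = U c x) ->
    (forall x, closure Omega x -> v' x = U c' x) ->
    (forall psi, spline0 Omega (T h) d psi ->
       - nu * B (v' \- v) psi + dF_form Omega v (v' \- v) psi =
       - (F_form Omega v psi - load Omega f psi)) <-> eqn c c'.
  move=> vc vc'.
  have trans psi y : (forall x, closure Omega x -> psi x = lincomb b y x) ->
      [/\ B (v' \- v) psi = bf (c' - c) y,
          dF_form Omega v (v' \- v) psi = - itg D (cof_density b (U c) (c' - c) y) &
          F_form Omega v psi - load Omega f psi = residual D b (uh h) c y].
    move=> py; have pO x : Omega x -> psi x = lincomb b y x by move=> /OC; exact: py.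
    have vO x : Omega x -> v x = U c x by move=> /OC; exact: vc.
    have dO x : Omega x -> (v' \- v) x = lincomb b (c' - c) x.
      by move=> /OC cx; rewrite XB /= vc// vc'.
    split.
    - exact: eqB.
    - by rewrite (eq_dF_form Omega_open vO dO pO) /dF_form (itg_domain hc).
    - rewrite (eq_F_form Omega_open vO pO) (eq_load f pO) -solU; last by apply/spline0P.
      exact (f_equal2 (fun s t => s - t) (itg_domain hc _) (itg_domain hc _)).
  split=> [hq y|hq psi /spline0P Spsi].
    have [E1 E2 E3] := trans (lincomb b y) y (fun x _ => erefl).
    by rewrite -E1 -E2 -E3; apply: hq; apply/spline0P.
  have [y yE] := spanb _ Spsi; have [E1 E2 E3] := trans psi y yE.
  by rewrite E1 E2 E3.
(* The Newton map is made total, with value 0 outside the ball where a step is guaranteed; the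
   iterates never leave that ball. *)
have /choice[nxt hnxt] : forall c, exists c', `|c| < delta ->
    [/\ eqn c c', forall c'', eqn c c'' -> c'' = c' & `|c'| <= rho * `|c|].
  move=> c; have [cd|cd] := ltP `|c| delta; last by exists 0.
  by have [c' hc'] := step c cd; exists c'.
have [c0 c0E] := coord u0 adm0.
pose cs k := iter k nxt c0.
have c0d : `|c0| < delta.
  rewrite -(ltr_pM2l k10) -lte_fin; apply: le_lt_trans u0small.
  by rewrite (H1E _ _ c0E); have /andP[] := H1 c0.
have csd k : `|cs k| < delta.
  elim: k => // k IH; have [_ _ h1] := hnxt (cs k) IH; apply: le_lt_trans IH.
  apply: le_trans h1 _; rewrite ler_piMl//; lra.
have cseqn k : eqn (cs k) (cs k.+1) by have [] := hnxt _ (csd k).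
have csuniq k c : eqn (cs k) c -> c = cs k.+1 by have [_ + _] := hnxt _ (csd k); apply.
have csrho k : `|cs k.+1| <= rho * `|cs k| by have [] := hnxt _ (csd k).
(* The initial function agrees with [U c0] on the closure of Omega only, so it is kept as it is to
   have [u 0%N = u0] as functions. *)
pose u k := if k is 0 then u0 else U (cs k).
have uE k x : closure Omega x -> u k x = U (cs k) x by case: k => [|k]//; exact: c0E.
exists u; split=> //.
- move=> k; split; first by case: k => [|k]; [exact: adm0|exact: admU].
  by apply/(eqnP _ _ _ _ (uE k) (uE k.+1)).
- move=> v v0 hv.
  suff vE k : forall x, closure Omega x -> v k x = U (cs k) x.
    by move=> k x /set_mem cx; rewrite vE// uE.
  elim: k => [|k IH]; first by move=> x; rewrite v0; exact: c0E.
  have [admk eqk] := hv k; have [admk1 _] := hv k.+1; have [c cE] := coord _ admk1.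
  by rewrite -(csuniq k c)//; apply/(eqnP _ _ _ _ IH cE).
- have bound k : (0 <= H1_norm Omega (u k \- uh h)%R <= (k2 * delta * (1 / 2) ^+ k)%:E)%E.
    rewrite H1_norm_ge0 (H1E _ _ (uE k)) /=.
    have /andP[_ h1] := H1 (cs k); apply: le_trans h1 _; rewrite lee_fin -mulrA ler_pM2l//.
    elim: k => [|k IH]; first by rewrite expr0 mulr1 ltW.
    apply: le_trans (csrho k) _; rewrite exprS mulrCA.
    apply: le_trans (_ : 1 / 2 * `|cs k| <= _); first by rewrite ler_wpM2r.
    by rewrite ler_pM2l.
  apply: (@squeeze_cvge _ _ _ _ (fun=> 0%E) _ (fun k => (k2 * delta * (1 / 2) ^+ k)%:E)).
  + by apply: nearW => k; exact: bound.
  + exact: cvg_cst.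
  + apply: cvg_EFin; first exact: nearW.
    rewrite -(mulr0 (k2 * delta)); apply: cvgMr; apply: cvg_expr.
    by rewrite ger0_norm; lra.
- exists (1 / 2) => [|k]; first lra.
  rewrite (H1E _ _ (uE k)) (H1E _ _ (uE k.+1)).
  have /andP[_ h1] := H1 (cs k.+1); have /andP[h2 _] := H1 (cs k).
  apply: le_trans h1 _; apply: le_trans (_ : ((1 / 2)%:E * (k1 * `|cs k|)%:E <= _)%E).
    rewrite -EFinM lee_fin; apply: le_trans (_ : k2 * (rho * `|cs k|) <= _).
      by rewrite ler_pM2l.
    by rewrite !mulrA ler_wpM2r.
  by apply: lee_wpmul2l => //; rewrite lee_fin; lra.
Qed.
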